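(* Let $\mu>0$, $b>0$, $\gamma\in\mathbb{R}$ with $\gamma\notin\{0,-2,-4,\ldots\}$, put $\chi=b^2/4$ and $$S_{1,\gamma}^{\mu}(a,b)=\sum_{n=1}^\infty \frac{n^\gamma K_1(nb/a)}{(n^2+a^2)^\mu}.$$ Then, as $|a|\to\infty$ in $|\arg a|<\tfrac12\pi$, $$S^\mu_{1,\gamma}(a,b)-a^{\gamma-2\mu+1}H_{1,\gamma}^\mu(1)\sim\frac{1}{2}a^{1-2\mu} \chi^{-1/2} \sum_{k=0}^\infty \frac{(-1)^k}{k!} (\mu)_k\, \zeta(1-\gamma-2k)\, a^{-2k}$$ $$+\,a^{-1-2\mu}\chi^{1/2}\sum_{k=0}^\infty\frac{(-1)^{k+1}}{k!} (\mu)_k\, \zeta(-\gamma-1-2k)\, F_k^{(\mu)}(1;\chi)\, a^{-2k} \left\{\log\frac{2a}{b}-\gamma_0+\frac{1}{2}+\frac{\zeta'(-\gamma-1-2k)}{\zeta(-\gamma-1-2k)}+F_*^{(1)}\right\},$$ where $$F_k^{(\mu)}(1;\chi)=\sum_{r=0}^k\frac{(-k)_r (-\chi)^r}{(2)_r (1-\mu-k)_r\, r!},$$ $$F_*^{(1)}=F_*^{(1)}(k)=\frac{1}{F_k^{(\mu)}(1;\chi)}\sum_{r=1}^k\frac{(-k)_r (-\chi)^r}{(2)_r(1-k-\mu)_r\, r!} \left(\psi(1+r)-\psi(1)-\frac{r}{2(1+r)}\right).$$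
   Context: $K_1$ is the modified Bessel function of the second kind of order $1$, $\zeta$ the Riemann zeta function, $\gamma_0=0.5772\ldots$ the Euler–Mascheroni constant, $\psi=\Gamma'/\Gamma$, $(x)_r=x(x+1)\cdots(x+r-1)$. Powers and logarithms take principal values. The products $\zeta(w)\cdot\frac{\zeta'(w)}{\zeta(w)}$ and $F_k^{(\mu)}(1;\chi)F_*^{(1)}$ are understood after cancellation, i.e. as $\zeta'(w)$ and as the finite sum defining $F_*^{(1)}$ without its prefactor, so zeros of the denominators cause no problem. $H_{1,\gamma}^\mu(1)$ is the value at $s=1$ of the meromorphic continuation in $s$ of $H_{1,\gamma}^\mu(s)=\int_0^\infty \frac{x^{\gamma+s-1}K_1(bx)}{(1+x^2)^\mu}\,dx$, the integral converging for $\Re s>-\gamma+1$. Meaning of the expansion: for every integer $K\ge0$ and every $\delta\in(0,\frac12\pi)$, the left-hand side minus both sums on the right truncated to the terms $0\le k<K$ is $O(|a|^{1-2\mu-2K})$ as $|a|\to\infty$ uniformly in $|\arg a|\le\frac12\pi-\delta$. *)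

(* Defs.v *)
From Stdlib Require Import Reals Factorial ClassicalEpsilon.
From Coquelicot Require Export Coquelicot.

Open Scope R_scope.

Definition Cexp (z : C) : C := (exp (Re z) * cos (Im z), exp (Re z) * sin (Im z)).

(** Principal argument, with values in [(-PI, PI]]; irrelevant at [z = 0]. *)
Definition Arg (z : C) : R :=
  if Rle_dec 0 (Im z) then acos (Re z / Cmod z) else - acos (Re z / Cmod z).

Definition Clog (z : C) : C := (ln (Cmod z), Arg z).

Definition Cpower (z w : C) : C := Cexp (w * Clog z)%C.

(** [Csum u n] is the sum of [u k] over [k < n], so [Csum u 0 = 0]. *)
Fixpoint Csum (u : nat -> C) (n : nat) : C :=
  match n with
  | O => 0%C
  | S m => (Csum u m + u m)%C
  end.

(** The sum of a convergent complex series, taken componentwise. *)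
Definition CSeries (u : nat -> C) : C :=
  (Series (fun n => Re (u n)), Series (fun n => Im (u n))).

Definition CInt_0_infty (f : R -> C) : C :=
  RInt_gen (V := C_R_CompleteNormedModule) f (at_right 0) (Rbar_locally p_infty).

Definition analytic_at (g : C -> C) (z0 : C) : Prop :=
  exists (c : nat -> C) (r : posreal), forall z : C,
    Cmod (z - z0)%C < r ->
    is_pseries (K := C_AbsRing) (V := C_NormedModule) c (z - z0)%C (g z).

Definition has_pole_at (f : C -> C) (z0 : C) : Prop :=
  exists (m : nat) (g : C -> C) (r : posreal),
    (0 < m)%nat /\ analytic_at g z0 /\ g z0 <> 0%C /\
    forall z : C, 0 < Cmod (z - z0)%C < r ->
      f z = (g z / pow_n (z - z0)%C m)%C.

(** Only the values at poles are arbitrary; in particular removable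
    singularities are required to be removed. *)
Definition meromorphic (f : C -> C) : Prop :=
  forall z0 : C, analytic_at f z0 \/ has_pole_at f z0.

(** The meromorphic function on the whole plane that agrees with [f] on the
    domain [D].  When [D] is a nonempty open set and such a function exists, it
    is determined up to its values at its poles. *)
Definition meromorphic_continuation (D : C -> Prop) (f : C -> C) : C -> C :=
  epsilon (inhabits f)
    (fun G => meromorphic G /\ forall s : C, D s -> G s = f s).

Definition zeta : C -> C :=
  meromorphic_continuation (fun s => 1 < Re s)
    (fun s => CSeries (fun n => Cpower (INR (S n)) (- s)%C)).

(** For [x > 0]. *)
Definition Gamma (x : R) : R :=
  RInt_gen (fun t => Rpower t (x - 1) * exp (- t))
    (at_right 0) (Rbar_locally p_infty).

Definition digamma (x : R) : R := Derive Gamma x / Gamma x.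

Definition Euler_gamma : R :=
  real (Lim_seq (fun n => sum_n_m (fun k => / INR k) 1 n - ln (INR n))).

(** For [Re z > 0]: the integral of [exp (- z cosh t) cosh t] over [t > 0]. *)
Definition BesselK1 (z : C) : C :=
  CInt_0_infty (fun t => Cexp (- z * cosh t) * cosh t)%C.

Fixpoint pochhammer (x : R) (r : nat) : R :=
  match r with
  | O => 1
  | S m => pochhammer x m * (x + INR m)
  end.

(** Summation over [n >= 1], with [n = S m]. *)
Definition S1 (mu gamma : R) (a : C) (b : R) : C :=
  CSeries (fun m => let n := INR (S m) in
    RtoC (Rpower n gamma) * BesselK1 (n * b / a) / Cpower (n * n + a * a) mu)%C.

Definition H1 (mu gamma b : R) : C -> C :=
  meromorphic_continuation (fun s => - gamma + 1 < Re s)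
    (fun s => CInt_0_infty (fun x =>
       Cpower x (gamma + s - 1) * BesselK1 (RtoC (b * x))
         / RtoC (Rpower (1 + x ^ 2) mu))%C).

Definition F_term (mu chi : R) (k r : nat) : R :=
  pochhammer (- INR k) r * (- chi) ^ r
    / (pochhammer 2 r * pochhammer (1 - mu - INR k) r * INR (fact r)).

Definition F (mu chi : R) (k : nat) : R :=
  sum_n_m (F_term mu chi k) 0 k.

(** The finite sum in [F_*^(1)(k)], that is, [F_k * F_*^(1)(k)]. *)
Definition Fstar_sum (mu chi : R) (k : nat) : R :=
  sum_n_m (fun r => F_term mu chi k r *
    (digamma (1 + INR r) - digamma 1 - INR r / (2 * (1 + INR r)))) 1 k.

Definition first_sum (mu gamma : R) (K : nat) (a : C) : C :=
  Csum (fun k =>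
    RtoC ((-1) ^ k / INR (fact k) * pochhammer mu k)
      * zeta (RtoC (1 - gamma - 2 * INR k))
      * Cpower a (RtoC (- 2 * INR k)))%C K.

(** The factor [zeta(w) F_k {log(2a/b) - gamma_0 + 1/2 + zeta'(w)/zeta(w) + F_*}],
    with [w = - gamma - 1 - 2k], is written after multiplying out, so that
    no division by [zeta(w)] or [F_k] remains. *)
Definition second_sum (mu b gamma chi : R) (K : nat) (a : C) : C :=
  Csum (fun k =>
    let w := RtoC (- gamma - 1 - 2 * INR k) in
    RtoC ((-1) ^ S k / INR (fact k) * pochhammer mu k)
      * Cpower a (RtoC (- 2 * INR k))
      * (zeta w * RtoC (F mu chi k)
           * (Clog (2 * a / b) - RtoC Euler_gamma + RtoC (1 / 2))
         + C_derive zeta w * RtoC (F mu chi k)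
         + zeta w * RtoC (Fstar_sum mu chi k)))%C K.

(* Main.v *)
(* Put [g z = z^gamma K1(b z) (1 + z^2)^(-mu)], so that [S1 = a^(gamma - 2 mu) sum_n g(n/a)].

   In the right half plane [g] has a primitive [G] that decays at infinity in every cone around the
   positive axis.  Integrating the expansion of [g] at 0 termwise gives
   [G = P - H + O(|z|^(gamma + 2 K + 1))] in such a cone, where [P] is a combination of the functions
   [z^w] and [z^w log z], and [H] is the integral of [g] over the half line, regularised at 0.
   The continuation of the Mellin transform of [K1(b x) (1 + x^2)^(-mu)] has this same value [H] at
   the point of interest.

   The Euler-Maclaurin functional, the limit of [sum_(n <= m) F'(n)] minus boundary terms at [m + 1],
   is linear in [F].  It gives the sum of [F'(n)] if [F] decays, [-c] on a constant [c],
   [zeta (1 - w)] on [z^w / w], hence [- zeta' (1 - w)] on the derivative of [z^w / w] in [w], and by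
   Cauchy's estimates it is [O(B)] on functions bounded by [B |z|^m] in a cone.  Applied to
   [F x = a G(x/a)] it yields the expansion for large [K]; the smaller [K] follow since the extra
   terms are of the order of the error. *)

Require Import Defs.
From Stdlib Require Import Reals ZArith Lra Lia Psatz Classical ClassicalEpsilon FunctionalExtensionality.
From Coquelicot Require Import Coquelicot.
Open Scope R_scope.

(** * Complex and real derivatives *)

(** The points [n / a] lie off the real axis when [a] is complex, so every bound on [g] and on its
    primitive is proved in cones around the positive axis. Dividing a very narrow cone by [a] lands
    in a wider one; this leaves a complex neighbourhood of the positive integers in which Cauchy's
    estimates bound all derivatives of the remainder from its size alone. The hypothesis on [gamma]
    keeps the exponents [gamma + 2 k] away from 0, where [z^w / w], the zeta value and the
    regularised integral would all have poles. The exponent [gamma + 2 k + 2] collects two sources,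
    the non-logarithmic series of index [k + 1] and the logarithmic one of index [k]; hence the two
    sums of the theorem share their zeta arguments up to a shift of the index. Zeta and [H1] are
    chosen by [epsilon]: an explicit meromorphic function shows that the choice is constrained, and
    the identity theorem shows that it agrees with this function wherever the latter is analytic.
    The logarithm in [K1] brings in Euler's constant, which is reached by comparing [K0] with the
    exponential integral at the origin. *)

Lemma Cmod_le_abs (z : C) : Cmod z <= Rabs (Re z) + Rabs (Im z).
Proof.
  replace z with (RtoC (Re z) + Ci * RtoC (Im z))%C at 1.
  - eapply Rle_trans; [apply Cmod_triangle|].
    rewrite Cmod_mult, Cmod_Ci, !Cmod_R. lra.
  - destruct z; unfold RtoC, Ci, Cplus, Cmult; simpl. f_equal; ring.
Qed.

Lemma im_le_Cmod (z : C) : Rabs (Im z) <= Cmod z.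
Proof.
  eapply Rle_trans; [apply Rmax_r|]. apply Rmax_Cmod.
Qed.

Lemma Cmod_minus_sym (x y : C) : Cmod (x - y)%C = Cmod (y - x)%C.
Proof. rewrite <- Cmod_opp. f_equal. ring. Qed.

Lemma Cmod_minus_triangle (x y : C) : Cmod (x - y)%C <= Cmod x + Cmod y.
Proof.
  eapply Rle_trans; [apply Cmod_triangle|]. rewrite Cmod_opp. lra.
Qed.

Lemma Cmod_rev_triangle (x y : C) : Cmod x - Cmod y <= Cmod (x - y)%C.
Proof.
  assert (H := Cmod_triangle (x - y) y).
  replace (x - y + y)%C with x in H by ring. lra.
Qed.

Lemma Cmod_split (x y z : C) : Cmod (x - z)%C <= Cmod (x - y)%C + Cmod (y - z)%C.
Proof.
  replace (x - z)%C with ((x - y) + (y - z))%C by ring. apply Cmod_triangle.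
Qed.

Lemma Cmod_small_eq (x y : C) : (forall eps, 0 < eps -> Cmod (x - y)%C <= eps) -> x = y.
Proof.
  intros H. apply Ceq_minus. apply Cmod_eq_0.
  destruct (Rle_lt_or_eq_dec 0 (Cmod (x - y)%C) (Cmod_ge_0 _)) as [h|h]; [|easy].
  specialize (H (Cmod (x - y)%C / 2)). lra.
Qed.

Lemma Cplus_minus_cancel (x y : C) : (x + (y - x))%C = y.
Proof. ring. Qed.

(** Continuity and derivatives are phrased through the increment [h] and [Cmod], because [C] carries
    several normed-module structures with different balls; lemmas such as [cderiv_is_derive] pass
    between this form and the filters. *)
Definition ccont (f : C -> C) (z : C) : Prop :=
  forall eps, 0 < eps -> exists d, 0 < d /\
    forall h, Cmod h < d -> Cmod (f (z + h)%C - f z)%C < eps.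

Definition cderiv (f : C -> C) (z l : C) : Prop :=
  forall eps, 0 < eps -> exists d, 0 < d /\
    forall h, Cmod h < d -> Cmod (f (z + h)%C - f z - l * h)%C <= eps * Cmod h.

Definition rcont (f : R -> C) (t : R) : Prop :=
  forall eps, 0 < eps -> exists d, 0 < d /\
    forall h, Rabs h < d -> Cmod (f (t + h)%R - f t)%C < eps.

Definition rderiv (f : R -> C) (t : R) (l : C) : Prop :=
  forall eps, 0 < eps -> exists d, 0 < d /\
    forall h : R, Rabs h < d -> Cmod (f (t + h)%R - f t - l * h)%C <= eps * Rabs h.

Lemma rcont_continuous (f : R -> C) t :
  rcont f t -> continuous (U := C_R_NormedModule) f t.
Proof.
  intros H. apply (filterlim_locally (F := locally t) (U := C_R_NormedModule) f (f t)).
  intros eps. destruct (H eps (cond_pos eps)) as [d [hd H1]].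
  exists (mkposreal d hd). intros y hy. simpl in hy.
  specialize (H1 (y - t)). rewrite Rplus_minus in H1.
  specialize (H1 hy). apply C_NormedModule_mixin_compat1. exact H1.
Qed.

Lemma norm_C_R (z : C) : norm (V := C_R_NormedModule) z = Cmod z.
Proof.
  destruct z as [x y].
  change (sqrt (Rabs x ^ 2 + Rabs y ^ 2) = sqrt (x ^ 2 + y ^ 2)).
  rewrite !pow2_abs. easy.
Qed.

Lemma rderiv_is_derive (f : R -> C) t l :
  rderiv f t l -> is_derive (K := R_AbsRing) (V := C_R_NormedModule) f t l.
Proof.
  intros H. split; [apply is_linear_scal_l|].
  intros x hx. assert (hx' := is_filter_lim_locally_unique (V := AbsRing_NormedModule R_AbsRing) t x hx).
  subst x. clear hx.
  intros eps. destruct (H eps (cond_pos eps)) as [d [hd H1]].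
  exists (mkposreal d hd). intros y hy.
  specialize (H1 (y - t)). rewrite Rplus_minus in H1.
  specialize (H1 hy).
  eapply Rle_trans; [|exact H1]. apply Req_le.
  etransitivity; [apply norm_C_R|].
  change (Cmod (f y - f t - scal (V := C_R_NormedModule) (y - t)%R l)%C =
    Cmod (f y - f t - l * RtoC (y - t))%C).
  rewrite scal_R_Cmult. f_equal. ring.
Qed.

Lemma is_derive_rderiv (f : R -> C) t a b :
  is_derive (fun x => Re (f x)) t a -> is_derive (fun x => Im (f x)) t b ->
  rderiv f t (a, b).
Proof.
  intros Ha Hb eps he.
  apply is_derive_Reals in Ha. apply is_derive_Reals in Hb.
  destruct (Ha (eps / 2)) as [d1 H1]; [lra|].
  destruct (Hb (eps / 2)) as [d2 H2]; [lra|].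
  exists (Rmin d1 d2). split; [apply Rmin_pos; apply cond_pos|].
  intros h hh.
  destruct (Req_dec h 0) as [->|h0].
  { rewrite Rplus_0_r, Rabs_R0, Rmult_0_r.
    replace (f t - f t - (a, b) * RtoC 0)%C with (RtoC 0) by ring. rewrite Cmod_0. lra. }
  specialize (H1 h h0 (Rlt_le_trans _ _ _ hh (Rmin_l _ _))).
  specialize (H2 h h0 (Rlt_le_trans _ _ _ hh (Rmin_r _ _))).
  assert (A : forall u v, Rabs (u / h - v) < eps / 2 -> Rabs (u - v * h) <= eps / 2 * Rabs h).
  { intros u v huv. replace (u - v * h) with ((u / h - v) * h) by (field; exact h0).
    rewrite Rabs_mult. apply Rmult_le_compat_r; [apply Rabs_pos|lra]. }
  apply A in H1. apply A in H2.
  eapply Rle_trans; [apply Cmod_le_abs|].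
  replace (Re (f (t + h)%R - f t - (a, b) * h)) with (Re (f (t + h)%R) - Re (f t) - a * h)
    by (unfold Re, Im, Cminus, Cplus, Copp, Cmult, RtoC; simpl; ring).
  replace (Im (f (t + h)%R - f t - (a, b) * h)) with (Im (f (t + h)%R) - Im (f t) - b * h)
    by (unfold Re, Im, Cminus, Cplus, Copp, Cmult, RtoC; simpl; ring).
  lra.
Qed.

Lemma rderiv_Re (f : R -> C) t l : rderiv f t l -> is_derive (fun x => Re (f x)) t (Re l).
Proof.
  intros H. apply is_derive_Reals. intros eps he.
  destruct (H (eps / 2)) as [d [hd H1]]; [lra|].
  exists (mkposreal d hd). intros h h0 hh. simpl in hh. specialize (H1 h hh).
  replace ((Re (f (t + h)%R) - Re (f t)) / h - Re l)
    with (Re (f (t + h)%R - f t - l * h) / h) by (unfold Re, Im, Cminus, Cplus, Copp, Cmult, RtoC; simpl; field; exact h0).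
  unfold Rdiv. rewrite Rabs_mult, Rabs_inv.
  assert (0 < Rabs h) by (apply Rabs_pos_lt; exact h0).
  apply Rmult_lt_reg_r with (Rabs h); [easy|].
  rewrite Rmult_assoc, Rinv_l, Rmult_1_r by lra.
  eapply Rle_lt_trans; [apply re_le_Cmod|]. eapply Rle_lt_trans; [exact H1|]. nra.
Qed.

Lemma cderiv_ccont f z l : cderiv f z l -> ccont f z.
Proof.
  intros H eps he. destruct (H 1 Rlt_0_1) as [d [hd H1]].
  assert (hl := Cmod_ge_0 l).
  exists (Rmin d (eps / (2 + Cmod l))). split.
  { apply Rmin_pos; [easy|]. apply Rdiv_lt_0_compat; lra. }
  intros h hh.
  assert (h1 := Rlt_le_trans _ _ _ hh (Rmin_l _ _)).
  assert (h2 := Rlt_le_trans _ _ _ hh (Rmin_r _ _)).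
  specialize (H1 h h1).
  replace (f (z + h)%C - f z)%C with ((f (z + h)%C - f z - l * h) + l * h)%C by ring.
  eapply Rle_lt_trans; [apply Cmod_triangle|]. rewrite Cmod_mult.
  apply Rmult_lt_compat_r with (r := 2 + Cmod l) in h2; [|lra].
  replace (eps / (2 + Cmod l) * (2 + Cmod l)) with eps in h2 by (field; lra).
  nra.
Qed.

Lemma rderiv_rcont f t l : rderiv f t l -> rcont f t.
Proof.
  intros H eps he. destruct (H 1 Rlt_0_1) as [d [hd H1]].
  assert (hl := Cmod_ge_0 l).
  exists (Rmin d (eps / (2 + Cmod l))). split.
  { apply Rmin_pos; [easy|]. apply Rdiv_lt_0_compat; lra. }
  intros h hh.
  assert (h1 := Rlt_le_trans _ _ _ hh (Rmin_l _ _)).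
  assert (h2 := Rlt_le_trans _ _ _ hh (Rmin_r _ _)).
  specialize (H1 h h1).
  replace (f (t + h)%R - f t)%C with ((f (t + h)%R - f t - l * h) + l * h)%C by ring.
  eapply Rle_lt_trans; [apply Cmod_triangle|]. rewrite Cmod_mult, Cmod_R.
  apply Rmult_lt_compat_r with (r := 2 + Cmod l) in h2; [|lra].
  replace (eps / (2 + Cmod l) * (2 + Cmod l)) with eps in h2 by (field; lra).
  nra.
Qed.

Lemma cderiv_is_derive (f : C -> C) z l :
  cderiv f z l <-> is_derive (K := C_AbsRing) (V := AbsRing_NormedModule C_AbsRing) f z l.
Proof.
  split.
  - intros H. split; [apply is_linear_scal_l|].
    intros x hx. assert (hx' := is_filter_lim_locally_unique (V := AbsRing_NormedModule C_AbsRing) z x hx).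
    subst x. clear hx.
    intros eps. destruct (H eps (cond_pos eps)) as [d [hd H1]].
    exists (mkposreal d hd). intros y hy.
    specialize (H1 (y - z)%C). rewrite Cplus_minus_cancel in H1.
    specialize (H1 hy).
    eapply Rle_trans; [|exact H1]. apply Req_le.
    change (Cmod (f y - f z - (y - z) * l)%C = Cmod (f y - f z - l * (y - z))%C).
    f_equal. ring.
  - intros [_ H] eps he.
    specialize (H z (fun P H => H) (mkposreal eps he)).
    destruct H as [d H]. exists d. split; [apply cond_pos|].
    intros h hh. specialize (H (z + h)%C).
    assert (e : (z + h - z)%C = h) by ring.
    assert (B : ball (M := AbsRing_UniformSpace C_AbsRing) z d (z + h)%C).
    { change (Cmod (z + h - z)%C < d). rewrite e. exact hh. }
    specialize (H B).
    change (Cmod (f (z + h)%C - f z - (z + h - z) * l)%C <= eps * Cmod (z + h - z)%C) in H.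
    rewrite e in H. replace (l * h)%C with (h * l)%C by ring. exact H.
Qed.

Lemma cderiv_C_derive f z l : cderiv f z l -> C_derive f z = l.
Proof.
  intros H. apply cderiv_is_derive in H. destruct H as [_ H].
  apply is_C_derive_unique. split; [apply is_linear_scal_l|exact H].
Qed.

Lemma cderiv_ext_loc f g z l d : 0 < d ->
  (forall w, Cmod (w - z)%C < d -> f w = g w) -> cderiv f z l -> cderiv g z l.
Proof.
  intros hd E H eps he. destruct (H eps he) as [d1 [hd1 H1]].
  exists (Rmin d d1). split; [apply Rmin_pos; easy|]. intros h hh.
  rewrite <- !E.
  - apply H1. eapply Rlt_le_trans; [exact hh|apply Rmin_r].
  - replace (z - z)%C with (RtoC 0) by ring. rewrite Cmod_0. easy.
  - replace (z + h - z)%C with h by ring. eapply Rlt_le_trans; [exact hh|apply Rmin_l].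
Qed.

Lemma cderiv_ext f g z l : (forall w, f w = g w) -> cderiv f z l -> cderiv g z l.
Proof. intros E. apply cderiv_ext_loc with 1; [lra|]. intros; apply E. Qed.

Lemma cderiv_eq f z l l' : l = l' -> cderiv f z l -> cderiv f z l'.
Proof. intros ->. easy. Qed.

Lemma cderiv_const c z : cderiv (fun _ => c) z 0.
Proof. rewrite cderiv_is_derive. apply (is_derive_const (V := AbsRing_NormedModule C_AbsRing)). Qed.

Lemma cderiv_id z : cderiv (fun w => w) z 1.
Proof.
  intros eps he. exists 1. split; [lra|]. intros h _.
  replace (z + h - z - 1 * h)%C with (RtoC 0) by ring. rewrite Cmod_0.
  assert (0 <= Cmod h) by apply Cmod_ge_0. nra.
Qed.

Lemma cderiv_plus f g z a b : cderiv f z a -> cderiv g z b ->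
  cderiv (fun w => f w + g w)%C z (a + b)%C.
Proof. rewrite !cderiv_is_derive. apply (is_derive_plus (V := AbsRing_NormedModule C_AbsRing)). Qed.

Lemma cderiv_mult f g z a b : cderiv f z a -> cderiv g z b ->
  cderiv (fun w => f w * g w)%C z (a * g z + f z * b)%C.
Proof. rewrite !cderiv_is_derive. intros Hf Hg. exact (is_derive_mult (K := C_AbsRing) f g z a b Hf Hg Cmult_comm). Qed.

Lemma cderiv_scal c f z a : cderiv f z a -> cderiv (fun w => c * f w)%C z (c * a)%C.
Proof.
  intros H. eapply cderiv_eq; [|apply (cderiv_mult _ _ _ _ _ (cderiv_const c z) H)]. ring.
Qed.

Lemma cderiv_opp f z a : cderiv f z a -> cderiv (fun w => - f w)%C z (- a)%C.
Proof.
  intros H. apply cderiv_ext with (fun w => (-1) * f w)%C; [intros; ring|].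
  eapply cderiv_eq; [|apply cderiv_scal; exact H]. ring.
Qed.

Lemma cderiv_minus f g z a b : cderiv f z a -> cderiv g z b ->
  cderiv (fun w => f w - g w)%C z (a - b)%C.
Proof. intros Hf Hg. apply cderiv_plus; [easy|]. apply cderiv_opp; easy. Qed.

Lemma cderiv_comp f g z a b : cderiv g z a -> cderiv f (g z) b ->
  cderiv (fun w => f (g w)) z (b * a)%C.
Proof. rewrite !cderiv_is_derive, Cmult_comm. intros Hg Hf. exact (is_derive_comp (K := C_AbsRing) (V := AbsRing_NormedModule C_AbsRing) f g z b a Hf Hg). Qed.

Lemma cderiv_inv_id (z : C) : z <> 0%C -> cderiv Cinv z (- / (z * z))%C.
Proof.
  intros hz eps he.
  assert (hm : 0 < Cmod z) by (apply Cmod_gt_0; exact hz).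
  set (m := Cmod z) in *.
  (* Within [m / 2] of [z] the modulus stays above [m / 2]; the other bound makes the exact
     remainder [h^2 / (z^2 (z + h))] at most [eps * Cmod h]. *)
  exists (Rmin (m / 2) (eps * (m * m * m) / 2)). split.
  { apply Rmin_pos; [lra|]. apply Rdiv_lt_0_compat; [|lra]. repeat apply Rmult_lt_0_compat; lra. }
  intros h hh. apply Rmin_Rgt_l in hh. destruct hh as [k1 k2].
  assert (T : m / 2 <= Cmod (z + h)%C).
  { assert (T := Cmod_rev_triangle z (- h)). rewrite Cmod_opp in T.
    replace (z - - h)%C with (z + h)%C in T by ring. unfold m in *. lra. }
  assert (hz' : (z + h)%C <> 0%C) by (apply Cmod_gt_0; lra).
  replace (/ (z + h)%C - / z - - / (z * z) * h)%C with (h * h / (z * z * (z + h)%C))%C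
    by (field; split; easy).
  rewrite Cmod_div by (repeat apply Cmult_neq_0; easy). rewrite !Cmod_mult. fold m.
  assert (G := Cmod_ge_0 h).
  apply Rmult_le_reg_r with (m * m * Cmod (z + h)%C); [repeat apply Rmult_lt_0_compat; lra|].
  unfold Rdiv. rewrite Rmult_assoc, Rinv_l, Rmult_1_r.
  2:{ apply Rgt_not_eq. repeat apply Rmult_lt_0_compat; lra. }
  assert (eps * (m * m * (m / 2)) <= eps * (m * m * Cmod (z + h)%C)).
  { apply Rmult_le_compat_l; [lra|]. apply Rmult_le_compat_l; nra. }
  assert (Cmod h * Cmod h <= Cmod h * (eps * (m * m * Cmod (z + h)%C))) by (apply Rmult_le_compat_l; lra).
  lra.
Qed.

Lemma cderiv_inv (f : C -> C) (z a : C) : f z <> 0%C -> cderiv f z a ->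
  cderiv (fun w => / f w)%C z (- a / (f z * f z))%C.
Proof.
  intros h H. eapply cderiv_eq; [|exact (cderiv_comp _ _ _ _ _ H (cderiv_inv_id _ h))].
  unfold Cdiv. ring.
Qed.

Lemma rderiv_comp (f : C -> C) (p : R -> C) t a b : rderiv p t a -> cderiv f (p t) b ->
  rderiv (fun s => f (p s)) t (b * a)%C.
Proof.
  intros Hg Hf eps he.
  assert (Cg := rderiv_rcont _ _ _ Hg).
  set (M := Cmod a + Cmod b + 2).
  assert (hM : 2 <= M).
  { unfold M. assert (A := Cmod_ge_0 a). assert (B := Cmod_ge_0 b). lra. }
  set (e := Rmin 1 (eps / (2 * M))).
  assert (hp : 0 < e) by (apply Rmin_pos; [lra|apply Rdiv_lt_0_compat; lra]).
  assert (hp' : 2 * (e * M) <= eps).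
  { assert (e <= eps / (2 * M)) by apply Rmin_r.
    apply Rmult_le_compat_r with (r := 2 * M) in H; [|lra].
    replace (eps / (2 * M) * (2 * M)) with eps in H by (field; lra). lra. }
  assert (he1 : e <= 1) by apply Rmin_l.
  destruct (Hf _ hp) as [d1 [h1 H1]].
  destruct (Hg _ hp) as [d2 [h2 H2]].
  destruct (Cg _ h1) as [d3 [h3 H3]].
  exists (Rmin d2 d3). split; [apply Rmin_pos; easy|]. intros h hh.
  apply Rmin_Rgt_l in hh. destruct hh as [k2 k3].
  specialize (H2 h k2). specialize (H3 h k3).
  specialize (H1 (p (t + h)%R - p t)%C H3).
  replace (p t + (p (t + h)%R - p t))%C with (p (t + h)%R) in H1 by ring.
  replace (f (p (t + h)%R) - f (p t) - b * a * h)%C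
    with ((f (p (t + h)%R) - f (p t) - b * (p (t + h)%R - p t)) + b * (p (t + h)%R - p t - a * h))%C
    by ring.
  eapply Rle_trans; [apply Cmod_triangle|]. rewrite Cmod_mult.
  assert (A := Cmod_ge_0 a). assert (B := Cmod_ge_0 b). assert (G := Rabs_pos h).
  assert (Q : Cmod (p (t + h)%R - p t)%C <= M * Rabs h).
  { replace (p (t + h)%R - p t)%C with ((p (t + h)%R - p t - a * h) + a * h)%C by ring.
    eapply Rle_trans; [apply Cmod_triangle|]. rewrite Cmod_mult, Cmod_R. unfold M. nra. }
  assert (P1 : e * Cmod (p (t + h)%R - p t)%C <= e * (M * Rabs h)) by (apply Rmult_le_compat_l; lra).
  assert (P2 : Cmod b * Cmod (p (t + h)%R - p t - a * h)%C <= M * (e * Rabs h)).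
  { apply Rmult_le_compat; try apply Cmod_ge_0; [unfold M; lra|easy]. }
  assert (2 * (e * M) * Rabs h <= eps * Rabs h) by (apply Rmult_le_compat_r; lra).
  lra.
Qed.

Lemma rderiv_line (c d : C) t : rderiv (fun s => c + RtoC s * d)%C t d.
Proof.
  intros eps he. exists 1. split; [lra|]. intros h _.
  rewrite RtoC_plus.
  replace (c + (RtoC t + RtoC h) * d - (c + t * d) - d * h)%C with (RtoC 0) by ring. rewrite Cmod_0.
  assert (0 <= Rabs h) by apply Rabs_pos. nra.
Qed.

Lemma rderiv_RtoC t : rderiv RtoC t 1.
Proof.
  intros eps he. exists 1. split; [lra|]. intros h _.
  rewrite RtoC_plus.
  replace (RtoC t + RtoC h - t - 1 * h)%C with (RtoC 0) by ring. rewrite Cmod_0.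
  assert (0 <= Rabs h) by apply Rabs_pos. nra.
Qed.

Lemma rderiv_eq f z l l' : l = l' -> rderiv f z l -> rderiv f z l'.
Proof. intros ->. easy. Qed.

Lemma rderiv_ext (f g : R -> C) t l : (forall s, f s = g s) -> rderiv f t l -> rderiv g t l.
Proof.
  intros E H eps he. destruct (H eps he) as [d [hd H1]]. exists d. split; [easy|].
  intros h hh. rewrite <- !E. apply H1; easy.
Qed.

Lemma rderiv_of_cderiv f (t : R) l : cderiv f t l -> rderiv (fun s => f (RtoC s)) t l.
Proof.
  intros H. eapply rderiv_eq; [|exact (rderiv_comp f RtoC t _ _ (rderiv_RtoC t) H)]. ring.
Qed.

(* The increment [D = F b - F a] is tested against the real function [Re (conj D * F)]. *)
Lemma cmvt_dom (F f : R -> C) (phi dphi : R -> R) a b : a <= b ->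
  (forall t, a <= t <= b -> rderiv F t (f t)) ->
  (forall t, a <= t <= b -> is_derive phi t (dphi t)) ->
  (forall t, a <= t <= b -> Cmod (f t)%C <= dphi t) ->
  Cmod (F b - F a)%C <= phi b - phi a.
Proof.
  intros hab HF Hp Hle.
  set (D := (F b - F a)%C).
  assert (HFd : forall t, a <= t <= b ->
    is_derive (fun s => Re (Cconj D * F s)) t (Re (Cconj D * f t))).
  { intros t ht.
    apply (rderiv_Re (fun s => Cconj D * F s)%C).
    apply (rderiv_comp (fun w => Cconj D * w)%C F t (f t) (Cconj D)); [apply HF; easy|].
    eapply cderiv_eq; [|apply cderiv_scal, cderiv_id]. ring. }
  assert (Hm : forall u : R -> R, forall du, (forall t, a <= t <= b -> is_derive u t (du t)) ->
     (forall t, a <= t <= b -> 0 <= du t) -> u a <= u b).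
  { intros u du Hu Hdu.
    destruct (MVT_gen u a b du) as [c [hc E]].
    - intros x hx. rewrite Rmin_left, Rmax_right in hx by lra. apply Hu; lra.
    - intros x hx. rewrite Rmin_left, Rmax_right in hx by lra.
      apply derivable_continuous_pt. exists (du x). apply is_derive_Reals. apply Hu; lra.
    - rewrite Rmin_left, Rmax_right in hc by lra. specialize (Hdu c hc). nra. }
  destruct (Req_dec (Cmod D) 0) as [h0|h0].
  - rewrite h0. assert (phi a <= phi b); [|lra].
    apply (Hm phi dphi); [easy|]. intros t ht. eapply Rle_trans; [apply Cmod_ge_0|]. apply Hle; easy.
  - assert (hD : 0 < Cmod D) by (assert (H := Cmod_ge_0 D); lra).
    assert (K := Hm (fun t => Cmod D * phi t - Re (Cconj D * F t))
      (fun t => Cmod D * dphi t - Re (Cconj D * f t))).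
    simpl in K.
    assert (K' : Cmod D * phi a - Re (Cconj D * F a) <= Cmod D * phi b - Re (Cconj D * F b)).
    { apply K.
      - intros t ht. apply (is_derive_minus (V := R_NormedModule)); [|apply HFd; easy].
        apply is_derive_scal. apply Hp; easy.
      - intros t ht.
        assert (Rabs (Re (Cconj D * f t)) <= Cmod D * dphi t).
        { eapply Rle_trans; [apply re_le_Cmod|]. rewrite Cmod_mult, Cmod_conj.
          apply Rmult_le_compat_l; [lra|apply Hle; easy]. }
        assert (T := Rle_abs (Re (Cconj D * f t))). simpl in *. lra. }
    (* The test function grows by exactly [|D|^2], so dividing the monotonicity inequality by [|D|]
       gives the claim. *)
    assert (E : Re (Cconj D * F b) - Re (Cconj D * F a) = Cmod D * Cmod D).
    { assert (Z := Cmod2_conj D).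
      replace (Cmod D * Cmod D) with (Re (RtoC (Cmod D ^ 2))) by (simpl; ring).
      rewrite Z. simpl. ring. }
    apply Rmult_le_reg_l with (Cmod D); [easy|]. simpl in *. lra.
Qed.

Lemma cmvt (F f : R -> C) (B : R) a b : a <= b ->
  (forall t, a <= t <= b -> rderiv F t (f t)) ->
  (forall t, a <= t <= b -> Cmod (f t)%C <= B) ->
  Cmod (F b - F a)%C <= B * (b - a).
Proof.
  intros hab HF Hle.
  replace (B * (b - a)) with (B * b - B * a) by ring.
  apply (cmvt_dom F f (fun t => B * t) (fun _ => B)); try easy.
  intros t _. auto_derive; [easy|ring].
Qed.

Lemma cmvt_seg (F f : C -> C) (B : R) (z w : C) :
  (forall t, 0 <= t <= 1 -> cderiv F (z + t * (w - z))%C (f (z + t * (w - z))%C)) ->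
  (forall t, 0 <= t <= 1 -> Cmod (f (z + t * (w - z)))%C <= B) ->
  Cmod (F w - F z)%C <= B * Cmod (w - z)%C.
Proof.
  intros HF Hle.
  assert (K := cmvt (fun t => F (z + RtoC t * (w - z)))%C
    (fun t => f (z + RtoC t * (w - z)) * (w - z))%C (B * Cmod (w - z)%C) 0 1 Rle_0_1).
  simpl in K. rewrite Rminus_0_r, Rmult_1_r in K.
  replace (z + 1 * (w - z))%C with w in K by ring.
  replace (z + 0 * (w - z))%C with z in K by ring.
  apply K.
  - intros t ht. apply (rderiv_comp F (fun t => z + RtoC t * (w - z))%C t (w - z)%C).
    + apply rderiv_line.
    + apply HF; easy.
  - intros t ht. rewrite Cmod_mult. apply Rmult_le_compat_r; [apply Cmod_ge_0|]. apply Hle; easy.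
Qed.

(** * The complex exponential *)

Lemma Cexp_plus z w : Cexp (z + w)%C = (Cexp z * Cexp w)%C.
Proof.
  destruct z as [a b], w as [c d]. unfold Cexp, Cmult, Cplus. simpl.
  rewrite exp_plus, cos_plus, sin_plus. f_equal; ring.
Qed.

Lemma Cexp_0 : Cexp 0 = 1%C.
Proof. unfold Cexp. simpl. rewrite exp_0, cos_0, sin_0. unfold RtoC. f_equal; ring. Qed.

Lemma Cmod_Cexp z : Cmod (Cexp z)%C = exp (Re z).
Proof.
  unfold Cexp, Cmod. simpl.
  replace (exp (Re z) * cos (Im z) * (exp (Re z) * cos (Im z) * 1) +
    exp (Re z) * sin (Im z) * (exp (Re z) * sin (Im z) * 1))
    with (Rsqr (exp (Re z)) * (Rsqr (sin (Im z)) + Rsqr (cos (Im z)))) by (unfold Rsqr; ring).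
  rewrite sin2_cos2, Rmult_1_r. apply sqrt_Rsqr. left. apply exp_pos.
Qed.

Lemma Cexp_neq_0 z : Cexp z <> 0%C.
Proof. apply Cmod_gt_0. rewrite Cmod_Cexp. apply exp_pos. Qed.

Lemma Cexp_opp z : Cexp (- z)%C = (/ Cexp z)%C.
Proof.
  assert (H : (Cexp (- z)%C * Cexp z)%C = 1%C).
  { rewrite <- Cexp_plus. replace (- z + z)%C with (RtoC 0) by ring. apply Cexp_0. }
  assert (N := Cexp_neq_0 z).
  replace (Cexp (- z)%C) with (Cexp (- z)%C * Cexp z / Cexp z)%C by (field; easy).
  rewrite H. field; easy.
Qed.

Lemma Cexp_RtoC x : Cexp (RtoC x)%C = RtoC (exp x).
Proof. unfold Cexp. simpl. rewrite cos_0, sin_0. unfold RtoC. f_equal; ring. Qed.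

(** Along a real ray both components are elementary functions. Integrating along such a ray bounds
    [Cexp h - 1 - h] to second order, and with [Cexp_plus] this yields the complex derivative. *)
Lemma rderiv_Cexp_line w t : rderiv (fun s => Cexp (RtoC s * w)%C) t (w * Cexp (RtoC t * w)%C)%C.
Proof.
  replace (w * Cexp (RtoC t * w)%C)%C with
    (Re w * exp (t * Re w) * cos (t * Im w) - Im w * exp (t * Re w) * sin (t * Im w),
     Re w * exp (t * Re w) * sin (t * Im w) + Im w * exp (t * Re w) * cos (t * Im w)).
  2:{ destruct w as [a b]. unfold Cexp, Cmult. simpl.
      replace (t * a - 0 * b) with (t * a) by ring.
      replace (t * b + 0 * a) with (t * b) by ring. f_equal; ring. }
  assert (E : forall s, Cexp (RtoC s * w)%C =
    (exp (s * Re w) * cos (s * Im w), exp (s * Re w) * sin (s * Im w))).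
  { intros s. destruct w as [a b]. unfold Cexp, Cmult. simpl.
    replace (s * a - 0 * b) with (s * a) by ring.
    replace (s * b + 0 * a) with (s * b) by ring. easy. }
  apply is_derive_rderiv.
  - apply is_derive_ext with (fun s => exp (s * Re w) * cos (s * Im w)).
    + intros s. rewrite E. easy.
    + auto_derive; [easy|]. ring.
  - apply is_derive_ext with (fun s => exp (s * Re w) * sin (s * Im w)).
    + intros s. rewrite E. easy.
    + auto_derive; [easy|]. ring.
Qed.

Lemma exp_ge_1 x : 0 <= x -> 1 <= exp x.
Proof. intros h. rewrite <- exp_0. destruct h as [h| <-]; [left; apply exp_increasing; easy|lra]. Qed.

Lemma exp_le x y : x <= y -> exp x <= exp y.
Proof. intros [h| ->]; [left; apply exp_increasing; easy|lra]. Qed.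

Lemma Cexp_sub_1 w : Cmod (Cexp w - 1)%C <= Cmod w * exp (Cmod w).
Proof.
  assert (K := cmvt (fun s => Cexp (RtoC s * w)%C) (fun s => w * Cexp (RtoC s * w)%C)%C
    (Cmod w * exp (Cmod w)) 0 1 Rle_0_1).
  cbv beta in K. replace (RtoC 1 * w)%C with w in K by ring. replace (RtoC 0 * w)%C with (RtoC 0) in K by ring.
  rewrite Cexp_0 in K. rewrite Rminus_0_r, Rmult_1_r in K. apply K.
  - intros t _. apply rderiv_Cexp_line.
  - intros t ht. rewrite Cmod_mult, Cmod_Cexp. apply Rmult_le_compat_l; [apply Cmod_ge_0|].
    apply exp_le. rewrite re_scal_l. assert (A := re_le_Cmod w). assert (B := Rle_abs (Re w)).
    assert (D := Cmod_ge_0 w). nra.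
Qed.

Lemma Cexp_sub_1_sub w : Cmod (Cexp w - 1 - w)%C <= Cmod w * Cmod w * exp (Cmod w).
Proof.
  assert (K := cmvt (fun s => Cexp (RtoC s * w)%C + RtoC s * (- w))%C
    (fun s => w * Cexp (RtoC s * w)%C + (- w))%C
    (Cmod w * Cmod w * exp (Cmod w)) 0 1 Rle_0_1).
  cbv beta in K.
  assert (E : (Cexp (1 * w)%C + 1 * - w - (Cexp (0 * w)%C + 0 * - w))%C = (Cexp w - 1 - w)%C).
  { replace (RtoC 1 * w)%C with w by ring. replace (RtoC 0 * w)%C with (RtoC 0) by ring.
    rewrite Cexp_0. ring. }
  rewrite E in K.
  rewrite Rminus_0_r, Rmult_1_r in K. apply K.
  - intros t _ eps he.
    destruct (rderiv_Cexp_line w t eps he) as [d [hd H]]. exists d. split; [easy|].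
    intros h hh. specialize (H h hh). eapply Rle_trans; [|exact H]. apply Req_le. f_equal.
    rewrite RtoC_plus. ring.
  - intros t ht. replace (w * Cexp (t * w)%C + - w)%C with (w * (Cexp (t * w)%C - 1))%C by ring.
    rewrite Cmod_mult, Rmult_assoc. apply Rmult_le_compat_l; [apply Cmod_ge_0|].
    eapply Rle_trans; [apply Cexp_sub_1|]. rewrite Cmod_mult, Cmod_R, Rabs_pos_eq by lra.
    assert (D := Cmod_ge_0 w).
    apply Rmult_le_compat; try nra; [left; apply exp_pos|]. apply exp_le. nra.
Qed.

Lemma cderiv_Cexp z : cderiv Cexp z (Cexp z).
Proof.
  intros eps he.
  set (M := Cmod (Cexp z)%C * exp 1).
  assert (hM : 0 < M).
  { unfold M. rewrite Cmod_Cexp. apply Rmult_lt_0_compat; apply exp_pos. }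
  exists (Rmin 1 (eps / M)). split.
  { apply Rmin_pos; [lra|]. apply Rdiv_lt_0_compat; lra. }
  intros h hh. apply Rmin_Rgt_l in hh. destruct hh as [k1 k2].
  replace (Cexp (z + h)%C - Cexp z - Cexp z * h)%C with (Cexp z * (Cexp h - 1 - h))%C
    by (rewrite Cexp_plus; ring).
  rewrite Cmod_mult. assert (G := Cmod_ge_0 h).
  assert (T := Cexp_sub_1_sub h).
  assert (exp (Cmod h) <= exp 1) by (apply exp_le; lra).
  assert (Cmod h * Cmod h * exp (Cmod h) <= Cmod h * Cmod h * exp 1)
    by (apply Rmult_le_compat_l; nra).
  assert (hz : 0 < Cmod (Cexp z)%C) by (rewrite Cmod_Cexp; apply exp_pos).
  assert (Cmod (Cexp z)%C * Cmod (Cexp h - 1 - h)%C <= Cmod (Cexp z)%C * (Cmod h * Cmod h * exp 1))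
    by (apply Rmult_le_compat_l; lra).
  apply Rmult_lt_compat_r with (r := M) in k2; [|easy].
  replace (eps / M * M) with eps in k2 by (field; lra).
  assert (Cmod h * (Cmod h * M) <= Cmod h * eps) by (apply Rmult_le_compat_l; lra).
  unfold M in *. lra.
Qed.

(** * Integrals of complex functions *)

Lemma rcont_const c t : rcont (fun _ => c) t.
Proof.
  intros eps he. exists 1. split; [lra|]. intros h _.
  replace (c - c)%C with (RtoC 0) by ring. rewrite Cmod_0. easy.
Qed.

Lemma ccont_continuous f z : ccont f z <->
  continuous (T := AbsRing_UniformSpace C_AbsRing) (U := AbsRing_UniformSpace C_AbsRing) f z.
Proof.
  split.
  - intros H. apply filterlim_locally. intros eps. destruct (H eps (cond_pos eps)) as [d [hd H1]].
    exists (mkposreal d hd). intros y hy. specialize (H1 (y - z)%C hy). rewrite Cplus_minus_cancel in H1. exact H1.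
  - intros H eps he. destruct (proj1 (filterlim_locally _ _) H (mkposreal eps he)) as [d Hd].
    exists d. split; [apply cond_pos|]. intros h hh. apply Hd. change (Cmod (z + h - z)%C < d).
    replace (z + h - z)%C with h by ring. exact hh.
Qed.

Lemma rcont_continuous_abs f t : rcont f t <-> continuous (T := R_UniformSpace) (U := AbsRing_UniformSpace C_AbsRing) f t.
Proof.
  split.
  - intros H. apply filterlim_locally. intros eps. destruct (H eps (cond_pos eps)) as [d [hd H1]].
    exists (mkposreal d hd). intros y hy. specialize (H1 (y - t) hy). rewrite Rplus_minus in H1. exact H1.
  - intros H eps he. destruct (proj1 (filterlim_locally _ _) H (mkposreal eps he)) as [d Hd].
    exists d. split; [apply cond_pos|]. intros h hh. apply Hd. change (Rabs (t + h - t) < d).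
    replace (t + h - t) with h by ring. exact hh.
Qed.

Lemma rcont_comp (f : C -> C) (p : R -> C) t : rcont p t -> ccont f (p t) ->
  rcont (fun s => f (p s)) t.
Proof. rewrite ccont_continuous, !rcont_continuous_abs. apply continuous_comp. Qed.

Lemma rcont_plus f g t : rcont f t -> rcont g t -> rcont (fun s => f s + g s)%C t.
Proof. rewrite !rcont_continuous_abs. apply (continuous_plus (V := AbsRing_NormedModule C_AbsRing)). Qed.

Lemma rcont_mult f g t : rcont f t -> rcont g t -> rcont (fun s => f s * g s)%C t.
Proof. rewrite !rcont_continuous_abs. apply (continuous_mult (K := C_AbsRing)). Qed.

Lemma rcont_opp f t : rcont f t -> rcont (fun s => - f s)%C t.
Proof.
  intros H. intros eps he. destruct (H eps he) as [d [hd H1]]. exists d. split; [easy|].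
  intros h hh. replace (- f (t + h)%R - - f t)%C with (- (f (t + h)%R - f t))%C by ring.
  rewrite Cmod_opp. apply H1; easy.
Qed.

Lemma rcont_minus f g t : rcont f t -> rcont g t -> rcont (fun s => f s - g s)%C t.
Proof. intros; apply rcont_plus; [easy|]. apply rcont_opp; easy. Qed.

Lemma rcont_ext (f g : R -> C) t : (forall s, f s = g s) -> rcont f t -> rcont g t.
Proof.
  intros E H eps he. destruct (H eps he) as [d [hd H1]]. exists d. split; [easy|].
  intros h hh. rewrite <- !E. apply H1; easy.
Qed.

Definition CI (f : R -> C) (a b : R) : C := RInt (V := C_R_CompleteNormedModule) f a b.

Definition is_CI (f : R -> C) (a b : R) (l : C) : Prop :=
  is_RInt (V := C_R_NormedModule) f a b l.

Lemma is_CI_CI f a b : a <= b -> (forall t, a <= t <= b -> rcont f t) ->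
  is_CI f a b (CI f a b).
Proof.
  intros hab H. apply (RInt_correct (V := C_R_CompleteNormedModule)).
  apply (ex_RInt_continuous (V := C_R_CompleteNormedModule)).
  intros z hz. rewrite Rmin_left, Rmax_right in hz by easy.
  apply rcont_continuous. apply H; easy.
Qed.

Lemma CI_unique f a b l : is_CI f a b l -> CI f a b = l.
Proof. apply (is_RInt_unique (V := C_R_CompleteNormedModule)). Qed.

Lemma is_CI_plus f g a b u v : is_CI f a b u -> is_CI g a b v ->
  is_CI (fun t => f t + g t)%C a b (u + v)%C.
Proof. apply (is_RInt_plus (V := C_R_NormedModule)). Qed.

(** The scalar is complex while the integral lives in the module over the reals, so linearity is
    checked on the two components. *)
Lemma is_CI_scal c f a b u : is_CI f a b u -> is_CI (fun t => c * f t)%C a b (c * u)%C.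
Proof.
  intros H.
  assert (H1 := is_RInt_fct_extend_fst (U := R_NormedModule) (V := R_NormedModule) f a b u H).
  assert (H2 := is_RInt_fct_extend_snd (U := R_NormedModule) (V := R_NormedModule) f a b u H).
  apply (is_RInt_fct_extend_pair (U := R_NormedModule) (V := R_NormedModule)
    (fun t => c * f t)%C a b).
  - apply (is_RInt_minus (V := R_NormedModule));
      apply (is_RInt_scal (V := R_NormedModule)); easy.
  - apply (is_RInt_plus (V := R_NormedModule));
      apply (is_RInt_scal (V := R_NormedModule)); easy.
Qed.

Lemma is_CI_minus f g a b u v : is_CI f a b u -> is_CI g a b v ->
  is_CI (fun t => f t - g t)%C a b (u - v)%C.
Proof. apply (is_RInt_minus (V := C_R_NormedModule)). Qed.

Lemma is_CI_ext f g a b u : a <= b -> (forall t, a <= t <= b -> f t = g t) ->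
  is_CI f a b u -> is_CI g a b u.
Proof.
  intros hab E. apply (is_RInt_ext (V := C_R_NormedModule)).
  intros x hx. rewrite Rmin_left, Rmax_right in hx by easy. apply E; lra.
Qed.

Lemma CI_ext f g a b : a <= b -> (forall t, a <= t <= b -> f t = g t) -> CI f a b = CI g a b.
Proof.
  intros hab E. apply (RInt_ext (V := C_R_CompleteNormedModule)).
  intros x hx. rewrite Rmin_left, Rmax_right in hx by easy. apply E; lra.
Qed.

Lemma is_CI_Chasles f a b c u v : is_CI f a b u -> is_CI f b c v -> is_CI f a c (u + v)%C.
Proof. apply (is_RInt_Chasles (V := C_R_NormedModule)). Qed.

Lemma is_CI_bound f a b u M : a <= b -> (forall t, a <= t <= b -> Cmod (f t)%C <= M) ->
  is_CI f a b u -> Cmod u <= (b - a) * M.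
Proof.
  intros hab H HI. rewrite <- norm_C_R.
  apply (norm_RInt_le_const (V := C_R_NormedModule) f a b u M hab); [|exact HI].
  intros x hx. rewrite norm_C_R. apply H; easy.
Qed.

Lemma is_CI_derive F f a b : a <= b ->
  (forall t, a <= t <= b -> rderiv F t (f t)) ->
  (forall t, a <= t <= b -> rcont f t) -> is_CI f a b (F b - F a)%C.
Proof.
  intros hab HF Hf.
  apply (is_RInt_derive (V := C_R_CompleteNormedModule) F f a b);
    intros x hx; rewrite Rmin_left, Rmax_right in hx by easy.
  - apply rderiv_is_derive. apply HF; easy.
  - apply rcont_continuous. apply Hf; easy.
Qed.

Lemma is_CI_const c a b : is_CI (fun _ => c) a b (RtoC (b - a) * c)%C.
Proof.
  assert (H := is_RInt_const (V := C_R_NormedModule) a b c).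
  rewrite scal_R_Cmult in H. exact H.
Qed.

Definition copen (U : C -> Prop) : Prop :=
  forall z, U z -> exists d, 0 < d /\ forall h, Cmod h < d -> U (z + h)%C.

(** Continuity of the derivative belongs to the notion because differentiation under the integral
    sign rests on it. *)
Definition Holo (U : C -> Prop) (f f' : C -> C) : Prop :=
  forall z, U z -> cderiv f z (f' z) /\ ccont f' z.

Lemma bounded_on f a b : (forall t, a <= t <= b -> rcont f t) ->
  exists M, 0 < M /\ forall t, a <= t <= b -> Cmod (f t)%C <= M.
Proof.
  intros H. destruct (bounded_continuity (V := C_R_NormedModule) f a b) as [M HM].
  { intros t ht. apply rcont_continuous, H, ht. }
  exists (Rabs M + 1). assert (T := Rabs_pos M). split; [lra|]. intros t ht.
  specialize (HM t ht). rewrite norm_C_R in HM. assert (T2 := Rle_abs M). lra.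
Qed.

(* Compactness of [[a, b]] makes the pointwise moduli of continuity of [f'] uniform in [t]. *)
Lemma cderiv_CI_affine (U : C -> Prop) (f f' : C -> C) (c q k : R -> C) a b (w0 : C) : a <= b ->
  copen U -> Holo U f f' ->
  (forall t, a <= t <= b -> rcont c t) -> (forall t, a <= t <= b -> rcont q t) ->
  (forall t, a <= t <= b -> rcont k t) ->
  (forall t, a <= t <= b -> U (c t + w0 * q t)%C) ->
  cderiv (fun w => CI (fun t => f (c t + w * q t) * k t)%C a b) w0
    (CI (fun t => f' (c t + w0 * q t) * q t * k t)%C a b).
Proof.
  intros hab HU Hf Hc Hq Hk Hin.
  destruct (bounded_on q a b Hq) as [Mq [hMq HMq]].
  destruct (bounded_on k a b Hk) as [Mk [hMk HMk]].
  assert (Huni : forall e, 0 < e -> exists d, 0 < d /\ forall t h, a <= t <= b -> Cmod h < d ->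
    U (c t + (w0 + h) * q t)%C /\
    Cmod (f' (c t + (w0 + h) * q t) - f' (c t + w0 * q t))%C <= 2 * e).
  { intros e he.
    assert (D : forall t, exists d : posreal, a <= t <= b ->
      forall s h, a <= s <= b -> Rabs (s - t) < d -> Cmod h < d ->
      U (c s + (w0 + h) * q s)%C /\
      Cmod (f' (c s + (w0 + h) * q s) - f' (c t + w0 * q t))%C < e).
    { intros t. destruct (classic (a <= t <= b)) as [ht|ht].
      2:{ exists (mkposreal 1 Rlt_0_1). easy. }
      destruct (HU _ (Hin t ht)) as [d1 [hd1 H1]].
      destruct (proj2 (Hf _ (Hin t ht)) e he) as [d2 [hd2 H2]].
      assert (Cc : rcont (fun s => c s + w0 * q s)%C t).
      { apply rcont_plus; [apply Hc; easy|]. apply rcont_mult; [apply rcont_const|apply Hq; easy]. }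
      set (m := Rmin d1 d2).
      assert (hm : 0 < m) by (apply Rmin_pos; easy).
      destruct (Cc (m / 2)) as [d3 [hd3 H3]]; [lra|].
      assert (hp : 0 < Rmin d3 (m / (2 * Mq))).
      { apply Rmin_pos; [easy|]. apply Rdiv_lt_0_compat; lra. }
      exists (mkposreal _ hp). intros _ s h hs hst hh. simpl in hst, hh.
      specialize (H3 (s - t)). rewrite Rplus_minus in H3.
      specialize (H3 (Rlt_le_trans _ _ _ hst (Rmin_l _ _))).
      assert (hh' := Rlt_le_trans _ _ _ hh (Rmin_r _ _)).
      apply Rmult_lt_compat_r with (r := Mq) in hh'; [|easy].
      replace (m / (2 * Mq) * Mq) with (m / 2) in hh' by (field; lra).
      set (u := (c s + (w0 + h) * q s - (c t + w0 * q t))%C).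
      assert (hu : Cmod u < m).
      { unfold u. replace (c s + (w0 + h) * q s - (c t + w0 * q t))%C with
          ((c s + w0 * q s - (c t + w0 * q t)) + h * q s)%C by ring.
        eapply Rle_lt_trans; [apply Cmod_triangle|]. rewrite Cmod_mult.
        assert (Cmod h * Cmod (q s)%C <= Cmod h * Mq)
          by (apply Rmult_le_compat_l; [apply Cmod_ge_0|apply HMq; easy]). lra. }
      replace (c s + (w0 + h) * q s)%C with ((c t + w0 * q t) + u)%C by (unfold u; ring).
      split.
      - apply H1. eapply Rlt_le_trans; [exact hu|apply Rmin_l].
      - apply H2. eapply Rlt_le_trans; [exact hu|apply Rmin_r]. }
    (* The radii found pointwise must form a function of [t]: the compactness principle takes a
       gauge. *)
    set (del := fun t => proj1_sig (constructive_indefinite_description _ (D t))).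
    assert (Hdel : forall t, a <= t <= b ->
      forall s h, a <= s <= b -> Rabs (s - t) < del t -> Cmod h < del t ->
      U (c s + (w0 + h) * q s)%C /\
      Cmod (f' (c s + (w0 + h) * q s) - f' (c t + w0 * q t))%C < e).
    { intros t. unfold del. destruct (constructive_indefinite_description _ (D t)). easy. }
    destruct (compactness_value_1d a b del) as [d Hd].
    exists d. split; [apply cond_pos|]. intros s h hs hh.
    (* The compactness principle delivers the covering point only under a double negation. *)
    apply NNPP. intros N. apply (Hd s hs). intros [t [ht [h1 h2]]]. apply N.
    assert (A := Hdel t ht s h hs h1 (Rlt_le_trans _ _ _ hh h2)).
    assert (B := Hdel t ht s 0%C hs h1).
    rewrite Cmod_0 in B. specialize (B (cond_pos _)).
    replace (w0 + 0)%C with w0 in B by ring.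
    split; [easy|].
    eapply Rle_trans; [apply Cmod_split with (y := f' (c t + w0 * q t)%C)|].
    rewrite (Cmod_minus_sym (f' (c t + w0 * q t)%C) (f' (c s + w0 * q s)%C)). lra. }
  intros eps he.
  set (e := eps / (2 * (Mq * Mk * (b - a + 1)))).
  assert (hP : 0 < Mq * Mk * (b - a + 1)) by (repeat apply Rmult_lt_0_compat; lra).
  assert (he' : 0 < e) by (apply Rdiv_lt_0_compat; lra).
  destruct (Huni e he') as [d [hd Hd]].
  exists d. split; [easy|]. intros h hh.
  assert (Cc : forall h, Cmod h < d -> forall t, a <= t <= b ->
    rcont (fun t => f (c t + (w0 + h) * q t) * k t)%C t).
  { intros h' hh' t ht. apply rcont_mult; [|apply Hk; easy].
    apply (rcont_comp f (fun t => c t + (w0 + h') * q t)%C).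
    - apply rcont_plus; [apply Hc; easy|]. apply rcont_mult; [apply rcont_const|apply Hq; easy].
    - eapply cderiv_ccont. apply Hf. apply Hd; easy. }
  assert (C0 : forall t, a <= t <= b -> rcont (fun t => f (c t + w0 * q t) * k t)%C t).
  { intros t ht. apply rcont_ext with (fun t => f (c t + (w0 + 0) * q t) * k t)%C.
    - intros s. replace (w0 + 0)%C with w0 by ring. easy.
    - apply Cc; [rewrite Cmod_0; easy|easy]. }
  assert (C1 : forall t, a <= t <= b -> rcont (fun t => f' (c t + w0 * q t) * q t * k t)%C t).
  { intros t ht. apply rcont_mult; [|apply Hk; easy]. apply rcont_mult; [|apply Hq; easy].
    apply (rcont_comp f' (fun t => c t + w0 * q t)%C).
    - apply rcont_plus; [apply Hc; easy|]. apply rcont_mult; [apply rcont_const|apply Hq; easy].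
    - apply Hf. apply Hin; easy. }
  assert (I1 := is_CI_CI _ a b hab (Cc h hh)).
  assert (I0 := is_CI_CI _ a b hab C0).
  assert (I2 := is_CI_CI _ a b hab C1).
  assert (I3 := is_CI_minus _ _ _ _ _ _ (is_CI_minus _ _ _ _ _ _ I1 I0) (is_CI_scal h _ _ _ _ I2)).
  rewrite (Cmult_comm _ h).
  eapply Rle_trans.
  { refine (is_CI_bound _ a b _ (2 * e * (Mq * Mk) * Cmod h) hab _ I3).
    intros t ht. cbv beta.
    replace (f (c t + (w0 + h) * q t) * k t - f (c t + w0 * q t) * k t
       - h * (f' (c t + w0 * q t) * q t * k t))%C
      with ((f (c t + (w0 + h) * q t) - f (c t + w0 * q t)
       - f' (c t + w0 * q t) * (h * q t)) * k t)%C by ring.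
    rewrite Cmod_mult.
    assert (T : Cmod (f (c t + (w0 + h) * q t) - f (c t + w0 * q t)
       - f' (c t + w0 * q t) * (h * q t))%C <= 2 * e * Cmod (h * q t)%C).
    (* Subtracting the linear part at the base point leaves a function whose derivative is the
       oscillation of [f'], at most [2 * e] on the whole segment by [Huni]. *)
    { assert (K := cmvt_seg (fun u => f u - f' (c t + w0 * q t) * u)%C
        (fun u => f' u - f' (c t + w0 * q t))%C (2 * e) (c t + w0 * q t)%C
        (c t + (w0 + h) * q t)%C).
      replace (c t + (w0 + h) * q t - (c t + w0 * q t))%C with (h * q t)%C in K by ring.
      replace (f (c t + (w0 + h) * q t) - f (c t + w0 * q t)
         - f' (c t + w0 * q t) * (h * q t))%C with
        (f (c t + (w0 + h) * q t) - f' (c t + w0 * q t) * (c t + (w0 + h) * q t)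
         - (f (c t + w0 * q t) - f' (c t + w0 * q t) * (c t + w0 * q t)))%C by ring.
      assert (P : forall s, 0 <= s <= 1 ->
        (c t + w0 * q t + s * (h * q t))%C = (c t + (w0 + s * h) * q t)%C) by (intros; ring).
      assert (Q : forall s, 0 <= s <= 1 -> Cmod (s * h)%C < d).
      { intros s hs. rewrite Cmod_mult, Cmod_R, Rabs_pos_eq by lra.
        assert (G := Cmod_ge_0 h). nra. }
      apply K.
      - intros s hs. rewrite P by easy.
        apply cderiv_minus; [apply Hf; apply Hd; [easy|apply Q; easy]|].
        eapply cderiv_eq; [|apply cderiv_scal, cderiv_id]. ring.
      - intros s hs. rewrite P by easy. apply Hd; [easy|apply Q; easy]. }
    rewrite Cmod_mult in T.
    assert (G := Cmod_ge_0 h). assert (A := HMq t ht). assert (B := HMk t ht).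
    replace (2 * e * (Mq * Mk) * Cmod h) with (2 * e * (Cmod h * Mq) * Mk) by ring.
    apply Rmult_le_compat; try apply Cmod_ge_0; [|easy].
    eapply Rle_trans; [exact T|]. apply Rmult_le_compat_l; [lra|].
    apply Rmult_le_compat_l; lra. }
  assert (E : 2 * e * (Mq * Mk) * (b - a + 1) = eps) by (unfold e; field; repeat split; lra).
  clearbody e.
  assert (G := Cmod_ge_0 h).
  replace ((b - a) * (2 * e * (Mq * Mk) * Cmod h)) with
    (2 * e * (Mq * Mk) * (b - a) * Cmod h) by ring.
  apply Rmult_le_compat_r; [easy|]. rewrite <- E. apply Rmult_le_compat_l; [|lra].
  repeat apply Rmult_le_pos; lra.
Qed.

(** * Cauchy's formula *)

Definition cis (t : R) : C := Cexp (RtoC t * Ci)%C.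

Definition circ (z0 : C) (r t : R) : C := (z0 + RtoC r * cis t)%C.

Lemma Cmod_cis t : Cmod (cis t)%C = 1.
Proof.
  unfold cis. rewrite Cmod_Cexp.
  replace (Re (RtoC t * Ci)) with 0 by (simpl; ring). apply exp_0.
Qed.

Lemma cis_neq_0 t : cis t <> 0%C.
Proof. apply Cexp_neq_0. Qed.

Lemma cis_0 : cis 0 = 1%C.
Proof. unfold cis. replace (RtoC 0 * Ci)%C with (RtoC 0) by ring. apply Cexp_0. Qed.

Lemma cis_2PI : cis (2 * PI) = 1%C.
Proof.
  unfold cis, Cexp. simpl.
  replace (2 * PI * 0 - 0 * 1) with 0 by ring.
  replace (2 * PI * 1 + 0 * 0) with (2 * PI) by ring.
  rewrite exp_0, cos_2PI, sin_2PI. unfold RtoC. f_equal; ring.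
Qed.

Lemma rderiv_cis t : rderiv cis t (Ci * cis t)%C.
Proof. apply rderiv_Cexp_line. Qed.

Lemma rderiv_circ z0 r t : rderiv (circ z0 r) t (RtoC r * (Ci * cis t))%C.
Proof.
  eapply rderiv_eq; [|apply (rderiv_comp (fun w => z0 + RtoC r * w)%C cis t _ (RtoC r) (rderiv_cis t))].
  - ring.
  - eapply cderiv_eq; [|apply cderiv_plus; [apply cderiv_const|apply cderiv_scal, cderiv_id]]. ring.
Qed.

Lemma rcont_cis t : rcont cis t.
Proof. eapply rderiv_rcont, rderiv_cis. Qed.

Lemma rcont_circ z0 r t : rcont (circ z0 r) t.
Proof. eapply rderiv_rcont, rderiv_circ. Qed.

Lemma Cmod_circ z0 r t : 0 <= r -> Cmod (circ z0 r t - z0)%C = r.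
Proof.
  intros h. unfold circ. replace (z0 + r * cis t - z0)%C with (r * cis t)%C by ring.
  rewrite Cmod_mult, Cmod_cis, Cmod_R, Rabs_pos_eq; lra.
Qed.

Lemma circ_dist z0 r t w : 0 <= r -> r - Cmod (w - z0)%C <= Cmod (circ z0 r t - w)%C.
Proof.
  intros h. assert (T := Cmod_rev_triangle (circ z0 r t - z0) (w - z0)).
  rewrite Cmod_circ in T by easy.
  replace (circ z0 r t - z0 - (w - z0))%C with (circ z0 r t - w)%C in T by ring. lra.
Qed.

(** The Cauchy kernel [dzeta / (i (zeta - w))] in the angle parameter. The factor [i] of
    [rderiv_circ] is divided out, so the kernel integrates to [2 * PI]. *)
Definition cker (z0 : C) (r : R) (w : C) (t : R) : C :=
  (RtoC r * cis t / (circ z0 r t - w))%C.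

Lemma rcont_cker z0 r w t : 0 < r -> Cmod (w - z0)%C < r -> rcont (cker z0 r w) t.
Proof.
  intros hr hw. apply rcont_mult.
  - apply rcont_mult; [apply rcont_const|apply rcont_cis].
  - apply (rcont_comp Cinv (fun t => circ z0 r t - w)%C).
    + apply rcont_minus; [apply rcont_circ|apply rcont_const].
    + eapply cderiv_ccont, cderiv_inv_id. apply Cmod_gt_0.
      assert (T := circ_dist z0 r t w (Rlt_le _ _ hr)). lra.
Qed.

Lemma Cmod_cker z0 r w t : 0 < r -> Cmod (w - z0)%C < r ->
  Cmod (cker z0 r w t)%C <= r / (r - Cmod (w - z0)%C).
Proof.
  intros hr hw. assert (T := circ_dist z0 r t w (Rlt_le _ _ hr)).
  unfold cker. rewrite Cmod_div by (apply Cmod_gt_0; lra).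
  rewrite Cmod_mult, Cmod_cis, Cmod_R, Rabs_pos_eq, Rmult_1_r by lra.
  apply Rmult_le_compat_l; [lra|]. apply Rinv_le_contravar; lra.
Qed.

(** One step of the geometric series of the kernel in the ratio [(w - z0) / (zeta - z0)]. Iteration
    gives the Taylor expansion with an explicit remainder. *)
Lemma cker_rec z0 r w t : 0 < r -> Cmod (w - z0)%C < r ->
  cker z0 r w t = (1 + (w - z0) / (RtoC r * cis t) * cker z0 r w t)%C.
Proof.
  intros hr hw. unfold cker.
  assert (h1 : (circ z0 r t - w)%C <> 0%C).
  { apply Cmod_gt_0. assert (T := circ_dist z0 r t w (Rlt_le _ _ hr)). lra. }
  assert (h2 := cis_neq_0 t).
  assert (h3 : RtoC r <> 0%C) by (intros E; apply RtoC_inj in E; lra).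
  unfold circ in *. field. repeat split; easy.
Qed.

Definition rpw (z0 : C) (r : R) (w : C) (t : R) (k : nat) : C :=
  (((w - z0) / (RtoC r * cis t)) ^ k)%C.

Lemma rcont_pow f t k : rcont f t -> rcont (fun s => f s ^ k)%C t.
Proof.
  intros H. induction k as [|k IH]; simpl; [apply rcont_const|]. apply rcont_mult; easy.
Qed.

Lemma rcont_rpw z0 r w t k : 0 < r -> rcont (fun t => rpw z0 r w t k) t.
Proof.
  intros hr. apply (rcont_pow (fun t => (w - z0) / (RtoC r * cis t))%C).
  apply rcont_mult; [apply rcont_const|].
  apply (rcont_comp Cinv (fun t => RtoC r * cis t)%C).
  - apply rcont_mult; [apply rcont_const|apply rcont_cis].
  - eapply cderiv_ccont, cderiv_inv_id. apply Cmult_neq_0; [|apply cis_neq_0].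
    intros E; apply RtoC_inj in E; lra.
Qed.

Lemma Cmod_rpw z0 r w t k : 0 < r -> Cmod (rpw z0 r w t k)%C = (Cmod (w - z0)%C / r) ^ k.
Proof.
  intros hr. unfold rpw. rewrite Cmod_pow, Cmod_div.
  - rewrite Cmod_mult, Cmod_cis, Cmod_R, Rabs_pos_eq, Rmult_1_r by lra. easy.
  - apply Cmult_neq_0; [|apply cis_neq_0]. intros E; apply RtoC_inj in E; lra.
Qed.

Lemma two_PI_pos : 0 < 2 * PI.
Proof. assert (H := PI_RGT_0). lra. Qed.

Lemma CI_cker_expand (phi : R -> C) z0 r w n : 0 < r -> Cmod (w - z0)%C < r ->
  (forall t, rcont phi t) ->
  CI (fun t => phi t * cker z0 r w t)%C 0 (2 * PI) =
  (Csum (fun k => CI (fun t => phi t * rpw z0 r w t k)%C 0 (2 * PI)) n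
   + CI (fun t => phi t * (rpw z0 r w t n * cker z0 r w t))%C 0 (2 * PI))%C.
Proof.
  intros hr hw Hp. assert (hP := two_PI_pos).
  induction n as [|n IH]; simpl.
  - rewrite Cplus_0_l. apply CI_ext; [lra|]. intros t _. unfold rpw. ring.
  - rewrite IH, <- Cplus_assoc. f_equal.
    apply CI_unique.
    apply is_CI_ext with
      (fun t => phi t * rpw z0 r w t n + phi t * (rpw z0 r w t (S n) * cker z0 r w t))%C; [lra| |].
    + intros t _. rewrite (cker_rec z0 r w t hr hw) at 2. unfold rpw. simpl. ring.
    + apply is_CI_plus; apply is_CI_CI; try lra; intros t _.
      * apply rcont_mult; [apply Hp|apply rcont_rpw; easy].
      * apply rcont_mult; [apply Hp|].
        apply rcont_mult; [apply rcont_rpw; easy|apply rcont_cker; easy].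
Qed.

Lemma CI_cker_rem (phi : R -> C) z0 r w n B : 0 < r -> Cmod (w - z0)%C < r ->
  (forall t, rcont phi t) -> (forall t, Cmod (phi t)%C <= B) ->
  Cmod (CI (fun t => phi t * (rpw z0 r w t n * cker z0 r w t))%C 0 (2 * PI))%C
  <= 2 * PI * (B * ((Cmod (w - z0)%C / r) ^ n * (r / (r - Cmod (w - z0)%C)))).
Proof.
  intros hr hw Hp HB. assert (hP := two_PI_pos).
  replace (2 * PI * (B * ((Cmod (w - z0)%C / r) ^ n * (r / (r - Cmod (w - z0)%C))))) with
    ((2 * PI - 0) * (B * ((Cmod (w - z0)%C / r) ^ n * (r / (r - Cmod (w - z0)%C))))) by ring.
  eapply is_CI_bound; [lra| |apply is_CI_CI; [lra|]].
  - intros t _. cbv beta. rewrite !Cmod_mult, Cmod_rpw by easy.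
    assert (0 <= (Cmod (w - z0)%C / r) ^ n).
    { apply pow_le. apply Rdiv_le_0_compat; [apply Cmod_ge_0|easy]. }
    apply Rmult_le_compat; try apply Cmod_ge_0.
    + apply Rmult_le_pos; [easy|apply Cmod_ge_0].
    + apply HB.
    + apply Rmult_le_compat_l; [easy|]. apply Cmod_cker; easy.
  - intros t _. apply rcont_mult; [apply Hp|].
    apply rcont_mult; [apply rcont_rpw; easy|apply rcont_cker; easy].
Qed.

Lemma Cexp_pow z k : (Cexp z ^ k)%C = Cexp (RtoC (INR k) * z)%C.
Proof.
  induction k as [|k IH].
  - simpl. replace (RtoC 0 * z)%C with (RtoC 0) by ring. rewrite Cexp_0. easy.
  - rewrite S_INR, RtoC_plus. replace ((INR k + 1) * z)%C with (z + INR k * z)%C by ring.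
    rewrite Cexp_plus, <- IH. easy.
Qed.

Lemma Ci_neq_0 : Ci <> 0%C.
Proof. intros E. apply (f_equal Im) in E. simpl in E. lra. Qed.

(** The integrand is a constant times [exp (- i (k + 1) t)], whose primitive has period [2 * PI]. *)
Lemma CI_rpw_zero z0 r w k : 0 < r -> CI (fun t => 1 * rpw z0 r w t (S k))%C 0 (2 * PI) = 0%C.
Proof.
  intros hr. assert (hP := two_PI_pos).
  assert (hr' : RtoC r <> 0%C) by (intros E; apply RtoC_inj in E; lra).
  set (m := (- (RtoC (INR (S k)) * Ci))%C).
  assert (hm : m <> 0%C).
  { intros E. apply (f_equal Im) in E. simpl Im in E.
    assert (H := S_INR k). assert (H' := pos_INR k). simpl in E. simpl in H. lra. }
  assert (Hx : forall t, (1 * rpw z0 r w t (S k) = ((w - z0) / r) ^ S k * Cexp (RtoC t * m)%C)%C).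
  { intros t. unfold rpw, cis.
    replace ((w - z0) / (r * Cexp (t * Ci)%C))%C with ((w - z0) / r * Cexp (- (t * Ci))%C)%C.
    2:{ rewrite Cexp_opp. field. split; first [exact hr' | apply Cexp_neq_0]. }
    rewrite Cpow_mult_l, Cexp_pow, Cmult_1_l. f_equal. f_equal. unfold m. ring. }
  apply CI_unique.
  apply is_CI_ext with (fun t => ((w - z0) / r) ^ S k * Cexp (RtoC t * m)%C)%C; [lra| |].
  { intros t _. symmetry. apply Hx. }
  replace (RtoC 0) with (((w - z0) / r) ^ S k * 0)%C by ring.
  apply is_CI_scal.
  assert (H := is_CI_derive (fun t => / m * Cexp (RtoC t * m)%C)%C (fun t => Cexp (RtoC t * m)%C)
    0 (2 * PI) (Rlt_le _ _ hP)).
  assert (E : (/ m * Cexp (RtoC (2 * PI) * m)%C - / m * Cexp (RtoC 0 * m)%C)%C = 0%C).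
  { unfold m.
    replace (RtoC (2 * PI) * - (INR (S k) * Ci))%C with (INR (S k) * - (RtoC (2 * PI) * Ci))%C by ring.
    rewrite <- Cexp_pow, Cexp_opp. change (Cexp (RtoC (2 * PI) * Ci)%C) with (cis (2 * PI)).
    rewrite cis_2PI.
    replace (0 * - (INR (S k) * Ci))%C with (RtoC 0) by ring. rewrite Cexp_0.
    replace (/ 1)%C with (RtoC 1) by (field; apply C1_nz). rewrite Cpow_1_l. ring. }
  cbv beta in H. rewrite E in H. apply H.
  - intros t _. eapply rderiv_eq; [|apply (rderiv_comp (fun u => / m * u)%C _ t _ (/ m) (rderiv_Cexp_line m t))].
    + field; easy.
    + eapply cderiv_eq; [|apply cderiv_scal, cderiv_id]. ring.
  - intros t _. eapply rderiv_rcont, rderiv_Cexp_line.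
Qed.

Lemma pow_small q eps : 0 <= q < 1 -> 0 < eps -> exists N, forall n, (N <= n)%nat -> q ^ n < eps.
Proof.
  intros hq he. destruct (pow_lt_1_zero q) with (y := eps) as [N HN].
  - rewrite Rabs_pos_eq; lra.
  - easy.
  - exists N. intros n hn. specialize (HN n hn). rewrite Rabs_pos_eq in HN; [easy|].
    apply pow_le; lra.
Qed.

Lemma ratio_small (x y r : R) eps : 0 <= x < r -> 0 <= y -> 0 < eps ->
  exists N, forall n, (N <= n)%nat -> y * (x / r) ^ n < eps.
Proof.
  intros hx hy he.
  destruct (pow_small (x / r) (eps / (y + 1))) as [N HN].
  - split; [apply Rdiv_le_0_compat; lra|].
    apply Rmult_lt_reg_r with r; [lra|]. unfold Rdiv. rewrite Rmult_assoc, Rinv_l; lra.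
  - apply Rdiv_lt_0_compat; lra.
  - exists N. intros n hn. specialize (HN n hn).
    apply Rmult_lt_compat_l with (r := y + 1) in HN; [|lra].
    replace ((y + 1) * (eps / (y + 1))) with eps in HN by (field; lra).
    nra.
Qed.

(** In the geometric expansion of the kernel only the term of order 0 has a nonzero integral, and
    the remainder decays geometrically. *)
Lemma CI_cker_one z0 r w : 0 < r -> Cmod (w - z0)%C < r ->
  CI (cker z0 r w) 0 (2 * PI) = RtoC (2 * PI).
Proof.
  intros hr hw. assert (hP := two_PI_pos). assert (hc := Cmod_ge_0 (w - z0)).
  replace (CI (cker z0 r w) 0 (2 * PI)) with (CI (fun t => 1 * cker z0 r w t)%C 0 (2 * PI)).
  2:{ apply CI_ext; [lra|]. intros; ring. }
  apply Cmod_small_eq. intros eps he.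
  destruct (ratio_small (Cmod (w - z0)%C) (2 * PI * (r / (r - Cmod (w - z0)%C))) r eps) as [N HN];
    [lra| |lra|].
  { apply Rmult_le_pos; [lra|]. apply Rdiv_le_0_compat; lra. }
  specialize (HN (S N) (Nat.le_succ_diag_r N)).
  rewrite (CI_cker_expand (fun _ => 1%C) z0 r w (S N) hr hw (fun t => rcont_const _ t)).
  assert (S1 : forall n, Csum (fun k => CI (fun t => 1 * rpw z0 r w t k)%C 0 (2 * PI)) (S n) = RtoC (2 * PI)).
  { induction n as [|n IH].
    - simpl. rewrite Cplus_0_l. apply CI_unique.
      assert (H := is_CI_const 1%C 0 (2 * PI)). rewrite Rminus_0_r, Cmult_1_r in H.
      eapply is_CI_ext; [lra| |exact H]. intros t _. unfold rpw. ring.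
    - change (Csum (fun k => CI (fun t => 1 * rpw z0 r w t k)%C 0 (2 * PI)) (S n)
        + CI (fun t => 1 * rpw z0 r w t (S n))%C 0 (2 * PI) = RtoC (2 * PI))%C.
      rewrite IH, CI_rpw_zero by easy. ring. }
  rewrite S1.
  assert (T := CI_cker_rem (fun _ => 1%C) z0 r w (S N) 1 hr hw (fun t => rcont_const _ t)).
  match goal with |- Cmod (?a + ?b - ?a)%C <= _ => replace (a + b - a)%C with b by ring end.
  eapply Rle_trans; [apply T; intros; rewrite Cmod_1; lra|].
  left. eapply Rle_lt_trans; [|exact HN]. apply Req_le. ring.
Qed.

(* [f] is given on the disc by its Cauchy integral over the circle. *)
Definition CF (f : C -> C) (z0 : C) (r : R) : Prop :=
  0 < r /\ (forall t, rcont (fun t => f (circ z0 r t)) t) /\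
  forall w, Cmod (w - z0)%C < r ->
    f w = (/ RtoC (2 * PI) * CI (fun t => f (circ z0 r t) * cker z0 r w t)%C 0 (2 * PI))%C.

Lemma RtoC_2PI_neq : RtoC (2 * PI) <> 0%C.
Proof. assert (H := two_PI_pos). intros E; apply RtoC_inj in E; lra. Qed.

(* With [zeta] on the circle, the integral of [f (w + s (zeta - w)) / (zeta - w)] is constant
   in [s], its [s]-derivative being the integral of a total derivative along the circle. *)
Lemma Cauchy_formula U f f' z0 r : copen U -> Holo U f f' -> 0 < r ->
  (forall w, Cmod (w - z0)%C <= r -> U w) -> CF f z0 r.
Proof.
  intros HU Hf hr Hd. assert (hP := two_PI_pos).
  split; [easy|]. split.
  { intros t. apply rcont_comp; [apply rcont_circ|]. eapply cderiv_ccont. apply Hf. apply Hd.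
    rewrite Cmod_circ; lra. }
  intros w hw.
  set (q := fun t => (circ z0 r t - w)%C).
  set (k := cker z0 r w).
  assert (hq : forall t, q t <> 0%C).
  { intros t. apply Cmod_gt_0. assert (T := circ_dist z0 r t w (Rlt_le _ _ hr)). unfold q. lra. }
  assert (Cq : forall t, rcont q t).
  { intros t. apply rcont_minus; [apply rcont_circ|apply rcont_const]. }
  assert (Hin : forall s t, 0 <= s <= 1 -> U (w + RtoC s * q t)%C).
  { intros s t hs. apply Hd. unfold q.
    replace (w + s * (circ z0 r t - w) - z0)%C with
      ((RtoC (1 - s) * (w - z0)) + s * (circ z0 r t - z0))%C by (rewrite RtoC_minus; ring).
    eapply Rle_trans; [apply Cmod_triangle|].
    rewrite !Cmod_mult, Cmod_circ, !Cmod_R, !Rabs_pos_eq by lra.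
    nra. }
  set (J := fun s : C => CI (fun t => f (w + s * q t) * k t)%C 0 (2 * PI)).
  assert (HJ : forall s, 0 <= s <= 1 -> cderiv J (RtoC s) 0).
  { intros s hs.
    assert (D := cderiv_CI_affine U f f' (fun _ => w) q k 0 (2 * PI) (RtoC s) (Rlt_le _ _ hP) HU Hf
      (fun t _ => rcont_const w t) (fun t _ => Cq t) (fun t _ => rcont_cker z0 r w t hr hw)
      (fun t _ => Hin s t hs)).
    eapply cderiv_eq; [|exact D].
    assert (E : forall t, (f' (w + s * q t) * q t * k t = f' (w + s * q t) * (r * cis t))%C).
    { intros t. unfold k, cker. fold (q t). field. apply hq. }
    apply CI_unique.
    apply is_CI_ext with (fun t => f' (w + s * q t) * (r * cis t))%C; [lra| |].
    { intros; symmetry; apply E. }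
    (* For [s <> 0] the primitive along the circle is [f (w + s q) / (s i)]; at [s = 0] the factor
       [f'] is constant and [circ] itself serves as primitive. *)
    destruct (Req_dec s 0) as [->|hs0].
    - apply is_CI_ext with (fun t => f' w * (r * cis t))%C; [lra| |].
      { intros. replace (w + 0 * q t)%C with w by ring. easy. }
      assert (H := is_CI_derive (fun t => f' w * (/ Ci * circ z0 r t))%C
        (fun t => f' w * (r * cis t))%C 0 (2 * PI) (Rlt_le _ _ hP)).
      cbv beta in H.
      assert (Ec : circ z0 r (2 * PI) = circ z0 r 0).
      { unfold circ. rewrite cis_2PI, cis_0. easy. }
      rewrite Ec in H. unfold Cminus in H at 1. rewrite Cplus_opp_r in H.
      apply H.
      + intros t _. eapply rderiv_eq;
          [|apply (rderiv_comp (fun u => f' w * (/ Ci * u))%C _ t _ (f' w * (/ Ci * 1))%C (rderiv_circ z0 r t))].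
        * field. apply Ci_neq_0.
        * apply cderiv_scal, cderiv_scal, cderiv_id.
      + intros t _. apply rcont_mult; [apply rcont_const|].
        apply rcont_mult; [apply rcont_const|apply rcont_cis].
    - assert (hsC : RtoC s <> 0%C) by (intros X; apply RtoC_inj in X; easy).
      assert (H := is_CI_derive (fun t => / (s * Ci) * f (w + s * q t))%C
        (fun t => f' (w + s * q t) * (r * cis t))%C 0 (2 * PI) (Rlt_le _ _ hP)).
      cbv beta in H.
      assert (Eq : q (2 * PI) = q 0).
      { unfold q, circ. rewrite cis_2PI, cis_0. easy. }
      rewrite Eq in H.
      unfold Cminus in H at 1. rewrite Cplus_opp_r in H.
      apply H.
      + intros t _.
        assert (Hp : rderiv (fun t => w + s * q t)%C t (s * (r * (Ci * cis t)))%C).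
        { eapply rderiv_eq;
            [|apply (rderiv_comp (fun u => w + s * (u - w))%C _ t _ (s * 1)%C (rderiv_circ z0 r t))].
          - ring.
          - eapply cderiv_eq; [|apply cderiv_plus; [apply cderiv_const|apply cderiv_scal;
              apply cderiv_minus; [apply cderiv_id|apply cderiv_const]]]. ring. }
        eapply rderiv_eq; [|apply (rderiv_comp (fun u => / (s * Ci) * f u)%C _ t _
            (/ (s * Ci) * f' (w + s * q t))%C Hp)].
        * field. split; first [exact hsC | apply Ci_neq_0].
        * apply cderiv_scal. apply Hf. apply Hin; easy.
      + intros t _. apply rcont_mult.
        * apply (rcont_comp f' (fun t => w + s * q t)%C); [|apply Hf; apply Hin; easy].
          apply rcont_plus; [apply rcont_const|]. apply rcont_mult; [apply rcont_const|apply Cq].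
        * apply rcont_mult; [apply rcont_const|apply rcont_cis]. }
  assert (EJ : J (RtoC 1) = J (RtoC 0)).
  { apply Ceq_minus. apply Cmod_eq_0.
    assert (K := cmvt (fun s => J (RtoC s)) (fun _ => 0%C) 0 0 1 Rle_0_1).
    cbv beta in K. rewrite Rmult_0_l in K.
    apply Rle_antisym; [|apply Cmod_ge_0]. apply K.
    - intros s hs. apply rderiv_of_cderiv. apply HJ; easy.
    - intros. rewrite Cmod_0. lra. }
  assert (E1 : J (RtoC 1) = CI (fun t => f (circ z0 r t) * cker z0 r w t)%C 0 (2 * PI)).
  { apply CI_ext; [lra|]. intros t _. unfold q, k.
    replace (w + 1 * (circ z0 r t - w))%C with (circ z0 r t) by ring. easy. }
  assert (E0 : J (RtoC 0) = (f w * RtoC (2 * PI))%C).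
  { apply CI_unique. rewrite <- (CI_cker_one z0 r w hr hw).
    apply is_CI_ext with (fun t => f w * k t)%C; [lra| |].
    - intros. replace (w + 0 * q t)%C with w by ring. easy.
    - apply is_CI_scal. apply is_CI_CI; [lra|]. intros; apply rcont_cker; easy. }
  change (f w = (/ RtoC (2 * PI) * CI (fun t => f (circ z0 r t) * cker z0 r w t)%C 0 (2 * PI))%C).
  rewrite <- E1, EJ, E0. field. apply RtoC_2PI_neq.
Qed.

(** Compactness bounds one period, and periodicity moves any real [t] into it. *)
Lemma CF_continuous_bound f z0 r : CF f z0 r -> exists B, 0 < B /\ forall t, Cmod (f (circ z0 r t))%C <= B.
Proof.
  intros [hr [Hc _]].
  destruct (bounded_on (fun t => f (circ z0 r t)) 0 (2 * PI)) as [M [hM HM]].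
  { intros t _. apply Hc. }
  exists M. split; [easy|].
  assert (P : forall k : Z, forall t, circ z0 r (t + IZR k * (2 * PI)) = circ z0 r t).
  { intros k t. unfold circ. f_equal. f_equal. unfold cis, Cexp. simpl.
    replace ((t + IZR k * (2 * PI)) * 0 - 0 * 1) with (t * 0 - 0 * 1) by ring.
    replace ((t + IZR k * (2 * PI)) * 1 + 0 * 0) with (t + 2 * IZR k * PI) by ring.
    replace (t * 1 + 0 * 0) with t by ring.
    assert (H : cos (t + 2 * IZR k * PI) = cos t /\ sin (t + 2 * IZR k * PI) = sin t).
    { assert (hk : IZR k = INR (Z.to_nat k) \/ IZR k = - INR (Z.to_nat (- k))).
      { destruct (Z_le_gt_dec 0 k) as [h|h].
        - left. rewrite INR_IZR_INZ, Z2Nat.id; easy.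
        - right. rewrite INR_IZR_INZ, Z2Nat.id by lia. rewrite opp_IZR. ring. }
      destruct hk as [->| ->].
      - split; [apply cos_period|apply sin_period].
      - set (n := Z.to_nat (- k)). set (u := t + 2 * - INR n * PI).
        replace t with (u + 2 * INR n * PI) by (unfold u; ring).
        split; symmetry; [apply cos_period|apply sin_period]. }
    destruct H as [-> ->]. easy. }
  intros t. assert (hP := two_PI_pos).
  set (k := Int_part (t / (2 * PI))).
  assert (B := base_Int_part (t / (2 * PI))). fold k in B.
  replace t with (t / (2 * PI) * (2 * PI)) by (field; lra).
  replace (t / (2 * PI) * (2 * PI)) with ((t / (2 * PI) - IZR k) * (2 * PI) + IZR k * (2 * PI)) by ring.
  rewrite P. apply HM.
  split; [apply Rmult_le_pos; lra|].
  replace (2 * PI) with (1 * (2 * PI)) at 3 by ring. apply Rmult_le_compat_r; lra.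
Qed.

(** The Taylor coefficient of order [k] at [z0], as an integral over the circle. *)
Definition ccoef (f : C -> C) (z0 : C) (r : R) (k : nat) : C :=
  (/ RtoC (2 * PI) * CI (fun t => f (circ z0 r t) * (/ (RtoC r * cis t)) ^ k)%C 0 (2 * PI))%C.

Lemma rcont_inv_cis r t : 0 < r -> rcont (fun t => / (RtoC r * cis t))%C t.
Proof.
  intros hr. apply (rcont_comp Cinv (fun t => RtoC r * cis t)%C).
  - apply rcont_mult; [apply rcont_const|apply rcont_cis].
  - eapply cderiv_ccont, cderiv_inv_id. apply Cmult_neq_0; [|apply cis_neq_0].
    intros E; apply RtoC_inj in E; lra.
Qed.

Lemma Cmod_inv_2PI : Cmod (/ RtoC (2 * PI))%C = / (2 * PI).
Proof.
  assert (hP := two_PI_pos).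
  rewrite Cmod_inv by apply RtoC_2PI_neq. rewrite Cmod_R, Rabs_pos_eq; lra.
Qed.

Lemma ccoef_term f z0 r w k : CF f z0 r ->
  (/ RtoC (2 * PI) * CI (fun t => f (circ z0 r t) * rpw z0 r w t k)%C 0 (2 * PI))%C
  = (ccoef f z0 r k * (w - z0) ^ k)%C.
Proof.
  intros [hr [Hc _]]. assert (hP := two_PI_pos).
  unfold ccoef. rewrite <- Cmult_assoc. f_equal. rewrite Cmult_comm.
  apply CI_unique.
  apply is_CI_ext with (fun t => (w - z0) ^ k * (f (circ z0 r t) * (/ (r * cis t)) ^ k))%C; [lra| |].
  - intros t _. unfold rpw, Cdiv. rewrite Cpow_mult_l. ring.
  - apply is_CI_scal, is_CI_CI; [lra|]. intros t _.
    apply rcont_mult; [apply Hc|]. apply rcont_pow, rcont_inv_cis; easy.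
Qed.

Lemma Csum_ext u v n : (forall k, (k < n)%nat -> u k = v k) -> Csum u n = Csum v n.
Proof.
  induction n as [|n IH]; intros H; [easy|]. simpl. rewrite IH, H; [easy|lia|].
  intros k hk. apply H. lia.
Qed.

Lemma Csum_scal c u n : Csum (fun k => c * u k)%C n = (c * Csum u n)%C.
Proof. induction n as [|n IH]; simpl; [ring|]. rewrite IH. ring. Qed.

Lemma CF_taylor f z0 r B w n : CF f z0 r -> (forall t, Cmod (f (circ z0 r t))%C <= B) ->
  Cmod (w - z0)%C < r ->
  Cmod (f w - Csum (fun k => ccoef f z0 r k * (w - z0) ^ k) n)%C
  <= B * ((Cmod (w - z0)%C / r) ^ n * (r / (r - Cmod (w - z0)%C))).
Proof.
  intros HF HB hw. assert (hP := two_PI_pos). destruct HF as [hr [Hc Hf]].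
  assert (HF : CF f z0 r) by (split; easy).
  rewrite (Hf w hw), (CI_cker_expand (fun t => f (circ z0 r t)) z0 r w n hr hw Hc).
  rewrite Cmult_plus_distr_l, <- Csum_scal.
  rewrite (Csum_ext _ (fun k => ccoef f z0 r k * (w - z0) ^ k)%C).
  2:{ intros k _. apply (ccoef_term f z0 r w k HF). }
  match goal with |- Cmod (?a + ?b - ?a)%C <= _ => replace (a + b - a)%C with b by ring end.
  rewrite Cmod_mult, Cmod_inv_2PI.
  apply Rmult_le_reg_l with (2 * PI); [easy|]. rewrite <- Rmult_assoc, Rinv_r, Rmult_1_l by lra.
  apply CI_cker_rem; easy.
Qed.

Lemma Csum_sum_n (u : nat -> C) n : sum_n (G := C_AbelianMonoid) u n = Csum u (S n).
Proof.
  induction n as [|n IH].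
  - rewrite sum_O. simpl. rewrite Cplus_0_l. easy.
  - rewrite sum_Sn, IH. easy.
Qed.

Lemma pow_n_Cpow (z : C) k : pow_n (K := C_Ring) z k = (z ^ k)%C.
Proof. induction k as [|k IH]; [easy|]. simpl. rewrite IH. easy. Qed.

Lemma is_pseries_Csum (c : nat -> C) (u l : C) :
  (forall eps, 0 < eps -> exists N, forall n, (N <= n)%nat ->
     Cmod (Csum (fun k => c k * u ^ k) n - l)%C < eps) <->
  is_pseries (K := C_AbsRing) (V := C_NormedModule) c u l.
Proof.
  assert (E : forall n, sum_n (G := C_AbelianMonoid)
      (fun k => scal (K := C_Ring) (V := C_ModuleSpace) (pow_n (K := C_Ring) u k) (c k)) n
      = Csum (fun k => c k * u ^ k)%C (S n)).
  { intros n. rewrite Csum_sum_n. apply Csum_ext. intros k _. rewrite pow_n_Cpow.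
    change ((u ^ k * c k)%C = (c k * u ^ k)%C). ring. }
  split.
  - intros H P [eps HP].
    destruct (H eps (cond_pos eps)) as [N HN]. exists N. intros n hn.
    apply HP.
    change (ball l eps (sum_n (G := C_AbelianMonoid)
      (fun k => scal (K := C_Ring) (V := C_ModuleSpace) (pow_n (K := C_Ring) u k) (c k)) n)).
    rewrite E. apply C_NormedModule_mixin_compat1. apply HN. lia.
  - intros H eps he.
    (* Balls of the complex module are squares, so passing from them back to [Cmod] loses a factor
       [sqrt 2]. *)
    assert (hs : 0 < eps / sqrt 2) by (apply Rdiv_lt_0_compat; [easy|apply sqrt_lt_R0; lra]).
    destruct (H (ball l (mkposreal _ hs))) as [N HN].
    { exists (mkposreal _ hs). easy. }
    exists (S N). intros n hn. destruct n as [|n]; [lia|].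
    specialize (HN n ltac:(lia)).
    change (ball l (mkposreal _ hs) (sum_n (G := C_AbelianMonoid)
      (fun k => scal (K := C_Ring) (V := C_ModuleSpace) (pow_n (K := C_Ring) u k) (c k)) n)) in HN.
    rewrite E in HN. apply C_NormedModule_mixin_compat2 in HN. simpl in HN.
    eapply Rlt_le_trans; [exact HN|]. apply Req_le. field.
    apply Rgt_not_eq, sqrt_lt_R0; lra.
Qed.

Lemma CF_analytic f z0 r : CF f z0 r -> analytic_at f z0.
Proof.
  intros H. destruct (CF_continuous_bound f z0 r H) as [B [hB HB]].
  assert (hr : 0 < r) by apply H.
  exists (ccoef f z0 r), (mkposreal r hr). intros w hw. simpl in hw.
  apply is_pseries_Csum. intros eps he.
  assert (hc := Cmod_ge_0 (w - z0)).
  destruct (ratio_small (Cmod (w - z0)%C) (B * (r / (r - Cmod (w - z0)%C))) r eps) as [N HN];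
    [lra| |lra|].
  { apply Rmult_le_pos; [lra|]. apply Rdiv_le_0_compat; lra. }
  exists N. intros n hn. specialize (HN n hn).
  rewrite Cmod_minus_sym. eapply Rle_lt_trans; [apply CF_taylor; eassumption|].
  eapply Rle_lt_trans; [|exact HN]. apply Req_le. ring.
Qed.

Lemma CF_minus f g z0 r : CF f z0 r -> CF g z0 r -> CF (fun w => f w - g w)%C z0 r.
Proof.
  intros [hr [Cf Hf]] [_ [Cg Hg]]. assert (hP := two_PI_pos).
  split; [easy|]. split.
  - intros t. apply rcont_minus; [apply Cf|apply Cg].
  - intros w hw. rewrite (Hf w hw), (Hg w hw).
    match goal with |- (?a * ?b - ?a * ?c)%C = _ => replace (a * b - a * c)%C with (a * (b - c))%C by ring end.
    f_equal. symmetry. apply CI_unique.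
    apply is_CI_ext with (fun t => f (circ z0 r t) * cker z0 r w t - g (circ z0 r t) * cker z0 r w t)%C;
      [lra|intros; ring|].
    apply is_CI_minus; apply is_CI_CI; try lra; intros t _; (apply rcont_mult; [|apply rcont_cker; easy]).
    + apply Cf. + apply Cg.
Qed.

Lemma cderiv_invpow (m : nat) (u : C) : u <> 0%C ->
  cderiv (fun u => (/ u) ^ m)%C u (- RtoC (INR m) * (/ u) ^ S m)%C.
Proof.
  intros hu. induction m as [|m IH].
  - simpl. eapply cderiv_eq; [|apply cderiv_const]. ring.
  - eapply cderiv_eq; [|apply (cderiv_mult _ _ _ _ _ (cderiv_inv_id u hu) IH)].
    rewrite S_INR, RtoC_plus. simpl. field. easy.
Qed.

(** Written with [w * (-1)] so that the argument has the affine shape [c t + w * q t] of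
    [cderiv_CI_affine]. *)
Definition Kint (phi : R -> C) (z0 : C) (r : R) (m : nat) (w : C) : C :=
  CI (fun t => (/ (circ z0 r t + w * (-1))) ^ m * phi t)%C 0 (2 * PI).

Lemma cderiv_Kint phi z0 r m w : 0 < r -> (forall t, rcont phi t) -> Cmod (w - z0)%C < r ->
  cderiv (Kint phi z0 r m) w (RtoC (INR m) * Kint phi z0 r (S m) w)%C.
Proof.
  intros hr Hp hw. assert (hP := two_PI_pos).
  set (U := fun u : C => u <> 0%C).
  assert (HU : copen U).
  { intros z hz. exists (Cmod z). split; [apply Cmod_gt_0; exact hz|].
    intros h hh E. assert (h = - z)%C by (replace h with ((z + h) - z)%C by ring; rewrite E; ring).
    subst h. rewrite Cmod_opp in hh. lra. }
  assert (Hin : forall t, U (circ z0 r t + w * (-1))%C).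
  { intros t. apply Cmod_gt_0. assert (T := circ_dist z0 r t w (Rlt_le _ _ hr)).
    replace (circ z0 r t + w * (-1))%C with (circ z0 r t - w)%C by ring. lra. }
  assert (HH : Holo U (fun u => (/ u) ^ m)%C (fun u => - RtoC (INR m) * (/ u) ^ S m)%C).
  { intros z hz. split; [apply cderiv_invpow; exact hz|].
    eapply cderiv_ccont. apply cderiv_scal. apply (cderiv_invpow (S m)). exact hz. }
  assert (D := cderiv_CI_affine U _ _ (circ z0 r) (fun _ => (-1)%C) phi 0 (2 * PI) w
    (Rlt_le _ _ hP) HU HH (fun t _ => rcont_circ z0 r t) (fun t _ => rcont_const _ t)
    (fun t _ => Hp t) (fun t _ => Hin t)).
  eapply cderiv_eq; [|exact D].
  apply CI_unique.
  apply is_CI_ext with (fun t => RtoC (INR m) * ((/ (circ z0 r t + w * (-1))) ^ S m * phi t))%C; [lra| |].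
  - intros; ring.
  - apply is_CI_scal, is_CI_CI; [lra|]. intros t _. apply rcont_mult; [|apply Hp].
    apply (rcont_pow (fun t => / (circ z0 r t + w * -1))%C).
    apply (rcont_comp Cinv (fun t => circ z0 r t + w * -1)%C).
    + apply rcont_plus; [apply rcont_circ|apply rcont_const].
    + eapply cderiv_ccont, cderiv_inv_id. apply Hin.
Qed.

Lemma CF_Kint f z0 r w : CF f z0 r -> Cmod (w - z0)%C < r ->
  f w = (/ RtoC (2 * PI) * Kint (fun t => f (circ z0 r t) * (RtoC r * cis t)) z0 r 1 w)%C.
Proof.
  intros [hr [Hc Hf]] hw. assert (hP := two_PI_pos). rewrite (Hf w hw). f_equal.
  apply CI_ext; [lra|]. intros t _. unfold cker, Cdiv.
  replace (circ z0 r t + w * -1)%C with (circ z0 r t - w)%C by ring. ring.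
Qed.

Lemma rcont_CF_kernel f z0 r : CF f z0 r -> forall t, rcont (fun t => f (circ z0 r t) * (RtoC r * cis t))%C t.
Proof.
  intros [hr [Hc Hf]] t. apply rcont_mult; [apply Hc|].
  apply rcont_mult; [apply rcont_const|apply rcont_cis].
Qed.

(** Cauchy's formula for the derivative of order [m]; the exponent is [S m], and order 0 reproduces
    [f] inside the disc. *)
Definition dCF (f : C -> C) (z0 : C) (r : R) (m : nat) (w : C) : C :=
  (/ RtoC (2 * PI) * (RtoC (INR (fact m)) *
    Kint (fun t => f (circ z0 r t) * (RtoC r * cis t)) z0 r (S m) w))%C.

Lemma cderiv_dCF f z0 r m w : CF f z0 r -> Cmod (w - z0)%C < r ->
  cderiv (dCF f z0 r m) w (dCF f z0 r (S m) w).
Proof.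
  intros HF hw. assert (hr : 0 < r) by apply HF.
  apply cderiv_scal.
  eapply cderiv_eq; [|apply cderiv_scal, cderiv_Kint; [easy|apply rcont_CF_kernel; easy|easy]].
  rewrite fact_simpl, mult_INR, RtoC_mult. ring.
Qed.

Lemma CF_cderiv f z0 r w : CF f z0 r -> Cmod (w - z0)%C < r -> cderiv f w (dCF f z0 r 1 w).
Proof.
  intros HF hw.
  apply cderiv_ext_loc with (f := dCF f z0 r 0) (d := r - Cmod (w - z0)%C); [lra| |apply cderiv_dCF; easy].
  intros u hu. unfold dCF. rewrite Cmult_1_l. symmetry. apply CF_Kint; [easy|].
  eapply Rle_lt_trans; [apply Cmod_split with (y := w)|]. lra.
Qed.

(** Every point of the circle is at distance [r] from the centre, so the kernel of the first
    derivative has modulus [1 / r]. *)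
Lemma CF_C_derive_bound f z0 r B : CF f z0 r -> (forall t, Cmod (f (circ z0 r t))%C <= B) ->
  Cmod (C_derive f z0)%C <= B / r.
Proof.
  intros HF HB. assert (hr : 0 < r) by apply HF. assert (hP := two_PI_pos).
  assert (h0 : Cmod (z0 - z0)%C < r).
  { replace (z0 - z0)%C with (RtoC 0) by ring. rewrite Cmod_0. easy. }
  rewrite (cderiv_C_derive _ _ _ (CF_cderiv f z0 r z0 HF h0)).
  unfold dCF. simpl fact. simpl INR. rewrite Cmult_1_l, Cmod_mult, Cmod_inv_2PI.
  apply Rmult_le_reg_l with (2 * PI); [easy|]. rewrite <- Rmult_assoc, Rinv_r, Rmult_1_l by lra.
  replace (2 * PI * (B / r)) with ((2 * PI - 0) * (B / r)) by ring.
  assert (E : forall t, Cmod (circ z0 r t + z0 * -1)%C = r).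
  { intros t. replace (circ z0 r t + z0 * -1)%C with (circ z0 r t - z0)%C by ring.
    apply Cmod_circ; lra. }
  assert (N : forall t, (circ z0 r t + z0 * -1)%C <> 0%C).
  { intros t. apply Cmod_gt_0. rewrite E. easy. }
  eapply is_CI_bound; [lra| |apply is_CI_CI; [lra|]].
  - intros t _. cbv beta. rewrite !Cmod_mult, Cmod_pow, Cmod_inv, E by apply N.
    rewrite Cmod_cis, Cmod_R, Rabs_pos_eq by lra. simpl.
    replace (/ r * (/ r * 1) * (Cmod (f (circ z0 r t))%C * (r * 1))) with (Cmod (f (circ z0 r t))%C / r)
      by (field; lra).
    apply Rmult_le_compat_r; [left; apply Rinv_0_lt_compat; easy|apply HB].
  - intros t _. apply rcont_mult; [|apply rcont_CF_kernel; easy].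
    apply (rcont_pow (fun t => / (circ z0 r t + z0 * -1))%C).
    apply (rcont_comp Cinv (fun t => circ z0 r t + z0 * -1)%C).
    + apply rcont_plus; [apply rcont_circ|apply rcont_const].
    + eapply cderiv_ccont, cderiv_inv_id. apply N.
Qed.

(** * Holomorphic functions: Cauchy estimates, uniform limits and closure properties *)

Definition holo (U : C -> Prop) (f : C -> C) : Prop := Holo U f (C_derive f).

Lemma ccont_ext_loc f g z d : 0 < d -> (forall w, Cmod (w - z)%C < d -> f w = g w) ->
  ccont f z -> ccont g z.
Proof.
  intros hd E H eps he. destruct (H eps he) as [d1 [hd1 H1]].
  exists (Rmin d d1). split; [apply Rmin_pos; easy|]. intros h hh.
  rewrite <- !E.
  - apply H1. eapply Rlt_le_trans; [exact hh|apply Rmin_r].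
  - replace (z - z)%C with (RtoC 0) by ring. rewrite Cmod_0. easy.
  - replace (z + h - z)%C with h by ring. eapply Rlt_le_trans; [exact hh|apply Rmin_l].
Qed.

Lemma copen_ball U z : copen U -> U z -> exists d, 0 < d /\ forall w, Cmod (w - z)%C < d -> U w.
Proof.
  intros H h. destruct (H z h) as [d [hd H1]]. exists d. split; [easy|]. intros w hw.
  replace w with (z + (w - z))%C by ring. apply H1; easy.
Qed.

Lemma Holo_holo U f f' : copen U -> Holo U f f' -> holo U f.
Proof.
  intros HU H z hz.
  assert (E : forall w, U w -> f' w = C_derive f w).
  { intros w hw. symmetry. apply cderiv_C_derive. apply H; easy. }
  split.
  - rewrite <- E by easy. apply H; easy.
  - destruct (copen_ball U z HU hz) as [d [hd Hd]].
    apply ccont_ext_loc with f' d; [easy| |apply H; easy].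
    intros w hw. apply E. apply Hd; easy.
Qed.

Lemma holo_cderiv U f z : holo U f -> U z -> cderiv f z (C_derive f z).
Proof. intros H hz. apply H; easy. Qed.

Lemma holo_CF U f z r : copen U -> holo U f -> 0 < r -> (forall w, Cmod (w - z)%C <= r -> U w) ->
  CF f z r.
Proof. intros HU H. apply (Cauchy_formula U f (C_derive f)); easy. Qed.

Lemma copen_closed_ball U z : copen U -> U z -> exists d, 0 < d /\ forall w, Cmod (w - z)%C <= d -> U w.
Proof.
  intros H h. destruct (copen_ball U z H h) as [d [hd H1]]. exists (d / 2). split; [lra|].
  intros w hw. apply H1. lra.
Qed.

(* The Cauchy integral is infinitely differentiable, so the pointwise property [CF] already
   yields holomorphy of [f] and of its derivative. *)
Lemma CF_holo_loc f z r : CF f z r ->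
  holo (fun w => Cmod (w - z)%C < r) f /\ holo (fun w => Cmod (w - z)%C < r) (C_derive f).
Proof.
  intros HF.
  assert (HU : copen (fun w => Cmod (w - z)%C < r)).
  { intros w hw. exists (r - Cmod (w - z)%C). split; [lra|]. intros h hh.
    replace (w + h - z)%C with ((w - z) + h)%C by ring.
    eapply Rle_lt_trans; [apply Cmod_triangle|]. lra. }
  assert (E : forall w, Cmod (w - z)%C < r -> C_derive f w = dCF f z r 1 w).
  { intros w hw. apply cderiv_C_derive, CF_cderiv; easy. }
  split.
  - apply Holo_holo with (dCF f z r 1); [easy|]. intros w hw. split; [apply CF_cderiv; easy|].
    eapply cderiv_ccont, cderiv_dCF; easy.
  - apply Holo_holo with (dCF f z r 2); [easy|]. intros w hw. split.
    + destruct (copen_ball _ w HU hw) as [d [hd Hd]].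
      apply cderiv_ext_loc with (f := dCF f z r 1) (d := d); [easy| |apply cderiv_dCF; easy].
      intros u hu. symmetry. apply E, Hd; easy.
    + eapply cderiv_ccont, cderiv_dCF; easy.
Qed.

Lemma CF_holo (U : C -> Prop) f : (forall z, U z -> exists r, CF f z r) -> holo U f.
Proof.
  intros H z hz. destruct (H z hz) as [r Hr].
  assert (hr : 0 < r) by apply Hr. destruct (CF_holo_loc f z r Hr) as [A _]. apply A.
  replace (z - z)%C with (RtoC 0) by ring. rewrite Cmod_0. easy.
Qed.

Lemma holo_derive U f : copen U -> holo U f -> holo U (C_derive f).
Proof.
  intros HU H z hz. destruct (copen_closed_ball U z HU hz) as [r [hr Hr]].
  destruct (CF_holo_loc f z r (holo_CF U f z r HU H hr Hr)) as [_ A]. apply A.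
  replace (z - z)%C with (RtoC 0) by ring. rewrite Cmod_0. easy.
Qed.

Lemma holo_analytic U f z : copen U -> holo U f -> U z -> analytic_at f z.
Proof.
  intros HU H hz. destruct (copen_closed_ball U z HU hz) as [r [hr Hr]].
  eapply CF_analytic, holo_CF; eassumption.
Qed.

Lemma Cauchy_estimate U f z r B : copen U -> holo U f -> 0 < r ->
  (forall w, Cmod (w - z)%C <= r -> U w /\ Cmod (f w)%C <= B) -> Cmod (C_derive f z)%C <= B / r.
Proof.
  intros HU H hr HB. apply CF_C_derive_bound.
  - apply (holo_CF U); try easy. intros w hw. apply HB; easy.
  - intros t. apply HB. rewrite Cmod_circ; lra.
Qed.

Lemma CF_limit (F : nat -> C -> C) f z r : 0 < r -> (forall n, CF (F n) z r) ->
  (forall eps, 0 < eps -> exists N, forall n, (N <= n)%nat ->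
    forall w, Cmod (w - z)%C <= r -> Cmod (F n w - f w)%C <= eps) ->
  CF f z r /\
  (forall eps, 0 < eps -> exists N, forall n, (N <= n)%nat ->
    Cmod (C_derive (F n) z - C_derive f z)%C <= eps).
Proof.
  intros hr HF Hlim. assert (hP := two_PI_pos).
  assert (Hc : forall t, rcont (fun t => f (circ z r t)) t).
  { intros t eps he. destruct (Hlim (eps / 4)) as [N HN]; [lra|].
    specialize (HN N (Nat.le_refl N)).
    destruct (proj1 (proj2 (HF N)) t (eps / 4)) as [d [hd Hd]]; [lra|].
    exists d. split; [easy|]. intros h hh. specialize (Hd h hh).
    assert (A := HN (circ z r (t + h)) ltac:(rewrite Cmod_circ; lra)).
    assert (B := HN (circ z r t) ltac:(rewrite Cmod_circ; lra)).
    rewrite Cmod_minus_sym in A.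
    eapply Rle_lt_trans; [apply Cmod_split with (y := F N (circ z r (t + h)))|].
    eapply Rle_lt_trans; [apply Rplus_le_compat_l, Cmod_split with (y := F N (circ z r t))|]. lra. }
  assert (HC : CF f z r).
  { split; [easy|]. split; [easy|]. intros w hw.
    set (I := fun g : C -> C => CI (fun t => g (circ z r t) * cker z r w t)%C 0 (2 * PI)).
    change (f w = (/ RtoC (2 * PI) * I f)%C).
    set (M := r / (r - Cmod (w - z)%C)).
    assert (hM : 0 < M) by (apply Rdiv_lt_0_compat; lra).
    apply Cmod_small_eq. intros eps he.
    destruct (Hlim (eps / (1 + M))) as [N HN]; [apply Rdiv_lt_0_compat; lra|].
    specialize (HN N (Nat.le_refl N)).
    assert (A := HN w (Rlt_le _ _ hw)).
    eapply Rle_trans; [apply Cmod_split with (y := F N w)|].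
    rewrite (Cmod_minus_sym (f w)).
    rewrite (proj2 (proj2 (HF N)) w hw) at 2. change (CI _ 0 (2 * PI)) with (I (F N)).
    replace (/ (2 * PI)%R * I (F N) - / (2 * PI)%R * I f)%C with (/ (2 * PI)%R * (I (F N) - I f))%C by ring.
    rewrite Cmod_mult, Cmod_inv_2PI.
    assert (B : Cmod (I (F N) - I f)%C <= (2 * PI - 0) * (eps / (1 + M) * M)).
    { eapply is_CI_bound; [lra| |apply is_CI_minus; apply is_CI_CI; try lra].
      - intros t _. cbv beta.
        replace (F N (circ z r t) * cker z r w t - f (circ z r t) * cker z r w t)%C with
          ((F N (circ z r t) - f (circ z r t)) * cker z r w t)%C by ring.
        rewrite Cmod_mult. apply Rmult_le_compat; try apply Cmod_ge_0.
        + apply HN. rewrite Cmod_circ; lra.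
        + apply Cmod_cker; easy.
      - intros t _. apply rcont_mult; [apply HF|apply rcont_cker; easy].
      - intros t _. apply rcont_mult; [apply Hc|apply rcont_cker; easy]. }
    rewrite Rminus_0_r in B.
    apply Rmult_le_compat_l with (r := / (2 * PI)) in B; [|left; apply Rinv_0_lt_compat; easy].
    rewrite <- Rmult_assoc, Rinv_l, Rmult_1_l in B by lra.
    apply Rle_trans with (eps / (1 + M) + eps / (1 + M) * M); [lra|].
    apply Req_le. field. lra. }
  split; [easy|].
  intros eps he. destruct (Hlim (eps * r)) as [N HN]; [apply Rmult_lt_0_compat; lra|].
  exists N. intros n hn.
  assert (h0 : Cmod (z - z)%C < r).
  { replace (z - z)%C with (RtoC 0) by ring. rewrite Cmod_0. easy. }
  assert (E : (C_derive (F n) z - C_derive f z)%C = C_derive (fun w => F n w - f w)%C z).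
  { symmetry. apply cderiv_C_derive.
    rewrite (cderiv_C_derive _ _ _ (CF_cderiv _ _ _ _ (HF n) h0)).
    rewrite (cderiv_C_derive _ _ _ (CF_cderiv _ _ _ _ HC h0)).
    apply cderiv_minus; apply CF_cderiv; easy. }
  rewrite E. replace eps with (eps * r / r) by (field; lra).
  apply CF_C_derive_bound; [apply CF_minus; easy|].
  intros t. apply HN; [easy|]. rewrite Cmod_circ; lra.
Qed.

Lemma Holo_ext U f g f' : copen U -> (forall z, U z -> f z = g z) -> Holo U f f' -> Holo U g f'.
Proof.
  intros HU E H z hz. split; [|apply H; easy].
  destruct (copen_ball U z HU hz) as [d [hd Hd]].
  apply cderiv_ext_loc with f d; [easy| |apply H; easy]. intros w hw. apply E, Hd; easy.
Qed.

Lemma holo_ext U f g : copen U -> (forall z, U z -> f z = g z) -> holo U f -> holo U g.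
Proof. intros HU E H. eapply Holo_holo; [easy|]. eapply Holo_ext; eassumption. Qed.

Lemma C_derive_ext U f g z : copen U -> (forall z, U z -> f z = g z) -> holo U f -> U z ->
  C_derive f z = C_derive g z.
Proof.
  intros HU E H hz. symmetry. apply cderiv_C_derive.
  apply (Holo_ext U f g (C_derive f)); easy.
Qed.

Lemma ccont_plus f g z : ccont f z -> ccont g z -> ccont (fun w => f w + g w)%C z.
Proof. rewrite !ccont_continuous. apply (continuous_plus (U := AbsRing_UniformSpace C_AbsRing) (V := AbsRing_NormedModule C_AbsRing)). Qed.

Lemma ccont_mult f g z : ccont f z -> ccont g z -> ccont (fun w => f w * g w)%C z.
Proof. rewrite !ccont_continuous. apply (continuous_mult (U := AbsRing_UniformSpace C_AbsRing) (K := C_AbsRing)). Qed.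

Lemma ccont_comp f g z : ccont g z -> ccont f (g z) -> ccont (fun w => f (g w)) z.
Proof.
  rewrite !ccont_continuous.
  apply (continuous_comp (U := AbsRing_UniformSpace C_AbsRing) (V := AbsRing_UniformSpace C_AbsRing) (W := AbsRing_UniformSpace C_AbsRing)).
Qed.

Lemma ccont_const c z : ccont (fun _ => c) z.
Proof. eapply cderiv_ccont, cderiv_const. Qed.

Lemma holo_const U c : copen U -> holo U (fun _ => c).
Proof.
  intros HU. apply Holo_holo with (fun _ => 0%C); [easy|]. intros z hz.
  split; [apply cderiv_const|apply ccont_const].
Qed.

Lemma holo_id U : copen U -> holo U (fun z => z).
Proof.
  intros HU. apply Holo_holo with (fun _ => 1%C); [easy|]. intros z hz.
  split; [apply cderiv_id|apply ccont_const].
Qed.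

Lemma holo_plus U f g : copen U -> holo U f -> holo U g -> holo U (fun z => f z + g z)%C.
Proof.
  intros HU Hf Hg. apply Holo_holo with (fun z => C_derive f z + C_derive g z)%C; [easy|].
  intros z hz. destruct (Hf z hz), (Hg z hz).
  split; [apply cderiv_plus; easy|apply ccont_plus; easy].
Qed.

Lemma holo_mult U f g : copen U -> holo U f -> holo U g -> holo U (fun z => f z * g z)%C.
Proof.
  intros HU Hf Hg.
  apply Holo_holo with (fun z => C_derive f z * g z + f z * C_derive g z)%C; [easy|].
  intros z hz. destruct (Hf z hz) as [a b], (Hg z hz) as [c d].
  split; [apply cderiv_mult; easy|].
  apply ccont_plus; apply ccont_mult; try easy; eapply cderiv_ccont; eassumption.
Qed.

Lemma holo_scal U c f : copen U -> holo U f -> holo U (fun z => c * f z)%C.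
Proof. intros HU H. apply holo_mult; [easy|apply holo_const; easy|easy]. Qed.

Lemma holo_opp U f : copen U -> holo U f -> holo U (fun z => - f z)%C.
Proof.
  intros HU H. apply holo_ext with (fun z => (-1) * f z)%C; [easy| |apply holo_scal; easy].
  intros; ring.
Qed.

Lemma holo_minus U f g : copen U -> holo U f -> holo U g -> holo U (fun z => f z - g z)%C.
Proof. intros HU Hf Hg. apply holo_plus; [easy|easy|]. apply holo_opp; easy. Qed.

Lemma holo_comp U V f g : copen U -> holo U g -> holo V f -> (forall z, U z -> V (g z)) ->
  holo U (fun z => f (g z)).
Proof.
  intros HU Hg Hf HV.
  apply Holo_holo with (fun z => C_derive f (g z) * C_derive g z)%C; [easy|].
  intros z hz. destruct (Hg z hz) as [a b], (Hf (g z) (HV z hz)) as [c d].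
  split; [apply cderiv_comp; easy|].
  apply ccont_mult; [|easy]. apply ccont_comp; [eapply cderiv_ccont; eassumption|easy].
Qed.

Lemma copen_neq0 : copen (fun u => u <> 0%C).
Proof.
  intros z hz. exists (Cmod z). split; [apply Cmod_gt_0; exact hz|].
  intros h hh E. assert (h = - z)%C by (replace h with ((z + h) - z)%C by ring; rewrite E; ring).
  subst h. rewrite Cmod_opp in hh. lra.
Qed.

Lemma holo_Cinv : holo (fun u => u <> 0%C) Cinv.
Proof.
  apply Holo_holo with (fun u => - / (u * u))%C; [apply copen_neq0|].
  intros z hz. split; [apply cderiv_inv_id; exact hz|].
  eapply cderiv_ccont. apply cderiv_opp.
  apply (cderiv_comp Cinv (fun u => u * u)%C z).
  - apply cderiv_mult; apply cderiv_id.
  - apply cderiv_inv_id. apply Cmult_neq_0; exact hz.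
Qed.

Lemma holo_inv U f : copen U -> holo U f -> (forall z, U z -> f z <> 0%C) -> holo U (fun z => / f z)%C.
Proof.
  intros HU H hn. apply (holo_comp U (fun u => u <> 0%C) Cinv f); [easy|easy|apply holo_Cinv|easy].
Qed.

Lemma holo_Cexp U f : copen U -> holo U f -> holo U (fun z => Cexp (f z)%C).
Proof.
  intros HU H. apply (holo_comp U (fun _ => True) Cexp f); try easy.
  apply Holo_holo with Cexp.
  - intros z _. exists 1. split; [lra|easy].
  - intros z _. split; [apply cderiv_Cexp|eapply cderiv_ccont, cderiv_Cexp].
Qed.

Lemma holo_subset (U V : C -> Prop) f : (forall z, V z -> U z) -> holo U f -> holo V f.
Proof. intros HV H z hz. apply H, HV; easy. Qed.

Lemma holo_pow U f n : copen U -> holo U f -> holo U (fun z => f z ^ n)%C.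
Proof.
  intros HU H. induction n as [|n IH]; simpl; [apply holo_const; easy|]. apply holo_mult; easy.
Qed.

Lemma holo_Csum U (u : nat -> C -> C) n : copen U -> (forall k, (k < n)%nat -> holo U (u k)) ->
  holo U (fun z => Csum (fun k => u k z) n).
Proof.
  intros HU H. induction n as [|n IH]; simpl; [apply holo_const; easy|].
  apply holo_plus; [easy| |apply H; lia]. apply IH. intros k hk. apply H. lia.
Qed.

(** * The principal logarithm *)

Lemma Cmod_sqr (z : C) : Cmod z * Cmod z = Re z * Re z + Im z * Im z.
Proof. assert (H := Cmod2_alt z). simpl in H. lra. Qed.

Lemma Re_div_Cmod_bounds (z : C) : z <> 0%C -> -1 <= Re z / Cmod z <= 1.
Proof.
  intros hz. assert (hm : 0 < Cmod z) by (apply Cmod_gt_0; exact hz).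
  assert (H := re_le_Cmod z). apply Rabs_le_between in H.
  split; apply Rmult_le_reg_r with (Cmod z); try easy;
    unfold Rdiv; rewrite Rmult_assoc, Rinv_l; lra.
Qed.

Lemma cos_Arg (z : C) : z <> 0%C -> cos (Arg z) = Re z / Cmod z.
Proof.
  intros hz. assert (B := Re_div_Cmod_bounds z hz).
  unfold Arg. destruct (Rle_dec 0 (Im z)); [|rewrite cos_neg]; apply cos_acos; lra.
Qed.

Lemma sin_Arg (z : C) : z <> 0%C -> sin (Arg z) = Im z / Cmod z.
Proof.
  intros hz. assert (B := Re_div_Cmod_bounds z hz).
  assert (hm : 0 < Cmod z) by (apply Cmod_gt_0; exact hz).
  assert (E : sqrt (1 - (Re z / Cmod z)²) = Rabs (Im z) / Cmod z).
  { rewrite <- (sqrt_Rsqr (Rabs (Im z) / Cmod z)).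
    2:{ apply Rdiv_le_0_compat; [apply Rabs_pos|easy]. }
    f_equal. unfold Rsqr.
    replace (Rabs (Im z) / Cmod z * (Rabs (Im z) / Cmod z)) with
      ((Rabs (Im z) * Rabs (Im z)) / (Cmod z * Cmod z)) by (field; lra).
    replace (Rabs (Im z) * Rabs (Im z)) with (Im z * Im z).
    2:{ rewrite <- Rabs_mult, Rabs_pos_eq; [easy|]. nra. }
    replace (Im z * Im z) with (Cmod z * Cmod z - Re z * Re z) by (rewrite Cmod_sqr; ring).
    field. lra. }
  unfold Arg. destruct (Rle_dec 0 (Im z)).
  - rewrite sin_acos by lra. rewrite E, Rabs_pos_eq; lra.
  - rewrite sin_neg, sin_acos by lra. rewrite E, Rabs_left by lra. field. lra.
Qed.

Lemma Cexp_Clog (z : C) : z <> 0%C -> Cexp (Clog z)%C = z.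
Proof.
  intros hz. assert (hm : 0 < Cmod z) by (apply Cmod_gt_0; exact hz).
  unfold Cexp, Clog. simpl. rewrite exp_ln, cos_Arg, sin_Arg by easy.
  destruct z as [x y]. simpl. f_equal; field; lra.
Qed.

Lemma Arg_bound (z : C) : z <> 0%C -> Rabs (Arg z) <= PI.
Proof.
  intros hz. unfold Arg. assert (B := acos_bound (Re z / Cmod z)).
  destruct (Rle_dec 0 (Im z)); apply Rabs_le; lra.
Qed.

(** The plane cut along the closed negative real axis: [Cmod z = - Re z] holds exactly there, so one
    strict inequality describes the domain. *)
Definition slit (z : C) : Prop := 0 < Cmod z + Re z.

Lemma slit_neq_0 (z : C) : slit z -> z <> 0%C.
Proof. unfold slit. intros h E. subst z. rewrite Cmod_0 in h. simpl in h. lra. Qed.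

Lemma slit_Re (z : C) : 0 < Re z -> slit z.
Proof. intros h. unfold slit. assert (H := Cmod_ge_0 z). lra. Qed.

Lemma slit_Im (z : C) : Im z <> 0 -> slit z.
Proof.
  intros h. unfold slit. assert (H := Cmod_ge_0 z). assert (E := Cmod_sqr z). nra.
Qed.

Lemma Arg_slit (z : C) : slit z -> Rabs (Arg z) < PI.
Proof.
  intros h. assert (hz := slit_neq_0 z h).
  destruct (Rle_lt_or_eq_dec _ _ (Arg_bound z hz)) as [H|H]; [easy|].
  exfalso. assert (E := cos_Arg z hz).
  assert (C1 : cos (Arg z) = -1).
  { unfold Rabs in H. destruct (Rcase_abs (Arg z)).
    - rewrite <- cos_neg, H. apply cos_PI.
    - rewrite H. apply cos_PI. }
  rewrite C1 in E. assert (hm : 0 < Cmod z) by (apply Cmod_gt_0; exact hz).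
  assert (Re z = - Cmod z).
  { replace (Re z) with (Re z / Cmod z * Cmod z) by (field; lra). rewrite <- E. ring. }
  unfold slit in h. lra.
Qed.

Lemma cos_pos_Arg (z : C) : z <> 0%C -> 0 < Re z -> Rabs (Arg z) < PI / 2.
Proof.
  intros hz h. assert (hm : 0 < Cmod z) by (apply Cmod_gt_0; exact hz).
  assert (P := Arg_bound z hz). assert (E := cos_Arg z hz).
  assert (hc : 0 < cos (Arg z)) by (rewrite E; apply Rdiv_lt_0_compat; lra).
  destruct (Rlt_le_dec (Rabs (Arg z)) (PI / 2)) as [H|H]; [easy|exfalso].
  assert (cos (Rabs (Arg z)) <= 0).
  { apply cos_le_0; [easy|]. lra. }
  assert (cos (Rabs (Arg z)) = cos (Arg z)).
  { unfold Rabs. destruct (Rcase_abs (Arg z)); [apply cos_neg|easy]. }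
  lra.
Qed.

Lemma Arg_Im_pos (z : C) : 0 < Im z -> 0 < Arg z < PI.
Proof.
  intros h. assert (hs : slit z) by (apply slit_Im; lra).
  assert (B := Arg_slit z hs). assert (hz := slit_neq_0 z hs).
  assert (hm : 0 < Cmod z) by (apply Cmod_gt_0; exact hz).
  assert (E := sin_Arg z hz). assert (0 < Im z / Cmod z) by (apply Rdiv_lt_0_compat; lra).
  apply Rabs_lt_between in B. split; [|lra].
  unfold Arg in *. destruct (Rle_dec 0 (Im z)); [|lra].
  assert (T := acos_bound (Re z / Cmod z)). destruct T as [[T|T] _]; [easy|].
  rewrite <- T, sin_0 in E. lra.
Qed.

Lemma Arg_Im_neg (z : C) : Im z < 0 -> - PI < Arg z < 0.
Proof.
  intros h. assert (hs : slit z) by (apply slit_Im; lra).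
  assert (B := Arg_slit z hs). assert (hz := slit_neq_0 z hs).
  assert (hm : 0 < Cmod z) by (apply Cmod_gt_0; exact hz).
  assert (E := sin_Arg z hz).
  assert (0 < (- Im z) / Cmod z) by (apply Rdiv_lt_0_compat; lra).
  replace (- Im z / Cmod z) with (- (Im z / Cmod z)) in H by (field; lra).
  apply Rabs_lt_between in B. split; [lra|].
  unfold Arg in *. destruct (Rle_dec 0 (Im z)); [lra|].
  assert (T := acos_bound (Re z / Cmod z)). destruct T as [[T|T] _]; [lra|].
  rewrite <- T, Ropp_0, sin_0 in E. lra.
Qed.

(** If [d = p - q] then [exp d = 1] forces [Re d = 0] and [sin (Im d / 2) = 0], while
    [|Im d / 2| < PI]. All logarithm identities below reduce to this by bounding arguments. *)
Lemma Cexp_inj (p q : C) : Rabs (Im p - Im q) < 2 * PI -> Cexp p = Cexp q -> p = q.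
Proof.
  intros hI E.
  assert (E1 : Cexp (p - q)%C = 1%C).
  { unfold Cminus. rewrite Cexp_plus, E, <- Cexp_plus.
    replace (q + - q)%C with (RtoC 0) by ring. apply Cexp_0. }
  set (d := (p - q)%C) in *.
  assert (hd : Im d = Im p - Im q) by (unfold d, Im, Cminus, Cplus, Copp; simpl; ring).
  assert (R0 : Re d = 0).
  { assert (M := Cmod_Cexp d). rewrite E1, Cmod_1 in M.
    apply exp_inv. rewrite exp_0. easy. }
  assert (Cs := f_equal Re E1). change (exp (Re d) * cos (Im d) = 1) in Cs.
  rewrite R0, exp_0, Rmult_1_l in Cs.
  assert (hh : sin (Im d / 2) = 0).
  { assert (K := cos_2a_sin (Im d / 2)).
    replace (2 * (Im d / 2)) with (Im d) in K by field. rewrite Cs in K. nra. }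
  assert (I0 : Im d = 0).
  { rewrite <- hd in hI. apply Rabs_lt_between in hI.
    destruct (Rtotal_order (Im d) 0) as [h|[h|h]]; [exfalso|easy|exfalso].
    - assert (0 < sin (- (Im d / 2))) by (apply sin_gt_0; lra). rewrite sin_neg in H. lra.
    - assert (0 < sin (Im d / 2)) by (apply sin_gt_0; lra). lra. }
  apply Ceq_minus. fold d. clearbody d. destruct d as [x y]. simpl in R0, I0.
  rewrite R0, I0. easy.
Qed.

Lemma Clog_mult (z w : C) : z <> 0%C -> w <> 0%C -> Rabs (Arg z + Arg w) < PI ->
  Clog (z * w)%C = (Clog z + Clog w)%C.
Proof.
  intros hz hw hA. assert (hzw := Cmult_neq_0 _ _ hz hw).
  apply Cexp_inj.
  - simpl. assert (B := Arg_bound _ hzw). apply Rabs_le_between in B.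
    apply Rabs_lt_between in hA. apply Rabs_lt_between. lra.
  - rewrite Cexp_plus, !Cexp_Clog; easy.
Qed.

Lemma Clog_inv (z : C) : slit z -> Clog (/ z)%C = (- Clog z)%C.
Proof.
  intros hz. assert (h0 := slit_neq_0 z hz). assert (hm : 0 < Cmod z) by (apply Cmod_gt_0; exact h0).
  assert (hi : (/ z)%C <> 0%C).
  { apply Cmod_gt_0. rewrite Cmod_inv by easy. apply Rinv_0_lt_compat; easy. }
  apply Cexp_inj.
  - simpl. assert (B := Arg_bound _ hi). assert (B2 := Arg_slit z hz).
    apply Rabs_le_between in B. apply Rabs_lt_between in B2. apply Rabs_lt_between. lra.
  - rewrite Cexp_opp, !Cexp_Clog; easy.
Qed.

Lemma Arg_pos_real (x : R) : 0 < x -> Arg x = 0.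
Proof.
  intros h. unfold Arg. simpl. destruct (Rle_dec 0 0); [|lra].
  rewrite Cmod_R, Rabs_pos_eq by lra. replace (x / x) with 1 by (field; lra). apply acos_1.
Qed.

Lemma Clog_RtoC (x : R) : 0 < x -> Clog x = RtoC (ln x).
Proof.
  intros h. unfold Clog. rewrite Arg_pos_real, Cmod_R, Rabs_pos_eq by lra. easy.
Qed.

Lemma Arg_inv (z : C) : slit z -> Arg (/ z)%C = - Arg z.
Proof. intros h. assert (E := f_equal Im (Clog_inv z h)). exact E. Qed.

Lemma ln_le_sub_1 x : 0 < x -> ln x <= x - 1.
Proof.
  intros h. assert (H := exp_ineq1_le (ln x)). rewrite exp_ln in H by easy. lra.
Qed.

(** The derivative of [sin x - x cos x] is [x sin x >= 0]. This converts a bound on the sine of an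
    argument into one on the argument. *)
Lemma x_cos_le_sin x : 0 <= x <= PI / 2 -> x * cos x <= sin x.
Proof.
  intros hx.
  destruct (MVT_gen (fun x => sin x - x * cos x) 0 x (fun x => x * sin x)) as [c [hc E]].
  - intros y _. auto_derive; [easy|]. ring.
  - intros y _. apply derivable_continuous_pt. exists (y * sin y). apply is_derive_Reals.
    auto_derive; [easy|]. ring.
  - rewrite Rmin_left, Rmax_right in hc by lra. rewrite sin_0 in E.
    assert (0 <= sin c) by (apply sin_ge_0; lra).
    assert (0 <= c * sin c * (x - 0)) by (repeat apply Rmult_le_pos; lra). lra.
Qed.

(** The real part is controlled by [ln x <= x - 1] at [r] and at [1 / r], the argument by
    [x cos x <= sin x], which reads [|Arg| * Re (1 + u) <= |Im u|]. The two contribute 2 and 4. *)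
Lemma Clog_near_1 (u : C) : Cmod u <= 1 / 2 -> Cmod (Clog (1 + u)%C)%C <= 6 * Cmod u.
Proof.
  intros hu.
  assert (A1 : 1 - Cmod u <= Cmod (1 + u)%C).
  { assert (T := Cmod_rev_triangle 1 (- u)). rewrite Cmod_1, Cmod_opp in T.
    replace (1 - - u)%C with (1 + u)%C in T by ring. lra. }
  assert (A2 : Cmod (1 + u)%C <= 1 + Cmod u).
  { eapply Rle_trans; [apply Cmod_triangle|]. rewrite Cmod_1. lra. }
  set (r := Cmod (1 + u)%C) in *.
  assert (hz : (1 + u)%C <> 0%C) by (apply Cmod_gt_0; unfold r in *; lra).
  assert (L : Rabs (ln r) <= 2 * Cmod u).
  { apply Rabs_le. split.
    - assert (T := ln_le_sub_1 (/ r) ltac:(apply Rinv_0_lt_compat; lra)).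
      rewrite ln_Rinv in T by lra.
      assert (/ r <= 1 + 2 * Cmod u); [|lra].
      apply Rmult_le_reg_l with r; [lra|]. rewrite Rinv_r by lra. nra.
    - assert (T := ln_le_sub_1 r ltac:(lra)). lra. }
  assert (hR := re_le_Cmod u). apply Rabs_le_between in hR.
  assert (hI := im_le_Cmod u).
  assert (Hre : 0 < Re (1 + u)) by (change (0 < 1 + Re u); lra).
  assert (hA := cos_pos_Arg _ hz Hre).
  assert (B : Rabs (Arg (1 + u)%C) <= 2 * (2 * Cmod u)).
  { assert (S := x_cos_le_sin (Rabs (Arg (1 + u)%C)) ltac:(split; [apply Rabs_pos|lra])).
    assert (E := sin_Arg _ hz). assert (Ec := cos_Arg _ hz). fold r in E, Ec.
    assert (Es : sin (Rabs (Arg (1 + u)%C)) <= Rabs (sin (Arg (1 + u)%C))).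
    { unfold Rabs at 1. destruct (Rcase_abs (Arg (1 + u)%C)).
      - rewrite sin_neg, <- Rabs_Ropp. apply Rle_abs.
      - apply Rle_abs. }
    assert (Ek : cos (Rabs (Arg (1 + u)%C)) = cos (Arg (1 + u)%C)).
    { unfold Rabs. destruct (Rcase_abs (Arg (1 + u)%C)); [apply cos_neg|easy]. }
    rewrite Ek, Ec in S. rewrite E in Es.
    unfold Rdiv in Es. rewrite Rabs_mult, (Rabs_pos_eq (/ r)) in Es
      by (left; apply Rinv_0_lt_compat; lra).
    assert (I1 : Im (1 + u) = Im u) by (unfold Re, Im; simpl; ring). rewrite I1 in Es.
    assert (H := Rle_trans _ _ _ S Es).
    apply Rmult_le_compat_r with (r := r) in H; [|lra].
    replace (Rabs (Im u) * / r * r) with (Rabs (Im u)) in H by (field; lra).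
    replace (Rabs (Arg (1 + u)%C) * (Re (1 + u) / r) * r) with (Rabs (Arg (1 + u)%C) * Re (1 + u)) in H
      by (field; lra).
    assert (1 / 2 <= Re (1 + u)) by (change (1 / 2 <= 1 + Re u); lra).
    nra. }
  eapply Rle_trans; [apply Cmod_le_abs|].
  change (Rabs (ln r) + Rabs (Arg (1 + u)%C) <= 6 * Cmod u). lra.
Qed.

(** Apply the second-order bound of the exponential at [w = Clog (1 + u)], where
    [exp w - 1 - w = u - w]. The factor 36 is the square of the 6 in [Clog_near_1], and [1 / 12]
    keeps [|w|] at most [1 / 2]. *)
Lemma Clog_near_1_sub (u : C) : Cmod u <= 1 / 12 ->
  Cmod (Clog (1 + u)%C - u)%C <= 36 * exp 1 * (Cmod u * Cmod u).
Proof.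
  intros hu.
  assert (T := Clog_near_1 u ltac:(lra)). set (w := Clog (1 + u)%C) in *.
  assert (hz : (1 + u)%C <> 0%C).
  { apply Cmod_gt_0. assert (R := Cmod_rev_triangle 1 (- u)). rewrite Cmod_1, Cmod_opp in R.
    replace (1 - - u)%C with (1 + u)%C in R by ring. lra. }
  assert (E := Cexp_Clog _ hz). fold w in E.
  assert (K := Cexp_sub_1_sub w). rewrite E in K.
  replace (1 + u - 1 - w)%C with (- (w - u))%C in K by ring. rewrite Cmod_opp in K.
  assert (hw0 := Cmod_ge_0 w).
  assert (exp (Cmod w) <= exp 1) by (apply exp_le; lra).
  assert (P := exp_pos 1).
  eapply Rle_trans; [exact K|].
  apply Rle_trans with (Cmod w * Cmod w * exp 1); [apply Rmult_le_compat_l; nra|].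
  replace (36 * exp 1 * (Cmod u * Cmod u)) with (6 * Cmod u * (6 * Cmod u) * exp 1) by ring.
  apply Rmult_le_compat_r; [lra|]. apply Rmult_le_compat; lra.
Qed.

Lemma cderiv_Clog (z : C) : slit z -> cderiv Clog z (/ z)%C.
Proof.
  intros hs eps he. assert (hz := slit_neq_0 z hs).
  assert (hm : 0 < Cmod z) by (apply Cmod_gt_0; exact hz).
  assert (hA := Arg_slit z hs).
  set (m := Cmod z) in *. set (b := PI - Rabs (Arg z)).
  set (M := 36 * exp 1). assert (hM : 0 < M) by (apply Rmult_lt_0_compat; [lra|apply exp_pos]).
  (* The bound [b / 12] makes [|Arg (1 + u)| < b / 2], so that [Arg z + Arg (1 + u)] does not cross
     the cut and the logarithm is additive; the last entry serves the error estimate. *)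
  exists (m * Rmin (1 / 12) (Rmin (b / 12) (eps * m / M))). split.
  { apply Rmult_lt_0_compat; [easy|]. repeat apply Rmin_pos; try lra.
    - unfold b. lra.
    - apply Rdiv_lt_0_compat; [apply Rmult_lt_0_compat; lra|easy]. }
  intros h hh. set (u := (h / z)%C).
  assert (hu : Cmod u = Cmod h / m) by (unfold u; rewrite Cmod_div; easy).
  assert (hu' : Cmod u < Rmin (1 / 12) (Rmin (b / 12) (eps * m / M))).
  { rewrite hu. apply Rmult_lt_reg_l with m; [easy|].
    replace (m * (Cmod h / m)) with (Cmod h) by (field; lra). easy. }
  apply Rmin_Rgt_l in hu'. destruct hu' as [k1 hu'].
  apply Rmin_Rgt_l in hu'. destruct hu' as [k2 k3].
  assert (hu0 := Cmod_ge_0 u).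
  assert (T := Clog_near_1 u ltac:(lra)).
  assert (T2 := Clog_near_1_sub u ltac:(lra)).
  assert (hz1 : (1 + u)%C <> 0%C).
  { apply Cmod_gt_0. assert (R := Cmod_rev_triangle 1 (- u)). rewrite Cmod_1, Cmod_opp in R.
    replace (1 - - u)%C with (1 + u)%C in R by ring. lra. }
  replace (z + h)%C with (z * (1 + u))%C by (unfold u; field; exact hz).
  rewrite Clog_mult; try easy.
  2:{ assert (I := im_le_Cmod (Clog (1 + u)%C)).
      change (Im (Clog (1 + u)%C)) with (Arg (1 + u)%C) in I.
      eapply Rle_lt_trans; [apply Rabs_triang|]. unfold b in k2. lra. }
  replace (Clog z + Clog (1 + u)%C - Clog z - / z * h)%C with (Clog (1 + u)%C - u)%C
    by (unfold u, Cdiv; ring).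
  eapply Rle_trans; [exact T2|]. fold M.
  apply Rmult_lt_compat_l with (r := M) in k3; [|easy].
  replace (M * (eps * m / M)) with (eps * m) in k3 by (field; lra).
  replace (Cmod h) with (m * Cmod u) by (rewrite hu; field; lra).
  assert (M * Cmod u * Cmod u <= eps * m * Cmod u) by (apply Rmult_le_compat_r; lra).
  lra.
Qed.

Lemma copen_slit : copen slit.
Proof.
  intros z hz. unfold slit in *. exists ((Cmod z + Re z) / 2). split; [lra|].
  intros h hh. assert (A := re_le_Cmod h). apply Rabs_le_between in A.
  assert (T := Cmod_rev_triangle z (- h)). rewrite Cmod_opp in T.
  replace (z - - h)%C with (z + h)%C in T by ring. unfold Re in *. simpl. lra.
Qed.

Lemma holo_Clog : holo slit Clog.
Proof.
  apply Holo_holo with Cinv; [apply copen_slit|]. intros z hz. split; [apply cderiv_Clog; easy|].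
  eapply cderiv_ccont, cderiv_inv_id, slit_neq_0; easy.
Qed.

Lemma Cpower_plus z u v : Cpower z (u + v) = (Cpower z u * Cpower z v)%C.
Proof. unfold Cpower. rewrite <- Cexp_plus. f_equal. ring. Qed.

Lemma Cpower_opp z w : Cpower z (- w) = (/ Cpower z w)%C.
Proof. unfold Cpower. rewrite <- Cexp_opp. f_equal. ring. Qed.

Lemma Cpower_0 z : Cpower z 0 = 1%C.
Proof. unfold Cpower. rewrite <- Cexp_0. f_equal. ring. Qed.

Lemma Cpower_1 (z : C) : z <> 0%C -> Cpower z 1 = z.
Proof. intros h. unfold Cpower. rewrite Cmult_1_l. apply Cexp_Clog; easy. Qed.

Lemma Cpower_minus_1 (z w : C) : z <> 0%C -> Cpower z (w - 1) = (Cpower z w / z)%C.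
Proof.
  intros h. unfold Cminus. rewrite Cpower_plus, Cpower_opp, Cpower_1; easy.
Qed.

Lemma Cpower_INR (z : C) n : z <> 0%C -> Cpower z (RtoC (INR n)) = (z ^ n)%C.
Proof.
  intros h. unfold Cpower. rewrite <- Cexp_pow, Cexp_Clog; easy.
Qed.

Lemma Cpower_RtoC (x r : R) : 0 < x -> Cpower x r = RtoC (Rpower x r).
Proof.
  intros h. unfold Cpower. rewrite Clog_RtoC, <- RtoC_mult, Cexp_RtoC by easy. easy.
Qed.

Lemma Cmod_Cpower z w : Cmod (Cpower z w)%C = exp (Re w * ln (Cmod z) - Im w * Arg z).
Proof. unfold Cpower. rewrite Cmod_Cexp. easy. Qed.

Lemma Cmod_Cpower_R z (r : R) : Cmod (Cpower z r)%C = Rpower (Cmod z) r.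
Proof. rewrite Cmod_Cpower. unfold Rpower. f_equal. simpl. ring. Qed.

Lemma cderiv_Cpower (z w : C) : slit z -> cderiv (fun u => Cpower u w) z (w * Cpower z (w - 1))%C.
Proof.
  intros h. assert (hz := slit_neq_0 z h).
  eapply cderiv_eq; [|apply (cderiv_comp Cexp (fun u => w * Clog u)%C z);
    [apply cderiv_scal, cderiv_Clog; easy|apply cderiv_Cexp]].
  rewrite Cpower_minus_1 by easy. unfold Cpower. field. exact hz.
Qed.

Lemma holo_Cpower w : holo slit (fun z => Cpower z w).
Proof.
  apply holo_Cexp; [apply copen_slit|].
  apply holo_scal; [apply copen_slit|apply holo_Clog].
Qed.

(** [n^2 + a^2] has imaginary part of the sign of [Im a], and [1 + (n/a)^2] of the opposite sign.
    With [|Arg a| < PI / 2] this confines the two candidate imaginary parts to within [2 * PI] of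
    each other, so the principal branches match. It is what lets [a^(- 2 mu)] be extracted from the
    summand. *)
Lemma Clog_sqr_plus (n : R) (a : C) : 0 < n -> 0 < Re a ->
  Clog (n * n + a * a)%C = (2 * Clog a + Clog (1 + (n / a) * (n / a))%C)%C.
Proof.
  intros hn ha.
  assert (ha0 : a <> 0%C) by (apply slit_neq_0, slit_Re; easy).
  assert (hA := cos_pos_Arg a ha0 ha). apply Rabs_lt_between in hA.
  assert (hm : 0 < Cmod a) by (apply Cmod_gt_0; exact ha0).
  set (x := (n * n + a * a)%C). set (y := (1 + n / a * (n / a))%C).
  assert (Exy : x = (a * a * y)%C) by (unfold x, y; field; exact ha0).
  assert (Ix : Im x = 2 * (Re a * Im a)) by (unfold x, Re, Im; simpl; ring).
  assert (Iy : Im y * (Cmod a * Cmod a * (Cmod a * Cmod a)) = - (n * n * (2 * (Re a * Im a)))).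
  { assert (E : (y * RtoC (Cmod a * Cmod a * (Cmod a * Cmod a)))%C =
      (RtoC (Cmod a * Cmod a * (Cmod a * Cmod a)) + RtoC (n * n) * (Cconj a * Cconj a))%C).
    { assert (Q : RtoC (Cmod a * Cmod a) = (a * Cconj a)%C).
      { replace (Cmod a * Cmod a) with (Cmod a ^ 2) by ring. apply Cmod2_conj. }
      rewrite (RtoC_mult (Cmod a * Cmod a)), Q. unfold y. rewrite RtoC_mult. field. exact ha0. }
    apply (f_equal Im) in E. unfold Re, Im in *. simpl in *. lra. }
  assert (P4 : 0 < Cmod a * Cmod a * (Cmod a * Cmod a)) by (repeat apply Rmult_lt_0_compat; easy).
  assert (Hn2 : 0 < n * n) by nra.
  assert (fin : x <> 0%C -> y <> 0%C -> Rabs (Arg x - (2 * Arg a + Arg y)) < 2 * PI ->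
    Clog x = (2 * Clog a + Clog y)%C).
  { intros hx hy hB. apply Cexp_inj.
    - replace (Im (Clog x) - Im (2 * Clog a + Clog y)) with (Arg x - (2 * Arg a + Arg y))
        by (unfold Re, Im; simpl; ring). easy.
    - replace (2 * Clog a + Clog y)%C with (Clog a + Clog a + Clog y)%C by ring.
      rewrite !Cexp_plus, !Cexp_Clog by easy. exact Exy. }
  destruct (Rtotal_order (Im a) 0) as [h|[h|h]].
  - assert (hx : Im x < 0) by (rewrite Ix; nra).
    assert (hy : 0 < Im y).
    { apply Rmult_lt_reg_r with (1 := P4). rewrite Iy. nra. }
    assert (B1 := Arg_Im_neg a h). assert (B2 := Arg_Im_neg x hx). assert (B3 := Arg_Im_pos y hy).
    apply fin; try (apply slit_neq_0, slit_Im; lra). apply Rabs_lt_between. lra.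
  - assert (Ha : a = RtoC (Re a)) by (destruct a as [p q]; simpl in *; subst; easy).
    set (p := Re a) in *.
    assert (hx : x = RtoC (n * n + p * p)).
    { unfold x. rewrite Ha, <- !RtoC_mult, <- RtoC_plus. easy. }
    assert (hy : y = RtoC (1 + n / p * (n / p))).
    { unfold y. rewrite Ha, <- RtoC_div by lra. rewrite <- RtoC_mult, <- RtoC_plus. easy. }
    assert (px : 0 < n * n + p * p) by nra.
    assert (py : 0 < 1 + n / p * (n / p)) by nra.
    apply fin.
    + rewrite hx. intros E. apply RtoC_inj in E. lra.
    + rewrite hy. intros E. apply RtoC_inj in E. lra.
    + rewrite hx, hy, Ha, !Arg_pos_real by easy.
      replace (0 - (2 * 0 + 0)) with 0 by ring. rewrite Rabs_R0. apply two_PI_pos.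
  - assert (hx : 0 < Im x) by (rewrite Ix; nra).
    assert (hy : Im y < 0).
    { apply Rmult_lt_reg_r with (1 := P4). rewrite Iy. nra. }
    assert (B1 := Arg_Im_pos a h). assert (B2 := Arg_Im_pos x hx). assert (B3 := Arg_Im_neg y hy).
    apply fin; try (apply slit_neq_0, slit_Im; lra). apply Rabs_lt_between. lra.
Qed.

Lemma slit_1_plus_sqr (z : C) : 0 < Re z -> slit (1 + z * z)%C.
Proof.
  intros h. destruct (Req_dec (Im z) 0) as [h0|h0].
  - apply slit_Re. unfold Re, Im in *. simpl. rewrite h0. nra.
  - apply slit_Im. unfold Re, Im in *. simpl. nra.
Qed.

(** * Improper integrals *)

Definition Clim (s : nat -> C) (l : C) : Prop :=
  forall eps, 0 < eps -> exists N, forall n, (N <= n)%nat -> Cmod (s n - l)%C <= eps.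

Lemma Clim_unique s l1 l2 : Clim s l1 -> Clim s l2 -> l1 = l2.
Proof.
  intros H1 H2. apply Cmod_small_eq. intros eps he.
  destruct (H1 (eps / 2)) as [N1 K1]; [lra|]. destruct (H2 (eps / 2)) as [N2 K2]; [lra|].
  specialize (K1 (max N1 N2) ltac:(lia)). specialize (K2 (max N1 N2) ltac:(lia)).
  rewrite Cmod_minus_sym in K1.
  eapply Rle_trans; [apply Cmod_split with (y := s (max N1 N2))|]. lra.
Qed.

Lemma Clim_plus s t a b : Clim s a -> Clim t b -> Clim (fun n => s n + t n)%C (a + b)%C.
Proof.
  intros H1 H2 eps he.
  destruct (H1 (eps / 2)) as [N1 K1]; [lra|]. destruct (H2 (eps / 2)) as [N2 K2]; [lra|].
  exists (max N1 N2). intros n hn. specialize (K1 n ltac:(lia)). specialize (K2 n ltac:(lia)).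
  replace (s n + t n - (a + b))%C with ((s n - a) + (t n - b))%C by ring.
  eapply Rle_trans; [apply Cmod_triangle|]. lra.
Qed.

Lemma Clim_scal c s a : Clim s a -> Clim (fun n => c * s n)%C (c * a)%C.
Proof.
  intros H eps he. assert (hc := Cmod_ge_0 c).
  destruct (H (eps / (1 + Cmod c))) as [N K]; [apply Rdiv_lt_0_compat; lra|].
  exists N. intros n hn. specialize (K n hn).
  replace (c * s n - c * a)%C with (c * (s n - a))%C by ring. rewrite Cmod_mult.
  apply Rle_trans with ((1 + Cmod c) * (eps / (1 + Cmod c))).
  - apply Rmult_le_compat; try apply Cmod_ge_0; lra.
  - apply Req_le. field. lra.
Qed.

Lemma Clim_ext s t l : (forall n, s n = t n) -> Clim s l -> Clim t l.
Proof.
  intros E H eps he. destruct (H eps he) as [N K]. exists N. intros n hn. rewrite <- E. auto.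
Qed.

Lemma Clim_const c : Clim (fun _ => c) c.
Proof.
  intros eps he. exists O. intros n _. replace (c - c)%C with (RtoC 0) by ring. rewrite Cmod_0. lra.
Qed.

Lemma Clim_opp s a : Clim s a -> Clim (fun n => - s n)%C (- a)%C.
Proof.
  intros H. replace (- a)%C with ((-1) * a)%C by ring.
  apply Clim_ext with (fun n => (-1) * s n)%C; [intros; ring|]. apply Clim_scal; easy.
Qed.

Lemma Clim_minus s t a b : Clim s a -> Clim t b -> Clim (fun n => s n - t n)%C (a - b)%C.
Proof. intros. apply Clim_plus; [easy|]. apply Clim_opp; easy. Qed.

Lemma Clim_le s l B : Clim s l -> (forall n, Cmod (s n)%C <= B) -> Cmod l <= B.
Proof.
  intros H HB. apply Rnot_lt_le. intros hlt.
  destruct (H ((Cmod l - B) / 2)) as [N K]; [lra|]. specialize (K N (Nat.le_refl N)).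
  specialize (HB N). assert (T := Cmod_rev_triangle l (s N)). rewrite Cmod_minus_sym in T. lra.
Qed.

Lemma Clim_Cauchy (s : nat -> C) :
  (forall eps, 0 < eps -> exists N, forall n m, (N <= n)%nat -> (N <= m)%nat -> Cmod (s n - s m)%C <= eps) ->
  exists l, Clim s l.
Proof.
  intros H.
  assert (A : forall g : C -> R, (forall x y, Rabs (g x - g y) <= Cmod (x - y)%C) ->
    exists l, Un_cv (fun n => g (s n)) l).
  { intros g Hg. assert (HC : Cauchy_crit (fun n => g (s n))).
    { intros eps he. destruct (H (eps / 2)) as [N K]; [lra|]. exists N. intros n m hn hm.
      eapply Rle_lt_trans; [apply Hg|]. specialize (K n m hn hm). lra. }
    destruct (Rcomplete.R_complete _ HC) as [l hl]. exists l. exact hl. }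
  destruct (A Re) as [x hx].
  { intros u v. change (Re u - Re v) with (Re (u - v)). apply re_le_Cmod. }
  destruct (A Im) as [y hy].
  { intros u v. change (Im u - Im v) with (Im (u - v)). apply im_le_Cmod. }
  exists (x, y). intros eps he.
  destruct (hx (eps / 2)) as [N1 K1]; [lra|]. destruct (hy (eps / 2)) as [N2 K2]; [lra|].
  exists (max N1 N2). intros n hn. specialize (K1 n ltac:(lia)). specialize (K2 n ltac:(lia)).
  unfold Rdist in *. eapply Rle_trans; [apply Cmod_le_abs|].
  change (Rabs (Re (s n) - x) + Rabs (Im (s n) - y) <= eps). lra.
Qed.

(** The two cut-offs tend to 0 and to infinity independently. Continuity is included so that [CI] is
    a true integral on every compact interval. *)
Definition IInt (f : R -> C) (l : C) : Prop :=
  (forall t, 0 < t -> rcont f t) /\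
  forall eps, 0 < eps -> exists r m, 0 < r /\ r < m /\
    forall a b, 0 < a < r -> m < b -> Cmod (CI f a b - l)%C <= eps.

Lemma IInt_CInt f l : IInt f l -> CInt_0_infty f = l.
Proof.
  intros [Hc H]. unfold CInt_0_infty.
  apply (is_RInt_gen_unique (V := C_R_CompleteNormedModule)).
  apply (filterlimi_locally (U := C_R_NormedModule)). intros eps.
  assert (he := cond_pos eps).
  destruct (H (eps / 2)) as [r [m [hr [hm K]]]]; [lra|].
  exists (fun a => 0 < a < r) (fun b => m < b).
  - exists (mkposreal r hr). intros y hy h0. split; [easy|].
    change (Rabs (y - 0) < r) in hy. rewrite Rminus_0_r, Rabs_pos_eq in hy; lra.
  - exists m. easy.
  - intros a b ha hb. exists (CI f a b). split.
    + apply is_CI_CI; [simpl; lra|]. intros t ht. apply Hc. simpl in ht. lra.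
    + apply C_NormedModule_mixin_compat1.
      eapply Rle_lt_trans; [apply (K a b ha hb)|]. lra.
Qed.

Lemma IInt_unique f l1 l2 : IInt f l1 -> IInt f l2 -> l1 = l2.
Proof. intros H1 H2. rewrite <- (IInt_CInt f l1 H1). apply IInt_CInt; easy. Qed.

Lemma IInt_ext f g l : (forall t, 0 < t -> f t = g t) -> IInt f l -> IInt g l.
Proof.
  intros E [Hc H]. split.
  - intros t ht eps he. destruct (Hc t ht eps he) as [d [hd Hd]].
    exists (Rmin d t). split; [apply Rmin_pos; easy|]. intros h hh.
    apply Rmin_Rgt_l in hh. destruct hh as [h1 h2]. apply Rabs_lt_between in h2.
    rewrite <- !E by lra. apply Hd; easy.
  - intros eps he. destruct (H eps he) as [r [m [hr [hm K]]]]. exists r, m.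
    repeat split; try easy. intros a b ha hb.
    rewrite <- (CI_ext f g); [apply K; easy|lra|]. intros t ht. apply E. lra.
Qed.

Lemma IInt_plus f g u v : IInt f u -> IInt g v -> IInt (fun t => f t + g t)%C (u + v)%C.
Proof.
  intros [Cf Hf] [Cg Hg]. split.
  - intros t ht. apply rcont_plus; auto.
  - intros eps he.
    destruct (Hf (eps / 2)) as [r1 [m1 [hr1 [hm1 K1]]]]; [lra|].
    destruct (Hg (eps / 2)) as [r2 [m2 [hr2 [hm2 K2]]]]; [lra|].
    exists (Rmin r1 r2), (Rmax m1 m2).
    assert (A := Rmin_l r1 r2). assert (B := Rmin_r r1 r2).
    assert (D := Rmax_l m1 m2). assert (E := Rmax_r m1 m2).
    split; [apply Rmin_pos; easy|]. split; [lra|]. intros a b ha hb.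
    assert (EI : CI (fun t => f t + g t)%C a b = (CI f a b + CI g a b)%C).
    { apply CI_unique, is_CI_plus; apply is_CI_CI; try lra; intros t ht;
        [apply Cf|apply Cg]; lra. }
    rewrite EI. replace (CI f a b + CI g a b - (u + v))%C with
      ((CI f a b - u) + (CI g a b - v))%C by ring.
    eapply Rle_trans; [apply Cmod_triangle|].
    specialize (K1 a b ltac:(lra) ltac:(lra)). specialize (K2 a b ltac:(lra) ltac:(lra)). lra.
Qed.

Lemma IInt_scal c f u : IInt f u -> IInt (fun t => c * f t)%C (c * u)%C.
Proof.
  intros [Cf Hf]. assert (hc := Cmod_ge_0 c). split.
  - intros t ht. apply rcont_mult; [apply rcont_const|auto].
  - intros eps he.
    destruct (Hf (eps / (1 + Cmod c))) as [r [m [hr [hm K]]]]; [apply Rdiv_lt_0_compat; lra|].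
    exists r, m. repeat split; try easy. intros a b ha hb.
    assert (EI : CI (fun t => c * f t)%C a b = (c * CI f a b)%C).
    { apply CI_unique, is_CI_scal, is_CI_CI; [lra|]. intros t ht. apply Cf; lra. }
    rewrite EI. replace (c * CI f a b - c * u)%C with (c * (CI f a b - u))%C by ring.
    rewrite Cmod_mult. specialize (K a b ha hb).
    apply Rle_trans with ((1 + Cmod c) * (eps / (1 + Cmod c))).
    + apply Rmult_le_compat; try apply Cmod_ge_0; lra.
    + apply Req_le. field. lra.
Qed.

Lemma IInt_minus f g u v : IInt f u -> IInt g v -> IInt (fun t => f t - g t)%C (u - v)%C.
Proof.
  intros Hf Hg. replace (u - v)%C with (u + (-1) * v)%C by ring.
  apply IInt_ext with (fun t => f t + (-1) * g t)%C; [intros; ring|].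
  apply IInt_plus; [easy|]. apply IInt_scal; easy.
Qed.

Lemma IInt_derive F f L0 L1 : (forall t, 0 < t -> rderiv F t (f t)) ->
  (forall t, 0 < t -> rcont f t) ->
  (forall eps, 0 < eps -> exists r, 0 < r /\ forall t, 0 < t < r -> Cmod (F t - L0)%C <= eps) ->
  (forall eps, 0 < eps -> exists m, forall t, m < t -> Cmod (F t - L1)%C <= eps) ->
  IInt f (L1 - L0)%C.
Proof.
  intros HF Hf H0 H1. split; [easy|]. intros eps he.
  destruct (H0 (eps / 2)) as [r [hr K0]]; [lra|]. destruct (H1 (eps / 2)) as [m K1]; [lra|].
  exists r, (Rmax m (r + 1)). assert (A := Rmax_l m (r + 1)). assert (B := Rmax_r m (r + 1)).
  split; [easy|]. split; [lra|]. intros a b ha hb.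
  rewrite (CI_unique f a b (F b - F a)).
  - replace (F b - F a - (L1 - L0))%C with ((F b - L1) - (F a - L0))%C by ring.
    eapply Rle_trans; [apply Cmod_minus_triangle|].
    specialize (K0 a ha). specialize (K1 b ltac:(lra)). lra.
  - apply is_CI_derive; [lra| |]; intros t ht; [apply HF|apply Hf]; lra.
Qed.

Lemma CI_dom f (phi dphi : R -> R) a b : a <= b ->
  (forall t, a <= t <= b -> rcont f t) ->
  (forall t, a <= t <= b -> is_derive phi t (dphi t)) ->
  (forall t, a <= t <= b -> ex_derive dphi t) ->
  (forall t, a <= t <= b -> Cmod (f t)%C <= dphi t) ->
  Cmod (CI f a b)%C <= phi b - phi a.
Proof.
  intros hab Hf Hp Hp' Hle. rewrite <- norm_C_R.
  apply (norm_RInt_le (V := C_R_NormedModule) f dphi a b); try easy.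
  - intros x hx. rewrite norm_C_R. apply Hle; easy.
  - apply is_CI_CI; easy.
  - apply (is_RInt_derive (V := R_CompleteNormedModule));
      intros x hx; rewrite Rmin_left, Rmax_right in hx by easy.
    + apply Hp; easy.
    + apply (ex_derive_continuous (V := R_NormedModule) dphi). apply Hp'; easy.
Qed.

Lemma is_derive_Rpower p t : 0 < t -> is_derive (fun t => Rpower t p) t (p * Rpower t (p - 1)).
Proof.
  intros ht. unfold Rpower. auto_derive; [easy|].
  replace (exp ((p - 1) * ln t)) with (exp (p * ln t) * / t).
  - ring.
  - replace ((p - 1) * ln t) with (p * ln t + - ln t) by ring.
    rewrite exp_plus, exp_Ropp, exp_ln by easy. easy.
Qed.

Lemma Rpower_pos x p : 0 < Rpower x p.
Proof. apply exp_pos. Qed.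

Lemma CI_dom_0 f B p a b : 0 < a <= b -> p > -1 -> (forall t, a <= t <= b -> rcont f t) ->
  (forall t, a <= t <= b -> Cmod (f t)%C <= B * Rpower t p) ->
  Cmod (CI f a b)%C <= B / (p + 1) * (Rpower b (p + 1) - Rpower a (p + 1)).
Proof.
  intros hab hp Hf HB.
  rewrite Rmult_minus_distr_l.
  apply (CI_dom f (fun t => B / (p + 1) * Rpower t (p + 1)) (fun t => B * Rpower t p)); [lra|exact Hf| | |exact HB].
  - intros t ht. assert (H := is_derive_Rpower (p + 1) t ltac:(lra)).
    apply (is_derive_scal _ _ (B / (p + 1))) in H.
    replace (B * Rpower t p) with (B / (p + 1) * ((p + 1) * Rpower t (p + 1 - 1))); [easy|].
    replace (p + 1 - 1) with p by ring. field. lra.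
  - intros t ht. eexists. apply is_derive_scal. apply is_derive_Rpower. lra.
Qed.

Lemma CI_dom_oo f B a b : 0 < a <= b -> (forall t, a <= t <= b -> rcont f t) ->
  (forall t, a <= t <= b -> Cmod (f t)%C <= B / (t * t)) ->
  Cmod (CI f a b)%C <= B * (/ a - / b).
Proof.
  intros hab Hf HB.
  replace (B * (/ a - / b)) with (- B * / b - - B * / a) by ring.
  apply (CI_dom f (fun t => - B * / t) (fun t => B / (t * t))); [lra|exact Hf| | |exact HB].
  - intros t ht. auto_derive; [lra|]. field. lra.
  - intros t ht. auto_derive. nra.
Qed.

Lemma is_CI_split f a b c : a <= b <= c -> (forall t, a <= t <= c -> rcont f t) ->
  CI f a c = (CI f a b + CI f b c)%C.
Proof.
  intros h H. apply CI_unique. eapply is_CI_Chasles; apply is_CI_CI; try lra;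
    intros t ht; apply H; lra.
Qed.

Lemma Rpower_small q eta : 0 < q -> 0 < eta -> exists r, 0 < r <= 1 /\ Rpower r q <= eta.
Proof.
  intros hq he. exists (Rmin 1 (Rpower eta (/ q))).
  split; [split; [apply Rmin_pos; [lra|apply Rpower_pos]|apply Rmin_l]|].
  apply Rle_trans with (Rpower (Rpower eta (/ q)) q).
  - apply Rle_Rpower_l; [lra|]. split; [apply Rmin_pos; [lra|apply Rpower_pos]|apply Rmin_r].
  - rewrite Rpower_mult, Rinv_l, Rpower_1 by lra. lra.
Qed.

(** The majorants [t^p] with [p > -1] near 0 and [1 / t^2] at infinity have explicit primitives,
    which give both the Cauchy criterion and the bound on the value. *)
Lemma IInt_dom f B p : 0 <= B -> p > -1 -> (forall t, 0 < t -> rcont f t) ->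
  (forall t, 0 < t <= 1 -> Cmod (f t)%C <= B * Rpower t p) ->
  (forall t, 1 <= t -> Cmod (f t)%C <= B / (t * t)) ->
  exists l, IInt f l /\ Cmod l <= B / (p + 1) + B.
Proof.
  intros hB hp Hc H0 H1.
  assert (hBp : 0 <= B / (p + 1)) by (apply Rdiv_le_0_compat; lra).
  assert (Tail : forall e m a a' b b', 0 < a <= e -> 0 < a' <= e -> e <= 1 -> 1 <= m ->
    m <= b -> m <= b' ->
    Cmod (CI f a b - CI f a' b')%C <= B / (p + 1) * Rpower e (p + 1) + B / m).
  { assert (Half : forall e m a a' b b', 0 < a <= a' -> a' <= e -> e <= 1 -> 1 <= m ->
      m <= b -> m <= b' ->
      Cmod (CI f a b - CI f a' b')%C <= B / (p + 1) * Rpower e (p + 1) + B / m).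
    { intros e m a a' b b' ha ha' he hm hb hb'.
      rewrite (is_CI_split f a a' b) by (lra || (intros; apply Hc; lra)).
      rewrite (is_CI_split f a' m b) by (lra || (intros; apply Hc; lra)).
      rewrite (is_CI_split f a' m b') by (lra || (intros; apply Hc; lra)).
      assert (Z1 : Cmod (CI f a a')%C <= B / (p + 1) * (Rpower a' (p + 1) - Rpower a (p + 1))).
      { apply CI_dom_0; try easy; intros t ht; [apply Hc|apply H0]; lra. }
      assert (P1 := Rpower_pos a (p + 1)).
      assert (P2 : Rpower a' (p + 1) <= Rpower e (p + 1)) by (apply Rle_Rpower_l; lra).
      assert (Z1' : Cmod (CI f a a')%C <= B / (p + 1) * Rpower e (p + 1)).
      { eapply Rle_trans; [exact Z1|]. apply Rmult_le_compat_l; lra. }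
      assert (W : Cmod (CI f m b - CI f m b')%C <= B / m).
      { assert (W' : forall b b', m <= b <= b' -> Cmod (CI f m b - CI f m b')%C <= B / m).
        { intros c c' hc.
          rewrite (is_CI_split f m c c') by (lra || (intros; apply Hc; lra)).
          replace (CI f m c - (CI f m c + CI f c c'))%C with (- CI f c c')%C by ring.
          rewrite Cmod_opp. eapply Rle_trans.
          - apply (CI_dom_oo f B c c'); [lra| |]; intros t ht; [apply Hc|apply H1]; lra.
          - apply Rmult_le_compat_l; [easy|].
            assert (/ c <= / m) by (apply Rinv_le_contravar; lra).
            assert (0 < / c') by (apply Rinv_0_lt_compat; lra). lra. }
        destruct (Rle_dec b b').
        - apply W'; lra.
        - rewrite Cmod_minus_sym. apply W'; lra. }
      replace (CI f a a' + (CI f a' m + CI f m b) - (CI f a' m + CI f m b'))%C with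
        (CI f a a' + (CI f m b - CI f m b'))%C by ring.
      eapply Rle_trans; [apply Cmod_triangle|]. lra. }
    intros e m a a' b b' ha ha' he hm hb hb'.
    destruct (Rle_dec a a').
    - apply Half; lra.
    - rewrite Cmod_minus_sym. apply Half; lra. }
  assert (Small : forall eps, 0 < eps -> exists e m, 0 < e <= 1 /\ 1 <= m /\
     B / (p + 1) * Rpower e (p + 1) + B / m <= eps).
  { intros eps he.
    destruct (Rpower_small (p + 1) (eps / (2 * (1 + B / (p + 1))))) as [e [h1 h2]]; [lra| |].
    { apply Rdiv_lt_0_compat; lra. }
    assert (hm : 0 < 2 * (1 + B) / eps) by (apply Rdiv_lt_0_compat; lra).
    exists e, (1 + 2 * (1 + B) / eps). repeat split; try lra.
    assert (B / (p + 1) * Rpower e (p + 1) <= eps / 2).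
    { apply Rle_trans with ((1 + B / (p + 1)) * (eps / (2 * (1 + B / (p + 1))))).
      - apply Rmult_le_compat; try lra. left; apply Rpower_pos.
      - apply Req_le. field. lra. }
    assert (B / (1 + 2 * (1 + B) / eps) <= eps / 2); [|lra].
    apply Rmult_le_reg_r with (1 + 2 * (1 + B) / eps); [lra|].
    replace (B / (1 + 2 * (1 + B) / eps) * (1 + 2 * (1 + B) / eps)) with B by (field; nra).
    replace (eps / 2 * (1 + 2 * (1 + B) / eps)) with (eps / 2 + (1 + B)) by (field; lra). lra. }
  assert (hseq : forall n, 0 < / (INR n + 1) <= 1).
  { intros n. assert (H := pos_INR n). split; [apply Rinv_0_lt_compat; lra|].
    rewrite <- Rinv_1. apply Rinv_le_contravar; lra. }
  (* A single sequence of symmetric cut-offs produces the limit; [Tail] then extends it to arbitrary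
     pairs of cut-offs. *)
  set (s := fun n => CI f (/ (INR n + 1)) (INR n + 1)).
  assert (Large : forall e m, 0 < e <= 1 -> 1 <= m -> exists N, forall n, (N <= n)%nat ->
    0 < / (INR n + 1) <= e /\ m <= INR n + 1).
  { intros e m he hm. destruct (archimed (Rmax (/ e) m)) as [A _].
    exists (Z.to_nat (up (Rmax (/ e) m))). intros n hn.
    assert (Rmax (/ e) m <= INR n).
    { apply Rle_trans with (INR (Z.to_nat (up (Rmax (/ e) m)))); [|apply le_INR; easy].
      rewrite INR_IZR_INZ, Z2Nat.id; [lra|]. apply le_IZR.
      assert (m <= Rmax (/ e) m) by apply Rmax_r. lra. }
    assert (/ e <= Rmax (/ e) m) by apply Rmax_l. assert (m <= Rmax (/ e) m) by apply Rmax_r.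
    split; [|lra]. split; [apply hseq|].
    rewrite <- (Rinv_inv e). apply Rinv_le_contravar; [apply Rinv_0_lt_compat|]; lra. }
  destruct (Clim_Cauchy s) as [l Hl].
  { intros eps he. destruct (Small eps he) as [e [m [h1 [h2 h3]]]].
    destruct (Large e m h1 h2) as [N HN]. exists N. intros n k hn hk.
    destruct (HN n hn), (HN k hk). eapply Rle_trans; [apply (Tail e m)|exact h3]; lra. }
  exists l. split.
  - split; [easy|]. intros eps he. destruct (Small (eps / 2)) as [e [m [h1 [h2 h3]]]]; [lra|].
    destruct (Large e m h1 h2) as [N HN]. destruct (Hl (eps / 2)) as [N' HN']; [lra|].
    exists e, (m + 1). split; [lra|]. split; [lra|]. intros a b ha hb.
    specialize (HN (max N N') ltac:(lia)). specialize (HN' (max N N') ltac:(lia)).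
    eapply Rle_trans; [apply Cmod_split with (y := s (max N N'))|].
    assert (Cmod (CI f a b - s (max N N'))%C <= eps / 2); [|lra].
    eapply Rle_trans; [apply (Tail e m)|exact h3]; lra.
  - apply (Clim_le s); [easy|]. intros n. unfold s.
    destruct (hseq n) as [q1 q2]. assert (pn := pos_INR n).
    rewrite (is_CI_split f _ 1) by (lra || (intros; apply Hc; lra)).
    eapply Rle_trans; [apply Cmod_triangle|]. apply Rplus_le_compat.
    + eapply Rle_trans.
      * apply (CI_dom_0 f B p); try easy; intros t ht; [apply Hc|apply H0]; lra.
      * rewrite <- (Rmult_1_r (B / (p + 1))) at 2. apply Rmult_le_compat_l; [easy|].
        unfold Rpower at 1. rewrite ln_1, Rmult_0_r, exp_0.
        assert (P := Rpower_pos (/ (INR n + 1)) (p + 1)). lra.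
    + eapply Rle_trans.
      * apply (CI_dom_oo f B); [lra| |]; intros t ht; [apply Hc|apply H1]; lra.
      * rewrite <- (Rmult_1_r B) at 2. apply Rmult_le_compat_l; [easy|].
        rewrite Rinv_1. lra.
Qed.

Lemma IInt_bound f B p l : 0 <= B -> p > -1 -> IInt f l ->
  (forall t, 0 < t <= 1 -> Cmod (f t)%C <= B * Rpower t p) ->
  (forall t, 1 <= t -> Cmod (f t)%C <= B / (t * t)) ->
  Cmod l <= B / (p + 1) + B.
Proof.
  intros hB hp H H0 H1. destruct (IInt_dom f B p hB hp (proj1 H) H0 H1) as [l' [A E]].
  rewrite (IInt_unique f l l'); easy.
Qed.

(** * Bessel functions as Laplace integrals *)

Lemma monotone_of_deriv (u du : R -> R) a b : a <= b ->
  (forall t, a <= t <= b -> is_derive u t (du t)) ->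
  (forall t, a <= t <= b -> 0 <= du t) -> u a <= u b.
Proof.
  intros hab Hu Hdu. destruct (MVT_gen u a b du) as [c [hc E]].
  - intros x hx. rewrite Rmin_left, Rmax_right in hx by lra. apply Hu; lra.
  - intros x hx. rewrite Rmin_left, Rmax_right in hx by lra.
    apply derivable_continuous_pt. exists (du x). apply is_derive_Reals. apply Hu; lra.
  - rewrite Rmin_left, Rmax_right in hc by lra. specialize (Hdu c hc). nra.
Qed.

Lemma pow_le_fact_exp n u : 0 <= u -> u ^ n <= INR (fact n) * exp u.
Proof.
  revert u. induction n as [|n IH]; intros u hu.
  - simpl. assert (H := exp_ge_1 u hu). lra.
  - rewrite fact_simpl, mult_INR.
    assert (F := INR_fact_lt_0 n). assert (G := pos_INR (S n)).
    set (A := INR (S n)) in *. set (Q := INR (fact n)) in *.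
    assert (H : A * Q * exp 0 - 0 ^ S n <= A * Q * exp u - u ^ S n).
    { apply (monotone_of_deriv (fun u => A * Q * exp u - u ^ S n) (fun u => A * (Q * exp u - u ^ n)) 0 u hu).
      - intros t ht. apply (is_derive_ext (fun u => A * Q * exp u - u ^ S n)); [easy|].
        apply is_derive_Reals.
        replace (A * (Q * exp t - t ^ n)) with (A * Q * exp t - A * t ^ n) by ring.
        apply derivable_pt_lim_minus.
        + apply derivable_pt_lim_scal, derivable_pt_lim_exp.
        + apply derivable_pt_lim_pow.
      - intros t ht. specialize (IH t ltac:(lra)). apply Rmult_le_pos; lra. }
    rewrite exp_0, pow_i in H by lia. nra.
Qed.

Lemma exp_neg_le n u : 0 < u -> exp (- u) <= INR (fact n) / u ^ n.
Proof.
  intros hu. assert (H := pow_le_fact_exp n u (Rlt_le _ _ hu)).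
  assert (P := exp_pos u). assert (Q : 0 < u ^ n) by (apply pow_lt; easy).
  rewrite exp_Ropp. apply Rmult_le_reg_r with (exp u * u ^ n); [apply Rmult_lt_0_compat; easy|].
  replace (/ exp u * (exp u * u ^ n)) with (u ^ n) by (field; lra).
  replace (INR (fact n) / u ^ n * (exp u * u ^ n)) with (INR (fact n) * exp u) by (field; lra). easy.
Qed.

Lemma rderiv_plus f g t a b : rderiv f t a -> rderiv g t b ->
  rderiv (fun s => f s + g s)%C t (a + b)%C.
Proof.
  intros Hf Hg eps he.
  destruct (Hf (eps / 2)) as [d1 [h1 H1]]; [lra|].
  destruct (Hg (eps / 2)) as [d2 [h2 H2]]; [lra|].
  exists (Rmin d1 d2). split; [apply Rmin_pos; easy|]. intros h hh.
  specialize (H1 h (Rlt_le_trans _ _ _ hh (Rmin_l _ _))).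
  specialize (H2 h (Rlt_le_trans _ _ _ hh (Rmin_r _ _))).
  replace (f (t + h)%R + g (t + h)%R - (f t + g t) - (a + b) * h)%C
    with ((f (t + h)%R - f t - a * h) + (g (t + h)%R - g t - b * h))%C by ring.
  eapply Rle_trans; [apply Cmod_triangle|]. lra.
Qed.

Lemma rderiv_scal c f t a : rderiv f t a -> rderiv (fun s => c * f s)%C t (c * a)%C.
Proof.
  intros H. apply (rderiv_comp (fun u => c * u)%C f t a c H).
  eapply cderiv_eq; [|apply cderiv_scal, cderiv_id]. ring.
Qed.

(* Polarization: [4 f g = (f + g)^2 - (f - g)^2]. *)
Lemma rderiv_mult f g t a b : rderiv f t a -> rderiv g t b ->
  rderiv (fun s => f s * g s)%C t (a * g t + f t * b)%C.
Proof.
  intros Hf Hg.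
  assert (Q : forall f a, rderiv f t a -> rderiv (fun s => f s * f s)%C t (2 * f t * a)%C).
  { intros u c H. eapply rderiv_eq; [|apply (rderiv_comp (fun u => u * u)%C u t c (2 * u t)%C H)]; [reflexivity|].
    eapply cderiv_eq; [|exact (cderiv_mult _ _ _ _ _ (cderiv_id (u t)) (cderiv_id (u t)))]. cbv beta. ring. }
  assert (H1 := Q _ _ (rderiv_plus _ _ _ _ _ Hf Hg)).
  assert (H2 := Q _ _ (rderiv_plus _ _ _ _ _ Hf (rderiv_scal (-1)%C _ _ _ Hg))).
  assert (H3 := rderiv_scal (/ 4)%C _ _ _ (rderiv_plus _ _ _ _ _ H1 (rderiv_scal (-1)%C _ _ _ H2))).
  eapply rderiv_eq; [|eapply rderiv_ext; [|exact H3]]; [|intros s]; cbv beta; field.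
Qed.

Lemma rderiv_RtoC_comp (f : R -> R) (t a : R) : is_derive f t a -> rderiv (fun t => RtoC (f t)) t (RtoC a).
Proof.
  intros H. apply (is_derive_rderiv (fun t => RtoC (f t)) t a 0).
  - exact H.
  - apply is_derive_Reals. exact (derivable_pt_lim_const 0 t).
Qed.

(** What [cosh] and [exp] have in common: [c >= 1] lets powers of [c] be compared, and [t^2 <= 4 c]
    supplies the [1 / t^2] needed at infinity. *)
Definition good_phase (c : R -> R) : Prop :=
  forall t, rcont (fun t => RtoC (c t)) t /\ (0 < t -> 1 <= c t /\ t * t <= 4 * c t).

Definition lapf (c : R -> R) (m : nat) (z : C) (t : R) : C := (Cexp (- z * c t)%C * RtoC (c t) ^ m)%C.

(** For [c = cosh] these integrals are Bessel functions. For [c = exp] the substitution [u = exp t]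
    shows that [Lap exp 0 y] is the exponential integral [E_1(y)]. *)
Definition Lap (c : R -> R) (m : nat) (z : C) : C := CInt_0_infty (lapf c m z).

Lemma rcont_Cexp p t : rcont p t -> rcont (fun t => Cexp (p t)%C) t.
Proof. intros H. apply (rcont_comp Cexp p); [easy|]. eapply cderiv_ccont, cderiv_Cexp. Qed.

Lemma rcont_lapf c m z t : good_phase c -> rcont (lapf c m z) t.
Proof.
  intros H. apply rcont_mult.
  - apply (rcont_Cexp (fun t => - z * c t)%C). apply rcont_mult; [apply rcont_const|apply H].
  - apply (rcont_pow (fun t => RtoC (c t))). apply H.
Qed.

Lemma Cmod_lapf c m z t : good_phase c -> 0 < t ->
  Cmod (lapf c m z t)%C = exp (- (Re z * c t)) * c t ^ m.
Proof.
  intros H ht. destruct (proj2 (H t) ht) as [h1 _].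
  unfold lapf. rewrite Cmod_mult, Cmod_Cexp, Cmod_pow, Cmod_R, Rabs_pos_eq by lra.
  f_equal. f_equal. unfold Re. simpl. ring.
Qed.

(** [exp (- u) <= n! / u^n] at [u = x c(t)] leaves at least one spare factor [1 / c(t)], because
    [m < n]; it is at most 1 and also at most [4 / t^2]. *)
Lemma phase_bound c m n x t : good_phase c -> 0 < t -> 0 < x -> (m < n)%nat ->
  exp (- (x * c t)) * c t ^ m <= INR (fact n) / x ^ n /\
  exp (- (x * c t)) * c t ^ m <= 4 * INR (fact n) / x ^ n / (t * t).
Proof.
  intros H ht hx hn. destruct (proj2 (H t) ht) as [h1 h2].
  assert (hu : 0 < x * c t) by nra.
  assert (E := exp_neg_le n (x * c t) hu).
  assert (hxn : 0 < x ^ n) by (apply pow_lt; easy).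
  assert (hf := INR_fact_lt_0 n).
  assert (A : exp (- (x * c t)) * c t ^ m <= INR (fact n) / x ^ n * / c t).
  { rewrite Rpow_mult_distr in E.
    assert (hcm : 0 < c t ^ m) by (apply pow_lt; lra).
    assert (hcn : 0 < c t ^ n) by (apply pow_lt; lra).
    apply Rmult_le_compat_r with (r := c t ^ m) in E; [|lra].
    eapply Rle_trans; [exact E|].
    replace (INR (fact n) / (x ^ n * c t ^ n) * c t ^ m) with (INR (fact n) / x ^ n * (c t ^ m / c t ^ n))
      by (field; lra).
    apply Rmult_le_compat_l; [left; apply Rdiv_lt_0_compat; lra|].
    apply Rmult_le_reg_r with (c t ^ n * c t); [apply Rmult_lt_0_compat; lra|].
    replace (c t ^ m / c t ^ n * (c t ^ n * c t)) with (c t ^ S m) by (simpl; field; lra).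
    replace (/ c t * (c t ^ n * c t)) with (c t ^ n) by (field; lra).
    apply Rle_pow; [lra|lia]. }
  assert (hq : 0 < INR (fact n) / x ^ n) by (apply Rdiv_lt_0_compat; lra).
  split; (eapply Rle_trans; [exact A|]).
  - rewrite <- (Rmult_1_r (INR (fact n) / x ^ n)) at 2. apply Rmult_le_compat_l; [lra|].
    rewrite <- Rinv_1. apply Rinv_le_contravar; lra.
  - replace (4 * INR (fact n) / x ^ n / (t * t)) with (INR (fact n) / x ^ n * (4 / (t * t)))
      by (field; split; nra).
    apply Rmult_le_compat_l; [lra|].
    apply Rmult_le_reg_r with (c t * (t * t)); [apply Rmult_lt_0_compat; nra|].
    replace (/ c t * (c t * (t * t))) with (t * t) by (field; lra).
    replace (4 / (t * t) * (c t * (t * t))) with (4 * c t) by (field; lra). easy.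
Qed.

Lemma IInt_phase_dom c f m n x A : good_phase c -> 0 < x -> (m < n)%nat -> 0 <= A ->
  (forall t, 0 < t -> rcont f t) ->
  (forall t, 0 < t -> Cmod (f t)%C <= A * (exp (- (x * c t)) * c t ^ m)) ->
  exists l, IInt f l /\ Cmod l <= A * (8 * INR (fact n) / x ^ n).
Proof.
  intros H hx hn hA Hc Hf.
  assert (hq : 0 < INR (fact n) / x ^ n).
  { apply Rdiv_lt_0_compat; [apply INR_fact_lt_0|apply pow_lt; easy]. }
  destruct (IInt_dom f (A * (4 * INR (fact n) / x ^ n)) 0) as [l [h1 h2]]; try lra; try easy.
  - apply Rmult_le_pos; [easy|]. unfold Rdiv in *. lra.
  - intros t ht. rewrite Rpower_O, Rmult_1_r by lra. eapply Rle_trans; [apply Hf; lra|].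
    apply Rmult_le_compat_l; [easy|].
    destruct (phase_bound c m n x t H ltac:(lra) hx hn) as [B _]. unfold Rdiv in *. lra.
  - intros t ht. eapply Rle_trans; [apply Hf; lra|].
    unfold Rdiv. rewrite Rmult_assoc. apply Rmult_le_compat_l; [easy|].
    destruct (phase_bound c m n x t H ltac:(lra) hx hn) as [_ B]. exact B.
  - exists l. split; [easy|]. eapply Rle_trans; [exact h2|]. apply Req_le. field.
    apply pow_nonzero; lra.
Qed.

Lemma Lap_IInt c m z : good_phase c -> 0 < Re z -> IInt (lapf c m z) (Lap c m z).
Proof.
  intros H hz. destruct (IInt_phase_dom c (lapf c m z) m (S m) (Re z) 1) as [l [h _]];
    try easy; try lra; try lia.
  - intros t _. apply rcont_lapf; easy.
  - intros t ht. rewrite Cmod_lapf by easy. lra.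
  - unfold Lap. rewrite (IInt_CInt _ _ h). easy.
Qed.

Lemma Lap_bound c m n z : good_phase c -> 0 < Re z -> (m < n)%nat ->
  Cmod (Lap c m z)%C <= 8 * INR (fact n) / Re z ^ n.
Proof.
  intros H hz hn. destruct (IInt_phase_dom c (lapf c m z) m n (Re z) 1) as [l [h b]];
    try easy; try lra; try lia.
  - intros t _. apply rcont_lapf; easy.
  - intros t ht. rewrite Cmod_lapf by easy. lra.
  - rewrite (IInt_unique _ _ _ (Lap_IInt c m z H hz) h). lra.
Qed.

(** The remainder of the integrand is [lapf] times [exp (- h c) - 1 + h c], which is quadratic in
    [h]. Half of the decay rate [Re z] absorbs [exp (|h| c)], and two more powers of [c] appear,
    whence the order [m + 3] in the bound. *)
Lemma cderiv_Lap c m z : good_phase c -> 0 < Re z -> cderiv (Lap c m) z (- Lap c (S m) z)%C.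
Proof.
  intros H hz eps he. set (x := Re z) in *. set (n := S (S (S m))).
  set (M := 8 * INR (fact n) / (x / 2) ^ n).
  assert (hM : 0 < M).
  { apply Rdiv_lt_0_compat; [|apply pow_lt; lra]. assert (h := INR_fact_lt_0 n). lra. }
  exists (Rmin (x / 2) (eps / M)). split.
  { apply Rmin_pos; [lra|]. apply Rdiv_lt_0_compat; lra. }
  intros h hh. apply Rmin_Rgt_l in hh. destruct hh as [k1 k2].
  assert (hh0 := Cmod_ge_0 h).
  assert (hzh : 0 < Re (z + h)).
  { assert (T := re_le_Cmod h). apply Rabs_le_between in T.
    change (Re (z + h)) with (Re z + Re h). fold x. lra. }
  assert (I : IInt (fun t => lapf c m (z + h) t - lapf c m z t + h * lapf c (S m) z t)%C
    (Lap c m (z + h) - Lap c m z + h * Lap c (S m) z)%C).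
  { apply IInt_plus; [apply IInt_minus|apply IInt_scal]; apply Lap_IInt; easy. }
  destruct (IInt_phase_dom c (fun t => lapf c m (z + h) t - lapf c m z t + h * lapf c (S m) z t)%C
     (S (S m)) n (x / 2) (Cmod h * Cmod h)) as [l [hl b]]; try easy; try lra; try (unfold n; lia).

  - nra.
  - apply I.
  - intros t ht. destruct (proj2 (H t) ht) as [h1 _].
    assert (E : (lapf c m (z + h) t - lapf c m z t + h * lapf c (S m) z t)%C =
      (lapf c m z t * (Cexp (- h * c t)%C - 1 - (- h * c t)))%C).
    { unfold lapf. replace (- (z + h) * c t)%C with (- z * c t + - h * c t)%C by ring.
      rewrite Cexp_plus. simpl. ring. }
    rewrite E, Cmod_mult, Cmod_lapf by easy. fold x.
    assert (T := Cexp_sub_1_sub (- h * c t)).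
    rewrite Cmod_mult, Cmod_opp, Cmod_R, (Rabs_pos_eq (c t)) in T by lra.
    assert (exp (Cmod h * c t) <= exp (x / 2 * c t)).
    { apply exp_le. apply Rmult_le_compat_r; lra. }
    assert (P : 0 <= exp (- (x * c t)) * c t ^ m).
    { apply Rmult_le_pos; [left; apply exp_pos|apply pow_le; lra]. }
    eapply Rle_trans; [apply Rmult_le_compat_l; [exact P|exact T]|].
    apply Rle_trans with (exp (- (x * c t)) * c t ^ m *
      (Cmod h * c t * (Cmod h * c t) * exp (x / 2 * c t))).
    { apply Rmult_le_compat_l; [easy|]. apply Rmult_le_compat_l; [|easy]. nra. }
    apply Req_le. replace (- (x * c t)) with (- (x / 2 * c t) + - (x / 2 * c t)) by field.
    rewrite exp_plus. simpl.
    assert (X : exp (- (x / 2 * c t)) * exp (x / 2 * c t) = 1).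
    { rewrite <- exp_plus. replace (- (x / 2 * c t) + x / 2 * c t) with 0 by ring. apply exp_0. }
    transitivity (exp (- (x / 2 * c t)) * c t ^ m * (Cmod h * c t * (Cmod h * c t))
      * (exp (- (x / 2 * c t)) * exp (x / 2 * c t))); [ring|]. rewrite X. ring.
  -
    replace (Lap c m (z + h) - Lap c m z - - Lap c (S m) z * h)%C with l.
    2:{ rewrite <- (IInt_unique _ _ _ I hl). ring. }
    fold M in b. eapply Rle_trans; [exact b|].
    apply Rmult_lt_compat_r with (r := M) in k2; [|easy].
    replace (eps / M * M) with eps in k2 by (field; lra).
    assert (Cmod h * (Cmod h * M) <= Cmod h * eps) by (apply Rmult_le_compat_l; lra). lra.
Qed.

Definition rhp (z : C) : Prop := 0 < Re z.

Lemma copen_rhp : copen rhp.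
Proof.
  intros z hz. unfold rhp in *. exists (Re z). split; [easy|]. intros h hh.
  assert (T := re_le_Cmod h). apply Rabs_le_between in T.
  change (0 < Re z + Re h). lra.
Qed.

Lemma holo_Lap c m : good_phase c -> holo rhp (Lap c m).
Proof.
  intros H. apply Holo_holo with (fun z => - Lap c (S m) z)%C; [apply copen_rhp|].
  intros z hz. split; [apply cderiv_Lap; easy|].
  eapply cderiv_ccont, cderiv_opp, cderiv_Lap; easy.
Qed.

Lemma cosh_ge_1 t : 1 <= cosh t.
Proof.
  unfold cosh. assert (H := exp_ineq1_le t). assert (H' := exp_ineq1_le (- t)). lra.
Qed.

Lemma cosh_ge_half_exp t : exp t <= 2 * cosh t.
Proof. unfold cosh. assert (H := exp_pos (- t)). lra. Qed.

Lemma is_derive_cosh t : is_derive cosh t (sinh t).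
Proof. apply is_derive_Reals, derivable_pt_lim_cosh. Qed.

Lemma is_derive_sinh t : is_derive sinh t (cosh t).
Proof. apply is_derive_Reals, derivable_pt_lim_sinh. Qed.

Lemma cosh_good : good_phase cosh.
Proof.
  intros t. split.
  - eapply rderiv_rcont, rderiv_RtoC_comp, is_derive_cosh.
  - intros ht. split; [apply cosh_ge_1|].
    assert (H := pow_le_fact_exp 2 t (Rlt_le _ _ ht)). simpl in H.
    assert (H' := cosh_ge_half_exp t). lra.
Qed.

Lemma exp_good : good_phase exp.
Proof.
  intros t. split.
  - eapply rderiv_rcont, rderiv_RtoC_comp, is_derive_exp.
  - intros ht. split; [apply exp_ge_1; lra|].
    assert (H := pow_le_fact_exp 2 t (Rlt_le _ _ ht)). simpl in H. assert (P := exp_pos t). lra.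
Qed.

(** [BK 0] and [BK 1] are [K_0] and [K_1]. Since powers of [cosh t] are integrated, [BK 2] is
    [(K_0 + K_2) / 2]. *)
Definition BK (m : nat) (z : C) : C := Lap cosh m z.

Lemma BesselK1_BK z : 0 < Re z -> BesselK1 z = BK 1 z.
Proof.
  intros hz. apply IInt_CInt.
  apply IInt_ext with (lapf cosh 1 z).
  - intros t _. unfold lapf. ring.
  - apply Lap_IInt; [apply cosh_good|easy].
Qed.

Lemma cosh_sqr t : cosh t * cosh t = 1 + sinh t * sinh t.
Proof.
  unfold cosh, sinh. assert (E : exp t * exp (- t) = 1).
  { rewrite <- exp_plus, Rplus_opp_r. apply exp_0. }
  nra.
Qed.

Lemma sinh_le_cosh t : 0 <= t -> 0 <= sinh t <= cosh t.
Proof.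
  intros ht. unfold sinh, cosh. assert (H := exp_pos (- t)).
  assert (exp (- t) <= exp t) by (apply exp_le; lra). lra.
Qed.

(** Integration by parts: [exp (- z cosh t) sinh t] vanishes at both ends, and [sinh^2 = cosh^2 - 1]
    turns its derivative into the three integrands. The relation becomes [(z K1)' = - z K0] in
    [cderiv_zBK1]. *)
Lemma BK_rec z : 0 < Re z -> BK 1 z = (z * (BK 2 z - BK 0 z))%C.
Proof.
  intros hz.
  assert (I1 : IInt (fun t => lapf cosh 1 z t - z * (lapf cosh 2 z t - lapf cosh 0 z t))%C
    (BK 1 z - z * (BK 2 z - BK 0 z))%C).
  { assert (L := fun m => Lap_IInt cosh m z cosh_good hz).
    apply IInt_minus; [apply L|]. apply IInt_scal, IInt_minus; apply L. }
  assert (I2 : IInt (fun t => lapf cosh 1 z t - z * (lapf cosh 2 z t - lapf cosh 0 z t))%C (0 - 0)%C).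
  { apply IInt_derive with (F := fun t => (Cexp (- z * cosh t)%C * RtoC (sinh t))%C).
    - intros t ht.
      assert (D1 : rderiv (fun t => Cexp (- z * cosh t)%C) t (Cexp (- z * cosh t)%C * (- z * sinh t))%C).
      { apply (rderiv_comp Cexp (fun t => - z * cosh t)%C); [|apply cderiv_Cexp].
        eapply rderiv_eq; [|apply (rderiv_comp (fun u => - z * u)%C (fun t => RtoC (cosh t)) t (sinh t) (- z * 1)%C)].
        - ring.
        - apply rderiv_RtoC_comp, is_derive_cosh.
        - apply cderiv_scal, cderiv_id. }
      assert (D2 := rderiv_RtoC_comp _ _ _ (is_derive_sinh t)).
      eapply rderiv_eq; [|apply (rderiv_mult _ _ _ _ _ D1 D2)].
      unfold lapf. simpl.
      replace (RtoC (cosh t) * (RtoC (cosh t) * 1))%C with (1 + RtoC (sinh t) * RtoC (sinh t))%C.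
      2:{ rewrite <- RtoC_mult, <- RtoC_plus, <- cosh_sqr, RtoC_mult. ring. }
      ring.
    - intros t ht. apply I1; easy.
    - intros eps he.
      assert (Cn := rderiv_rcont _ _ _ (rderiv_RtoC_comp _ _ _ (is_derive_sinh 0)) eps he).
      destruct Cn as [d [hd Hd]]. exists d. split; [easy|]. intros t ht.
      specialize (Hd t ltac:(rewrite Rabs_pos_eq; lra)).
      rewrite Rplus_0_l, sinh_0 in Hd.
      replace (Cexp (- z * cosh t)%C * sinh t - 0)%C with (Cexp (- z * cosh t)%C * (sinh t - 0))%C by ring.
      rewrite Cmod_mult, Cmod_Cexp.
      replace (Re (- z * cosh t)) with (- (Re z * cosh t)) by (unfold Re; simpl; ring).
      assert (exp (- (Re z * cosh t)) <= 1).
      { rewrite <- exp_0. apply exp_le. assert (T := cosh_ge_1 t). nra. }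
      assert (P := exp_pos (- (Re z * cosh t))). nra.
    - intros eps he. set (B := 4 * INR (fact 2) / Re z ^ 2).
      assert (hB : 0 < B).
      { apply Rdiv_lt_0_compat; [simpl; lra|apply pow_lt; easy]. }
      exists (1 + B / eps). intros t ht.
      assert (hBe : 0 < B / eps) by (apply Rdiv_lt_0_compat; lra).
      replace (Cexp (- z * cosh t)%C * sinh t - 0)%C with (Cexp (- z * cosh t)%C * sinh t)%C by ring.
      rewrite Cmod_mult, Cmod_Cexp, Cmod_R.
      replace (Re (- z * cosh t)) with (- (Re z * cosh t)) by (unfold Re; simpl; ring).
      assert (S := sinh_le_cosh t ltac:(lra)). rewrite Rabs_pos_eq by lra.
      destruct (phase_bound cosh 1 2 (Re z) t cosh_good ltac:(lra) hz ltac:(lia)) as [_ Q].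
      fold B in Q. rewrite pow_1 in Q.
      apply Rle_trans with (exp (- (Re z * cosh t)) * cosh t).
      { apply Rmult_le_compat_l; [left; apply exp_pos|lra]. }
      eapply Rle_trans; [exact Q|].
      apply Rmult_le_reg_r with (t * t); [nra|].
      replace (B / (t * t) * (t * t)) with B by (field; nra).
      assert (eps * (B / eps) = B) by (field; lra).
      assert (B <= eps * t) by nra. nra. }
  assert (E := IInt_unique _ _ _ I1 I2).
  apply Ceq_minus. rewrite E. ring.
Qed.

Lemma cderiv_BK0 z : 0 < Re z -> cderiv (BK 0) z (- BK 1 z)%C.
Proof. intros h. apply cderiv_Lap; [apply cosh_good|easy]. Qed.

Lemma cderiv_zBK1 z : 0 < Re z -> cderiv (fun z => z * BK 1 z)%C z (- (z * BK 0 z))%C.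
Proof.
  intros h. eapply cderiv_eq; [|apply (cderiv_mult _ _ _ _ _ (cderiv_id z) (cderiv_Lap cosh 1 z cosh_good h))].
  change (Lap cosh 1 z) with (BK 1 z). rewrite (BK_rec z h). unfold BK. ring.
Qed.

(** * Euler's constant *)

Fixpoint Rsum (u : nat -> R) (n : nat) : R :=
  match n with O => 0 | S m => Rsum u m + u m end.

Lemma Rsum_sum_n_m u n : sum_n_m (G := R_AbelianMonoid) u 1 n = Rsum (fun k => u (S k)) n.
Proof.
  induction n as [|n IH].
  - rewrite sum_n_m_zero by lia. easy.
  - rewrite sum_n_Sm by lia. rewrite IH. easy.
Qed.

Lemma pow_le_1 x n : 0 <= x <= 1 -> x ^ n <= 1.
Proof. intros h. assert (H := pow_incr x 1 n h). rewrite pow1 in H. easy. Qed.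

Lemma Bernoulli_minus a n : 0 <= a <= 1 -> 1 - INR n * a <= (1 - a) ^ n.
Proof.
  intros ha. induction n as [|n IH]; [simpl; lra|].
  rewrite S_INR. simpl.
  assert (P : 0 <= (1 - a) ^ n <= 1).
  { split; [apply pow_le; lra|]. apply pow_le_1. lra. }
  assert (a * (1 - a) ^ n <= a * 1) by (apply Rmult_le_compat_l; lra).
  set (p := (1 - a) ^ n) in *. lra.
Qed.

Definition hsum (n : nat) : R := Rsum (fun k => / INR (S k)) n.

(** The primitive of [(1 - (1 - y/n)^n) / y] that vanishes at [y = n]; at [y = 0] it equals minus
    the harmonic number. As [(1 - y/n)^n] approaches [exp (- y)], it is compared with
    [E_1(y) + ln y]. *)
Definition hpoly (n : nat) (y : R) : R := - Rsum (fun k => (1 - y / INR n) ^ S k / INR (S k)) n.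

Lemma is_derive_Rsum (u d : nat -> R -> R) n y : (forall k, is_derive (u k) y (d k y)) ->
  is_derive (fun y => Rsum (fun k => u k y) n) y (Rsum (fun k => d k y) n).
Proof.
  intros H. induction n as [|n IH]; simpl.
  - apply is_derive_Reals. exact (derivable_pt_lim_const 0 y).
  - apply (is_derive_plus (V := R_NormedModule)); [exact IH|apply H].
Qed.

Lemma is_derive_hpoly n y : (0 < n)%nat ->
  is_derive (hpoly n) y (Rsum (fun k => (1 - y / INR n) ^ k / INR n) n).
Proof.
  intros hn. assert (hN : 0 < INR n) by (apply lt_0_INR; easy).
  assert (H := is_derive_Rsum (fun k y => (1 - y / INR n) ^ S k / INR (S k))
    (fun k y => - ((1 - y / INR n) ^ k / INR n)) n y).
  replace (Rsum (fun k => (1 - y / INR n) ^ k / INR n) n) with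
    (- Rsum (fun k => - ((1 - y / INR n) ^ k / INR n)) n).
  - apply (is_derive_opp (V := R_NormedModule)). apply H. intros k.
    assert (hk : 0 < INR (S k)) by (apply lt_0_INR; lia).
    set (K := INR (S k)) in *.
    apply (is_derive_ext (fun y => / K * (1 - y / INR n) ^ S k)); [intros; apply Rmult_comm|].
    apply is_derive_Reals.
    replace (- ((1 - y / INR n) ^ k / INR n)) with (/ K * (K * (1 - y / INR n) ^ k * (0 - / INR n)))
      by (field; lra).
    apply derivable_pt_lim_scal.
    apply (derivable_pt_lim_comp (fun y => 1 - y / INR n) (fun x => x ^ S k)).
    + apply derivable_pt_lim_minus; [apply derivable_pt_lim_const|].
      apply is_derive_Reals. auto_derive; [lra|]. field. lra.
    + apply derivable_pt_lim_pow.
  - clear. generalize (INR n) at 1 2 3 4. intros N. induction n as [|n IH]; simpl; [ring|]. rewrite <- IH. ring.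
Qed.

Lemma geom_Rsum s N n : Rsum (fun k => s ^ k / N) n * (1 - s) = (1 - s ^ n) / N.
Proof.
  induction n as [|n IH]; simpl; [unfold Rdiv; ring|].
  rewrite Rmult_plus_distr_r, IH. unfold Rdiv. ring.
Qed.

(** With [a = y / n], the upper bound is [1 - a <= exp (- a)]. The lower one combines
    [exp (- a) (1 - a^2) <= 1 - a] with Bernoulli's inequality for [(1 - a^2)^n]. *)
Lemma exp_approx n y : (0 < n)%nat -> 0 < y <= INR n ->
  Rabs ((1 - y / INR n) ^ n - exp (- y)) <= y * y * exp (- y) / INR n.
Proof.
  intros hn hy. set (N := INR n) in *. assert (hN : 0 < N) by (apply lt_0_INR; easy).
  assert (ha : 0 <= y / N <= 1).
  { split; [apply Rdiv_le_0_compat; lra|]. apply Rmult_le_reg_r with N; [easy|].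
    unfold Rdiv. rewrite Rmult_assoc, Rinv_l; lra. }
  set (a := y / N) in *.
  assert (E : y = N * a) by (unfold a; field; lra).
  assert (Ex : forall x, exp x ^ n = exp (N * x)).
  { intros x. unfold N. clear. induction n as [|n IH].
    - rewrite Rmult_0_l, exp_0. easy.
    - rewrite S_INR. simpl. rewrite IH, <- exp_plus. f_equal. ring. }
  assert (U : (1 - a) ^ n <= exp (- y)).
  { rewrite E. replace (- (N * a)) with (N * - a) by ring. rewrite <- Ex. apply pow_incr.
    assert (H := exp_ineq1_le (- a)). lra. }
  assert (L : exp (- y) * (1 - N * (a * a)) <= (1 - a) ^ n).
  { assert (B := Bernoulli_minus (a * a) n ltac:(nra)). fold N in B.
    apply Rle_trans with (exp (- y) * (1 - a * a) ^ n).
    - apply Rmult_le_compat_l; [left; apply exp_pos|easy].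
    - rewrite E. replace (- (N * a)) with (N * - a) by ring. rewrite <- Ex, <- Rpow_mult_distr.
      apply pow_incr. assert (H := exp_ineq1_le (- a)). assert (H1 := exp_ineq1_le a).
      split; [apply Rmult_le_pos; nra|].
      assert (X : exp (- a) * exp a = 1).
      { rewrite <- exp_plus. replace (- a + a) with 0 by ring. apply exp_0. }
      nra. }
  replace (y * y * exp (- y) / N) with (exp (- y) * (N * (a * a))) by (rewrite E; field; lra).
  apply Rabs_le. nra.
Qed.

Lemma IInt_exp_phase y : 0 < y -> Lap exp 1 y = RtoC (exp (- y) / y).
Proof.
  intros hy. apply IInt_unique with (lapf exp 1 y); [apply Lap_IInt; [apply exp_good|easy]|].
  replace (RtoC (exp (- y) / y)) with (0 - RtoC (- (exp (- y) / y)))%C by (rewrite RtoC_opp; ring).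
  assert (Hl : forall t, lapf exp 1 y t = RtoC (exp (- (y * exp t)) * exp t)).
  { intros t. unfold lapf. rewrite <- RtoC_opp, <- RtoC_mult, Cexp_RtoC. simpl Cpow.
    rewrite Cmult_1_r, <- RtoC_mult. f_equal. f_equal. f_equal. ring. }
  apply IInt_derive with (F := fun t => RtoC (- (exp (- (y * exp t)) / y))).
  - intros t ht. rewrite Hl. apply (rderiv_RtoC_comp (fun t => - (exp (- (y * exp t)) / y))).
    auto_derive; [lra|]. field. lra.
  - intros t ht. apply rcont_lapf, exp_good.
  - intros eps he.
    assert (D : is_derive (fun t => - (exp (- (y * exp t)) / y)) 0 (exp (- (y * exp 0)) * exp 0)).
    { auto_derive; [lra|]. field. lra. }
    destruct (rderiv_rcont _ _ _ (rderiv_RtoC_comp _ _ _ D) eps he) as [d [hd Hd]].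
    exists d. split; [easy|]. intros t ht.
    specialize (Hd t ltac:(rewrite Rabs_pos_eq; lra)).
    rewrite Rplus_0_l, exp_0, Rmult_1_r in Hd. lra.
  - intros eps he. exists (1 + 1 / (y * y * eps)). intros t ht.
    assert (hyy : 0 < y * y * eps) by (repeat apply Rmult_lt_0_compat; lra).
    assert (hq : 0 < 1 / (y * y * eps)) by (apply Rdiv_lt_0_compat; lra).
    replace (RtoC (- (exp (- (y * exp t)) / y)) - 0)%C with (RtoC (- (exp (- (y * exp t)) / y))) by ring.
    rewrite Cmod_R, Rabs_Ropp, Rabs_pos_eq.
    2:{ apply Rdiv_le_0_compat; [left; apply exp_pos|easy]. }
    assert (E := exp_ineq1_le t).
    assert (T := exp_neg_le 1 (y * exp t) ltac:(apply Rmult_lt_0_compat; lra)). simpl in T. rewrite Rmult_1_r in T.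
    apply Rmult_le_reg_r with y; [easy|].
    replace (exp (- (y * exp t)) / y * y) with (exp (- (y * exp t))) by (field; lra).
    eapply Rle_trans; [exact T|].
    apply Rmult_le_reg_r with (y * exp t); [nra|].
    replace (1 / (y * exp t) * (y * exp t)) with 1 by (field; lra).
    assert (eps * y * y * (1 / (y * y * eps)) = 1) by (field; lra).
    assert (eps * y * y * (1 / (y * y * eps)) <= eps * y * y * exp t).
    { apply Rmult_le_compat_l; lra. }
    lra.
Qed.

(** By Bernoulli's inequality each of the [n] summands differs from its value at 0 by at most
    [y / n]. *)
Lemma hpoly_near_0 n y : (0 < n)%nat -> 0 < y <= INR n -> Rabs (hpoly n y + hsum n) <= y.
Proof.
  intros hn hy. set (N := INR n) in *. assert (hN : 0 < N) by (apply lt_0_INR; easy).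
  assert (ha : 0 <= y / N <= 1).
  { split; [apply Rdiv_le_0_compat; lra|]. apply Rmult_le_reg_r with N; [easy|].
    unfold Rdiv. rewrite Rmult_assoc, Rinv_l; lra. }
  assert (G : forall m, 0 <= Rsum (fun k => / INR (S k)) m
     - Rsum (fun k => (1 - y / N) ^ S k / INR (S k)) m <= INR m * (y / N)).
  { induction m as [|m IH]; [simpl; lra|].
    rewrite S_INR. cbn [Rsum].
    assert (hk : 0 < INR (S m)) by (apply lt_0_INR; lia).
    assert (B := Bernoulli_minus (y / N) (S m) ha).
    assert (P : (1 - y / N) ^ S m <= 1).
    { apply pow_le_1. lra. }
    assert (Q : 0 <= / INR (S m) - (1 - y / N) ^ S m / INR (S m) <= y / N).
    { replace (/ INR (S m) - (1 - y / N) ^ S m / INR (S m)) with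
        ((1 - (1 - y / N) ^ S m) / INR (S m)) by (field; lra).
      split; [apply Rdiv_le_0_compat; lra|].
      apply Rmult_le_reg_r with (INR (S m)); [easy|].
      unfold Rdiv at 1. rewrite Rmult_assoc, Rinv_l by lra. lra. }
    lra. }
  specialize (G n). fold N in G. replace (N * (y / N)) with y in G by (field; lra).
  unfold hpoly, hsum. fold N. apply Rabs_le. lra.
Qed.

Lemma hpoly_end n : (0 < n)%nat -> hpoly n (INR n) = 0.
Proof.
  intros hn. assert (hN : 0 < INR n) by (apply lt_0_INR; easy).
  unfold hpoly. replace (1 - INR n / INR n) with 0 by (field; lra).
  generalize n at 1. intros m. induction m as [|m IH]; simpl; [ring|].
  simpl in IH. unfold Rdiv in *. lra.
Qed.

(** [E_1(y) + ln y - hpoly n y] has derivative [((1 - y/n)^n - exp (- y)) / y], dominated by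
    [y exp (- y) / n]. Integrating from [y] to [n] costs [1 / n], the value [E_1(n)] at most
    [8 / n], and replacing [hpoly] by its value at 0 at most [y]. *)
Lemma E1_harmonic n y : (0 < n)%nat -> 0 < y <= INR n ->
  Cmod (Lap exp 0 y + RtoC (ln y + (hsum n - ln (INR n))))%C <= 9 / INR n + y.
Proof.
  intros hn hy. set (N := INR n) in *. assert (hN : 0 < N) by (apply lt_0_INR; easy).
  assert (K := cmvt_dom (fun y => Lap exp 0 y + RtoC (ln y - hpoly n y))%C
    (fun y => RtoC (((1 - y / N) ^ n - exp (- y)) / y))
    (fun y => - ((y + 1) * exp (- y)) / N) (fun y => y * exp (- y) / N) y N ltac:(lra)).
  assert (K' : Cmod (Lap exp 0 N + RtoC (ln N - hpoly n N) - (Lap exp 0 y + RtoC (ln y - hpoly n y)))%C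
     <= - ((N + 1) * exp (- N)) / N - - ((y + 1) * exp (- y)) / N).
  { apply K.
    - intros t ht.
      eapply rderiv_eq; [|apply rderiv_plus; [apply (rderiv_of_cderiv (Lap exp 0)), cderiv_Lap|apply rderiv_RtoC_comp]].
      2:{ apply exp_good. } 2:{ simpl; lra. }
      2:{ apply (is_derive_minus (V := R_NormedModule)); [apply is_derive_ln; lra|apply is_derive_hpoly; easy]. }
      rewrite IInt_exp_phase by lra.
      assert (E : Rsum (fun k => (1 - t / INR n) ^ k / INR n) n = (1 - (1 - t / N) ^ n) / t).
      { assert (G := geom_Rsum (1 - t / N) N n). fold N.
        replace (1 - (1 - t / N)) with (t / N) in G by ring.
        apply Rmult_eq_reg_r with (t / N).
        - rewrite G. field. lra.
        - apply Rgt_not_eq, Rdiv_lt_0_compat; lra. }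
      rewrite E. rewrite <- RtoC_opp, <- RtoC_plus. f_equal.
      change (minus (/ t) ((1 - (1 - t / N) ^ n) / t)) with (/ t - (1 - (1 - t / N) ^ n) / t).
      field. lra.
    - intros t ht. auto_derive; [lra|]. field. lra.
    - intros t ht. rewrite Cmod_R. unfold Rdiv at 1. rewrite Rabs_mult, (Rabs_pos_eq (/ t)).
      2:{ left. apply Rinv_0_lt_compat. lra. }
      assert (X := exp_approx n t hn ltac:(fold N; lra)). fold N in X.
      apply Rmult_le_reg_r with t; [lra|]. rewrite Rmult_assoc, Rinv_l, Rmult_1_r by lra.
      replace (t * exp (- t) / N * t) with (t * t * exp (- t) / N) by (field; lra). easy. }
  unfold N in K' at 3. rewrite hpoly_end in K' by easy.
  assert (B1 : - ((N + 1) * exp (- N)) / N - - ((y + 1) * exp (- y)) / N <= 1 / N).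
  { apply Rmult_le_reg_r with N; [easy|].
    replace ((- ((N + 1) * exp (- N)) / N - - ((y + 1) * exp (- y)) / N) * N) with
      ((y + 1) * exp (- y) - (N + 1) * exp (- N)) by (field; lra).
    replace (1 / N * N) with 1 by (field; lra).
    assert (P := exp_pos (- N)). assert (0 < (N + 1) * exp (- N)) by (apply Rmult_lt_0_compat; lra).
    assert (T := exp_ineq1_le y). assert (X : exp (- y) * exp y = 1).
    { rewrite <- exp_plus. replace (- y + y) with 0 by ring. apply exp_0. }
    nra. }
  assert (B2 := Lap_bound exp 0 1 N exp_good ltac:(simpl; lra) ltac:(lia)).
  simpl in B2. rewrite !Rmult_1_r in B2.
  assert (B3 := hpoly_near_0 n y hn hy).
  rewrite Rminus_0_r in K'.
  replace (Lap exp 0 y + RtoC (ln y + (hsum n - ln N)))%C with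
    (- (Lap exp 0 N + RtoC (ln N) - (Lap exp 0 y + RtoC (ln y - hpoly n y)))
     + Lap exp 0 N + RtoC (hpoly n y + hsum n))%C.
  2:{ rewrite !RtoC_plus, !RtoC_minus. ring. }
  eapply Rle_trans; [apply Cmod_triangle|].
  eapply Rle_trans; [apply Rplus_le_compat_r, Cmod_triangle|].
  rewrite Cmod_opp, Cmod_R. unfold Rdiv in *. lra.
Qed.

Lemma hsum_Euler n : sum_n_m (G := R_AbelianMonoid) (fun k => / INR k) 1 n = hsum n.
Proof. apply Rsum_sum_n_m. Qed.

Lemma INR_large (x : R) : exists N, forall n, (N <= n)%nat -> x <= INR n.
Proof.
  destruct (archimed (Rmax x 0)) as [A _].
  exists (Z.to_nat (up (Rmax x 0))). intros n hn.
  assert (B := Rmax_l x 0). assert (D := Rmax_r x 0).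
  apply Rle_trans with (INR (Z.to_nat (up (Rmax x 0)))); [|apply le_INR; easy].
  rewrite INR_IZR_INZ, Z2Nat.id; [lra|]. apply le_IZR. lra.
Qed.

(** For each [y], the numbers [H_n - ln n] are eventually within [y + eps] of [- (E_1(y) + ln y)].
    Small [y] shows that they form a Cauchy sequence, so the limit that defines Euler's constant
    exists, and the same estimate compares it with [E_1(y)]. *)
Lemma E1_Euler y : 0 < y -> Cmod (Lap exp 0 y + RtoC (ln y + Euler_gamma))%C <= y.
Proof.
  set (a := fun n => RtoC (hsum n - ln (INR n))).
  assert (Q : forall y, 0 < y -> forall eps, 0 < eps -> exists N, forall n, (N <= n)%nat ->
    Cmod (a n - - (Lap exp 0 y + RtoC (ln y)))%C <= y + eps).
  { intros z hz eps he. destruct (INR_large (Rmax z (Rmax 1 (9 / eps)))) as [N HN].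
    exists N. intros n hn. specialize (HN n hn).
    assert (A := Rmax_l z (Rmax 1 (9 / eps))). assert (B := Rmax_r z (Rmax 1 (9 / eps))).
    assert (B' := Rmax_r 1 (9 / eps)).
    assert (hn0 : (0 < n)%nat) by (apply INR_lt; simpl; lra).
    assert (H := E1_harmonic n z hn0 ltac:(lra)).
    replace (a n - - (Lap exp 0 z + RtoC (ln z)))%C with
      (Lap exp 0 z + RtoC (ln z + (hsum n - ln (INR n))))%C
      by (unfold a; rewrite (RtoC_plus (ln z)); ring).
    eapply Rle_trans; [exact H|].
    assert (9 / INR n <= eps); [|lra].
    apply Rmult_le_reg_r with (INR n); [lra|].
    replace (9 / INR n * INR n) with 9 by (field; lra).
    assert (eps * (9 / eps) = 9) by (field; lra).
    assert (eps * (9 / eps) <= eps * INR n) by (apply Rmult_le_compat_l; lra). lra. }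
  destruct (Clim_Cauchy a) as [l Hl].
  { intros eps he. destruct (Q (eps / 4) ltac:(lra) (eps / 4) ltac:(lra)) as [N HN].
    exists N. intros n m hn hm.
    set (c := (- (Lap exp 0 (eps / 4)%R + RtoC (ln (eps / 4))))%C) in *.
    assert (A := HN n hn). assert (B := HN m hm). rewrite Cmod_minus_sym in B.
    eapply Rle_trans; [apply Cmod_split with (y := c)|]. lra. }
  assert (EG : Euler_gamma = Re l).
  { unfold Euler_gamma.
    rewrite (is_lim_seq_unique _ (Re l)); [easy|].
    apply is_lim_seq_Reals. intros eps he.
    destruct (Hl (eps / 2)) as [N HN]; [lra|]. exists N. intros n hn.
    specialize (HN n hn). unfold Rdist.
    rewrite hsum_Euler.
    assert (T := re_le_Cmod (a n - l)).
    change (Re (a n - l)) with (hsum n - ln (INR n) - Re l) in T. lra. }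
  assert (Il : Im l = 0).
  { assert (T : forall eps, 0 < eps -> Rabs (Im l) <= eps).
    { intros eps he. destruct (Hl eps he) as [N HN]. specialize (HN N (Nat.le_refl N)).
      assert (T := im_le_Cmod (a N - l)).
      replace (Im (a N - l)) with (- Im l) in T by (unfold a, Im; simpl; ring).
      rewrite Rabs_Ropp in T. lra. }
    destruct (Req_dec (Im l) 0) as [h|h]; [easy|].
    assert (P := Rabs_pos_lt _ h). specialize (T (Rabs (Im l) / 2)). lra. }
  assert (El : l = RtoC Euler_gamma).
  { rewrite EG. destruct l as [p q]. simpl in *. subst q. easy. }
  intros hy. apply Rnot_lt_le. intros hlt.
  set (d := Cmod (Lap exp 0 y + RtoC (ln y + Euler_gamma))%C - y).
  assert (hd : 0 < d) by (unfold d; lra).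
  destruct (Q y hy (d / 4) ltac:(lra)) as [N1 H1].
  destruct (Hl (d / 4) ltac:(lra)) as [N2 H2].
  specialize (H1 (max N1 N2) ltac:(lia)). specialize (H2 (max N1 N2) ltac:(lia)).
  assert (T := Cmod_split l (a (max N1 N2)) (- (Lap exp 0 y + RtoC (ln y)))).
  rewrite Cmod_minus_sym in H2.
  replace (l - - (Lap exp 0 y + RtoC (ln y)))%C with (Lap exp 0 y + RtoC (ln y + Euler_gamma))%C in T
    by (rewrite El, RtoC_plus; ring).
  unfold d in *. lra.
Qed.

(** * Behaviour of the Bessel functions at the origin *)

Lemma lapf_real c m x t : lapf c m (RtoC x) t = RtoC (exp (- (x * c t)) * c t ^ m).
Proof.
  unfold lapf. rewrite <- RtoC_opp, <- RtoC_mult, Cexp_RtoC, <- RtoC_pow, <- RtoC_mult.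
  f_equal. f_equal. f_equal. ring.
Qed.

Lemma exp_diff_le u v : 0 <= v -> Rabs (exp (- (u + v)) - exp (- u)) <= exp (- u) * v.
Proof.
  intros hv. replace (- (u + v)) with (- u + - v) by ring. rewrite exp_plus.
  replace (exp (- u) * exp (- v) - exp (- u)) with (- (exp (- u) * (1 - exp (- v)))) by ring.
  assert (H := exp_ineq1_le (- v)). assert (H' : exp (- v) <= 1) by (rewrite <- exp_0; apply exp_le; lra).
  assert (P := exp_pos (- u)).
  rewrite Rabs_Ropp, Rabs_pos_eq by (apply Rmult_le_pos; lra).
  apply Rmult_le_compat_l; lra.
Qed.

(** As [cosh t = exp t / 2 + exp (- t) / 2], dropping the second summand from the phase changes the
    integrand by at most [x / 2 * exp (- t)]. *)
Lemma BK0_near_E1 x : 0 < x -> Cmod (BK 0 x - Lap exp 0 (RtoC (x / 2)))%C <= 2 * x.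
Proof.
  intros hx.
  assert (I : IInt (fun t => lapf cosh 0 x t - lapf exp 0 (RtoC (x / 2)) t)%C
    (BK 0 x - Lap exp 0 (RtoC (x / 2)))%C).
  { apply IInt_minus; apply Lap_IInt; try apply cosh_good; try apply exp_good; simpl; lra. }
  assert (B : forall t, 0 < t -> Cmod (lapf cosh 0 x t - lapf exp 0 (RtoC (x / 2)) t)%C <= x / 2 * exp (- t)).
  { intros t ht. rewrite !lapf_real, <- RtoC_minus, Cmod_R. rewrite !Rmult_1_r.
    replace (x * cosh t) with (x / 2 * exp t + x / 2 * exp (- t)) by (unfold cosh; field).
    assert (P := exp_pos (- t)). assert (P' := exp_pos t).
    eapply Rle_trans; [apply exp_diff_le; nra|].
    rewrite <- (Rmult_1_l (x / 2 * exp (- t))) at 2. apply Rmult_le_compat_r; [nra|].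
    rewrite <- exp_0. apply exp_le. nra. }
  assert (H := IInt_bound _ x 0 _ (Rlt_le _ _ hx) ltac:(lra) I).
  assert (E : 2 * x = x / (0 + 1) + x) by field. rewrite E. apply H; clear E H.
  - intros t ht. rewrite Rpower_O, Rmult_1_r by lra. eapply Rle_trans; [apply B; lra|].
    assert (exp (- t) <= 1) by (rewrite <- exp_0; apply exp_le; lra). nra.
  - intros t ht. eapply Rle_trans; [apply B; lra|].
    assert (T := exp_neg_le 2 t ltac:(lra)). simpl in T.
    replace (x / (t * t)) with (x / 2 * ((1 + 1) / (t * (t * 1)))) by (field; lra).
    apply Rmult_le_compat_l; lra.
Qed.

Lemma BK0_limit x : 0 < x -> Cmod (BK 0 x + RtoC (ln (x / 2) + Euler_gamma))%C <= 3 * x.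
Proof.
  intros hx. assert (H := BK0_near_E1 x hx). assert (H' := E1_Euler (x / 2) ltac:(lra)).
  replace (BK 0 x + RtoC (ln (x / 2) + Euler_gamma))%C with
    ((BK 0 x - Lap exp 0 (RtoC (x / 2))) + (Lap exp 0 (RtoC (x / 2)) + RtoC (ln (x / 2) + Euler_gamma)))%C
    by ring.
  eapply Rle_trans; [apply Cmod_triangle|]. lra.
Qed.

Lemma inv_INR_S p : 0 < / INR (S p) <= 1.
Proof.
  assert (T := pos_INR p). rewrite S_INR. split; [apply Rinv_0_lt_compat; lra|].
  rewrite <- Rinv_1. apply Rinv_le_contravar; lra.
Qed.

Lemma INR_S_ge_1 n : 1 <= INR (S n).
Proof. change 1 with (INR 1). apply le_INR. lia. Qed.

Lemma inv_INR_small r : 0 < r -> exists N, forall n, (N <= n)%nat -> 0 < / INR (S n) < r.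
Proof.
  intros hr. destruct (INR_large (/ r)) as [N HN]. exists N. intros n hn. specialize (HN n hn).
  split; [apply inv_INR_S|]. rewrite <- (Rinv_inv r). assert (h := Rinv_0_lt_compat r hr).
  apply Rinv_lt_contravar; rewrite S_INR; [apply Rmult_lt_0_compat|]; lra.
Qed.

Lemma primitive_increment F f A m x y : 0 < x <= y -> m <> -1 ->
  (forall t, x <= t <= y -> cderiv F (RtoC t) (f (RtoC t))) ->
  (forall t, x <= t <= y -> Cmod (f (RtoC t))%C <= A * Rpower t m) ->
  Cmod (F (RtoC y) - F (RtoC x))%C <= A / (m + 1) * Rpower y (m + 1) - A / (m + 1) * Rpower x (m + 1).
Proof.
  intros hx hm HF Hf.
  apply (cmvt_dom (fun t => F (RtoC t)) (fun t => f (RtoC t)) (fun t => A / (m + 1) * Rpower t (m + 1)) (fun t => A * Rpower t m)); [lra| | |easy].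
  - intros t ht. apply rderiv_of_cderiv, HF, ht.
  - intros t ht. evar_last; [apply is_derive_scal, is_derive_Rpower; lra|].
    unfold scal; simpl; unfold mult; simpl. replace (m + 1 - 1) with m by ring. field. lra.
Qed.

Lemma limit_at_0 F f A m : 0 <= A -> m > -1 ->
  (forall t, 0 < t -> cderiv F (RtoC t) (f (RtoC t))) ->
  (forall t, 0 < t -> Cmod (f (RtoC t))%C <= A * Rpower t m) ->
  exists l, forall x, 0 < x -> Cmod (F (RtoC x) - l)%C <= A / (m + 1) * Rpower x (m + 1).
Proof.
  intros hA hm HF Hf. set (c := A / (m + 1)). assert (hc : 0 <= c) by (apply Rdiv_le_0_compat; lra).
  assert (Inc : forall x y, 0 < x <= y -> Cmod (F (RtoC y) - F (RtoC x))%C <= c * Rpower y (m + 1)).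
  { intros x y hxy. eapply Rle_trans; [apply (primitive_increment F f A m); [easy|lra| |]|].
    - intros t ht. apply HF. lra.
    - intros t ht. apply Hf. lra.
    - fold c. assert (P := Rpower_pos x (m + 1)). assert (0 <= c * Rpower x (m + 1)) by (apply Rmult_le_pos; lra). lra. }
  destruct (Clim_Cauchy (fun n => F (RtoC (/ INR (S n))))) as [l Hl].
  { intros eps he. destruct (Rpower_small (m + 1) (eps / (c + 1)) ltac:(lra) ltac:(apply Rdiv_lt_0_compat; lra)) as [r [hr Hr]].
    destruct (inv_INR_small r (proj1 hr)) as [N HN]. exists N.
    assert (K : forall n p, (N <= n)%nat -> (n <= p)%nat -> Cmod (F (RtoC (/ INR (S n))) - F (RtoC (/ INR (S p))))%C <= eps).
    { intros n p hn hp. specialize (HN n hn). assert (h := INR_S_ge_1 n). assert (hp' := inv_INR_S p).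
      eapply Rle_trans; [apply Inc; split; [easy|apply Rinv_le_contravar; [lra|apply le_INR; lia]]|].
      assert (Rpower (/ INR (S n)) (m + 1) <= Rpower r (m + 1)) by (apply Rle_Rpower_l; lra).
      assert (P := Rpower_pos (/ INR (S n)) (m + 1)).
      apply Rle_trans with ((c + 1) * (eps / (c + 1))); [apply Rmult_le_compat; lra|apply Req_le; field; lra]. }
    intros n p hn hp. destruct (Nat.le_ge_cases n p) as [h|h]; [|rewrite Cmod_minus_sym]; apply K; easy. }
  exists l. intros x hx. apply le_epsilon. intros eps he.
  destruct (inv_INR_small x hx) as [N HN]. destruct (Hl eps he) as [N2 HN2].
  specialize (HN2 (max N N2) ltac:(lia)). specialize (HN (max N N2) ltac:(lia)). cbv beta in HN2.
  specialize (Inc (/ INR (S (max N N2))) x ltac:(lra)).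
  eapply Rle_trans; [apply Cmod_split with (y := F (RtoC (/ INR (S (max N N2)))))|]. lra.
Qed.

(* [x K1(x)] has some limit [c] at 0, so [K0(x) + c ln x] is bounded there; as [K0(x) + ln x] is bounded too, [c = 1]. *)
Lemma BK1_limit x : 0 < x -> Cmod (RtoC x * BK 1 x - 1)%C <= 8 * x.
Proof.
  revert x.
  destruct (limit_at_0 (fun z => z * BK 1 z)%C (fun z => - (z * BK 0 z))%C 8 0) as [c Hc]; try lra.
  { intros t ht. apply cderiv_zBK1. easy. }
  { intros t ht. assert (T := Lap_bound cosh 0 1 (RtoC t) cosh_good ht ltac:(lia)). simpl in T.
    rewrite Rpower_O, Cmod_opp, Cmod_mult, Cmod_R, Rabs_pos_eq by lra.
    apply Rmult_le_compat_l with (r := t) in T; [|lra]. replace (t * (8 * 1 / (t * 1))) with (8 * 1) in T by (field; lra). exact T. }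
  assert (Hc' : forall x, 0 < x -> Cmod (RtoC x * BK 1 x - c)%C <= 8 * x).
  { intros x hx. specialize (Hc x hx). rewrite Rplus_0_l, Rpower_1 in Hc by easy. lra. }
  set (F := fun z => (BK 0 z + c * Clog z)%C).
  set (M := 8 + Cmod (F 1)%C + 3 + Cmod (RtoC (Euler_gamma - ln 2))%C).
  assert (HM : forall x, 0 < x <= 1 -> Cmod ((c - 1) * RtoC (ln x))%C <= M).
  { intros x hx.
    assert (I : Cmod (F (RtoC 1) - F (RtoC x))%C <= 8 / (0 + 1) * Rpower 1 (0 + 1) - 8 / (0 + 1) * Rpower x (0 + 1)).
    { apply (primitive_increment F (fun z => - BK 1 z + c * / z)%C); [lra|lra| |].
      - intros t ht. apply cderiv_plus; [apply cderiv_BK0; simpl; lra|]. apply cderiv_scal, cderiv_Clog, slit_Re. simpl. lra.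
      - intros t ht. assert (t0 : RtoC t <> 0%C) by (intros E; apply RtoC_inj in E; lra).
        rewrite Rpower_O by lra. apply Rmult_le_reg_r with t; [lra|].
        replace (Cmod (- BK 1 t + c * / t)%C * t) with (Cmod (RtoC t * BK 1 t - c)%C).
        { specialize (Hc' t ltac:(lra)). lra. }
        replace (RtoC t * BK 1 t - c)%C with (- (RtoC t * (- BK 1 t + c * / t)))%C by (field; easy).
        rewrite Cmod_opp, Cmod_mult, Cmod_R, Rabs_pos_eq by lra. ring. }
    rewrite Rplus_0_l, !Rpower_1 in I by lra. assert (B := BK0_limit x ltac:(lra)).
    rewrite ln_div in B by lra.
    replace ((c - 1) * RtoC (ln x))%C with (F (RtoC x) - (BK 0 x + RtoC (ln x - ln 2 + Euler_gamma)) + RtoC (Euler_gamma - ln 2))%C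
      by (unfold F; rewrite Clog_RtoC, !RtoC_plus, !RtoC_minus by lra; ring).
    eapply Rle_trans; [apply Cmod_triangle|].
    assert (T := Cmod_minus_triangle (F (RtoC x)) (BK 0 x + RtoC (ln x - ln 2 + Euler_gamma))).
    assert (T2 := Cmod_rev_triangle (F (RtoC x)) (F (RtoC 1))). rewrite Cmod_minus_sym in T2. unfold M. lra. }
  assert (E : c = 1%C).
  { apply Ceq_minus, Cmod_eq_0. assert (h := Cmod_ge_0 (c - 1)). destruct (Req_dec (Cmod (c - 1)%C) 0) as [|h0]; [easy|].
    (* At [x = exp (- n)] the logarithm equals [- n], so the bound [M] fails for large [n] unless
       [c = 1]. *)
    destruct (INR_large (M / Cmod (c - 1)%C + 1)) as [n Hn]. specialize (Hn n (Nat.le_refl n)).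
    assert (P := pos_INR n). specialize (HM (exp (- INR n)) ltac:(split; [apply exp_pos|rewrite <- exp_0; apply exp_le; lra])).
    rewrite ln_exp, Cmod_mult, Cmod_R, Rabs_Ropp, Rabs_pos_eq in HM by easy.
    apply Rmult_le_compat_l with (r := Cmod (c - 1)%C) in Hn; [|easy].
    replace (Cmod (c - 1)%C * (M / Cmod (c - 1)%C + 1)) with (M + Cmod (c - 1)%C) in Hn by (field; easy). lra. }
  rewrite <- E. exact Hc'.
Qed.

(** For [0 <= s < 1] this is the open sector [|arg z| < arccos s]. It is invariant under positive
    scaling, and [Re z] and [Cmod z] are comparable in it when [s > 0]. *)
Definition cone (s : R) (z : C) : Prop := s * Cmod z < Re z.

Lemma cone_rhp s z : 0 <= s -> cone s z -> 0 < Re z.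
Proof. unfold cone. intros hs h. assert (H := Cmod_ge_0 z). nra. Qed.

Lemma copen_cone s : 0 <= s -> copen (cone s).
Proof.
  intros hs z hz. unfold cone in *. exists ((Re z - s * Cmod z) / (1 + s)). split.
  { apply Rdiv_lt_0_compat; lra. }
  intros h hh. assert (T := re_le_Cmod h). apply Rabs_le_between in T.
  assert (T2 := Cmod_triangle z h).
  apply Rmult_lt_compat_r with (r := 1 + s) in hh; [|lra].
  replace ((Re z - s * Cmod z) / (1 + s) * (1 + s)) with (Re z - s * Cmod z) in hh by (field; lra).
  change (s * Cmod (z + h)%C < Re z + Re h). nra.
Qed.

Lemma cone_lt_1 s z : cone s z -> 0 < Cmod z -> s < 1.
Proof.
  unfold cone. intros h hz. assert (T := re_le_Cmod z). apply Rabs_le_between in T. nra.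
Qed.

Lemma Rpower_between s r x m : 0 < s <= 1 -> 0 < r -> s * r <= x <= r ->
  Rpower x m <= (1 + Rpower s m) * Rpower r m.
Proof.
  intros hs hr hx. assert (P := Rpower_pos s m). assert (Q := Rpower_pos r m).
  assert (hsr : 0 < s * r) by (apply Rmult_lt_0_compat; lra).
  destruct (Rle_dec 0 m) as [hm|hm].
  - assert (Rpower x m <= Rpower r m) by (apply Rle_Rpower_l; lra). nra.
  - assert (Rpower x m <= Rpower (s * r) m).
    { replace m with (- - m) by ring. rewrite !(Rpower_Ropp _ (- m)).
      apply Rinv_le_contravar; [apply Rpower_pos|]. apply Rle_Rpower_l; lra. }
    rewrite <- Rpower_mult_distr in H by lra. nra.
Qed.

(** The cone is convex and contains [|z|]. Both ends of the chord have real part above [s |z|],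
    which keeps the modulus comparable to [|z|], so a power of the modulus varies by a bounded
    factor along it. *)
Lemma seg_in_cone s z t : 0 < s -> cone s z -> 0 <= t <= 1 ->
  let p := (z + t * (RtoC (Cmod z) - z))%C in
  cone s p /\ s * Cmod z <= Cmod p <= Cmod z.
Proof.
  intros hs hz ht p. assert (hre := cone_rhp s z (Rlt_le _ _ hs) hz).
  assert (hm : 0 < Cmod z) by (apply Cmod_gt_0, slit_neq_0, slit_Re; easy).
  assert (h1 := cone_lt_1 s z hz hm). unfold cone in *.
  assert (Hre : s * Cmod z < Re p).
  { replace (Re p) with ((1 - t) * Re z + t * Cmod z) by (unfold p, Re; simpl; ring).
    assert (hB : 0 < (1 - s) * Cmod z) by (apply Rmult_lt_0_compat; lra).
    destruct (Req_dec t 0) as [->|h0]; [lra|].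
    assert (0 < t * ((1 - s) * Cmod z)) by (apply Rmult_lt_0_compat; lra).
    assert (0 <= (1 - t) * (Re z - s * Cmod z)) by (apply Rmult_le_pos; lra). lra. }
  assert (Hle : Cmod p <= Cmod z).
  { replace p with (RtoC (1 - t) * z + t * RtoC (Cmod z))%C by (unfold p; rewrite RtoC_minus; ring).
    eapply Rle_trans; [apply Cmod_triangle|].
    rewrite !Cmod_mult, !Cmod_R, !Rabs_pos_eq by lra. nra. }
  assert (T := re_le_Cmod p). apply Rabs_le_between in T.
  split; [nra|lra].
Qed.

(* Integrate [e] on the real axis from [0] to [|z|], then along the chord from [|z|] to [z]. *)
Lemma cone_int s m A (E e : C -> C) : 0 < s -> m > -1 -> 0 <= A ->
  (forall z, cone s z -> cderiv E z (e z)) ->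
  (forall z, cone s z -> Cmod (e z)%C <= A * Rpower (Cmod z) m) ->
  (forall eps, 0 < eps -> exists r, 0 < r /\ forall x, 0 < x < r -> Cmod (E (RtoC x))%C <= eps) ->
  exists B, 0 <= B /\ forall z, cone s z -> Cmod (E z)%C <= B * Rpower (Cmod z) (m + 1).
Proof.
  intros hs hm hA HE He H0.
  exists (A / (m + 1) + A * (1 + Rpower s m) * 2).
  assert (hq : 0 <= A / (m + 1)) by (apply Rdiv_le_0_compat; lra).
  assert (Ps := Rpower_pos s m).
  split; [assert (0 <= A * (1 + Rpower s m)) by (apply Rmult_le_pos; lra); lra|]. intros z hz.
  assert (hre := cone_rhp s z (Rlt_le _ _ hs) hz).
  assert (hr : 0 < Cmod z) by (apply Cmod_gt_0, slit_neq_0, slit_Re; easy).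
  assert (h1 := cone_lt_1 s z hz hr).
  set (r := Cmod z) in *.
  assert (Hx : forall x, 0 < x -> cone s (RtoC x)).
  { intros x hx. unfold cone. rewrite Cmod_R, Rabs_pos_eq by lra. simpl. nra. }
  assert (Real : Cmod (E (RtoC r))%C <= A / (m + 1) * Rpower r (m + 1)).
  { apply Rnot_lt_le. intros hlt.
    set (d := Cmod (E (RtoC r))%C - A / (m + 1) * Rpower r (m + 1)).
    destruct (H0 (d / 2)) as [r0 [hr0 K]]; [unfold d; lra|].
    set (x := Rmin (r / 2) (r0 / 2)).
    assert (hx : 0 < x) by (apply Rmin_pos; lra).
    assert (hx1 : x <= r / 2) by apply Rmin_l. assert (hx2 : x <= r0 / 2) by apply Rmin_r.
    specialize (K x ltac:(lra)).
    assert (M := cmvt_dom (fun t => E (RtoC t)) (fun t => e (RtoC t))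
      (fun t => A / (m + 1) * Rpower t (m + 1)) (fun t => A * Rpower t m) x r ltac:(lra)).
    assert (M' : Cmod (E (RtoC r) - E (RtoC x))%C <= A / (m + 1) * Rpower r (m + 1) - A / (m + 1) * Rpower x (m + 1)).
    { apply M.
      - intros t ht. apply rderiv_of_cderiv, HE, Hx. lra.
      - intros t ht. assert (D := is_derive_Rpower (m + 1) t ltac:(lra)).
        apply (is_derive_scal _ _ (A / (m + 1))) in D.
        replace (A * Rpower t m) with (A / (m + 1) * ((m + 1) * Rpower t (m + 1 - 1))); [exact D|].
        replace (m + 1 - 1) with m by ring. field. lra.
      - intros t ht. eapply Rle_trans; [apply He, Hx; lra|]. rewrite Cmod_R, Rabs_pos_eq; lra. }
    assert (T := Cmod_rev_triangle (E (RtoC r)) (E (RtoC x))).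
    assert (0 <= A / (m + 1) * Rpower x (m + 1)) by (apply Rmult_le_pos; [easy|left; apply Rpower_pos]).
    unfold d in *. lra. }
  assert (Jump : Cmod (E (RtoC r) - E z)%C <= A * (1 + Rpower s m) * Rpower r m * Cmod (RtoC r - z)%C).
  { apply (cmvt_seg E e).
    - intros t ht. apply HE. apply (seg_in_cone s z t hs hz ht).
    - intros t ht. destruct (seg_in_cone s z t hs hz ht) as [c1 c2].
      eapply Rle_trans; [apply He; exact c1|]. rewrite Rmult_assoc.
      apply Rmult_le_compat_l; [easy|]. fold r in c2. apply Rpower_between; lra. }
  assert (D : Cmod (RtoC r - z)%C <= 2 * r).
  { eapply Rle_trans; [apply Cmod_minus_triangle|]. rewrite Cmod_R, Rabs_pos_eq by lra. fold r. lra. }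
  assert (Pr := Rpower_pos r m).
  assert (Er : Rpower r (m + 1) = Rpower r m * r) by (rewrite Rpower_plus, Rpower_1; easy).
  rewrite Er in *.
  assert (J2 : Cmod (E (RtoC r) - E z)%C <= A * (1 + Rpower s m) * Rpower r m * (2 * r)).
  { eapply Rle_trans; [exact Jump|]. apply Rmult_le_compat_l; [|easy].
    repeat apply Rmult_le_pos; lra. }
  assert (T := Cmod_rev_triangle (E z) (E (RtoC r))).
  rewrite Cmod_minus_sym in T.
  rewrite Rmult_plus_distr_r.
  replace (A * (1 + Rpower s m) * 2 * (Rpower r m * r)) with (A * (1 + Rpower s m) * Rpower r m * (2 * r)) by ring.
  lra.
Qed.

Lemma cderiv_pow z n : cderiv (fun z => z ^ S n)%C z (RtoC (INR (S n)) * z ^ n)%C.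
Proof.
  induction n as [|n IH].
  - eapply cderiv_eq; [|exact (cderiv_mult _ _ _ _ _ (cderiv_id z) (cderiv_const 1%C z))].
    simpl. ring.
  - eapply cderiv_eq; [|exact (cderiv_mult _ _ _ _ _ (cderiv_id z) IH)].
    rewrite (S_INR (S n)), RtoC_plus. change (z ^ S n)%C with (z * z ^ n)%C. ring.
Qed.

Lemma cderiv_Csum (u : nat -> C -> C) d z n : (forall k, cderiv (u k) z (d k)) ->
  cderiv (fun w => Csum (fun k => u k w) n) z (Csum d n).
Proof.
  intros H. induction n as [|n IH]; simpl; [apply cderiv_const|]. apply cderiv_plus; easy.
Qed.

Lemma Csum_S_l u n : Csum u (S n) = (u 0%nat + Csum (fun k => u (S k)) n)%C.
Proof.
  induction n as [|n IH]; [simpl; ring|].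
  change (Csum u (S (S n))) with (Csum u (S n) + u (S n))%C. rewrite IH. simpl. ring.
Qed.

(** * Expansions of [K0] and [K1] at the origin *)

Definition Lg (z : C) : C := (Clog z - RtoC (ln 2))%C.

Lemma cderiv_Lg z : 0 < Re z -> cderiv Lg z (/ z)%C.
Proof.
  intros h. eapply cderiv_eq; [|apply cderiv_minus; [apply cderiv_Clog, slit_Re; easy|apply cderiv_const]].
  ring.
Qed.

(** [tc r] is the coefficient of [z^(2r)] in [I_0(z)], and [sc r] that of [z^(2r+2)] in
    [z I_1(z)]. *)
Definition tc (r : nat) : R := / (4 ^ r * (INR (fact r) * INR (fact r))).
Definition sc (r : nat) : R := tc r / (2 * INR (S r)).

(** The classical series terms: [K0t] of [K_0(z)] and [K1t] of [z K_1(z) - 1]. The harmonic numbers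
    are [psi (r + 1)] plus Euler's constant. *)
Definition K0t (r : nat) (z : C) : C :=
  (RtoC (tc r) * (z ^ (2 * r) * (RtoC (hsum r - Euler_gamma) - Lg z)))%C.
Definition K1t (r : nat) (z : C) : C :=
  (RtoC (sc r) * (z ^ (2 * S r) * (Lg z + RtoC (Euler_gamma - hsum r - / (2 * INR (S r))))))%C.
Definition K0s (J : nat) (z : C) : C := Csum (fun r => K0t r z) J.
Definition K1s (J : nat) (z : C) : C := Csum (fun r => K1t r z) J.

Lemma hsum_S r : hsum (S r) = hsum r + / INR (S r).
Proof. easy. Qed.

Lemma tc_S r : tc (S r) * (2 * INR (S r)) = sc r.
Proof.
  unfold sc, tc. rewrite fact_simpl, mult_INR. simpl pow.
  assert (A := INR_fact_lt_0 r). assert (B : 0 < INR (S r)) by (apply lt_0_INR; lia).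
  assert (D : 0 < 4 ^ r) by (apply pow_lt; lra). field. lra.
Qed.

Lemma INR_2S r : INR (S (S (2 * r))) = 2 * INR (S r).
Proof. rewrite !S_INR, mult_INR. simpl. ring. Qed.

Lemma cderiv_K1t r z : 0 < Re z -> cderiv (K1t r) z (- (z * K0t r z))%C.
Proof.
  intros h. assert (hz := slit_neq_0 z (slit_Re z h)).
  assert (B : 0 < INR (S r)) by (apply lt_0_INR; lia).
  assert (E : (2 * S r = S (S (2 * r)))%nat) by lia.
  unfold K1t. rewrite E.
  eapply cderiv_eq; [|apply cderiv_scal, cderiv_mult; [apply (cderiv_pow z (S (2 * r)))|
    apply cderiv_plus; [apply cderiv_Lg; easy|apply cderiv_const]]].
  rewrite INR_2S. unfold K0t, sc.
  rewrite RtoC_div, !RtoC_minus, RtoC_inv, RtoC_mult by lra.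
  assert (hs : RtoC (INR (S r)) <> 0%C) by (intros X; apply RtoC_inj in X; lra).
  set (w := (z ^ (2 * r))%C).
  change (z ^ S (S (2 * r)))%C with (z * (z * w))%C. change (z ^ S (2 * r))%C with (z * w)%C.
  field. repeat split; easy.
Qed.

Lemma cderiv_K0t_0 z : 0 < Re z -> cderiv (K0t 0) z (- / z)%C.
Proof.
  intros h. apply cderiv_ext with (fun z => RtoC (hsum 0 - Euler_gamma) - Lg z)%C.
  - intros w. unfold K0t, tc. simpl. replace (/ (1 * (1 * 1))) with 1 by field. ring.
  - eapply cderiv_eq; [|apply cderiv_minus; [apply cderiv_const|apply cderiv_Lg; easy]]. ring.
Qed.

Lemma cderiv_K0t_S r z : 0 < Re z -> cderiv (K0t (S r)) z (- (K1t r z / z))%C.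
Proof.
  intros h. assert (hz := slit_neq_0 z (slit_Re z h)).
  assert (B : 0 < INR (S r)) by (apply lt_0_INR; lia).
  assert (E : (2 * S r = S (S (2 * r)))%nat) by lia.
  unfold K0t, K1t. rewrite E.
  eapply cderiv_eq; [|apply cderiv_scal, cderiv_mult; [apply (cderiv_pow z (S (2 * r)))|
    apply cderiv_minus; [apply cderiv_const|apply cderiv_Lg; easy]]].
  rewrite INR_2S, <- tc_S, hsum_S.
  rewrite !RtoC_minus, !RtoC_plus, !RtoC_mult, !RtoC_inv, !RtoC_mult by lra.
  assert (hs : RtoC (INR (S r)) <> 0%C) by (intros X; apply RtoC_inj in X; lra).
  set (w := (z ^ (2 * r))%C).
  change (z ^ S (S (2 * r)))%C with (z * (z * w))%C. change (z ^ S (2 * r))%C with (z * w)%C.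
  field. repeat split; easy.
Qed.

Lemma ln_2_bound : 0 < ln 2 <= 1.
Proof.
  split; [rewrite <- ln_1; apply ln_increasing; lra|].
  assert (H := ln_le_sub_1 2). lra.
Qed.

Lemma small_term c n x : 0 < x <= 1 ->
  Cmod (RtoC x ^ S (S n) * (Lg x + c))%C <= x * (2 + Cmod c).
Proof.
  intros hx. rewrite Cmod_mult, Cmod_pow, Cmod_R, Rabs_pos_eq by lra.
  assert (L : x * Cmod (Lg x + c)%C <= 2 + Cmod c).
  { assert (T := Cmod_triangle (Lg x) c).
    assert (B : Cmod (Lg x)%C <= / x + 1).
    { unfold Lg. rewrite Clog_RtoC, <- RtoC_minus, Cmod_R by lra.
      assert (A := ln_2_bound). assert (D := ln_le_sub_1 (/ x) ltac:(apply Rinv_0_lt_compat; lra)).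
      rewrite ln_Rinv in D by lra. assert (D2 := ln_le_sub_1 x ltac:(lra)).
      apply Rabs_le. lra. }
    apply Rle_trans with (x * (/ x + 1 + Cmod c)); [apply Rmult_le_compat_l; lra|].
    rewrite !Rmult_plus_distr_l, Rinv_r by lra. assert (H := Cmod_ge_0 c). nra. }
  assert (P : 0 <= x ^ n <= 1) by (split; [apply pow_le; lra|apply pow_le_1; lra]).
  simpl. assert (H := Cmod_ge_0 (Lg x + c)).
  replace (x * (x * x ^ n) * Cmod (Lg x + c)%C) with (x ^ n * (x * (x * Cmod (Lg x + c)%C))) by ring.
  rewrite <- (Rmult_1_l (x * (2 + Cmod c))).
  apply Rmult_le_compat; try lra.
  - apply Rmult_le_pos; [lra|]. apply Rmult_le_pos; lra.
  - apply Rmult_le_compat_l; lra.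
Qed.

Lemma sum_bound_linear (u : nat -> C -> C) n :
  (forall k, exists B, forall x, 0 < x <= 1 -> Cmod (u k (RtoC x))%C <= B * x) ->
  exists B, 0 <= B /\ forall x, 0 < x <= 1 -> Cmod (Csum (fun k => u k (RtoC x)) n)%C <= B * x.
Proof.
  intros H. induction n as [|n [B [hB IH]]].
  - exists 0. split; [lra|]. intros x hx. simpl. rewrite Cmod_0. lra.
  - destruct (H n) as [B' HB']. exists (B + Rabs B'). split.
    { assert (T := Rabs_pos B'). lra. }
    intros x hx. simpl. eapply Rle_trans; [apply Cmod_triangle|].
    specialize (IH x hx). specialize (HB' x hx). assert (T := Rle_abs B'). nra.
Qed.

Lemma K1t_small r : exists B, forall x, 0 < x <= 1 -> Cmod (K1t r (RtoC x))%C <= B * x.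
Proof.
  set (c := RtoC (Euler_gamma - hsum r - / (2 * INR (S r)))).
  exists (Rabs (sc r) * (2 + Cmod c)). intros x hx. unfold K1t. fold c.
  assert (E : (2 * S r = S (S (2 * r)))%nat) by lia. rewrite E.
  rewrite Cmod_mult, Cmod_R. rewrite Rmult_assoc, (Rmult_comm _ x).
  apply Rmult_le_compat_l; [apply Rabs_pos|]. apply small_term; easy.
Qed.

Lemma K0t_small r : exists B, forall x, 0 < x <= 1 -> Cmod (K0t (S r) (RtoC x))%C <= B * x.
Proof.
  set (c := (- RtoC (hsum (S r) - Euler_gamma))%C).
  exists (Rabs (tc (S r)) * (2 + Cmod c)). intros x hx. unfold K0t.
  assert (E : (2 * S r = S (S (2 * r)))%nat) by lia. rewrite E.
  rewrite Cmod_mult, Cmod_R. rewrite Rmult_assoc, (Rmult_comm _ x).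
  apply Rmult_le_compat_l; [apply Rabs_pos|].
  replace (RtoC x ^ S (S (2 * r)) * (RtoC (hsum (S r) - Euler_gamma) - Lg x))%C
    with (- (RtoC x ^ S (S (2 * r)) * (Lg x + c)))%C by (unfold c; ring).
  rewrite Cmod_opp. apply small_term; easy.
Qed.

Lemma linear_to_limit (E : C -> C) B : 0 <= B ->
  (forall x, 0 < x <= 1 -> Cmod (E (RtoC x))%C <= B * x) ->
  forall eps, 0 < eps -> exists r, 0 < r /\ forall x, 0 < x < r -> Cmod (E (RtoC x))%C <= eps.
Proof.
  intros hB H eps he. exists (Rmin 1 (eps / (B + 1))). split.
  { apply Rmin_pos; [lra|]. apply Rdiv_lt_0_compat; lra. }
  intros x hx. assert (A := Rmin_l 1 (eps / (B + 1))). assert (D := Rmin_r 1 (eps / (B + 1))).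
  eapply Rle_trans; [apply H; lra|].
  apply Rle_trans with ((B + 1) * (eps / (B + 1))); [apply Rmult_le_compat; lra|].
  apply Req_le. field. lra.
Qed.

(** Bootstrap with the pair [K0' = - K1] and [(z K1)' = - z K0]. An expansion of [K0] with error
    [|z|^(2J-1)] integrates to one of [z K1] with error [|z|^(2J+1)]; dividing by [z] and
    integrating again gives [K0] with one more term. The limits [BK1_limit] and [BK0_limit] fix the
    constants of integration, and the terms [K0t] and [K1t] differentiate into each other in the
    same way. *)
Lemma BK_expansion s J : 0 < s ->
  (exists A, 0 <= A /\ forall z, cone s z ->
    Cmod (BK 0 z - K0s J z)%C <= A * Rpower (Cmod z) (2 * INR J - 1)) /\
  (exists A, 0 <= A /\ forall z, cone s z ->
    Cmod (z * BK 1 z - (1 + K1s J z))%C <= A * Rpower (Cmod z) (2 * INR J + 1)).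
Proof.
  intros hs.
  assert (Step1 : forall J, (exists A, 0 <= A /\ forall z, cone s z ->
      Cmod (BK 0 z - K0s J z)%C <= A * Rpower (Cmod z) (2 * INR J - 1)) ->
    (exists A, 0 <= A /\ forall z, cone s z ->
      Cmod (z * BK 1 z - (1 + K1s J z))%C <= A * Rpower (Cmod z) (2 * INR J + 1))).
  { intros n [A [hA HA]].
    apply (cone_int s (2 * INR n) A _ (fun z => - (z * (BK 0 z - K0s n z)))%C hs); try easy.
    - assert (H := pos_INR n). lra.
    - intros z hz. assert (hre := cone_rhp s z (Rlt_le _ _ hs) hz).
      eapply cderiv_eq; [|apply cderiv_minus; [apply cderiv_zBK1; easy|
        apply cderiv_plus; [apply cderiv_const|
        apply (cderiv_Csum K1t (fun r => - (z * K0t r z))%C); intros k; apply cderiv_K1t; easy]]].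
      unfold K0s.
      rewrite (Csum_ext (fun r => - (z * K0t r z))%C (fun r => (- z) * K0t r z)%C) by (intros; ring).
      rewrite Csum_scal. ring.
    - intros z hz. assert (hre := cone_rhp s z (Rlt_le _ _ hs) hz).
      assert (hm : 0 < Cmod z) by (apply Cmod_gt_0, slit_neq_0, slit_Re; easy).
      rewrite Cmod_opp, Cmod_mult.
      replace (2 * INR n) with (2 * INR n - 1 + 1) by ring.
      rewrite Rpower_plus, Rpower_1 by easy.
      specialize (HA z hz). nra.
    - destruct (sum_bound_linear K1t n K1t_small) as [B [hB HB]].
      apply (linear_to_limit (fun z => z * BK 1 z - (1 + K1s n z))%C (8 + B)); [lra|]. intros x hx.
      replace (x * BK 1 x - (1 + K1s n x))%C with ((x * BK 1 x - 1) - K1s n x)%C by ring.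
      eapply Rle_trans; [apply Cmod_minus_triangle|].
      assert (H1 := BK1_limit x (proj1 hx)). specialize (HB x hx). unfold K1s. lra. }
  assert (Main : exists A, 0 <= A /\ forall z, cone s z ->
    Cmod (BK 0 z - K0s J z)%C <= A * Rpower (Cmod z) (2 * INR J - 1)).
  { induction J as [|n IH].
    (* Before any term is subtracted, [Lap_bound] gives [8 / Re z], and [Re z] exceeds [s * Cmod z]
       in the cone. *)
    - exists (8 / s). split; [apply Rdiv_le_0_compat; lra|]. intros z hz.
      assert (hre := cone_rhp s z (Rlt_le _ _ hs) hz).
      assert (hm : 0 < Cmod z) by (apply Cmod_gt_0, slit_neq_0, slit_Re; easy).
      unfold K0s. simpl Csum. replace (BK 0 z - 0)%C with (BK 0 z) by ring.
      assert (H := Lap_bound cosh 0 1 z cosh_good hre ltac:(lia)).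
      eapply Rle_trans; [exact H|]. simpl. rewrite !Rmult_1_r.
      replace (2 * 0 - 1) with (- (1)) by ring. rewrite Rpower_Ropp, Rpower_1 by easy.
      unfold cone in hz.
      replace (8 / s * / Cmod z) with (8 / (s * Cmod z)) by (field; lra).
      apply Rmult_le_compat_l; [lra|]. apply Rinv_le_contravar; [apply Rmult_lt_0_compat; lra|lra].
    - destruct (Step1 n IH) as [A [hA HA]].
      assert (X : 2 * INR (S n) - 1 = 2 * INR n + 1) by (rewrite S_INR; ring).
      rewrite X.
      apply (cone_int s (2 * INR n) A _ (fun z => - ((z * BK 1 z - (1 + K1s n z)) / z))%C hs); try easy.
      + assert (H := pos_INR n). lra.
      + intros z hz. assert (hre := cone_rhp s z (Rlt_le _ _ hs) hz).
        assert (h0 := slit_neq_0 z (slit_Re z hre)).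
        eapply cderiv_eq; [|apply cderiv_minus; [apply cderiv_BK0; easy|]].
        2:{ apply cderiv_ext with (fun z => K0t 0 z + Csum (fun k => K0t (S k) z) n)%C.
            { intros w. unfold K0s. rewrite Csum_S_l. easy. }
            apply cderiv_plus; [apply cderiv_K0t_0; easy|].
            apply (cderiv_Csum (fun k => K0t (S k)) (fun r => - (K1t r z / z))%C).
            intros k. apply cderiv_K0t_S; easy. }
        unfold K1s.
        rewrite (Csum_ext (fun r => - (K1t r z / z))%C (fun r => (- / z) * K1t r z)%C)
          by (intros; unfold Cdiv; ring).
        rewrite Csum_scal. field. exact h0.
      + intros z hz. assert (hre := cone_rhp s z (Rlt_le _ _ hs) hz).
        assert (h0 := slit_neq_0 z (slit_Re z hre)).
        assert (hm : 0 < Cmod z) by (apply Cmod_gt_0; easy).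
        rewrite Cmod_opp, Cmod_div by easy. specialize (HA z hz).
        rewrite Rpower_plus, Rpower_1 in HA by easy.
        apply Rmult_le_reg_r with (Cmod z); [easy|].
        unfold Rdiv. rewrite Rmult_assoc, Rinv_l by lra. lra.
      + destruct (sum_bound_linear (fun k => K0t (S k)) n K0t_small) as [B [hB HB]].
        apply (linear_to_limit (fun z => BK 0 z - K0s (S n) z)%C (3 + B)); [lra|]. intros x hx.
        assert (EK : (BK 0 x - K0s (S n) x)%C = (BK 0 x + RtoC (ln (x / 2) + Euler_gamma)
          - Csum (fun k => K0t (S k) x) n)%C).
        { unfold K0s. rewrite Csum_S_l. unfold K0t at 1, tc, hsum, Lg. simpl.
          rewrite Clog_RtoC, ln_div, !RtoC_plus, !RtoC_minus by lra.
          replace (/ (1 * (1 * 1))) with 1 by field. ring. }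
        rewrite EK. eapply Rle_trans; [apply Cmod_minus_triangle|].
        assert (H1 := BK0_limit x ltac:(lra)). specialize (HB x hx). lra. }
  split; [exact Main|]. apply Step1, Main.
Qed.

Lemma BK1_expansion s J : 0 < s -> exists A, 0 <= A /\ forall z, cone s z ->
  Cmod (BK 1 z - (1 + K1s J z) / z)%C <= A * Rpower (Cmod z) (2 * INR J).
Proof.
  intros hs. destruct (proj2 (BK_expansion s J hs)) as [A [hA HA]]. exists A. split; [easy|].
  intros z hz. assert (hre := cone_rhp s z (Rlt_le _ _ hs) hz).
  assert (h0 := slit_neq_0 z (slit_Re z hre)).
  assert (hm : 0 < Cmod z) by (apply Cmod_gt_0; easy). specialize (HA z hz).
  replace (BK 1 z - (1 + K1s J z) / z)%C with ((z * BK 1 z - (1 + K1s J z)) / z)%C by (field; easy).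
  rewrite Cmod_div by easy. rewrite Rpower_plus, Rpower_1 in HA by easy.
  apply Rmult_le_reg_r with (Cmod z); [easy|].
  unfold Rdiv. rewrite Rmult_assoc, Rinv_l by lra. lra.
Qed.

(** * Euler-Maclaurin summation *)

(** A course-of-values recursion made structural: [bseq N] tabulates the first [N] coefficients, and
    each further stage adds one entry without changing the others. *)
Fixpoint bseq (N : nat) : nat -> R :=
  match N with
  | O => fun _ => 0
  | S M => fun k => if Nat.eqb k M
      then (if Nat.eqb M 0 then 1 else 0) - Rsum (fun j => bseq M j / INR (fact (S M - j))) M
      else bseq M k
  end.

(* The Euler-Maclaurin coefficients [B_k / k!], defined by the triangular system that makes the
   formula [F' a = sum_k bcoef k * (F^(k) (a + 1) - F^(k) a)] exact on polynomials. *)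
Definition bcoef (k : nat) : R := bseq (S k) k.

Lemma bseq_stable N k : (k < N)%nat -> bseq N k = bcoef k.
Proof.
  intros h. induction N as [|N IH]; [lia|].
  destruct (Nat.eq_dec k N) as [->|hk]; [easy|].
  simpl. destruct (Nat.eqb_spec k N) as [E|E]; [lia|]. apply IH. lia.
Qed.

Lemma Rsum_ext u v n : (forall k, (k < n)%nat -> u k = v k) -> Rsum u n = Rsum v n.
Proof.
  induction n as [|n IH]; intros H; [easy|]. simpl. rewrite IH, H; [easy|lia|].
  intros k hk. apply H. lia.
Qed.

Lemma bcoef_eq N : bcoef N =
  (if Nat.eqb N 0 then 1 else 0) - Rsum (fun j => bcoef j / INR (fact (S N - j))) N.
Proof.
  unfold bcoef at 1. cbn [bseq]. rewrite Nat.eqb_refl. f_equal. apply Rsum_ext.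
  intros k hk. rewrite bseq_stable by easy. easy.
Qed.

Lemma bcoef_0 : bcoef 0 = 1.
Proof. unfold bcoef. simpl. ring. Qed.

Lemma Csum_plus u v n : Csum (fun k => u k + v k)%C n = (Csum u n + Csum v n)%C.
Proof. induction n as [|n IH]; simpl; [ring|]. rewrite IH. ring. Qed.

Lemma Csum_minus u v n : Csum (fun k => u k - v k)%C n = (Csum u n - Csum v n)%C.
Proof. induction n as [|n IH]; simpl; [ring|]. rewrite IH. ring. Qed.

Lemma Csum_RtoC u n : Csum (fun k => RtoC (u k)) n = RtoC (Rsum u n).
Proof. induction n as [|n IH]; simpl; [easy|]. rewrite IH, RtoC_plus. easy. Qed.

Lemma rderiv_monomial a n t : rderiv (fun t => RtoC ((t - a) ^ S n / INR (fact (S n)))) t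
  (RtoC ((t - a) ^ n / INR (fact n))).
Proof.
  apply (rderiv_RtoC_comp (fun t => (t - a) ^ S n / INR (fact (S n)))).
  assert (A := INR_fact_lt_0 n). assert (B : 0 < INR (S n)) by (apply lt_0_INR; lia).
  apply (is_derive_ext (fun t => / INR (fact (S n)) * (t - a) ^ S n)); [intros; apply Rmult_comm|].
  apply is_derive_Reals.
  replace ((t - a) ^ n / INR (fact n)) with (/ INR (fact (S n)) * (INR (S n) * (t - a) ^ n * (1 - 0))).
  - apply derivable_pt_lim_scal.
    apply (derivable_pt_lim_comp (fun t => t - a) (fun x => x ^ S n)).
    + apply derivable_pt_lim_minus; [apply derivable_pt_lim_id|apply derivable_pt_lim_const].
    + apply derivable_pt_lim_pow.
  - rewrite fact_simpl, mult_INR. field. lra.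
Qed.

Lemma Euler_Maclaurin_step N : exists A, 0 <= A /\ forall (f : nat -> R -> C) a M,
  (forall k t, (k <= N)%nat -> a <= t <= a + 1 -> rderiv (f k) t (f (S k) t)) ->
  (forall t, a <= t <= a + 1 -> Cmod (f (S N) t)%C <= M) ->
  Cmod (f 1%nat a - Csum (fun k => RtoC (bcoef k) * (f k (a + 1)%R - f k a)) N)%C <= A * M.
Proof.
  induction N as [|N [A [hA IH]]].
  - exists 1. split; [lra|]. intros f a M Hd HM. simpl.
    replace (f 1%nat a - 0)%C with (f 1%nat a) by ring. rewrite Rmult_1_l. apply HM. lra.
  - exists (A + Rabs (bcoef N)). split; [assert (T := Rabs_pos (bcoef N)); lra|].
    intros f a M Hd HM.
    (* Subtracting [c (t - a)^(N+1) / (N+1)!] makes the derivative of order [N + 1] vanish at [a],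
       hence bounded by [M] on the interval, so the induction hypothesis applies to [q]. The
       recursion [bcoef_eq] states exactly what the monomial contributes. *)
    set (c := f (S N) a).
    set (q := fun k t => if (k <=? S N)%nat
       then (f k t - c * RtoC ((t - a) ^ (S N - k) / INR (fact (S N - k))))%C else f k t).
    assert (Q : Cmod (q 1%nat a - Csum (fun k => RtoC (bcoef k) * (q k (a + 1)%R - q k a)) N)%C <= A * M).
    { apply IH.
      - intros k t hk ht. unfold q.
        destruct (Nat.leb_spec k (S N)) as [_|h]; [|lia].
        destruct (Nat.leb_spec (S k) (S N)) as [_|h]; [|lia].
        replace (S N - k)%nat with (S (S N - S k)) by lia.
        apply rderiv_eq with (f (S k) t + (- c) * RtoC ((t - a) ^ (S N - S k) / INR (fact (S N - S k))))%C;
          [ring|].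
        apply rderiv_ext with (fun t => f k t + (- c) * RtoC ((t - a) ^ S (S N - S k) / INR (fact (S (S N - S k)))))%C;
          [intros; ring|].
        apply rderiv_plus; [apply Hd; lia || easy|]. apply rderiv_scal, rderiv_monomial.
      - intros t ht. unfold q. rewrite Nat.leb_refl, Nat.sub_diag. simpl.
        replace (f (S N) t - c * RtoC (1 / 1))%C with (f (S N) t - f (S N) a)%C.
        2:{ replace (1 / 1) with 1 by field. unfold c. ring. }
        assert (K := cmvt (f (S N)) (f (S (S N))) M a t ltac:(lra)).
        assert (HM0 : 0 <= M) by (eapply Rle_trans; [apply Cmod_ge_0|apply (HM a); lra]).
        apply Rle_trans with (M * (t - a)); [|nra]. apply K.
        + intros s hs. apply Hd; lia || lra.
        + intros s hs. apply HM; lra. }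
    assert (Dl : Cmod (f N (a + 1)%R - f N a - c)%C <= M).
    { assert (HM0 : 0 <= M) by (eapply Rle_trans; [apply Cmod_ge_0|apply (HM a); lra]).
      assert (K := cmvt (fun t => f N t + RtoC t * (- c))%C (fun t => f (S N) t + (- c))%C M a (a + 1) ltac:(lra)).
      cbv beta in K.
      replace (f N (a + 1)%R + RtoC (a + 1) * - c - (f N a + RtoC a * - c))%C
        with (f N (a + 1)%R - f N a - c)%C in K by (rewrite RtoC_plus; ring).
      replace M with (M * (a + 1 - a)) by ring. apply K.
      - intros t ht. apply rderiv_plus; [apply Hd; lia || lra|].
        eapply rderiv_ext; [|apply (rderiv_line 0 (- c))]. intros s. simpl. ring.
      - intros t ht.
        assert (K2 := cmvt (f (S N)) (f (S (S N))) M a t ltac:(lra)).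
        apply Rle_trans with (M * (t - a)); [|nra].
        replace (f (S N) t + - c)%C with (f (S N) t - f (S N) a)%C by (unfold c; ring). apply K2.
        + intros s hs. apply Hd; lia || lra.
        + intros s hs. apply HM; lra. }
    assert (Eq : (f 1%nat a - Csum (fun k => RtoC (bcoef k) * (f k (a + 1)%R - f k a)) N - c * RtoC (bcoef N))%C
       = (q 1%nat a - Csum (fun k => RtoC (bcoef k) * (q k (a + 1)%R - q k a)) N)%C).
    { assert (Eq1 : q 1%nat a = (f 1%nat a - c * RtoC (if Nat.eqb N 0 then 1 else 0))%C).
      { unfold q. destruct (Nat.leb_spec 1 (S N)) as [_|h]; [|lia].
        replace (S N - 1)%nat with N by lia. replace (a - a) with 0 by ring.
        destruct N as [|N']; simpl; [replace (1 / 1) with 1 by field; easy|].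
        replace (0 * 0 ^ N' / INR (fact N' + N' * fact N')) with 0 by (unfold Rdiv; ring). easy. }
      rewrite Eq1.
      rewrite (Csum_ext (fun k => RtoC (bcoef k) * (q k (a + 1)%R - q k a))%C
        (fun k => RtoC (bcoef k) * (f k (a + 1)%R - f k a) - c * RtoC (bcoef k / INR (fact (S N - k))))%C).
      2:{ intros k hk. unfold q. destruct (Nat.leb_spec k (S N)) as [_|h]; [|lia].
          replace (a + 1 - a) with 1 by ring. replace (a - a) with 0 by ring.
          rewrite pow1, pow_i by lia. unfold Rdiv. rewrite !RtoC_mult. ring. }
      rewrite Csum_minus, Csum_scal, Csum_RtoC, (bcoef_eq N), RtoC_minus. ring. }
    cbn [Csum].
    replace (f 1%nat a - (Csum (fun k => RtoC (bcoef k) * (f k (a + 1)%R - f k a)) N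
        + RtoC (bcoef N) * (f N (a + 1)%R - f N a)))%C
      with ((f 1%nat a - Csum (fun k => RtoC (bcoef k) * (f k (a + 1)%R - f k a)) N - c * RtoC (bcoef N))
        - RtoC (bcoef N) * (f N (a + 1)%R - f N a - c))%C by ring.
    rewrite Eq.
    eapply Rle_trans; [apply Cmod_minus_triangle|]. rewrite Cmod_mult, Cmod_R.
    assert (Rabs (bcoef N) * Cmod (f N (a + 1)%R - f N a - c)%C <= Rabs (bcoef N) * M)
      by (apply Rmult_le_compat_l; [apply Rabs_pos|easy]).
    lra.
Qed.

(** * The Euler-Maclaurin functional and its bounds in cones *)

Fixpoint Dn (k : nat) (f : C -> C) : C -> C :=
  match k with O => f | S j => C_derive (Dn j f) end.

Lemma holo_Dn U k f : copen U -> holo U f -> holo U (Dn k f).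
Proof. intros HU H. induction k as [|k IH]; [easy|]. apply holo_derive; easy. Qed.

Lemma Dn_ext U k f g z : copen U -> holo U f -> (forall z, U z -> f z = g z) -> U z -> Dn k f z = Dn k g z.
Proof.
  intros HU H E. revert z. induction k as [|k IH]; intros z hz; [apply E; easy|].
  apply (C_derive_ext U); try easy. apply holo_Dn; easy.
Qed.

Lemma Dn_plus U k f g z : copen U -> holo U f -> holo U g -> U z ->
  Dn k (fun w => f w + g w)%C z = (Dn k f z + Dn k g z)%C.
Proof.
  intros HU Hf Hg. revert z. induction k as [|k IH]; intros z hz; [easy|].
  change (C_derive (Dn k (fun w => f w + g w)%C) z = (C_derive (Dn k f) z + C_derive (Dn k g) z)%C).
  rewrite (C_derive_ext U _ (fun w => Dn k f w + Dn k g w)%C z HU IH).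
  - apply cderiv_C_derive, cderiv_plus; eapply holo_cderiv; try eassumption; apply holo_Dn; easy.
  - apply holo_Dn; [easy|]. apply holo_plus; easy.
  - easy.
Qed.

Lemma Dn_scal U k c f z : copen U -> holo U f -> U z -> Dn k (fun w => c * f w)%C z = (c * Dn k f z)%C.
Proof.
  intros HU Hf. revert z. induction k as [|k IH]; intros z hz; [easy|].
  change (C_derive (Dn k (fun w => c * f w)%C) z = (c * C_derive (Dn k f) z)%C).
  rewrite (C_derive_ext U _ (fun w => c * Dn k f w)%C z HU IH).
  - apply cderiv_C_derive, cderiv_scal; eapply holo_cderiv; try eassumption; apply holo_Dn; easy.
  - apply holo_Dn; [easy|]. apply holo_scal; easy.
  - easy.
Qed.

Lemma Dn_const k c z : Dn (S k) (fun _ => c) z = 0%C.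
Proof.
  revert z. induction k as [|k IH]; intros z.
  - apply cderiv_C_derive, cderiv_const.
  - change (C_derive (Dn (S k) (fun _ => c)) z = 0%C).
    apply cderiv_C_derive. apply cderiv_ext with (fun _ => 0%C); [intros; symmetry; apply IH|].
    apply cderiv_const.
Qed.

(* Partial sums [sum_{n <= m} F' n], corrected by the Euler-Maclaurin boundary terms at [m + 1]. *)
Definition LamS (N m : nat) (F : C -> C) : C :=
  (Csum (fun n => C_derive F (RtoC (INR (S n)))) m
   - Csum (fun k => RtoC (bcoef k) * Dn k F (RtoC (INR (S m)))) N)%C.

Lemma LamS_step N : exists A, 0 <= A /\ forall U F m M, copen U -> holo U F ->
  (forall t, INR (S m) <= t <= INR (S m) + 1 -> U (RtoC t) /\ Cmod (Dn (S N) F (RtoC t))%C <= M) ->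
  Cmod (LamS N (S m) F - LamS N m F)%C <= A * M.
Proof.
  destruct (Euler_Maclaurin_step N) as [A [hA HA]]. exists A. split; [easy|].
  intros U F m M HU HF H.
  assert (E := HA (fun k t => Dn k F (RtoC t)) (INR (S m)) M).
  unfold LamS. cbn [Csum].
  replace (Csum (fun n => C_derive F (RtoC (INR (S n)))) m + C_derive F (RtoC (INR (S m)))
     - Csum (fun k => RtoC (bcoef k) * Dn k F (RtoC (INR (S (S m))))) N
     - (Csum (fun n => C_derive F (RtoC (INR (S n)))) m
     - Csum (fun k => RtoC (bcoef k) * Dn k F (RtoC (INR (S m)))) N))%C
    with (Dn 1 F (RtoC (INR (S m))) - Csum (fun k => RtoC (bcoef k) *
       (Dn k F (RtoC (INR (S m) + 1)) - Dn k F (RtoC (INR (S m))))) N)%C.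
  - apply E.
    + intros k t _ ht. apply rderiv_of_cderiv. apply (holo_cderiv U); [apply holo_Dn; easy|].
      apply H; easy.
    + intros t ht. apply H; easy.
  - rewrite (Csum_ext (fun k => RtoC (bcoef k) * (Dn k F (RtoC (INR (S m) + 1)) - Dn k F (RtoC (INR (S m)))))%C
      (fun k => RtoC (bcoef k) * Dn k F (RtoC (INR (S (S m)))) - RtoC (bcoef k) * Dn k F (RtoC (INR (S m))))%C).
    + rewrite Csum_minus. change (Dn 1 F) with (C_derive F). ring.
    + intros k _. rewrite (S_INR (S m)). ring.
Qed.

Lemma Rpower_ratio r x m : 0 < r -> r / 2 <= x <= 2 * r -> Rpower x m <= Rpower 2 (Rabs m) * Rpower r m.
Proof.
  intros hr hx. unfold Rpower. rewrite <- exp_plus. apply exp_le.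
  assert (L : Rabs (ln x - ln r) <= ln 2).
  { assert (A : ln x <= ln (2 * r)) by (apply ln_le; lra).
    assert (B : ln (r / 2) <= ln x) by (apply ln_le; lra).
    rewrite ln_mult in A by lra. rewrite ln_div in B by lra. apply Rabs_le. lra. }
  assert (T := Rle_abs (m * (ln x - ln r))). rewrite Rabs_mult in T.
  assert (Rabs m * Rabs (ln x - ln r) <= Rabs m * ln 2) by (apply Rmult_le_compat_l; [apply Rabs_pos|easy]).
  lra.
Qed.

(** Around a point [z] of the narrower cone the disc of radius [e |z|], with [e] half the gap
    between the parameters, stays in the wider cone. Moduli change there by at most a factor 2, so
    Cauchy's estimate gains one power of [1 / |z|]. *)
Lemma cone_D1 s s' m : 0 < s -> s < s' -> s' < 1 -> exists A, 0 <= A /\ forall F B,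
  holo (cone s) F -> (forall z, cone s z -> Cmod (F z)%C <= B * Rpower (Cmod z) m) ->
  forall z, cone s' z -> Cmod (C_derive F z)%C <= A * B * Rpower (Cmod z) (m - 1).
Proof.
  intros hs hss hs'. set (e := (s' - s) / 2). assert (he : 0 < e <= 1 / 2) by (unfold e; lra).
  exists (Rpower 2 (Rabs m) / e).
  assert (P2 := Rpower_pos 2 (Rabs m)).
  split; [apply Rdiv_le_0_compat; lra|].
  intros F B HF HB z hz.
  assert (hre := cone_rhp s' z ltac:(lra) hz).
  assert (hm : 0 < Cmod z) by (apply Cmod_gt_0, slit_neq_0, slit_Re; easy).
  set (r := Cmod z) in *.
  assert (hB : 0 <= B).
  { assert (T := HB z). unfold cone in *. specialize (T ltac:(fold r in hz |- *; nra)).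
    assert (0 <= B * Rpower (Cmod z) m) by (eapply Rle_trans; [apply Cmod_ge_0|exact T]).
    assert (Q := Rpower_pos (Cmod z) m). nra. }
  replace (Rpower 2 (Rabs m) / e * B * Rpower r (m - 1)) with
    (B * (Rpower 2 (Rabs m) * Rpower r m) / (e * r)).
  2:{ unfold Rminus. rewrite Rpower_plus, Rpower_Ropp, Rpower_1 by easy. field. lra. }
  apply (Cauchy_estimate (cone s)); [apply copen_cone; lra|easy|apply Rmult_lt_0_compat; lra|].
  intros w hw. assert (T1 := Cmod_rev_triangle z w). rewrite Cmod_minus_sym in T1.
  assert (T2 := Cmod_rev_triangle w z). fold r in T1, T2.
  assert (T3 := re_le_Cmod (w - z)). apply Rabs_le_between in T3.
  change (Re (w - z)) with (Re w - Re z) in T3.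
  assert (hcw : cone s w).
  { unfold cone in *. fold r in hz.
    assert (s * Cmod w <= s * (r + e * r)) by (apply Rmult_le_compat_l; lra).
    assert (s * (r + e * r) <= (s' - e) * r); [|lra].
    unfold e in *. nra. }
  split; [easy|]. eapply Rle_trans; [apply HB; easy|]. apply Rmult_le_compat_l; [easy|].
  apply Rpower_ratio; nra.
Qed.

Lemma cone_Dn k : forall s s' m, 0 < s -> s < s' -> s' < 1 -> exists A, 0 <= A /\ forall F B,
  holo (cone s) F -> (forall z, cone s z -> Cmod (F z)%C <= B * Rpower (Cmod z) m) ->
  forall z, cone s' z -> Cmod (Dn k F z)%C <= A * B * Rpower (Cmod z) (m - INR k).
Proof.
  induction k as [|k IH]; intros s s' m hs hss hs'.
  - exists 1. split; [lra|]. intros F B HF HB z hz. rewrite Rminus_0_r, Rmult_1_l. apply HB.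
    unfold cone in *. assert (H := Cmod_ge_0 z). nra.
  - destruct (IH s ((s + s') / 2) m hs ltac:(lra) ltac:(lra)) as [A [hA HA]].
    destruct (cone_D1 ((s + s') / 2) s' (m - INR k) ltac:(lra) ltac:(lra) ltac:(lra)) as [A' [hA' HA']].
    exists (A' * A). split; [apply Rmult_le_pos; easy|]. intros F B HF HB z hz.
    rewrite S_INR. replace (m - (INR k + 1)) with (m - INR k - 1) by ring. rewrite (Rmult_assoc A' A B).
    apply (HA' (Dn k F)); [|apply HA; easy|easy].
    apply holo_Dn; [apply copen_cone; lra|].
    apply (holo_subset (cone s)); [|easy]. intros w hw. unfold cone in *.
    assert (H := Cmod_ge_0 w). nra.
Qed.

Lemma cone_RtoC s x : s < 1 -> 0 < x -> cone s (RtoC x).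
Proof. intros hs hx. unfold cone. rewrite Cmod_R, Rabs_pos_eq by lra. simpl. nra. Qed.

Lemma inv_sqr_telescope x : 1 <= x -> / (x * x) <= 2 * (/ x - / (x + 1)).
Proof.
  intros hx. apply Rmult_le_reg_r with (x * x * (x + 1)); [nra|].
  replace (/ (x * x) * (x * x * (x + 1))) with (x + 1) by (field; lra).
  replace (2 * (/ x - / (x + 1)) * (x * x * (x + 1))) with (2 * x) by (field; lra). lra.
Qed.

(** Each increment is the error of one Euler-Maclaurin step, of order [1 / x^2], and
    [inv_sqr_telescope] sums these errors to [1 / INR (S n)]. *)
Lemma LamS_tail N : exists A, 0 <= A /\ forall U F M, copen U -> holo U F ->
  (forall t, 1 <= t -> U (RtoC t) /\ Cmod (Dn (S N) F (RtoC t))%C <= M / (t * t)) ->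
  forall n p, (n <= p)%nat -> Cmod (LamS N p F - LamS N n F)%C <= A * M / INR (S n).
Proof.
  destruct (LamS_step N) as [A0 [hA0 HA0]].
  exists (2 * A0). split; [lra|]. intros U F M HU HF H.
  assert (hM : 0 <= M).
  { destruct (H 1 (Rle_refl 1)) as [_ T]. assert (G := Cmod_ge_0 (Dn (S N) F (RtoC 1))). lra. }
  assert (hQ : 0 <= A0 * M) by (apply Rmult_le_pos; easy).
  assert (St : forall n, Cmod (LamS N (S n) F - LamS N n F)%C <= 2 * A0 * M * (/ INR (S n) - / INR (S (S n)))).
  { intros n. assert (hn : 1 <= INR (S n)) by (rewrite S_INR; assert (T := pos_INR n); lra).
    set (x := INR (S n)) in *.
    eapply Rle_trans.
    - apply (HA0 U F n (M * / (x * x))); [easy|easy|].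
      fold x. intros t ht. destruct (H t ltac:(lra)) as [h1 h2]. split; [easy|].
      eapply Rle_trans; [exact h2|]. apply Rmult_le_compat_l; [easy|].
      apply Rinv_le_contravar; nra.
    - rewrite (S_INR (S n)). fold x. assert (T := inv_sqr_telescope x hn).
      replace (A0 * (M * / (x * x))) with (A0 * M * / (x * x)) by ring.
      replace (2 * A0 * M * (/ x - / (x + 1))) with (A0 * M * (2 * (/ x - / (x + 1)))) by ring.
      apply Rmult_le_compat_l; easy. }
  assert (Tl : forall n p, (n <= p)%nat ->
    Cmod (LamS N p F - LamS N n F)%C <= 2 * A0 * M * (/ INR (S n) - / INR (S p))).
  { intros n p h. induction h as [|p h IH].
    - replace (LamS N n F - LamS N n F)%C with (RtoC 0) by ring. rewrite Cmod_0. lra.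
    - eapply Rle_trans; [apply Cmod_split with (y := LamS N p F)|].
      specialize (St p). lra. }
  intros n p h. eapply Rle_trans; [apply Tl; easy|].
  assert (P2 := inv_INR_S p).
  apply Rmult_le_compat_l; lra.
Qed.

Lemma Rpower_le_inv_sqr x e : 1 <= x -> e <= -2 -> Rpower x e <= / (x * x).
Proof.
  intros hx he. replace (/ (x * x)) with (Rpower x (-2)).
  - apply Rle_Rpower; lra.
  - replace (-2) with (- INR 2) by (simpl; ring). rewrite Rpower_Ropp, Rpower_pow by lra.
    f_equal. ring.
Qed.

(** The constant depends only on [s], [m] and [N], so the bound is linear in [B]. This uniformity
    turns a remainder that is small in [a] into an equally small error of the sum. The condition on
    [N] makes the derivative of order [N + 1] decay like [1 / t^2]. *)
Lemma LamS_bound s m N : 0 < s < 1 -> m - INR (S N) <= -2 -> exists A, 0 <= A /\ forall F B,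
  holo (cone s) F -> (forall z, cone s z -> Cmod (F z)%C <= B * Rpower (Cmod z) m) ->
  (forall n, Cmod (LamS N n F)%C <= A * B) /\
  (forall n p, (n <= p)%nat -> Cmod (LamS N p F - LamS N n F)%C <= A * B / INR (S n)).
Proof.
  intros hs hm.
  set (s' := (s + 1) / 2). assert (hs' : s < s' < 1) by (unfold s'; lra).
  assert (HD := fun k => cone_Dn k s s' m ltac:(lra) ltac:(lra) ltac:(lra)).
  destruct (LamS_tail N) as [A0 [hA0 HA0]].
  destruct (HD (S N)) as [A1 [hA1 HA1]].
  (* The initial value consists of boundary terms at the point 1 alone, where every power of the
     modulus equals 1. *)
  assert (H0 : exists A2, 0 <= A2 /\ forall F B, 0 <= B ->
    holo (cone s) F -> (forall z, cone s z -> Cmod (F z)%C <= B * Rpower (Cmod z) m) ->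
    Cmod (LamS N 0 F)%C <= A2 * B).
  { clear - HD hs'. unfold LamS. induction N as [|N [A [hA IH]]].
    - exists 0. split; [lra|]. intros F B hB HF HB. simpl. replace (0 - 0)%C with (RtoC 0) by ring.
      rewrite Cmod_0. lra.
    - destruct (HD N) as [A' [hA' HA']]. exists (A + Rabs (bcoef N) * A').
      split; [assert (T := Rabs_pos (bcoef N)); nra|]. intros F B hB HF HB.
      specialize (IH F B hB HF HB). specialize (HA' F B HF HB 1%C (cone_RtoC s' 1 ltac:(lra) ltac:(lra))).
      cbn [Csum] in *. simpl INR in *.
      assert (R1 : Rpower (Cmod 1) (m - INR N) = 1).
      { rewrite Cmod_1. unfold Rpower. rewrite ln_1, Rmult_0_r. apply exp_0. }
      rewrite R1, Rmult_1_r in HA'.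
      match goal with |- Cmod (Cminus _ (Cplus ?u ?v))%C <= _ => replace (0 - (u + v))%C with ((0 - u) - v)%C by ring end.
      eapply Rle_trans; [apply Cmod_minus_triangle|]. rewrite Cmod_mult, Cmod_R.
      assert (Rabs (bcoef N) * Cmod (Dn N F 1)%C <= Rabs (bcoef N) * (A' * B))
        by (apply Rmult_le_compat_l; [apply Rabs_pos|easy]).
      lra. }
  destruct H0 as [A2 [hA2 HA2]].
  assert (hQ : 0 <= A0 * A1) by (apply Rmult_le_pos; easy).
  exists (A2 + A0 * A1). split; [lra|]. intros F B HF HB.
  assert (hB : 0 <= B).
  { assert (T := HB 1%C (cone_RtoC s 1 ltac:(lra) ltac:(lra))).
    assert (P := Rpower_pos (Cmod 1) m). assert (G := Cmod_ge_0 (F 1%C)). nra. }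
  assert (Tl : forall n p, (n <= p)%nat -> Cmod (LamS N p F - LamS N n F)%C <= A0 * (A1 * B) / INR (S n)).
  { apply (HA0 (cone s)); [apply copen_cone; lra|easy|].
    intros t ht. split; [apply cone_RtoC; lra|].
    eapply Rle_trans; [apply (HA1 F B HF HB); apply cone_RtoC; lra|].
    rewrite Cmod_R, Rabs_pos_eq by lra.
    apply Rmult_le_compat_l; [apply Rmult_le_pos; easy|]. apply Rpower_le_inv_sqr; easy. }
  assert (hAB : 0 <= A2 * B) by (apply Rmult_le_pos; easy).
  split.
  - intros n. replace (LamS N n F) with (LamS N 0 F + (LamS N n F - LamS N 0 F))%C by ring.
    eapply Rle_trans; [apply Cmod_triangle|].
    assert (T1 := HA2 F B hB HF HB). assert (T2 := Tl 0%nat n ltac:(lia)).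
    simpl INR in T2. lra.
  - intros n p h. eapply Rle_trans; [apply Tl; easy|].
    assert (P1 := inv_INR_S n).
    apply Rmult_le_compat_r; lra.
Qed.

Lemma LamS_plus U N n F G : copen U -> holo U F -> holo U G -> (forall x, 0 < x -> U (RtoC x)) ->
  LamS N n (fun z => F z + G z)%C = (LamS N n F + LamS N n G)%C.
Proof.
  intros HU HF HG HP. unfold LamS.
  assert (P : forall k, U (RtoC (INR (S k)))) by (intros; apply HP, lt_0_INR; lia).
  rewrite (Csum_ext (fun k => C_derive (fun z => F z + G z)%C (RtoC (INR (S k))))
    (fun k => C_derive F (RtoC (INR (S k))) + C_derive G (RtoC (INR (S k))))%C).
  2:{ intros k _. apply (Dn_plus U 1 F G); auto. }
  rewrite (Csum_ext (fun k => bcoef k * Dn k (fun z => F z + G z) (RtoC (INR (S n))))%C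
    (fun k => bcoef k * Dn k F (RtoC (INR (S n))) + bcoef k * Dn k G (RtoC (INR (S n))))%C).
  2:{ intros k _. rewrite (Dn_plus U k F G); auto. ring. }
  rewrite !Csum_plus. ring.
Qed.

Lemma LamS_scal U N n c F : copen U -> holo U F -> (forall x, 0 < x -> U (RtoC x)) ->
  LamS N n (fun z => c * F z)%C = (c * LamS N n F)%C.
Proof.
  intros HU HF HP. unfold LamS.
  assert (P : forall k, U (RtoC (INR (S k)))) by (intros; apply HP, lt_0_INR; lia).
  rewrite (Csum_ext (fun k => C_derive (fun z => c * F z)%C (RtoC (INR (S k))))
    (fun k => c * C_derive F (RtoC (INR (S k))))%C).
  2:{ intros k _. apply (Dn_scal U 1 c F); auto. }
  rewrite (Csum_ext (fun k => bcoef k * Dn k (fun z => c * F z) (RtoC (INR (S n))))%C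
    (fun k => c * (bcoef k * Dn k F (RtoC (INR (S n)))))%C).
  2:{ intros k _. rewrite (Dn_scal U k c F); auto. ring. }
  rewrite !Csum_scal. ring.
Qed.

Lemma LamS_ext U N n F G : copen U -> holo U F -> (forall z, U z -> F z = G z) ->
  (forall x, 0 < x -> U (RtoC x)) -> LamS N n F = LamS N n G.
Proof.
  intros HU HF E HP. unfold LamS.
  assert (P : forall k, U (RtoC (INR (S k)))) by (intros; apply HP, lt_0_INR; lia).
  rewrite (Csum_ext (fun k => C_derive F (RtoC (INR (S k)))) (fun k => C_derive G (RtoC (INR (S k))))).
  2:{ intros k _. apply (Dn_ext U 1 F G); auto. }
  rewrite (Csum_ext (fun k => bcoef k * Dn k F (RtoC (INR (S n))))%C
    (fun k => bcoef k * Dn k G (RtoC (INR (S n))))%C); [easy|].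
  intros k _. rewrite (Dn_ext U k F G); auto.
Qed.

(** A constant is seen only by the boundary term of order 0, whose coefficient is [bcoef 0 = 1] and
    which is subtracted. Hence the order of the functional must be at least 1. *)
Lemma LamS_const N n c : LamS (S N) n (fun _ => c) = (- c)%C.
Proof.
  unfold LamS.
  rewrite (Csum_ext (fun k => C_derive (fun _ => c) (RtoC (INR (S k)))) (fun k => 0 * 0)%C).
  2:{ intros k _. rewrite (cderiv_C_derive _ _ _ (cderiv_const c _)). ring. }
  rewrite Csum_scal, Csum_S_l, bcoef_0.
  rewrite (Csum_ext (fun k => bcoef (S k) * Dn (S k) (fun _ => c) (RtoC (INR (S n))))%C (fun k => 0 * 0)%C).
  2:{ intros k _. rewrite Dn_const. ring. }
  rewrite Csum_scal. simpl. ring.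
Qed.

Lemma LamS_succ N F l : Clim (fun n => LamS N n F) l -> Clim (fun n => Dn N F (RtoC (INR (S n)))) 0 ->
  Clim (fun n => LamS (S N) n F) l.
Proof.
  intros H1 H2. replace l with (l - RtoC (bcoef N) * 0)%C by ring.
  apply Clim_ext with (fun n => LamS N n F - RtoC (bcoef N) * Dn N F (RtoC (INR (S n))))%C.
  - intros n. unfold LamS. cbn [Csum]. ring.
  - apply Clim_minus; [easy|]. apply Clim_scal; easy.
Qed.

(** * The functional on powers and the analytic function [Zt] *)

Fixpoint ff (w : C) (k : nat) : C :=
  match k with O => 1%C | S j => (ff w j * (w - RtoC (INR j)))%C end.

(** The derivative in [w] of the falling factorial [ff w k], which is the factor produced by [k]
    derivatives of [z^w]. It appears when the exponent is varied, so that [pl w] is the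
    [w]-derivative of [pw w]. *)
Fixpoint dff (w : C) (k : nat) : C :=
  match k with O => 0%C | S j => (dff w j * (w - RtoC (INR j)) + ff w j)%C end.

Definition pw (w z : C) : C := Cpower z w.
Definition pl (w z : C) : C := (Cpower z w * Clog z)%C.

Lemma holo_pw w : holo slit (pw w).
Proof. apply holo_Cpower. Qed.

Lemma holo_pl w : holo slit (pl w).
Proof. apply holo_mult; [apply copen_slit|apply holo_Cpower|apply holo_Clog]. Qed.

Lemma slit_pos x : 0 < x -> slit (RtoC x).
Proof. intros h. apply slit_Re. easy. Qed.

Lemma Dn_pw w k z : slit z -> Dn k (pw w) z = (ff w k * Cpower z (w - RtoC (INR k)))%C.
Proof.
  revert z. induction k as [|k IH]; intros z hz.
  - simpl. unfold pw. rewrite Cmult_1_l. f_equal. ring.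
  - change (C_derive (Dn k (pw w)) z = (ff w (S k) * Cpower z (w - INR (S k)))%C).
    rewrite (C_derive_ext slit _ (fun z => ff w k * Cpower z (w - RtoC (INR k)))%C z); try easy.
    + apply cderiv_C_derive.
      eapply cderiv_eq; [|apply cderiv_scal, cderiv_Cpower; easy].
      rewrite S_INR, RtoC_plus. simpl.
      replace (w - INR k - 1)%C with (w - (INR k + 1))%C by ring. ring.
    + apply copen_slit.
    + apply holo_Dn; [apply copen_slit|apply holo_pw].
Qed.

Lemma Dn_pl w k z : slit z ->
  Dn k (pl w) z = (ff w k * (Cpower z (w - RtoC (INR k)) * Clog z) + dff w k * Cpower z (w - RtoC (INR k)))%C.
Proof.
  revert z. induction k as [|k IH]; intros z hz.
  - simpl. unfold pl. replace (w - 0)%C with w by ring. ring.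
  - change (C_derive (Dn k (pl w)) z = (ff w (S k) * (Cpower z (w - INR (S k)) * Clog z)
      + dff w (S k) * Cpower z (w - INR (S k)))%C).
    rewrite (C_derive_ext slit _ (fun z => ff w k * (Cpower z (w - RtoC (INR k)) * Clog z)
      + dff w k * Cpower z (w - RtoC (INR k)))%C z); try easy.
    + apply cderiv_C_derive.
      eapply cderiv_eq; [|apply cderiv_plus; [apply cderiv_scal, cderiv_mult;
        [apply cderiv_Cpower; easy|apply cderiv_Clog; easy]|apply cderiv_scal, cderiv_Cpower; easy]].
      rewrite S_INR, RtoC_plus. simpl.
      replace (w - (INR k + 1))%C with (w - INR k - 1)%C by ring.
      rewrite Cpower_minus_1 by (apply slit_neq_0; easy). field. apply slit_neq_0; easy.
    + apply copen_slit.
    + apply holo_Dn; [apply copen_slit|apply holo_pl].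
Qed.

Lemma ff_bound w k : Cmod (ff w k)%C <= (Cmod w + INR k) ^ k.
Proof.
  assert (G : forall n, (k <= n)%nat -> Cmod (ff w k)%C <= (Cmod w + INR n) ^ k).
  { intros n. induction k as [|k IH]; intros h; simpl.
    - rewrite Cmod_1. lra.
    - rewrite Cmod_mult, Rmult_comm. apply Rmult_le_compat; try apply Cmod_ge_0.
      + eapply Rle_trans; [apply Cmod_minus_triangle|]. rewrite Cmod_R, Rabs_pos_eq by apply pos_INR.
        assert (INR k <= INR n) by (apply le_INR; lia). lra.
      + apply IH. lia. }
  apply G. lia.
Qed.

Definition plane (z : C) : Prop := True.

Lemma copen_plane : copen plane.
Proof. intros z _. exists 1. split; [lra|easy]. Qed.

Lemma cderiv_ff w k : cderiv (fun w => ff w k) w (dff w k).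
Proof.
  induction k as [|k IH]; simpl; [apply cderiv_const|].
  eapply cderiv_eq; [|apply cderiv_mult; [exact IH|apply cderiv_minus; [apply cderiv_id|apply cderiv_const]]].
  cbv beta. ring.
Qed.

Lemma holo_ff k : holo plane (fun w => ff w k).
Proof.
  induction k as [|k IH]; simpl; [apply holo_const, copen_plane|].
  apply holo_mult; [apply copen_plane|easy|].
  apply holo_minus; [apply copen_plane|apply holo_id, copen_plane|apply holo_const, copen_plane].
Qed.

Lemma cderiv_Cpower_exp z c w : cderiv (fun w => Cpower z (w - c)) w (Cpower z (w - c) * Clog z)%C.
Proof.
  apply (cderiv_comp Cexp (fun w => (w - c) * Clog z)%C); [|apply cderiv_Cexp].
  eapply cderiv_eq; [|apply cderiv_mult; [apply cderiv_minus; [apply cderiv_id|apply cderiv_const]|apply cderiv_const]].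
  cbv beta. ring.
Qed.

Lemma holo_Cpower_exp z c : holo plane (fun w => Cpower z (w - c)).
Proof.
  apply holo_Cexp; [apply copen_plane|].
  apply holo_mult; [apply copen_plane| |apply holo_const, copen_plane].
  apply holo_minus; [apply copen_plane|apply holo_id, copen_plane|apply holo_const, copen_plane].
Qed.

(** Derivatives in the exponent and in the variable commute, as both orders have the same closed
    form. This is how values on [z^w log z] become derivatives of values on [z^w]. *)
Lemma cderiv_Dn_pw k x w : slit x -> cderiv (fun w => Dn k (pw w) x) w (Dn k (pl w) x).
Proof.
  intros hx. apply cderiv_ext with (fun w => ff w k * Cpower x (w - INR k))%C.
  { intros u. symmetry. apply Dn_pw; easy. }
  eapply cderiv_eq; [|apply cderiv_mult; [apply cderiv_ff|apply cderiv_Cpower_exp]].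
  rewrite Dn_pl by easy. ring.
Qed.

Lemma holo_Dn_pw k x : slit x -> holo plane (fun w => Dn k (pw w) x).
Proof.
  intros hx. apply holo_ext with (fun w => ff w k * Cpower x (w - INR k))%C.
  - apply copen_plane.
  - intros u _. symmetry. apply Dn_pw; easy.
  - apply holo_mult; [apply copen_plane|apply holo_ff|apply holo_Cpower_exp].
Qed.

Lemma slit_INR_S n : slit (RtoC (INR (S n))).
Proof. apply slit_pos, lt_0_INR. lia. Qed.

Lemma cderiv_LamS_pw N n w : cderiv (fun w => LamS N n (pw w)) w (LamS N n (pl w)).
Proof.
  apply cderiv_minus.
  - apply (cderiv_Csum (fun k w => C_derive (pw w) (RtoC (INR (S k))))).
    intros k. apply (cderiv_Dn_pw 1), slit_INR_S.
  - apply (cderiv_Csum (fun k w => bcoef k * Dn k (pw w) (RtoC (INR (S n))))%C).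
    intros k. apply cderiv_scal, cderiv_Dn_pw, slit_INR_S.
Qed.

Lemma holo_LamS_pw N n : holo plane (fun w => LamS N n (pw w)).
Proof.
  apply holo_minus; [apply copen_plane| |].
  - apply (holo_Csum plane (fun k w => C_derive (pw w) (RtoC (INR (S k))))); [apply copen_plane|].
    intros k _. apply (holo_Dn_pw 1), slit_INR_S.
  - apply (holo_Csum plane (fun k w => bcoef k * Dn k (pw w) (RtoC (INR (S n))))%C); [apply copen_plane|].
    intros k _. apply holo_scal; [apply copen_plane|]. apply holo_Dn_pw, slit_INR_S.
Qed.

Lemma Cmod_Cpower_pos x w : 0 < x -> Cmod (Cpower (RtoC x) w)%C = Rpower x (Re w).
Proof.
  intros hx. rewrite Cmod_Cpower, Arg_pos_real, Cmod_R, Rabs_pos_eq by lra.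
  unfold Rpower. f_equal. ring.
Qed.

(** The derivative of order [N + 1] of [z^w] is at most a fixed multiple of [t^-2] when [w] is
    bounded and [Re w <= N - 1]. The rate is thus uniform in [w], as Weierstrass's theorem
    requires. *)
Lemma LamS_pw_Cauchy N R0 : exists M, 0 <= M /\ forall w, Cmod w <= R0 -> Re w <= INR N - 1 ->
  forall n p, (n <= p)%nat -> Cmod (LamS N p (pw w) - LamS N n (pw w))%C <= M / INR (S n).
Proof.
  destruct (LamS_tail N) as [A [hA HA]].
  set (Q := (Rabs R0 + INR (S N)) ^ S N).
  assert (hQ : 0 <= Q).
  { apply pow_le. assert (T := Rabs_pos R0). assert (T' := pos_INR (S N)). lra. }
  exists (A * Q). split; [apply Rmult_le_pos; easy|]. intros w hw hre n p h.
  apply (HA slit (pw w) Q); [apply copen_slit|apply holo_pw| |easy].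
  intros t ht. split; [apply slit_pos; lra|].
  rewrite Dn_pw by (apply slit_pos; lra). rewrite Cmod_mult, Cmod_Cpower_pos by lra.
  apply Rmult_le_compat; try apply Cmod_ge_0.
  - left; apply Rpower_pos.
  - eapply Rle_trans; [apply ff_bound|]. apply pow_incr.
    assert (T := Rle_abs R0). assert (T' := pos_INR (S N)). assert (T2 := Cmod_ge_0 w). lra.
  - apply Rpower_le_inv_sqr; [easy|].
    change (Re (w - RtoC (INR (S N)))) with (Re w - INR (S N)). rewrite S_INR. lra.
Qed.

Lemma LamS_pw_lim N w : Re w <= INR N - 1 -> exists l, Clim (fun n => LamS N n (pw w)) l.
Proof.
  intros h. destruct (LamS_pw_Cauchy N (Cmod w)) as [M [hM HM]].
  apply Clim_Cauchy. intros eps he.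
  destruct (INR_large (M / eps)) as [K HK]. exists K.
  assert (G : forall n, (K <= n)%nat -> M / INR (S n) <= eps).
  { intros n hn. specialize (HK (S n) ltac:(lia)).
    assert (hS : 0 < INR (S n)) by (apply lt_0_INR; lia).
    apply Rmult_le_reg_r with (INR (S n)); [easy|].
    replace (M / INR (S n) * INR (S n)) with M by (field; lra).
    assert (eps * (M / eps) = M) by (field; lra). nra. }
  intros n m hn hm. destruct (Nat.le_ge_cases n m) as [H|H].
  - rewrite Cmod_minus_sym. eapply Rle_trans; [apply HM; easy|]. apply G; easy.
  - eapply Rle_trans; [apply HM; easy|]. apply G; easy.
Qed.

Lemma Rpower_neg_lim e : e < 0 -> forall eps, 0 < eps -> exists X, 1 <= X /\ forall x, X <= x -> Rpower x e <= eps.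
Proof.
  intros he eps hep. destruct (Rpower_small (- e) eps ltac:(lra) hep) as [r [hr H]].
  exists (/ r). split; [rewrite <- Rinv_1; apply Rinv_le_contravar; lra|]. intros x hx.
  assert (hr' : 0 < / r) by (apply Rinv_0_lt_compat; lra).
  eapply Rle_trans; [|exact H].
  replace (Rpower x e) with (Rpower (/ x) (- e)).
  - apply Rle_Rpower_l; [lra|]. split; [apply Rinv_0_lt_compat; lra|].
    rewrite <- (Rinv_inv r). apply Rinv_le_contravar; lra.
  - unfold Rpower. rewrite ln_Rinv by lra. f_equal. ring.
Qed.

Lemma Dn_pw_lim0 k w : Re w < INR k -> Clim (fun n => Dn k (pw w) (RtoC (INR (S n)))) 0.
Proof.
  intros h eps he. set (A := Cmod (ff w k)%C). assert (hA := Cmod_ge_0 (ff w k)). fold A in hA.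
  destruct (Rpower_neg_lim (Re w - INR k) ltac:(lra) (eps / (A + 1))) as [X [hX HX]];
    [apply Rdiv_lt_0_compat; lra|].
  destruct (INR_large X) as [K HK]. exists K. intros n hn. specialize (HK (S n) ltac:(lia)).
  replace (Dn k (pw w) (RtoC (INR (S n))) - 0)%C with (Dn k (pw w) (RtoC (INR (S n)))) by ring.
  rewrite Dn_pw by apply slit_INR_S. rewrite Cmod_mult, Cmod_Cpower_pos by lra. fold A.
  change (Re (w - RtoC (INR k))) with (Re w - INR k). specialize (HX _ HK).
  apply Rle_trans with ((A + 1) * (eps / (A + 1))).
  - apply Rmult_le_compat; try lra. left; apply Rpower_pos.
  - apply Req_le. field. lra.
Qed.

(** A boundary term of order above [Re w] tends to 0, so raising the order does not change the
    limit. *)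
Lemma LamS_pw_stable N N' w l : (N <= N')%nat -> Re w < INR N ->
  Clim (fun n => LamS N n (pw w)) l -> Clim (fun n => LamS N' n (pw w)) l.
Proof.
  intros h hw H. induction h as [|N' h IH]; [easy|].
  apply LamS_succ; [easy|]. apply Dn_pw_lim0. assert (T := le_INR _ _ h). lra.
Qed.

(* The regularised sum of [d/dz z^w], that is [w * zeta (1 - w)]. *)
Definition is_Zt (w l : C) : Prop :=
  exists N, Re w <= INR N - 1 /\ Clim (fun n => LamS N n (pw w)) l.

Definition Zt (w : C) : C := epsilon (inhabits (RtoC 0)) (is_Zt w).

Lemma Zt_spec N w : Re w <= INR N - 1 -> Clim (fun n => LamS N n (pw w)) (Zt w).
Proof.
  intros h. assert (E : exists l, is_Zt w l).
  { destruct (LamS_pw_lim N w h) as [l Hl]. exists l, N. easy. }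
  apply (epsilon_spec (inhabits (RtoC 0))) in E. fold (Zt w) in E.
  destruct E as [N' [h' H']].
  destruct (LamS_pw_lim N w h) as [l Hl].
  replace (Zt w) with l; [easy|].
  (* The order chosen inside [is_Zt] and the given one are compared at their maximum, where both
     limits persist. *)
  apply (Clim_unique (fun n => LamS (max N N') n (pw w))).
  - apply (LamS_pw_stable N); [lia|lra|easy].
  - apply (LamS_pw_stable N'); [lia|lra|easy].
Qed.

Lemma Zt_uniform N R0 : forall eps, 0 < eps -> exists K, forall n, (K <= n)%nat ->
  forall w, Cmod w <= R0 -> Re w <= INR N - 1 -> Cmod (LamS N n (pw w) - Zt w)%C <= eps.
Proof.
  intros eps he. destruct (LamS_pw_Cauchy N R0) as [M [hM HM]].
  destruct (INR_large (M / eps)) as [K HK]. exists K. intros n hn w hw hre.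
  specialize (HK (S n) ltac:(lia)).
  assert (hS : 0 < INR (S n)) by (apply lt_0_INR; lia).
  assert (G : M / INR (S n) <= eps).
  { apply Rmult_le_reg_r with (INR (S n)); [easy|].
    replace (M / INR (S n) * INR (S n)) with M by (field; lra).
    assert (eps * (M / eps) = M) by (field; lra). nra. }
  apply Rnot_lt_le. intros hlt.
  set (d := Cmod (LamS N n (pw w) - Zt w)%C - eps). assert (hd : 0 < d) by (unfold d; lra).
  destruct (Zt_spec N w hre (d / 2) ltac:(lra)) as [K2 HK2].
  specialize (HK2 (max n K2) ltac:(lia)).
  assert (T := HM w hw hre n (max n K2) ltac:(lia)).
  assert (T2 := Cmod_split (LamS N n (pw w)) (LamS N (max n K2) (pw w)) (Zt w)).
  rewrite Cmod_minus_sym in T. unfold d in *. lra.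
Qed.

(** On the unit disc around [w] the truncations are entire in the exponent and converge uniformly.
    [CF_limit] therefore gives the Cauchy formula for [Zt], and its statement on derivatives
    evaluates the functional on [pl w]. *)
Lemma Zt_CF w : CF Zt w 1 /\ forall N, Re w + 1 <= INR N - 1 ->
  Clim (fun n => LamS N n (pl w)) (C_derive Zt w).
Proof.
  assert (G : forall N, Re w + 1 <= INR N - 1 -> CF Zt w 1 /\
    Clim (fun n => LamS N n (pl w)) (C_derive Zt w)).
  { intros N hN.
    destruct (CF_limit (fun n w => LamS N n (pw w)) Zt w 1 Rlt_0_1) as [A B].
    - intros n. apply (holo_CF plane); [apply copen_plane|apply holo_LamS_pw|lra|easy].
    - intros eps he. destruct (Zt_uniform N (Cmod w + 1) eps he) as [K HK].
      exists K. intros n hn u hu. apply HK; [easy| |].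
      + assert (T := Cmod_rev_triangle u w). lra.
      + assert (T := re_le_Cmod (u - w)). apply Rabs_le_between in T.
        change (Re (u - w)) with (Re u - Re w) in T. lra.
    - split; [easy|]. intros eps he. destruct (B eps he) as [K HK]. exists K. intros n hn.
      specialize (HK n hn). rewrite (cderiv_C_derive _ _ _ (cderiv_LamS_pw N n w)) in HK. easy. }
  split; [|intros N hN; apply G; easy].
  destruct (INR_large (Re w + 2)) as [N HN]. apply (G N). specialize (HN N (Nat.le_refl N)). lra.
Qed.

Lemma holo_Zt : holo plane Zt.
Proof. apply CF_holo. intros z _. exists 1. apply Zt_CF. Qed.

(** [z^0] is constant, and the functional sends a constant to its negative. The nonzero value makes
    the singularity of zeta at 1 a genuine pole. *)
Lemma Zt_0 : Zt 0 = (-1)%C.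
Proof.
  apply (Clim_unique (fun n => LamS 1 n (pw 0))).
  - apply Zt_spec. simpl. lra.
  - apply Clim_ext with (fun _ => (-1)%C); [|apply Clim_const]. intros n.
    rewrite (LamS_ext slit 1 n (pw 0) (fun _ => 1%C)).
    + rewrite (LamS_const 0). ring.
    + apply copen_slit.
    + apply holo_pw.
    + intros z _. apply Cpower_0.
    + intros x hx. apply slit_pos; easy.
Qed.

Lemma CSeries_Clim u l : Clim (Csum u) l -> CSeries u = l.
Proof.
  intros H.
  assert (G : forall g : C -> R, (forall x y, g (x + y)%C = g x + g y) -> (forall x, Rabs (g x) <= Cmod x) ->
     g 0%C = 0 -> Series (fun n => g (u n)) = g l).
  { intros g ga gb g0. apply is_series_unique. intros P [eps HP].
    destruct (H (eps / 2)) as [N HN]; [assert (T := cond_pos eps); lra|].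
    exists N. intros n hn. apply HP.
    assert (E : sum_n (G := R_AbelianMonoid) (fun n => g (u n)) n = g (Csum u (S n))).
    { clear - ga g0. induction n as [|n IH].
      - rewrite sum_O. simpl. rewrite ga, g0. ring.
      - rewrite sum_Sn, IH. simpl. rewrite !ga. easy. }
    change (Rabs (sum_n (G := R_AbelianMonoid) (fun n => g (u n)) n - g l) < eps).
    rewrite E. specialize (HN (S n) ltac:(lia)).
    assert (gm : g (Csum u (S n) - l)%C = g (Csum u (S n)) - g l).
    { assert (T := ga (Csum u (S n) - l)%C l).
      replace (Csum u (S n) - l + l)%C with (Csum u (S n)) in T by ring. lra. }
    rewrite <- gm. eapply Rle_lt_trans; [apply gb|]. assert (T := cond_pos eps). lra. }
  unfold CSeries. rewrite (G Re), (G Im); try easy.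
  - destruct l; easy.
  - apply im_le_Cmod.
  - apply re_le_Cmod.
Qed.

Definition Zc (s : C) : C := (Zt (1 - s) / (1 - s))%C.

Lemma Zc_series s : 1 < Re s -> Zc s = CSeries (fun n => Cpower (INR (S n)) (- s)%C).
Proof.
  intros hs. symmetry. apply CSeries_Clim.
  assert (hw : (1 - s)%C <> 0%C).
  { intros E. apply (f_equal Re) in E. change (1 - Re s = 0) in E. lra. }
  assert (hre : Re (1 - s) < 0) by (change (1 - Re s < 0); lra).
  (* With order 1 the sole boundary term is [z^(1-s)] itself, which tends to 0 for [Re s > 1]; what
     remains is [1 - s] times the partial sum. *)
  assert (H := Zt_spec 1 (1 - s)%C ltac:(simpl INR; lra)).
  assert (H2 := Dn_pw_lim0 0 (1 - s)%C hre).
  assert (H3 := Clim_scal (/ (1 - s))%C _ _ (Clim_plus _ _ _ _ H H2)).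
  replace (Zc s) with (/ (1 - s) * (Zt (1 - s) + 0))%C by (unfold Zc; field; exact hw).
  eapply Clim_ext; [|exact H3]. intros n. cbv beta.
  unfold LamS. cbn [Csum]. rewrite bcoef_0.
  rewrite (Csum_ext (fun k => C_derive (pw (1 - s)) (RtoC (INR (S k))))
    (fun k => (1 - s) * Cpower (INR (S k)) (- s))%C).
  - rewrite Csum_scal. field. exact hw.
  - intros k _. assert (E := Dn_pw (1 - s)%C 1 _ (slit_INR_S k)).
    change (Dn 1 (pw (1 - s)) (RtoC (INR (S k)))) with (C_derive (pw (1 - s)) (RtoC (INR (S k)))) in E.
    rewrite E. cbn [ff]. change (INR 0) with 0. change (INR 1) with 1.
    replace (1 - s - 1)%C with (- s)%C by ring. ring.
Qed.

Lemma Zc_holo : holo (fun s => (1 - s)%C <> 0%C) Zc.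
Proof.
  assert (HU : copen (fun s => (1 - s)%C <> 0%C)).
  { intros z hz. exists (Cmod (1 - z)%C). split; [apply Cmod_gt_0; exact hz|].
    intros h hh E. assert (h = (1 - z)%C) by (apply Ceq_minus; replace (h - (1 - z))%C with (- (1 - (z + h)))%C by ring; rewrite E; ring).
    subst h. lra. }
  assert (L : holo (fun s => (1 - s)%C <> 0%C) (fun s => 1 - s)%C).
  { apply holo_minus; [easy|apply holo_const; easy|apply holo_id; easy]. }
  apply holo_mult; [easy| |apply holo_inv; easy].
  apply (holo_comp _ plane Zt (fun s => 1 - s)%C); try easy. apply holo_Zt.
Qed.

Lemma Zc_derive s N : (1 - s)%C <> 0%C -> Re (1 - s) + 1 <= INR N - 1 ->
  Clim (fun n => LamS N n (fun z => pl (1 - s) z / (1 - s) - pw (1 - s) z / ((1 - s) * (1 - s)))%C)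
    (- C_derive Zc s)%C.
Proof.
  intros hs hN. set (w := (1 - s)%C) in *.
  assert (D : cderiv Zc s (- (C_derive Zt w / w - Zt w / (w * w)))%C).
  {
    assert (D1 : cderiv (fun s => 1 - s)%C s (0 - 1)%C)
      by (apply cderiv_minus; [apply cderiv_const|apply cderiv_id]).
    eapply cderiv_eq; [|apply cderiv_mult;
      [apply (cderiv_comp Zt (fun s => 1 - s)%C s _ _ D1 (holo_cderiv plane Zt _ holo_Zt I))
      |apply (cderiv_inv _ _ _ hs D1)]].
    cbv beta. fold w. field. exact hs. }
  rewrite (cderiv_C_derive _ _ _ D).
  replace (- - (C_derive Zt w / w - Zt w / (w * w)))%C with (C_derive Zt w / w - Zt w / (w * w))%C by ring.
  apply Clim_ext with (fun n => / w * LamS N n (pl w) - / (w * w) * LamS N n (pw w))%C.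
  - intros n. symmetry.
    rewrite (LamS_ext slit N n _ (fun z => / w * pl w z + (- / (w * w)) * pw w z)%C).
    + rewrite (LamS_plus slit), !(LamS_scal slit); [ring|..]; try apply copen_slit;
        try apply holo_pl; try apply holo_pw; try apply slit_pos; apply holo_scal;
        try apply copen_slit; try apply holo_pl; apply holo_pw.
    + apply copen_slit.
    + apply holo_minus; [apply copen_slit| |]; (apply holo_mult; [apply copen_slit| |apply holo_const, copen_slit]).
      * apply holo_pl. * apply holo_pw.
    + intros z _. unfold Cdiv. ring.
    + apply slit_pos.
  - replace (C_derive Zt w / w - Zt w / (w * w))%C with
      (/ w * C_derive Zt w - / (w * w) * Zt w)%C by (unfold Cdiv; ring).
    apply Clim_minus; apply Clim_scal; [apply Zt_CF; easy|apply Zt_spec; lra].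
Qed.

(** * Meromorphic continuation *)

Lemma Cmod_pow_sum_bound (c : nat -> C) u q B n m : 0 <= q <= 1 / 2 -> 0 <= B ->
  (forall k, Cmod (c k * u ^ k)%C <= B * q ^ k) -> (m <= n)%nat ->
  Cmod (Csum (fun k => c k * u ^ k) n - Csum (fun k => c k * u ^ k) m)%C <= 2 * B * q ^ m - 2 * B * q ^ n.
Proof.
  intros hq hB H h. induction h as [|n h IH].
  - match goal with |- Cmod (Cminus ?a _)%C <= _ => replace (a - a)%C with (RtoC 0) by ring end.
    rewrite Cmod_0. lra.
  - cbn [Csum].
    match goal with |- Cmod (Cminus (Cplus ?a ?b) ?d)%C <= _ => replace (a + b - d)%C with ((a - d) + b)%C by ring end.
    eapply Rle_trans; [apply Cmod_triangle|]. specialize (H n).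
    assert (0 <= q ^ n) by (apply pow_le; lra). simpl.
    assert (B * q ^ n * (2 * q) <= B * q ^ n * 1) by (apply Rmult_le_compat_l; [apply Rmult_le_pos; lra|lra]).
    lra.
Qed.

(** Convergence bounds the terms at radius [r / 2], so at radius [r / 4] the polynomials converge
    geometrically and uniformly, and the Cauchy formula passes to the limit. *)
Lemma analytic_CF f z0 : analytic_at f z0 -> exists r, CF f z0 r.
Proof.
  intros [c [r Hc]]. assert (hr := cond_pos r).
  assert (Hs : forall u, Cmod u < r -> Clim (Csum (fun k => c k * u ^ k)%C) (f (z0 + u)%C)).
  { intros u hu. specialize (Hc (z0 + u)%C). replace (z0 + u - z0)%C with u in Hc by ring.
    specialize (Hc hu). intros eps he.
    destruct (proj2 (is_pseries_Csum c u (f (z0 + u)%C)) Hc eps he) as [N HN].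
    exists N. intros n hn. left. apply HN; easy. }
  assert (hB : exists B, 0 <= B /\ forall k, Cmod (c k)%C * (r / 2) ^ k <= B).
  { set (u := RtoC (r / 2)).
    assert (hu : Cmod u = r / 2) by (unfold u; rewrite Cmod_R, Rabs_pos_eq; lra).
    destruct (Hs u ltac:(lra) 1 Rlt_0_1) as [N HN].
    assert (T : forall k, (N <= k)%nat -> Cmod (c k)%C * (r / 2) ^ k <= 2).
    { intros k hk. assert (A := HN k hk). assert (B := HN (S k) ltac:(lia)).
      replace (Cmod (c k)%C * (r / 2) ^ k) with (Cmod (c k * u ^ k)%C) by (rewrite Cmod_mult, Cmod_pow, hu; easy).
      cbn [Csum] in B. set (S0 := Csum (fun k => c k * u ^ k)%C k) in *.
      replace (c k * u ^ k)%C with ((S0 + c k * u ^ k - f (z0 + u)) - (S0 - f (z0 + u)))%C by ring.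
      eapply Rle_trans; [apply Cmod_minus_triangle|]. lra. }
    assert (F : forall n, exists B, 0 <= B /\ forall k, (k < n)%nat -> Cmod (c k)%C * (r / 2) ^ k <= B).
    { induction n as [|n [B [h IH]]].
      - exists 0. split; [lra|]. intros k hk. lia.
      - exists (B + Cmod (c n)%C * (r / 2) ^ n).
        assert (P : 0 <= Cmod (c n)%C * (r / 2) ^ n) by (apply Rmult_le_pos; [apply Cmod_ge_0|apply pow_le; lra]).
        split; [lra|]. intros k hk. destruct (Nat.eq_dec k n) as [->|E]; [lra|].
        specialize (IH k ltac:(lia)). lra. }
    destruct (F N) as [B [h HB]]. exists (B + 2). split; [lra|]. intros k.
    destruct (Nat.lt_ge_cases k N) as [hk|hk].
    - specialize (HB k hk). lra.
    - specialize (T k hk). lra. }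
  destruct hB as [B [hB HB]].
  assert (U : forall u n, Cmod u <= r / 4 -> Cmod (Csum (fun k => c k * u ^ k) n - f (z0 + u))%C <= 2 * B * (1 / 2) ^ n).
  { intros u n hu.
    assert (Hk : forall k, Cmod (c k * u ^ k)%C <= B * (1 / 2) ^ k).
    { intros k. rewrite Cmod_mult, Cmod_pow.
      apply Rle_trans with (Cmod (c k)%C * ((r / 2) ^ k * (1 / 2) ^ k)).
      - apply Rmult_le_compat_l; [apply Cmod_ge_0|]. rewrite <- Rpow_mult_distr.
        apply pow_incr. split; [apply Cmod_ge_0|]. lra.
      - rewrite <- Rmult_assoc. apply Rmult_le_compat_r; [apply pow_le; lra|apply HB]. }
    apply Rnot_lt_le. intros hlt.
    set (d := Cmod (Csum (fun k => c k * u ^ k)%C n - f (z0 + u)%C)%C - 2 * B * (1 / 2) ^ n).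
    destruct (Hs u ltac:(lra) (d / 2) ltac:(unfold d; lra)) as [N HN].
    specialize (HN (max n N) ltac:(lia)).
    assert (T := Cmod_pow_sum_bound c u (1 / 2) B (max n N) n ltac:(lra) hB Hk ltac:(lia)).
    assert (T2 := Cmod_split (Csum (fun k => c k * u ^ k)%C n) (Csum (fun k => c k * u ^ k)%C (max n N)) (f (z0 + u)%C)).
    rewrite Cmod_minus_sym in T.
    assert (0 <= 2 * B * (1 / 2) ^ max n N) by (apply Rmult_le_pos; [lra|apply pow_le; lra]).
    unfold d in *. lra. }
  exists (r / 4).
  apply (CF_limit (fun n w => Csum (fun k => c k * (w - z0) ^ k) n)%C f z0 (r / 4)); [lra| |].
  - intros n. apply (holo_CF plane); [apply copen_plane| |lra|easy].
    apply (holo_Csum plane (fun k w => c k * (w - z0) ^ k)%C); [apply copen_plane|].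
    intros k _. apply holo_scal; [apply copen_plane|]. apply holo_pow; [apply copen_plane|].
    apply holo_minus; [apply copen_plane|apply holo_id, copen_plane|apply holo_const, copen_plane].
  - intros eps he. destruct (pow_small (1 / 2) (eps / (2 * B + 1)) ltac:(lra)) as [N HN].
    { apply Rdiv_lt_0_compat; lra. }
    exists N. intros n hn w hw. specialize (U (w - z0)%C n hw).
    replace (z0 + (w - z0))%C with w in U by ring.
    eapply Rle_trans; [exact U|]. specialize (HN n hn).
    assert (0 <= (1 / 2) ^ n) by (apply pow_le; lra).
    apply Rle_trans with ((2 * B + 1) * (eps / (2 * B + 1))); [apply Rmult_le_compat; lra|].
    apply Req_le. field. lra.
Qed.

(** * Isolated zeros, the identity theorem and removable singularities *)

Definition punct (z0 : C) (r : R) (w : C) : Prop := 0 < Cmod (w - z0)%C < r.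

Definition cdisc (z0 : C) (r : R) (w : C) : Prop := Cmod (w - z0)%C < r.

Lemma disc_center z0 r : 0 < r -> cdisc z0 r z0.
Proof. intros h. unfold cdisc. replace (z0 - z0)%C with (RtoC 0) by ring. rewrite Cmod_0. easy. Qed.

Lemma copen_disc z0 r : copen (fun w => Cmod (w - z0)%C < r).
Proof.
  intros w hw. exists (r - Cmod (w - z0)%C). split; [lra|]. intros h hh.
  replace (w + h - z0)%C with ((w - z0) + h)%C by ring.
  eapply Rle_lt_trans; [apply Cmod_triangle|]. lra.
Qed.

Lemma copen_punct z0 r : copen (punct z0 r).
Proof.
  intros w [h1 h2]. exists (Rmin (Cmod (w - z0)%C) (r - Cmod (w - z0)%C)). split; [apply Rmin_pos; lra|].
  intros h hh. apply Rmin_Rgt_l in hh. destruct hh as [k1 k2]. unfold punct.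
  replace (w + h - z0)%C with ((w - z0) + h)%C by ring.
  assert (T := Cmod_triangle (w - z0) h). assert (T2 := Cmod_rev_triangle (w - z0) (- h)).
  rewrite Cmod_opp in T2. replace (w - z0 - - h)%C with (w - z0 + h)%C in T2 by ring. lra.
Qed.

Lemma CF_holo_disc f z0 r : CF f z0 r -> holo (fun w => Cmod (w - z0)%C < r) f.
Proof. intros H. apply CF_holo_loc; easy. Qed.

Lemma disc_CF U f z0 r : copen U -> holo U f -> 0 < r -> (forall w, Cmod (w - z0)%C < r -> U w) -> CF f z0 (r / 2).
Proof.
  intros HU H hr HD. apply (holo_CF U); try easy; [lra|]. intros w hw. apply HD. lra.
Qed.

Lemma least_nat (P : nat -> Prop) : (exists n, P n) -> exists n, P n /\ forall k, (k < n)%nat -> ~ P k.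
Proof.
  intros [n Hn]. revert Hn. induction n as [n IH] using lt_wf_ind. intros Hn.
  destruct (classic (exists k, (k < n)%nat /\ P k)) as [[k [hk Hk]]|N].
  - apply (IH k hk Hk).
  - exists n. split; [easy|]. intros k hk Hk. apply N. exists k. easy.
Qed.

(** If every Taylor coefficient vanishes, the Taylor remainder forces [f] to be 0 on the disc.
    Otherwise the first nonzero coefficient dominates the remainder near the centre. *)
Lemma zero_dichotomy f z0 r : CF f z0 r ->
  (forall w, Cmod (w - z0)%C < r -> f w = 0%C) \/
  (exists r', 0 < r' /\ forall w, punct z0 r' w -> f w <> 0%C).
Proof.
  intros HF. assert (hr : 0 < r) by apply HF.
  destruct (CF_continuous_bound f z0 r HF) as [B [hB HB]].
  destruct (classic (exists k, ccoef f z0 r k <> 0%C)) as [E|E].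
  - right. apply least_nat in E. destruct E as [m [hm Hm]].
    set (c := ccoef f z0 r m) in *.
    assert (hc : 0 < Cmod c) by (apply Cmod_gt_0; exact hm).
    assert (hrm : 0 < r ^ S m) by (apply pow_lt; easy).
    (* For [u < r / 2] the remainder is at most [2 B (u / r)^(m+1)]; the second bound makes this
       less than half of [|c| u^m]. *)
    exists (Rmin (r / 2) (Cmod c * r ^ S m / (4 * B))). split.
    { apply Rmin_pos; [lra|]. apply Rdiv_lt_0_compat; [apply Rmult_lt_0_compat|]; lra. }
    intros w [h1 h2] E. apply Rmin_Rgt_l in h2. destruct h2 as [k1 k2].
    set (u := Cmod (w - z0)%C) in *.
    assert (T := CF_taylor f z0 r B w (S m) HF HB ltac:(fold u; lra)). fold u in T.
    rewrite E in T. cbn [Csum] in T.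
    assert (S0 : Csum (fun k => ccoef f z0 r k * (w - z0) ^ k)%C m = 0%C).
    { rewrite (Csum_ext _ (fun k => 0 * 0)%C).
      - rewrite Csum_scal. ring.
      - intros k hk. assert (Z : ccoef f z0 r k = 0%C) by (apply NNPP; apply Hm; easy). rewrite Z. ring. }
    rewrite S0 in T. fold c in T.
    replace (0 - (0 + c * (w - z0) ^ m))%C with (- (c * (w - z0) ^ m))%C in T by ring.
    rewrite Cmod_opp, Cmod_mult, Cmod_pow in T. fold u in T.
    assert (hu : 0 < u ^ m) by (apply pow_lt; easy).
    assert (X : r / (r - u) <= 2).
    { apply Rmult_le_reg_r with (r - u); [lra|]. unfold Rdiv. rewrite Rmult_assoc, Rinv_l; lra. }
    assert (Y : 0 <= (u / r) ^ S m) by (apply pow_le, Rdiv_le_0_compat; lra).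
    assert (T2 : Cmod c * u ^ m <= B * ((u / r) ^ S m * 2)).
    { eapply Rle_trans; [exact T|]. apply Rmult_le_compat_l; [lra|]. apply Rmult_le_compat_l; lra. }
    unfold Rdiv in T2 at 1. rewrite Rpow_mult_distr, pow_inv in T2.
    apply Rmult_le_compat_r with (r := r ^ S m) in T2; [|lra].
    replace (B * (u ^ S m * / r ^ S m * 2) * r ^ S m) with (2 * B * u * u ^ m) in T2
      by (simpl in *; field; split; [apply pow_nonzero|]; lra).
    apply Rmult_lt_compat_l with (r := 4 * B) in k2; [|lra].
    replace (4 * B * (Cmod c * r ^ S m / (4 * B))) with (Cmod c * r ^ S m) in k2 by (field; lra).
    assert (Cmod c * r ^ S m * u ^ m > 4 * B * u * u ^ m) by (apply Rmult_lt_compat_r; easy).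
    assert (0 < B * u * u ^ m) by (repeat apply Rmult_lt_0_compat; lra). lra.
  - left. intros w hw. apply Cmod_small_eq. intros eps he.
    assert (hu := Cmod_ge_0 (w - z0)).
    destruct (ratio_small (Cmod (w - z0)%C) (B * (r / (r - Cmod (w - z0)%C))) r eps) as [N HN];
      [lra| |lra|].
    { apply Rmult_le_pos; [lra|]. apply Rdiv_le_0_compat; lra. }
    specialize (HN N (Nat.le_refl N)).
    assert (T := CF_taylor f z0 r B w N HF HB hw).
    rewrite (Csum_ext _ (fun k => 0 * 0)%C) in T.
    + rewrite Csum_scal in T. replace (f w - 0 * Csum (fun _ => 0%C) N)%C with (f w - 0)%C in T by ring.
      left. eapply Rle_lt_trans; [exact T|]. eapply Rle_lt_trans; [|exact HN]. apply Req_le. ring.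
    + intros k _. assert (Z : ccoef f z0 r k = 0%C) by (apply NNPP; intros X; apply E; exists k; easy).
      rewrite Z. ring.
Qed.

(* The value at the center is not constrained. *)
Definition mrep (f : C -> C) (z0 : C) : Prop :=
  exists (m : nat) (A : C -> C) (r : R), CF A z0 r /\
    forall w, punct z0 r w -> f w = (A w / (w - z0) ^ m)%C.

Lemma CF_smaller f z0 r r' : CF f z0 r -> 0 < r' < r -> CF f z0 r'.
Proof.
  intros H h. apply (holo_CF (fun w => Cmod (w - z0)%C < r)); [apply copen_disc|apply CF_holo_disc; easy|lra|].
  intros w hw. lra.
Qed.

Lemma analytic_mrep f z0 : analytic_at f z0 -> mrep f z0.
Proof.
  intros H. destruct (analytic_CF f z0 H) as [r Hr]. exists O, f, r. split; [easy|].
  intros w _. field.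
Qed.

Lemma pole_mrep f z0 : has_pole_at f z0 -> mrep f z0.
Proof.
  intros [m [g [r [_ [Hg [_ E]]]]]]. destruct (analytic_CF g z0 Hg) as [r' Hr'].
  assert (hr := cond_pos r). assert (hr' : 0 < r') by apply Hr'.
  assert (hm : 0 < Rmin r r') by (apply Rmin_pos; easy).
  assert (A := Rmin_l r r'). assert (B := Rmin_r r r').
  exists m, g, (Rmin r r' / 2). split; [apply (CF_smaller g z0 r'); [easy|lra]|].
  intros w [h1 h2]. rewrite <- pow_n_Cpow. apply E. lra.
Qed.

Lemma mero_mrep f : meromorphic f -> forall z, mrep f z.
Proof. intros H z. destruct (H z); [apply analytic_mrep|apply pole_mrep]; easy. Qed.

(** Clearing denominators turns agreement off the centre into the vanishing of one analytic
    function, to which [zero_dichotomy] applies. *)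
Lemma mrep_dichotomy f g z0 : mrep f z0 -> mrep g z0 ->
  (exists r, 0 < r /\ forall w, punct z0 r w -> f w = g w) \/
  (exists r, 0 < r /\ forall w, punct z0 r w -> f w <> g w).
Proof.
  intros [m1 [A1 [r1 [C1 E1]]]] [m2 [A2 [r2 [C2 E2]]]].
  assert (h1 : 0 < r1) by apply C1. assert (h2 : 0 < r2) by apply C2.
  set (r := Rmin r1 r2). assert (hr : 0 < r) by (apply Rmin_pos; easy).
  assert (l1 : r <= r1) by apply Rmin_l. assert (l2 : r <= r2) by apply Rmin_r.
  set (U := fun w => Cmod (w - z0)%C < r).
  assert (HU : copen U) by apply copen_disc.
  set (D := fun w => (A1 w * (w - z0) ^ m2 - A2 w * (w - z0) ^ m1)%C).
  assert (HD : holo U D).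
  { assert (P : forall m, holo U (fun w => (w - z0) ^ m)%C).
    { intros m. apply holo_pow; [easy|]. apply holo_minus; [easy|apply holo_id; easy|apply holo_const; easy]. }
    apply holo_minus; [easy| |]; (apply holo_mult; [easy| |apply P]).
    - apply (holo_subset (fun w => Cmod (w - z0)%C < r1)); [|apply CF_holo_disc; easy].
      intros w hw. unfold U in hw. lra.
    - apply (holo_subset (fun w => Cmod (w - z0)%C < r2)); [|apply CF_holo_disc; easy].
      intros w hw. unfold U in hw. lra. }
  assert (HC : CF D z0 (r / 2)) by (apply (disc_CF U); easy).
  assert (K : forall w, punct z0 r w -> (f w = g w <-> D w = 0%C)).
  { intros w [k1 k2]. assert (hu : (w - z0)%C <> 0%C) by (apply Cmod_gt_0; easy).
    rewrite (E1 w ltac:(split; lra)), (E2 w ltac:(split; lra)). unfold D.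
    assert (p1 := Cpow_nz _ m1 hu). assert (p2 := Cpow_nz _ m2 hu).
    split; intros E.
    - apply Ceq_minus in E.
      replace (A1 w * (w - z0) ^ m2 - A2 w * (w - z0) ^ m1)%C with
        ((A1 w / (w - z0) ^ m1 - A2 w / (w - z0) ^ m2) * ((w - z0) ^ m1 * (w - z0) ^ m2))%C by (field; easy).
      rewrite E. ring.
    - apply Ceq_minus.
      replace (A1 w / (w - z0) ^ m1 - A2 w / (w - z0) ^ m2)%C with
        ((A1 w * (w - z0) ^ m2 - A2 w * (w - z0) ^ m1) / ((w - z0) ^ m1 * (w - z0) ^ m2))%C by (field; easy).
      rewrite E. field. easy. }
  destruct (zero_dichotomy D z0 (r / 2) HC) as [Z|[r' [hr' Z]]].
  - left. exists (r / 2). split; [lra|]. intros w [k1 k2]. apply K; [split; lra|]. apply Z; easy.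
  - right. exists (Rmin r r'). split; [apply Rmin_pos; easy|]. intros w [k1 k2] E.
    apply Rmin_Rgt_l in k2. apply (Z w); [split; lra|]. apply K; [split; lra|easy].
Qed.

(** Connectedness of [[0, 1]]: at the supremum of the initial segments on which [P] holds, local
    constancy would extend [P] further. *)
Lemma loc_const_interval (P : R -> Prop) :
  (forall t, 0 <= t <= 1 -> exists d, 0 < d /\ forall s, 0 <= s <= 1 -> Rabs (s - t) < d -> (P s <-> P t)) ->
  P 0 -> P 1.
Proof.
  intros H H0.
  set (E := fun t => 0 <= t <= 1 /\ forall s, 0 <= s <= t -> P s).
  destruct (completeness E) as [l [ub lub]].
  { exists 1. intros t [ht _]. lra. }
  { exists 0. split; [lra|]. intros s hs. replace s with 0 by lra. easy. }
  assert (E0 : E 0) by (split; [lra|]; intros s hs; replace s with 0 by lra; easy).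
  assert (hl : 0 <= l <= 1).
  { split; [apply ub; easy|]. apply lub. intros t [ht _]. lra. }
  destruct (H l hl) as [d [hd Hd]].
  assert (X : exists t, E t /\ l - d < t).
  { apply NNPP. intros N. assert (l <= l - d); [|lra]. apply lub. intros t Et.
    apply Rnot_lt_le. intros hlt. apply N. exists t. easy. }
  destruct X as [t [[ht Et] hlt]].
  assert (htl : t <= l) by (apply ub; split; easy).
  assert (Pl : P l).
  { apply (Hd t ht); [rewrite Rabs_left1; lra|]. apply Et. lra. }
  assert (All : forall s, 0 <= s <= 1 -> s < l + d -> P s).
  { intros s hs h. destruct (Rle_dec s t) as [k|k]; [apply Et; lra|].
    apply (Hd s hs); [apply Rabs_lt_between; lra|easy]. }
  destruct (Rle_dec 1 l) as [k|k]; [apply All; lra|].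
  exfalso. set (s := Rmin 1 (l + d / 2)).
  assert (s1 : s <= 1) by apply Rmin_l. assert (s2 : s <= l + d / 2) by apply Rmin_r.
  assert (s3 : l < s) by (apply Rmin_glb_lt; lra).
  assert (s <= l); [|lra]. apply ub. split; [lra|]. intros u hu. apply All; lra.
Qed.

(** Along the segment from [z1] to [z2], agreement near a point except possibly at the point itself
    is a locally constant property, by [mrep_dichotomy]. The complement of a discrete pole set thus
    never has to be shown connected: poles on the segment are covered by the punctured discs. *)
Lemma mero_identity f g z1 z2 : (forall z, mrep f z) -> (forall z, mrep g z) ->
  (exists r, 0 < r /\ forall w, Cmod (w - z1)%C < r -> f w = g w) ->
  exists r, 0 < r /\ forall w, punct z2 r w -> f w = g w.
Proof.
  intros Hf Hg [r0 [hr0 H0]].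
  destruct (Req_dec (Cmod (z2 - z1)%C) 0) as [h0|h0].
  { apply Cmod_eq_0 in h0. apply Ceq_minus in h0. subst z2. exists r0. split; [easy|].
    intros w [k1 k2]. apply H0; easy. }
  assert (L : 0 < Cmod (z2 - z1)%C) by (assert (T := Cmod_ge_0 (z2 - z1)); lra).
  set (l := Cmod (z2 - z1)%C) in *.
  set (p := fun t : R => (z1 + t * (z2 - z1))%C).
  assert (Dp : forall s t, Cmod (p s - p t)%C = Rabs (s - t) * l).
  { intros s t. unfold p. replace (z1 + s * (z2 - z1) - (z1 + t * (z2 - z1)))%C with
      (RtoC (s - t) * (z2 - z1))%C by (rewrite RtoC_minus; ring).
    rewrite Cmod_mult, Cmod_R. easy. }
  set (P := fun t => exists r, 0 < r /\ forall w, punct (p t) r w -> f w = g w).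
  assert (K : P 1).
  { apply loc_const_interval.
    - intros t ht.
      (* A point of the segment near [p t] but distinct from it has a small full disc inside the
         punctured disc of [p t]. *)
      assert (Sub : forall r s, 0 < r -> 0 < Rabs (s - t) -> Rabs (s - t) < r / l ->
        exists r', 0 < r' /\ forall w, Cmod (w - p s)%C < r' -> punct (p t) r w).
      { intros r s hr k1 k2.
        assert (k2' : Cmod (p s - p t)%C < r).
        { rewrite Dp. apply Rmult_lt_compat_r with (r := l) in k2; [|easy].
          replace (r / l * l) with r in k2 by (field; lra). easy. }
        assert (k1' : 0 < Cmod (p s - p t)%C) by (rewrite Dp; apply Rmult_lt_0_compat; easy).
        destruct (copen_ball (punct (p t) r) (p s) (copen_punct _ _)) as [d [hd Hd]]; [split; easy|].
        exists d. split; easy. }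
      destruct (mrep_dichotomy f g (p t) (Hf _) (Hg _)) as [[r [hr E]]|[r [hr E]]].
      + exists (r / l). split; [apply Rdiv_lt_0_compat; easy|]. intros s hs hst.
        split; intros _; [exists r; easy|].
        destruct (Req_dec s t) as [->|hne]; [exists r; easy|].
        destruct (Sub r s hr ltac:(apply Rabs_pos_lt; lra) hst) as [r' [hr' H']].
        exists r'. split; [easy|]. intros w [k1 k2]. apply E, H'; easy.
      + exists (r / l). split; [apply Rdiv_lt_0_compat; easy|]. intros s hs hst.
        assert (Wit : forall z r1 r2, 0 < r1 -> 0 < r2 -> exists w, punct z r1 w /\ punct z r2 w).
        { intros z a b ha hb. exists (z + RtoC (Rmin a b / 2))%C. unfold punct.
          replace (z + RtoC (Rmin a b / 2) - z)%C with (RtoC (Rmin a b / 2)) by ring.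
          assert (0 < Rmin a b) by (apply Rmin_pos; easy).
          assert (Rmin a b <= a) by apply Rmin_l. assert (Rmin a b <= b) by apply Rmin_r.
          rewrite Cmod_R, Rabs_pos_eq by lra. lra. }
        assert (Nt : ~ P t).
        { intros [r1 [h1 E1]]. destruct (Wit (p t) r r1 hr h1) as [w [w1 w2]].
          apply (E w w1), E1; easy. }
        split; intros Hs; [|easy]. exfalso.
        destruct (Req_dec s t) as [->|hne]; [easy|].
        destruct (Sub r s hr ltac:(apply Rabs_pos_lt; lra) hst) as [r' [hr' H']].
        destruct Hs as [r1 [h1 E1]]. destruct (Wit (p s) r' r1 hr' h1) as [w [[w0 w1] w2]].
        apply (E w); [apply H'; easy|]. apply E1; easy.
    - exists r0. split; [easy|]. intros w [k1 k2]. apply H0.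
      replace (p 0) with z1 in k2 by (unfold p; ring). easy. }
  replace z2 with (p 1) by (unfold p; ring). exact K.
Qed.

Lemma ccont_punct_eq f g z r : 0 < r -> ccont f z -> ccont g z ->
  (forall w, punct z r w -> f w = g w) -> f z = g z.
Proof.
  intros hr Hf Hg E. apply Cmod_small_eq. intros eps he.
  destruct (Hf (eps / 2)) as [d1 [h1 H1]]; [lra|].
  destruct (Hg (eps / 2)) as [d2 [h2 H2]]; [lra|].
  set (m := Rmin r (Rmin d1 d2)).
  assert (hm : 0 < m) by (repeat apply Rmin_pos; easy).
  assert (m1 : m <= r) by apply Rmin_l.
  assert (m2 : m <= Rmin d1 d2) by apply Rmin_r.
  assert (m3 := Rmin_l d1 d2). assert (m4 := Rmin_r d1 d2).
  assert (hc : Cmod (RtoC (m / 2))%C = m / 2) by (rewrite Cmod_R, Rabs_pos_eq; lra).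
  specialize (H1 (RtoC (m / 2)) ltac:(lra)). specialize (H2 (RtoC (m / 2)) ltac:(lra)).
  rewrite E in H1.
  - rewrite Cmod_minus_sym in H1.
    eapply Rle_trans; [apply Cmod_split with (y := g (z + RtoC (m / 2))%C)|]. lra.
  - unfold punct. replace (z + RtoC (m / 2) - z)%C with (RtoC (m / 2)) by ring. lra.
Qed.

Lemma CF_ccont f z r : CF f z r -> ccont f z.
Proof.
  intros H. eapply cderiv_ccont. eapply CF_cderiv; [exact H|].
  replace (z - z)%C with (RtoC 0) by ring. rewrite Cmod_0. apply H.
Qed.

(* If the continuation had a pole where [G] is analytic, then [u^m G] would be continuous there
   with value [0], contradicting [g z0 <> 0]. *)
Lemma continuation_eq (D : C -> Prop) (f G : C -> C) z1 z2 : copen D -> D z1 ->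
  meromorphic G -> (forall s, D s -> G s = f s) -> analytic_at G z2 ->
  exists r, 0 < r /\ forall w, Cmod (w - z2)%C < r -> meromorphic_continuation D f w = G w.
Proof.
  intros HD h1 HG HGf Han.
  set (F := meromorphic_continuation D f).
  assert (HF : meromorphic F /\ forall s, D s -> F s = f s).
  { unfold F, meromorphic_continuation. apply epsilon_spec. exists G. split; easy. }
  destruct HF as [HF HFf].
  destruct (mero_identity F G z1 z2 (mero_mrep F HF) (mero_mrep G HG)) as [r [hr E]].
  { destruct (copen_ball D z1 HD h1) as [d [hd Hd]]. exists d. split; [easy|].
    intros w hw. rewrite HFf, HGf; auto. }
  destruct (analytic_CF G z2 Han) as [rG CG].
  assert (E2 : F z2 = G z2).
  { destruct (HF z2) as [HA|[m [g [r' [hm [Hg [hg0 Eg]]]]]]].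
    - destruct (analytic_CF F z2 HA) as [rF CFF].
      apply (ccont_punct_eq F G z2 r hr); [eapply CF_ccont; eassumption|eapply CF_ccont; eassumption|easy].
    - exfalso. destruct (analytic_CF g z2 Hg) as [rg Cg]. apply hg0.
      assert (hr' := cond_pos r').
      rewrite (ccont_punct_eq g (fun w => (w - z2) ^ m * G w)%C z2 (Rmin r r')).
      + replace (z2 - z2)%C with (RtoC 0) by ring. destruct m as [|m]; [lia|]. simpl. ring.
      + apply Rmin_pos; easy.
      + eapply CF_ccont; eassumption.
      + apply ccont_mult; [|eapply CF_ccont; eassumption].
        eapply cderiv_ccont, (holo_cderiv plane); [|easy].
        apply holo_pow; [apply copen_plane|].
        apply holo_minus; [apply copen_plane|apply holo_id, copen_plane|apply holo_const, copen_plane].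
      + intros w [k1 k2]. apply Rmin_Rgt_l in k2.
        assert (EF := E w ltac:(split; lra)). rewrite (Eg w ltac:(lra)), pow_n_Cpow in EF. rewrite <- EF. field. apply Cpow_nz, Cmod_gt_0; easy. }
  exists r. split; [easy|]. intros w hw.
  destruct (Req_dec (Cmod (w - z2)%C) 0) as [h0|h0].
  - apply Cmod_eq_0, Ceq_minus in h0. subst w. exact E2.
  - apply E. split; [|easy]. assert (T := Cmod_ge_0 (w - z2)). lra.
Qed.

(* Riemann's removable singularity theorem, through the Cauchy integral of [A (zeta) / (zeta - w)]. *)
Lemma CF_divide A z0 r : CF A z0 r -> A z0 = 0%C ->
  exists B r', CF B z0 r' /\ r' <= r /\ forall w, punct z0 r' w -> A w = ((w - z0) * B w)%C.
Proof.
  intros HA h0. assert (hr : 0 < r) by apply HA. assert (hP := two_PI_pos).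
  set (phi := fun t => A (circ z0 r t)).
  assert (Hphi : forall t, rcont phi t) by apply HA.
  set (B := fun w => (/ RtoC (2 * PI) * Kint phi z0 r 1 w)%C).
  assert (HB : holo (fun w => Cmod (w - z0)%C < r) B).
  { apply Holo_holo with (fun w => / RtoC (2 * PI) * (RtoC (INR 1) * Kint phi z0 r 2 w))%C; [apply copen_disc|].
    intros w hw. split; [apply cderiv_scal, cderiv_Kint; easy|].
    eapply cderiv_ccont. apply cderiv_scal, cderiv_scal, cderiv_Kint; easy. }
  exists B, (r / 2). split; [apply (disc_CF (fun w => Cmod (w - z0)%C < r)); [apply copen_disc|easy|easy|easy]|].
  split; [lra|]. intros w [k1 k2].
  assert (hz : Cmod (z0 - z0)%C < r) by (replace (z0 - z0)%C with (RtoC 0) by ring; rewrite Cmod_0; easy).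
  destruct HA as [_ [_ Hf]].
  assert (E1 := Hf w ltac:(lra)). assert (E2 := Hf z0 hz). rewrite h0 in E2.
  replace (A w) with (A w - 0)%C by ring. rewrite E1. rewrite E2 at 1. unfold B.
  match goal with |- (?a * ?b - ?a * ?c)%C = (?d * (?a * ?e))%C =>
    replace (a * b - a * c)%C with (a * (b - c))%C by ring;
    replace (d * (a * e))%C with (a * (d * e))%C by ring end.
  f_equal.
  assert (N : forall t v, Cmod (v - z0)%C < r -> (circ z0 r t - v)%C <> 0%C).
  { intros t v hv. apply Cmod_gt_0. assert (T := circ_dist z0 r t v (Rlt_le _ _ hr)). lra. }
  assert (Ck : forall t, rcont (fun t => (/ (circ z0 r t + w * -1)) ^ 1 * phi t)%C t).
  { intros t. apply rcont_mult; [|apply Hphi].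
    apply (rcont_pow (fun t => / (circ z0 r t + w * -1))%C).
    apply (rcont_comp Cinv (fun t => circ z0 r t + w * -1)%C).
    - apply rcont_plus; [apply rcont_circ|apply rcont_const].
    - eapply cderiv_ccont, cderiv_inv_id. replace (circ z0 r t + w * -1)%C with (circ z0 r t - w)%C by ring.
      apply N. lra. }
  assert (I1 : is_CI (fun t => A (circ z0 r t) * cker z0 r w t - A (circ z0 r t) * cker z0 r z0 t)%C 0 (2 * PI)
    (CI (fun t => A (circ z0 r t) * cker z0 r w t)%C 0 (2 * PI) - CI (fun t => A (circ z0 r t) * cker z0 r z0 t)%C 0 (2 * PI))%C).
  { apply is_CI_minus; apply is_CI_CI; try lra; intros t _; (apply rcont_mult; [apply Hphi|apply rcont_cker; [easy|lra]]). }
  rewrite <- (CI_unique _ _ _ _ I1).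
  apply CI_unique.
  apply is_CI_ext with (fun t => (w - z0) * ((/ (circ z0 r t + w * -1)) ^ 1 * phi t))%C; [lra| |].
  - intros t _. unfold phi, cker. replace (circ z0 r t + w * -1)%C with (circ z0 r t - w)%C by ring.
    assert (n1 := N t w ltac:(lra)). assert (n2 := N t z0 hz).
    replace (RtoC r * cis t)%C with (circ z0 r t - z0)%C by (unfold circ; ring).
    field. split; easy.
  - apply is_CI_scal, is_CI_CI; [lra|]. intros t _. apply Ck.
Qed.

(** As long as the numerator vanishes at the centre, one factor [w - z0] cancels. The process ends
    with a nonzero numerator or with order 0. *)
Lemma mrep_cases f z0 : mrep f z0 ->
  (exists A r, CF A z0 r /\ forall w, punct z0 r w -> f w = A w) \/
  (exists m A r, (0 < m)%nat /\ CF A z0 r /\ A z0 <> 0%C /\ forall w, punct z0 r w -> f w = (A w / (w - z0) ^ m)%C).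
Proof.
  intros [m H]. revert H. induction m as [|m IH]; intros [A [r [HA E]]].
  - left. exists A, r. split; [easy|]. intros w hw. rewrite (E w hw). field.
  - destruct (classic (A z0 = 0%C)) as [h0|h0].
    + destruct (CF_divide A z0 r HA h0) as [B [r' [HB [hr' E']]]]. apply IH.
      exists B, r'. split; [easy|]. intros w [k1 k2].
      rewrite (E w ltac:(split; lra)), (E' w ltac:(split; lra)). simpl.
      assert (hu : (w - z0)%C <> 0%C) by (apply Cmod_gt_0; easy).
      field. split; [apply Cpow_nz|]; easy.
    + right. exists (S m), A, r. split; [lia|]. split; [exact HA|]. split; [exact h0|exact E].
Qed.

(* Filling in the removable singularities of a function that is locally [A / u^m]. *)
Lemma mero_repair f : (forall z, mrep f z) ->
  exists G, meromorphic G /\ forall z, analytic_at f z -> G z = f z.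
Proof.
  intros Hf.
  (* [Rm z v] says that [v] is the value at [z] of an analytic extension of [f] from a punctured
     disc; continuity makes this value unique. *)
  set (Rm := fun z v => exists A r, CF A z r /\ A z = v /\ forall w, punct z r w -> f w = A w).
  set (G := fun z => match excluded_middle_informative (exists v, Rm z v) with
    | left _ => epsilon (inhabits (RtoC 0)) (Rm z) | right _ => f z end).
  assert (Uq : forall z v v', Rm z v -> Rm z v' -> v = v').
  { intros z v v' [A [r [HA [<- E]]]] [A' [r' [HA' [<- E']]]].
    assert (hr : 0 < r) by apply HA. assert (hr' : 0 < r') by apply HA'.
    apply (ccont_punct_eq A A' z (Rmin r r')); [apply Rmin_pos; easy|eapply CF_ccont; eassumption|eapply CF_ccont; eassumption|].
    intros w [k1 k2]. apply Rmin_Rgt_l in k2. rewrite <- E, <- E'; [easy| |]; split; lra. }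
  assert (GR : forall z v, Rm z v -> G z = v).
  { intros z v Hv. unfold G. destruct (excluded_middle_informative (exists v, Rm z v)) as [X|X].
    - apply (Uq z); [|easy]. apply epsilon_spec. exact X.
    - exfalso. apply X. exists v. easy. }
  assert (Ga : forall z, analytic_at f z -> G z = f z).
  { intros z Hz. apply GR. destruct (analytic_CF f z Hz) as [r Hr]. exists f, r. repeat split; try easy; apply Hr. }
  exists G. split; [|easy].
  intros z0.
  (* In the punctured disc [f] is already analytic, so the repair can alter only the value at the
     centre. *)
  assert (Loc : forall m A r, CF A z0 r -> (forall w, punct z0 r w -> f w = (A w / (w - z0) ^ m)%C) ->
    forall w, punct z0 r w -> G w = f w).
  { intros m A r HA E w hw. apply Ga.
    assert (Hh : holo (punct z0 r) (fun w => A w / (w - z0) ^ m)%C).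
    { assert (O := copen_punct z0 r). apply holo_mult; [easy| |apply holo_inv; [easy| |]].
      - apply (holo_subset (fun w => Cmod (w - z0)%C < r)); [intros u [_ hu]; easy|apply CF_holo_disc; easy].
      - apply holo_pow; [easy|]. apply holo_minus; [easy|apply holo_id; easy|apply holo_const; easy].
      - intros u [hu _]. apply Cpow_nz, Cmod_gt_0; easy. }
    apply (holo_analytic (punct z0 r)); [apply copen_punct| |easy].
    apply (holo_ext _ (fun w => A w / (w - z0) ^ m)%C); [apply copen_punct| |easy].
    intros u hu. symmetry. apply E; easy. }
  destruct (mrep_cases f z0 (Hf z0)) as [[A [r [HA E]]]|[m [A [r [hm [HA [h0 E]]]]]]].
  - left. assert (hr : 0 < r) by apply HA.
    assert (GA : forall w, Cmod (w - z0)%C < r -> A w = G w).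
    { intros w hw. destruct (Req_dec (Cmod (w - z0)%C) 0) as [k|k].
      - apply Cmod_eq_0, Ceq_minus in k. subst w. symmetry. apply GR. exists A, r. easy.
      - assert (T := Cmod_ge_0 (w - z0)). rewrite (Loc O A r HA) by (try split; try lra; intros u hu; rewrite (E u hu); simpl; field).
        symmetry. apply E. split; lra. }
    apply (holo_analytic (fun w => Cmod (w - z0)%C < r)); [apply copen_disc| |].
    + apply (holo_ext _ A); [apply copen_disc|easy|apply CF_holo_disc; easy].
    + replace (z0 - z0)%C with (RtoC 0) by ring. rewrite Cmod_0. easy.
  - right. assert (hr : 0 < r) by apply HA.
    exists m, A, (mkposreal r hr). split; [easy|]. split; [eapply CF_analytic; eassumption|].
    split; [easy|]. intros w hw. simpl in hw. rewrite pow_n_Cpow, (Loc m A r HA E w hw). apply E; easy.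
Qed.

(** * The zeta function *)

Lemma copen_Re_gt x : copen (fun s => x < Re s).
Proof.
  intros s hs. exists (Re s - x). split; [lra|]. intros h hh.
  assert (T := re_le_Cmod h). assert (T2 := Rle_abs (- Re h)). rewrite Rabs_Ropp in T2.
  unfold Re in *. simpl. lra.
Qed.

Lemma copen_one_minus : copen (fun s => (1 - s)%C <> 0%C).
Proof.
  intros s hs. apply Cmod_gt_0 in hs. exists (Cmod (1 - s)%C). split; [easy|]. intros h hh.
  apply Cmod_gt_0. replace (1 - (s + h))%C with ((1 - s) - h)%C by ring.
  assert (T := Cmod_rev_triangle (1 - s) h). lra.
Qed.

Lemma Zc_meromorphic : meromorphic Zc.
Proof.
  intros s. destruct (classic ((1 - s)%C = 0%C)) as [h|h].
  - right. assert (s = 1%C) as -> by (replace s with (1 - (1 - s))%C by ring; rewrite h; ring).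
    (* Near 1 the function is [- Zt (1 - s) / (s - 1)], a simple pole whose residue [- Zt 0] is
       1. *)
    exists 1%nat, (fun s => - Zt (1 - s))%C, (mkposreal 1 Rlt_0_1). split; [lia|]. split; [|split].
    + apply (holo_analytic plane); [apply copen_plane| |easy].
      apply holo_opp; [apply copen_plane|]. apply (holo_comp plane plane); [apply copen_plane| |apply holo_Zt|easy].
      apply holo_minus; [apply copen_plane|apply holo_const, copen_plane|apply holo_id, copen_plane].
    + replace (1 - 1)%C with (RtoC 0) by ring. rewrite Zt_0. intros E. apply (f_equal Re) in E. simpl in E. lra.
    + intros z hz. rewrite pow_n_Cpow. unfold Zc.
      assert ((z - 1)%C <> 0%C) by (apply Cmod_gt_0; easy).
      assert ((1 - z)%C <> 0%C) by (intros E; apply H; replace (z - 1)%C with (- (1 - z))%C by ring; rewrite E; ring).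
      field. easy.
  - left. apply (holo_analytic (fun s => (1 - s)%C <> 0%C)); [apply copen_one_minus|apply Zc_holo|easy].
Qed.

Lemma zeta_Zc s : (1 - s)%C <> 0%C -> exists r, 0 < r /\ forall w, Cmod (w - s)%C < r -> zeta w = Zc w.
Proof.
  intros hs. apply (continuation_eq _ _ Zc (RtoC 2)).
  - apply copen_Re_gt.
  - simpl. lra.
  - apply Zc_meromorphic.
  - intros w hw. apply Zc_series; easy.
  - apply (holo_analytic (fun s => (1 - s)%C <> 0%C)); [apply copen_one_minus|apply Zc_holo|easy].
Qed.

Lemma zeta_at s : (1 - s)%C <> 0%C -> zeta s = Zc s /\ C_derive zeta s = C_derive Zc s.
Proof.
  intros hs. destruct (zeta_Zc s hs) as [r [hr E]]. split.
  - apply E. replace (s - s)%C with (RtoC 0) by ring. rewrite Cmod_0. easy.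
  - apply cderiv_C_derive. apply (cderiv_ext_loc Zc _ s _ r hr).
    + intros w hw. symmetry. apply E; easy.
    + apply (holo_cderiv (fun s => (1 - s)%C <> 0%C)); [apply Zc_holo|easy].
Qed.

(* [z^w / w] is a primitive of [z^(w-1)]. *)
Lemma LamS_zeta (w : C) N : w <> 0%C -> Re w + 1 <= INR N - 1 ->
  Clim (fun n => LamS N n (fun z => / w * pw w z)%C) (zeta (1 - w)).
Proof.
  intros hw hN.
  assert (hs : (1 - (1 - w))%C <> 0%C) by (replace (1 - (1 - w))%C with w by ring; easy).
  destruct (zeta_at (1 - w) hs) as [-> _].
  unfold Zc. replace (1 - (1 - w))%C with w by ring.
  apply Clim_ext with (fun n => / w * LamS N n (pw w))%C.
  - intros n. symmetry. apply (LamS_scal slit); [apply copen_slit|apply holo_pw|apply slit_pos].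
  - replace (Zt w / w)%C with (/ w * Zt w)%C by (field; easy). apply Clim_scal, Zt_spec. lra.
Qed.

Lemma LamS_zeta' (w : C) N : w <> 0%C -> Re w + 1 <= INR N - 1 ->
  Clim (fun n => LamS N n (fun z => / w * pl w z - / (w * w) * pw w z)%C) (- C_derive zeta (1 - w))%C.
Proof.
  intros hw hN.
  assert (hs : (1 - (1 - w))%C <> 0%C) by (replace (1 - (1 - w))%C with w by ring; easy).
  destruct (zeta_at (1 - w) hs) as [_ ->].
  assert (T := Zc_derive (1 - w) N hs). replace (1 - (1 - w))%C with w in T by ring.
  eapply Clim_ext; [|apply T; easy]. intros n. cbv beta. f_equal.
  apply functional_extensionality. intros z. field. easy.
Qed.

(** * Mellin transforms and the digamma function *)

Lemma IInt_RInt_gen (h : R -> R) l : IInt (fun t => RtoC (h t)) l ->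
  RInt_gen (V := R_CompleteNormedModule) h (at_right 0) (Rbar_locally p_infty) = Re l.
Proof.
  intros [Hc H].
  apply (is_RInt_gen_unique (V := R_CompleteNormedModule)).
  apply (filterlimi_locally (U := R_CompleteNormedModule)). intros eps.
  assert (he := cond_pos eps).
  destruct (H (eps / 2)) as [r [m [hr [hm K]]]]; [lra|].
  exists (fun a => 0 < a < r) (fun b => m < b).
  - exists (mkposreal r hr). intros y hy h0. split; [easy|].
    change (Rabs (y - 0) < r) in hy. rewrite Rminus_0_r, Rabs_pos_eq in hy; lra.
  - exists m. easy.
  - intros a b ha hb. simpl in ha, hb. exists (Re (CI (fun t => RtoC (h t)) a b)). split.
    + assert (T : is_CI (fun t => RtoC (h t)) a b (CI (fun t => RtoC (h t)) a b)).
      { apply is_CI_CI; [simpl; lra|]. intros t ht. apply Hc. simpl in ht. lra. }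
      apply (is_RInt_fct_extend_fst (U := R_NormedModule) (V := R_NormedModule)) in T. exact T.
    + specialize (K a b ha hb).
      change (Rabs (Re (CI (fun t => RtoC (h t)) a b) - Re l) < eps).
      assert (T := re_le_Cmod (CI (fun t => RtoC (h t)) a b - l)).
      change (Re (CI (fun t => RtoC (h t)) a b - l)) with (Re (CI (fun t => RtoC (h t)) a b) - Re l) in T. lra.
Qed.

Lemma Rpower_le_pow t x n : 1 <= t -> x <= INR n -> Rpower t x <= t ^ n.
Proof. intros ht hx. rewrite <- Rpower_pow by lra. apply Rle_Rpower; easy. Qed.

Lemma Rpower_anti t p q : 0 < t <= 1 -> p <= q -> Rpower t q <= Rpower t p.
Proof.
  intros ht h. apply exp_le.
  assert (ln t <= 0).
  { rewrite <- ln_1. destruct (Req_dec t 1) as [->|]; [lra|]. left. apply ln_increasing; lra. }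
  nra.
Qed.

Lemma rcont_ln t : 0 < t -> rcont (fun t => RtoC (ln t)) t.
Proof. intros ht. eapply rderiv_rcont, rderiv_RtoC_comp. auto_derive; [easy|reflexivity]. Qed.

(** The power [t^w] for [t > 0], written in the form [Cexp (c + w * q t)] with [c = 0] so that
    [cderiv_CI_affine] applies to it as a function of [w]. *)
Definition tpow (w : C) (t : R) : C := Cexp (0 + w * RtoC (ln t))%C.

Lemma tpow_Cpower w t : 0 < t -> tpow w t = Cpower (RtoC t) w.
Proof. intros ht. unfold tpow, Cpower. rewrite Clog_RtoC by easy. f_equal. ring. Qed.

Lemma Cmod_tpow w t : 0 < t -> Cmod (tpow w t)%C = Rpower t (Re w).
Proof. intros ht. rewrite tpow_Cpower by easy. apply Cmod_Cpower_pos; easy. Qed.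

Lemma rcont_tpow w t : 0 < t -> rcont (tpow w) t.
Proof.
  intros ht. apply (rcont_Cexp (fun t => 0 + w * RtoC (ln t))%C).
  apply rcont_plus; [apply rcont_const|]. apply rcont_mult; [apply rcont_const|apply rcont_ln; easy].
Qed.

Lemma Holo_Cexp : Holo plane Cexp Cexp.
Proof. intros z _. split; [apply cderiv_Cexp|eapply cderiv_ccont, cderiv_Cexp]. Qed.

Lemma holo_Mellin (k : R -> C) a b : 0 < a <= b -> (forall t, 0 < t -> rcont k t) ->
  holo plane (fun w => CI (fun t => tpow w t * k t)%C a b).
Proof.
  intros hab hk.
  assert (D : forall (j : R -> C), (forall t, 0 < t -> rcont j t) -> forall w,
    cderiv (fun w => CI (fun t => tpow w t * j t)%C a b) w (CI (fun t => tpow w t * (RtoC (ln t) * j t))%C a b)).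
  { intros j hj w.
    eapply cderiv_eq; [|apply (cderiv_CI_affine plane Cexp Cexp (fun _ => 0%C)%C (fun t => RtoC (ln t)) j a b w);
      [lra|apply copen_plane|apply Holo_Cexp|intros; apply rcont_const|intros; apply rcont_ln; lra|intros; apply hj; lra|easy]].
    apply CI_ext; [lra|]. intros t ht. unfold tpow. ring. }
  apply (Holo_holo plane _ (fun w => CI (fun t => tpow w t * (RtoC (ln t) * k t))%C a b)); [apply copen_plane|].
  intros w _. split; [apply D; easy|]. eapply cderiv_ccont, D.
  intros t ht. apply rcont_mult; [apply rcont_ln|apply hk]; easy.
Qed.

(** A truncated Mellin integral with separate integrands on the two sides of 1: an expansion at 0 is
    to be subtracted on [(0, 1]] only, since it would spoil the decay at infinity. *)
Definition Mn (u v : R -> C) (n : nat) (w : C) : C :=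
  (CI (fun t => tpow w t * u t) (/ INR (S n)) 1 + CI (fun t => tpow w t * v t) 1 (INR (S n)))%C.

(** Order [t^m] at 0 and decay faster than every power at infinity; the integral then converges for
    [Re w > - m - 1]. *)
Definition Mellin_data (u v : R -> C) (m : R) : Prop :=
  (forall t, 0 < t -> rcont u t /\ rcont v t) /\
  (exists A, 0 < A /\ forall t, 0 < t <= 1 -> Cmod (u t)%C <= A * Rpower t m) /\
  (forall q, exists B, 0 <= B /\ forall t, 1 <= t -> Cmod (v t)%C * t ^ q <= B).

Lemma Mellin_far (v : R -> C) tau : (forall q, exists B, 0 <= B /\ forall t, 1 <= t -> Cmod (v t)%C * t ^ q <= B) ->
  exists B, 0 <= B /\ forall w t, Re w <= tau -> 1 <= t -> Cmod (tpow w t * v t)%C <= B / (t * t).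
Proof.
  intros H. destruct (INR_large tau) as [q hq]. specialize (hq q (Nat.le_refl _)).
  destruct (H (q + 2)%nat) as [B [hB HB]]. exists B. split; [easy|]. intros w t hw ht.
  rewrite Cmod_mult, Cmod_tpow by lra. specialize (HB t ht). rewrite pow_add in HB.
  assert (Y : Rpower t (Re w) * (t * t) <= t ^ q * t ^ 2).
  { simpl (t ^ 2). rewrite Rmult_1_r. apply Rmult_le_compat_r; [nra|]. apply Rpower_le_pow; lra. }
  assert (h2 : 0 < t * t) by nra.
  apply Rmult_le_reg_r with (t * t); [easy|]. unfold Rdiv. rewrite (Rmult_assoc B), Rinv_l, Rmult_1_r by lra.
  eapply Rle_trans; [|exact HB]. rewrite (Rmult_comm (Rpower _ _)), Rmult_assoc.
  apply Rmult_le_compat_l; [apply Cmod_ge_0|easy].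
Qed.

Lemma Mellin_near (u : R -> C) A m : 0 < A -> (forall t, 0 < t <= 1 -> Cmod (u t)%C <= A * Rpower t m) ->
  forall w t e, e <= Re w + m -> 0 < t <= 1 -> Cmod (tpow w t * u t)%C <= A * Rpower t e.
Proof.
  intros hA H w t e hw ht. rewrite Cmod_mult, Cmod_tpow by lra. assert (P := Rpower_pos t (Re w)).
  apply Rle_trans with (Rpower t (Re w) * (A * Rpower t m)); [apply Rmult_le_compat_l; [lra|apply H, ht]|].
  replace (Rpower t (Re w) * (A * Rpower t m)) with (A * Rpower t (Re w + m)) by (rewrite Rpower_plus; ring).
  apply Rmult_le_compat_l; [lra|]. apply Rpower_anti; lra.
Qed.

Lemma Re_near w w0 e : Cmod (w - w0)%C <= e -> Re w0 - e <= Re w <= Re w0 + e.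
Proof.
  intros h. assert (T := Rle_trans _ _ _ (re_le_Cmod (w - w0)) h). change (Re (w - w0)) with (Re w - Re w0) in T.
  apply Rabs_le_between in T. lra.
Qed.

(** Throughout the disc of radius [eta] the integrands are dominated by fixed multiples of
    [t^(eta - 1)] near 0 and of [1 / t^2] at infinity, so the tails are small uniformly in [w]. *)
Lemma Mn_Cauchy u v m w0 eta : Mellin_data u v m -> 0 < eta -> eta - 1 <= Re w0 - eta + m ->
  forall eps, 0 < eps -> exists N, forall n p, (N <= n)%nat -> (n <= p)%nat ->
  forall w, Cmod (w - w0)%C <= eta -> Cmod (Mn u v p w - Mn u v n w)%C <= eps.
Proof.
  intros [Hc [[A [hA HA]] HB]] heta hRe eps heps.
  destruct (Mellin_far v (Re w0 + eta) HB) as [B [hB HBv]].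
  assert (hAe : 0 < A / eta) by (apply Rdiv_lt_0_compat; lra).
  destruct (Rpower_small eta (eps / 2 / (A / eta)) heta) as [r [hr Hr]].
  { apply Rdiv_lt_0_compat; lra. }
  destruct (inv_INR_small (Rmin r (eps / (2 * (B + 1))))) as [N HN].
  { apply Rmin_pos; [lra|apply Rdiv_lt_0_compat; lra]. }
  exists N. intros n p hn hp w hw. apply Re_near in hw.
  destruct (HN n hn) as [hn0 hn1]. apply Rmin_Rgt_l in hn1. destruct hn1 as [hn1 hn2].
  assert (h1n := INR_S_ge_1 n). assert (hp0 := inv_INR_S p).
  assert (hnp : INR (S n) <= INR (S p)) by (apply le_INR; lia).
  assert (hin : / INR (S p) <= / INR (S n)) by (apply Rinv_le_contravar; lra).
  set (f := fun t => (tpow w t * u t)%C). set (g := fun t => (tpow w t * v t)%C).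
  assert (Cf : forall t, 0 < t -> rcont f t) by (intros t ht; apply rcont_mult; [apply rcont_tpow|apply Hc]; easy).
  assert (Cg : forall t, 0 < t -> rcont g t) by (intros t ht; apply rcont_mult; [apply rcont_tpow|apply Hc]; easy).
  unfold Mn. fold f g.
  rewrite (is_CI_split f (/ INR (S p)) (/ INR (S n)) 1) by (try lra; intros t ht; apply Cf; lra).
  rewrite (is_CI_split g 1 (INR (S n)) (INR (S p))) by (try lra; intros t ht; apply Cg; lra).
  match goal with |- Cmod (Cminus (Cplus (Cplus ?a ?b) (Cplus ?c ?d)) _)%C <= _ =>
    replace (a + b + (c + d) - (b + c))%C with (a + d)%C by ring end.
  eapply Rle_trans; [apply Cmod_triangle|].
  assert (Tf : Cmod (CI f (/ INR (S p)) (/ INR (S n)))%C <= eps / 2).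
  { eapply Rle_trans; [apply (CI_dom_0 f A (eta - 1)); [lra|lra|intros t ht; apply Cf; lra|]|].
    - intros t ht. apply (Mellin_near u A m); try easy; lra.
    - replace (eta - 1 + 1) with eta by ring.
      assert (P : Rpower (/ INR (S n)) eta <= Rpower r eta) by (apply Rle_Rpower_l; lra).
      assert (P0 := Rpower_pos (/ INR (S p)) eta).
      apply Rle_trans with (A / eta * (eps / 2 / (A / eta))); [apply Rmult_le_compat_l; lra|].
      apply Req_le. field. lra. }
  assert (Tg : Cmod (CI g (INR (S n)) (INR (S p)))%C <= eps / 2).
  { eapply Rle_trans; [apply (CI_dom_oo g B); [lra|intros t ht; apply Cg; lra|]|].
    - intros t ht. apply HBv; lra.
    - apply Rle_trans with ((B + 1) * (eps / (2 * (B + 1)))); [apply Rmult_le_compat; lra|apply Req_le; field; lra]. }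
  lra.
Qed.

Definition Mlim (u v : R -> C) (w : C) : C := epsilon (inhabits (RtoC 0)) (Clim (fun n => Mn u v n w)).

Lemma Mlim_spec u v m w : Mellin_data u v m -> - m - 1 < Re w -> Clim (fun n => Mn u v n w) (Mlim u v w).
Proof.
  intros H hw. unfold Mlim. apply epsilon_spec. apply Clim_Cauchy. intros eps he.
  destruct (Mn_Cauchy u v m w ((Re w + m + 1) / 2) H ltac:(lra) ltac:(lra) eps he) as [N HN].
  exists N. assert (hz : Cmod (w - w)%C <= (Re w + m + 1) / 2) by (replace (w - w)%C with (RtoC 0) by ring; rewrite Cmod_0; lra).
  intros n p hn hp. destruct (Nat.le_ge_cases n p) as [h|h]; [rewrite Cmod_minus_sym|]; apply HN; easy.
Qed.

Lemma Mlim_unique u v m w l : Mellin_data u v m -> - m - 1 < Re w -> Clim (fun n => Mn u v n w) l -> Mlim u v w = l.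
Proof. intros H hw hl. eapply Clim_unique; [eapply Mlim_spec; eassumption|exact hl]. Qed.

(** The truncated integrals are entire in [w] and converge uniformly on a disc, so [CF_limit]
    carries the Cauchy formula to the limit. *)
Lemma Mlim_CF u v m w0 : Mellin_data u v m -> - m - 1 < Re w0 -> exists r, CF (Mlim u v) w0 r.
Proof.
  intros H hw. set (eta := (Re w0 + m + 1) / 2). assert (heta : 0 < eta) by (unfold eta; lra).
  exists eta. apply (CF_limit (Mn u v)); [easy| |].
  - intros n. assert (h := inv_INR_S n). assert (h1 := INR_S_ge_1 n).
    apply (holo_CF plane); [apply copen_plane| |easy|easy].
    apply holo_plus; [apply copen_plane| |]; apply holo_Mellin; try lra; apply H.
  - intros eps he. destruct (Mn_Cauchy u v m w0 eta H heta ltac:(unfold eta; lra) (eps / 2) ltac:(lra)) as [N HN].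
    exists N. intros n hn w hw'. assert (hRw := Re_near _ _ _ hw').
    destruct (Mlim_spec u v m w H ltac:(unfold eta in hRw; lra) (eps / 2) ltac:(lra)) as [M HM].
    specialize (HM (max n M) ltac:(lia)). specialize (HN n (max n M) hn ltac:(lia) w hw').
    rewrite Cmod_minus_sym in HN.
    eapply Rle_trans; [apply Cmod_split with (y := Mn u v (max n M) w)|]. lra.
Qed.

Lemma Mlim_IInt u m w : Mellin_data u u m -> - m - 1 < Re w -> IInt (fun t => tpow w t * u t)%C (Mlim u u w).
Proof.
  intros H hw. assert (H' := H). destruct H' as [Hc [[A [hA HA]] HB]].
  destruct (Mellin_far u (Re w) HB) as [B [hB HBu]].
  set (f := fun t => (tpow w t * u t)%C).
  assert (Cf : forall t, 0 < t -> rcont f t) by (intros t ht; apply rcont_mult; [apply rcont_tpow|apply Hc]; easy).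
  destruct (IInt_dom f (A + B) (Re w + m)) as [l [hl _]]; try easy; try lra.
  - intros t ht. eapply Rle_trans; [apply (Mellin_near u A m hA HA w t (Re w + m)); lra|].
    apply Rmult_le_compat_r; [left; apply Rpower_pos|lra].
  - intros t ht. eapply Rle_trans; [apply HBu; lra|].
    apply Rmult_le_compat_r; [left; apply Rinv_0_lt_compat; nra|lra].
  - rewrite (Mlim_unique u u m w l H hw); [easy|].
    intros eps he. destruct (proj2 hl eps he) as [r [M [hr [hM K]]]].
    destruct (inv_INR_small r hr) as [N HN]. destruct (INR_large M) as [N' HN'].
    exists (max N N'). intros n hn. specialize (HN n ltac:(lia)). specialize (HN' n ltac:(lia)).
    assert (h := inv_INR_S n). assert (h1 := INR_S_ge_1 n). unfold Mn. fold f.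
    rewrite <- (is_CI_split f) by (try lra; intros t ht; apply Cf; lra). apply K; [easy|]. rewrite S_INR. lra.
Qed.

(** * The Gamma function at positive reals and differences of digamma *)

Definition gf (x t : R) : R := Rpower t (x - 1) * exp (- t).

Lemma gf_pos x t : 0 < gf x t.
Proof. apply Rmult_lt_0_compat; [apply Rpower_pos|apply exp_pos]. Qed.

Lemma is_derive_gf x t : 0 < t ->
  is_derive (fun t => - gf (x + 1) t) t (gf (x + 1) t - x * gf x t).
Proof.
  intros ht. unfold gf. replace (x + 1 - 1) with x by ring.
  assert (E : Rpower t (x - 1) = Rpower t x / t).
  { unfold Rminus. rewrite Rpower_plus, Rpower_Ropp, Rpower_1 by easy. easy. }
  rewrite E. unfold Rpower. auto_derive; [easy|]. field. lra.
Qed.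

Definition expm (t : R) : C := RtoC (exp (- t)).

Lemma expm_data : Mellin_data expm expm 0.
Proof.
  assert (Cm : forall t, Cmod (expm t)%C = exp (- t)).
  { intros t. unfold expm. rewrite Cmod_R. apply Rabs_pos_eq. left. apply exp_pos. }
  repeat split.
  - eapply rderiv_rcont, rderiv_RtoC_comp. auto_derive; [easy|reflexivity].
  - eapply rderiv_rcont, rderiv_RtoC_comp. auto_derive; [easy|reflexivity].
  - exists 1. split; [lra|]. intros t ht. rewrite Cm, Rpower_O, Rmult_1_r, <- exp_0 by lra. apply exp_le. lra.
  - intros q. exists (INR (fact q)). split; [left; apply INR_fact_lt_0|]. intros t ht. rewrite Cm.
    assert (T := exp_neg_le q t ltac:(lra)). assert (P : 0 < t ^ q) by (apply pow_lt; lra).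
    apply Rmult_le_compat_r with (r := t ^ q) in T; [|lra].
    replace (INR (fact q) / t ^ q * t ^ q) with (INR (fact q)) in T by (field; lra). exact T.
Qed.

Definition Gc (x : R) : C := Mlim expm expm (RtoC (x - 1)).

Lemma Gc_IInt x : 0 < x -> IInt (fun t => RtoC (gf x t)) (Gc x).
Proof.
  intros hx. apply IInt_ext with (fun t => tpow (RtoC (x - 1)) t * expm t)%C.
  - intros t ht. rewrite tpow_Cpower, Cpower_RtoC by easy. unfold gf, expm. rewrite RtoC_mult. easy.
  - apply (Mlim_IInt expm 0); [apply expm_data|]. simpl. lra.
Qed.

Lemma Gamma_Gc x : 0 < x -> Gamma x = Re (Gc x).
Proof. intros hx. apply (IInt_RInt_gen (gf x)), Gc_IInt, hx. Qed.

Lemma gf_limits x : 0 <= x ->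
  (forall eps, 0 < eps -> exists m, forall t, m < t -> gf (x + 1) t <= eps).
Proof.
  intros hx eps he. destruct (INR_large x) as [n hn]. specialize (hn n (Nat.le_refl n)).
  assert (hf := INR_fact_lt_0 (S n)).
  exists (1 + INR (fact (S n)) / eps). intros t ht.
  assert (h1 : 0 < INR (fact (S n)) / eps) by (apply Rdiv_lt_0_compat; easy).
  unfold gf. replace (x + 1 - 1) with x by ring.
  assert (P := Rpower_le_pow t x n ltac:(lra) hn).
  assert (E := exp_neg_le (S n) t ltac:(lra)).
  assert (hp : 0 < t ^ n) by (apply pow_lt; lra).
  apply Rle_trans with (t ^ n * (INR (fact (S n)) / t ^ S n)).
  { apply Rmult_le_compat; try easy; left; [apply Rpower_pos|apply exp_pos]. }
  replace (t ^ n * (INR (fact (S n)) / t ^ S n)) with (INR (fact (S n)) / t) by (simpl pow; field; split; lra).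
  apply Rmult_le_reg_r with t; [lra|]. unfold Rdiv. rewrite Rmult_assoc, Rinv_l by lra.
  assert (T : INR (fact (S n)) / eps * eps <= t * eps) by (apply Rmult_le_compat_r; lra).
  replace (INR (fact (S n)) / eps * eps) with (INR (fact (S n))) in T by (field; lra). lra.
Qed.

Lemma Gamma_succ x : 0 < x -> Gamma (x + 1) = x * Gamma x.
Proof.
  intros hx.
  assert (I1 : IInt (fun t => RtoC (gf (x + 1) t) - RtoC x * RtoC (gf x t))%C (Gc (x + 1) - RtoC x * Gc x)%C).
  { apply IInt_minus; [|apply IInt_scal]; apply Gc_IInt; lra. }
  assert (I2 : IInt (fun t => RtoC (gf (x + 1) t) - RtoC x * RtoC (gf x t))%C (0 - 0)%C).
  { apply (IInt_derive (fun t => RtoC (- gf (x + 1) t))).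
    - intros t ht. eapply rderiv_eq; [|apply rderiv_RtoC_comp, is_derive_gf, ht].
      rewrite RtoC_minus, RtoC_mult. easy.
    - apply I1.
    - intros eps he. destruct (Rpower_small x eps) as [r [hr E]]; [lra|easy|]. exists r. split; [easy|].
      intros t ht. replace (RtoC (- gf (x + 1) t) - 0)%C with (RtoC (- gf (x + 1) t)) by ring.
      rewrite Cmod_R, Rabs_Ropp, Rabs_pos_eq by (left; apply gf_pos).
      unfold gf. replace (x + 1 - 1) with x by ring.
      assert (Rpower t x <= Rpower r x) by (apply Rle_Rpower_l; lra).
      assert (exp (- t) <= 1) by (rewrite <- exp_0; apply exp_le; lra).
      assert (P := Rpower_pos t x). assert (Rpower t x * exp (- t) <= Rpower t x * 1) by (apply Rmult_le_compat_l; lra).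
      lra.
    - intros eps he. destruct (gf_limits x ltac:(lra) eps he) as [m Hm]. exists m. intros t ht.
      replace (RtoC (- gf (x + 1) t) - 0)%C with (RtoC (- gf (x + 1) t)) by ring.
      rewrite Cmod_R, Rabs_Ropp, Rabs_pos_eq by (left; apply gf_pos). apply Hm. easy. }
  assert (E := IInt_unique _ _ _ I1 I2). rewrite !Gamma_Gc by lra.
  replace (Gc (x + 1)) with ((Gc (x + 1) - RtoC x * Gc x) + RtoC x * Gc x)%C by ring. rewrite E. unfold Re. simpl. ring.
Qed.

Lemma Gamma_1 : Gamma 1 = 1.
Proof.
  assert (I1 := Gc_IInt 1 ltac:(lra)).
  assert (E1 : forall t, gf 1 t = exp (- t)).
  { intros t. unfold gf. replace (1 - 1) with 0 by ring. unfold Rpower. rewrite Rmult_0_l, exp_0. ring. }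
  assert (I2 : IInt (fun t => RtoC (gf 1 t)) (0 - RtoC (-1))%C).
  { apply (IInt_derive (fun t => RtoC (- exp (- t)))).
    - intros t ht. rewrite E1. apply rderiv_RtoC_comp. auto_derive; [easy|]. ring.
    - apply I1.
    - intros eps he. exists eps. split; [easy|]. intros t ht. rewrite <- RtoC_minus, Cmod_R.
      assert (T := exp_ineq1_le (- t)).
      assert (exp (- t) <= 1) by (rewrite <- exp_0; apply exp_le; lra).
      rewrite Rabs_pos_eq; lra.
    - intros eps he. destruct (gf_limits 0 ltac:(lra) eps he) as [m Hm]. exists m. intros t ht.
      specialize (Hm t ht). rewrite Rplus_0_l, E1 in Hm.
      replace (RtoC (- exp (- t)) - 0)%C with (RtoC (- exp (- t))) by ring.
      rewrite Cmod_R, Rabs_Ropp, Rabs_pos_eq by (left; apply exp_pos). easy. }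
  rewrite Gamma_Gc, (IInt_unique _ _ _ I1 I2) by lra. simpl. ring.
Qed.

(** [Gamma] is the real part of a Mellin integral, which is analytic in its exponent; the shift by 1
    comes from the exponent [x - 1]. *)
Lemma ex_derive_Gamma x : 0 < x -> ex_derive Gamma x.
Proof.
  intros hx. destruct (Mlim_CF expm expm 0 (RtoC (x - 1)) expm_data ltac:(simpl; lra)) as [r Hr].
  assert (D := CF_cderiv _ _ _ _ Hr (disc_center (RtoC (x - 1)) r (proj1 Hr))).
  apply (rderiv_of_cderiv (Mlim expm expm)), rderiv_Re in D.
  eexists. apply (is_derive_ext_loc (fun y => Re (Mlim expm expm (RtoC (y - 1))))).
  - exists (mkposreal x hx). intros y hy. symmetry. apply Gamma_Gc.
    change (Rabs (y - x) < x) in hy. apply Rabs_lt_between in hy. lra.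
  - apply (is_derive_comp (fun t => Re (Mlim expm expm (RtoC t))) (fun y => y - 1)); [exact D|].
    auto_derive; [easy|reflexivity].
Qed.

Lemma digamma_succ x : 0 < x -> Gamma x <> 0 -> digamma (x + 1) = digamma x + / x.
Proof.
  intros hx hG. unfold digamma.
  assert (D : Derive Gamma (x + 1) = Gamma x + x * Derive Gamma x).
  { assert (H : is_derive (fun y => Gamma (y + 1)) x (Derive Gamma (x + 1))).
    { evar_last; [apply (is_derive_comp Gamma (fun y => y + 1))|].
      - apply Derive_correct, ex_derive_Gamma. lra.
      - auto_derive; [easy|reflexivity].
      - unfold scal; simpl; unfold mult; simpl. ring. }
    assert (H2 : is_derive (fun y => Gamma (y + 1)) x (Gamma x + x * Derive Gamma x)).
    { apply (is_derive_ext_loc (fun y => y * Gamma y)).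
      - exists (mkposreal x hx). intros y hy. symmetry. apply Gamma_succ.
        change (Rabs (y - x) < x) in hy. apply Rabs_lt_between in hy. lra.
      - auto_derive; [apply ex_derive_Gamma; easy|]. change (fun x0 => Gamma x0) with Gamma. ring. }
    apply is_derive_unique in H. apply is_derive_unique in H2. rewrite H in H2. exact H2. }
  rewrite D, Gamma_succ by lra. field. lra.
Qed.

Lemma Gamma_INR_pos r : 0 < Gamma (1 + INR r).
Proof.
  induction r as [|r IH].
  - rewrite Rplus_0_r, Gamma_1. lra.
  - rewrite S_INR. replace (1 + (INR r + 1)) with ((1 + INR r) + 1) by ring.
    assert (h := pos_INR r). rewrite Gamma_succ by lra. apply Rmult_lt_0_compat; lra.
Qed.

(** Logarithmic differentiation of [Gamma (x + 1) = x Gamma x] adds [1 / x] at each step. The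
    theorem uses digamma only through these differences. *)
Lemma digamma_harmonic r : digamma (1 + INR r) - digamma 1 = hsum r.
Proof.
  induction r as [|r IH].
  - rewrite Rplus_0_r. unfold hsum. simpl. ring.
  - assert (h := pos_INR r). assert (P := Gamma_INR_pos r).
    replace (1 + INR (S r)) with ((1 + INR r) + 1) by (rewrite S_INR; ring).
    rewrite digamma_succ by lra. rewrite hsum_S, <- IH, S_INR.
    replace (INR r + 1) with (1 + INR r) by ring. ring.
Qed.

(** * Expansion of the summand *)

Lemma pochhammer_S_l x n : pochhammer x (S n) = x * pochhammer (x + 1) n.
Proof.
  induction n as [|n IH].
  - simpl. ring.
  - change (pochhammer x (S (S n))) with (pochhammer x (S n) * (x + INR (S n))). rewrite IH.
    cbn [pochhammer]. rewrite S_INR. ring.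
Qed.

Lemma pochhammer_pos x n : 0 < x -> 0 < pochhammer x n.
Proof.
  intros hx. induction n as [|n IH]; simpl; [lra|]. apply Rmult_lt_0_compat; [easy|].
  assert (T := pos_INR n). lra.
Qed.

Lemma pochhammer_neg k r : (r <= k)%nat ->
  pochhammer (- INR k) r * INR (fact (k - r)) = (-1) ^ r * INR (fact k).
Proof.
  induction r as [|r IH]; intros h.
  - simpl. rewrite Nat.sub_0_r. ring.
  - specialize (IH ltac:(lia)). cbn [pochhammer].
    replace (k - r)%nat with (S (k - S r)) in IH by lia. rewrite fact_simpl, mult_INR in IH.
    assert (E : INR (S (k - S r)) = INR k - INR r) by (rewrite <- minus_INR by lia; f_equal; lia).
    rewrite E in IH. rewrite <- tech_pow_Rmult, (Rmult_assoc (-1)), <- IH. ring.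
Qed.

Lemma pochhammer_two r : pochhammer 2 r = INR (fact (S r)).
Proof.
  induction r as [|r IH]; [simpl; ring|]. cbn [pochhammer]. rewrite IH, (fact_simpl (S r)), mult_INR, !S_INR. ring.
Qed.

Lemma pochhammer_reflect mu k r : (r <= k)%nat ->
  pochhammer (1 - mu - INR k) r * pochhammer mu (k - r) = (-1) ^ r * pochhammer mu k.
Proof.
  induction r as [|r IH]; intros h.
  - simpl. rewrite Nat.sub_0_r. ring.
  - specialize (IH ltac:(lia)). cbn [pochhammer].
    replace (k - r)%nat with (S (k - S r)) in IH by lia. cbn [pochhammer] in IH.
    assert (E : INR (k - S r) = INR k - INR r - 1) by (rewrite minus_INR by lia; rewrite S_INR; ring).
    rewrite E in IH. rewrite <- tech_pow_Rmult, (Rmult_assoc (-1)), <- IH. ring.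
Qed.

(** The coefficient of [z^(2k)] in the binomial series of [(1 + z^2)^(- mu)]. *)
Definition hc (mu : R) (k : nat) : R := (-1) ^ k / INR (fact k) * pochhammer mu k.

(** The product of a Bessel coefficient and a binomial coefficient, brought to the form in the
    theorem by reversing Pochhammer symbols: [(mu)_(k-r) (1-mu-k)_r = (-1)^r (mu)_k], and likewise
    for [(-k)_r]. Positivity of [mu] keeps the denominators nonzero. *)
Lemma F_term_hc mu b k r : 0 < mu -> (r <= k)%nat ->
  sc r * b ^ (2 * r + 1) * hc mu (k - r) = b / 2 * hc mu k * F_term mu (b ^ 2 / 4) k r.
Proof.
  intros hmu h. unfold hc, F_term, sc, tc.
  assert (P1 := pochhammer_neg k r h). assert (P2 := pochhammer_reflect mu k r h).
  assert (h1 := INR_fact_neq_0 (k - r)). assert (h2 := INR_fact_neq_0 k). assert (h3 := INR_fact_neq_0 r).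
  assert (h4 := pochhammer_pos mu (k - r) hmu). assert (h5 := pochhammer_pos mu k hmu).
  assert (h6 : (-1) ^ r * (-1) ^ r = 1) by (rewrite <- Rpow_mult_distr; replace (-1 * -1) with 1 by ring; apply pow1).
  assert (h7 : (-1) ^ r <> 0) by (apply pow_nonzero; lra).
  assert (E1 : pochhammer (- INR k) r = (-1) ^ r * INR (fact k) / INR (fact (k - r))) by (rewrite <- P1; field; easy).
  assert (E2 : pochhammer (1 - mu - INR k) r = (-1) ^ r * pochhammer mu k / pochhammer mu (k - r)) by (rewrite <- P2; field; lra).
  assert (E3 : (-1) ^ k = (-1) ^ r * (-1) ^ (k - r)) by (rewrite <- pow_add; f_equal; lia).
  assert (E4 : (- (b ^ 2 / 4)) ^ r = (-1) ^ r * (b ^ (2 * r) / 4 ^ r)).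
  { replace (- (b ^ 2 / 4)) with (-1 * (b ^ 2 * / 4)) by field. rewrite !Rpow_mult_distr, pow_inv, pow_mult. easy. }
  rewrite E1, E2, E3, E4, pochhammer_two, fact_simpl, mult_INR.
  assert (h8 : 4 ^ r <> 0) by (apply pow_nonzero; lra).
  assert (h9 : INR (S r) <> 0) by (apply not_0_INR; lia).
  rewrite pow_add. simpl (b ^ 1).
  transitivity ((-1) ^ (k - r) * pochhammer mu (k - r) * b ^ (2 * r) * b / (2 * 4 ^ r * INR (fact r) * INR (fact r) * INR (S r) * INR (fact (k - r)))).
  - field. repeat split; easy.
  - set (e := (-1) ^ r) in *.
    transitivity ((e * e) * ((-1) ^ (k - r) * pochhammer mu (k - r) * b ^ (2 * r) * b / (2 * 4 ^ r * INR (fact r) * INR (fact r) * INR (S r) * INR (fact (k - r))))); [rewrite h6; ring|].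
    field. repeat split; try easy; lra.
Qed.

(* Near 0, [phi] is the sum of the [al k * z^(2k-1)] and the [(Ac k * log z + Bc k) * z^(2k+1)]. *)
Definition al (mu b : R) (k : nat) : R := hc mu k / b.
Definition Ac (mu b : R) (k : nat) : R := b / 2 * hc mu k * F mu (b ^ 2 / 4) k.
Definition Bc (mu b : R) (k : nat) : R :=
  b / 2 * hc mu k * ((Euler_gamma - 1 / 2 + ln (b / 2)) * F mu (b ^ 2 / 4) k - Fstar_sum mu (b ^ 2 / 4) k).

Lemma Rsum_sum_0 u k : sum_n_m (G := R_AbelianMonoid) u 0 k = Rsum u (S k).
Proof.
  change (sum_n (G := R_AbelianMonoid) u k = Rsum u (S k)).
  induction k as [|k IH]; [rewrite sum_O; simpl; symmetry; apply Rplus_0_l|]. rewrite sum_Sn, IH. easy.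
Qed.

Lemma Rsum_S_l u n : Rsum u (S n) = u 0%nat + Rsum (fun k => u (S k)) n.
Proof. induction n as [|n IH]; [simpl; ring|]. change (Rsum u (S (S n))) with (Rsum u (S n) + u (S n)). rewrite IH. simpl. ring. Qed.

(** Since [r / (2 (1 + r)) = 1/2 - 1 / (2 (r + 1))], the weight is the constant in the term [K1t]
    shifted by [1/2]. It vanishes at [r = 0], so the sum can start there. *)
Lemma Fstar_hsum mu chi k :
  Fstar_sum mu chi k = Rsum (fun r => F_term mu chi k r * (hsum r + / (2 * INR (S r)) - 1 / 2)) (S k).
Proof.
  unfold Fstar_sum. rewrite Rsum_sum_n_m, Rsum_S_l.
  replace (F_term mu chi k 0 * (hsum 0 + / (2 * INR 1) - 1 / 2)) with 0 by (unfold hsum; simpl; field).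
  rewrite Rplus_0_l. apply Rsum_ext. intros r _. rewrite digamma_harmonic. f_equal.
  assert (0 < INR (S r)) by (apply lt_0_INR; lia).
  rewrite (S_INR (S r)). replace (1 + INR (S r)) with (INR (S r) + 1) by ring. field. lra.
Qed.

Lemma Rsum_lin c u d v n : Rsum (fun k => c * u k + d * v k) n = c * Rsum u n + d * Rsum v n.
Proof. induction n as [|n IH]; simpl; [ring|]. rewrite IH. ring. Qed.

(** The Cauchy product of the Bessel and binomial series at [z^(2k+1)]. The shift by [1/2] in
    [Fstar_hsum] reappears as the [- 1/2] in [Bc]. *)
Lemma log_coef mu b k (l : C) : 0 < mu -> 0 < b ->
  Csum (fun r => RtoC (sc r * b ^ (2 * r + 1) * hc mu (k - r)) *
     (l + RtoC (ln (b / 2)) + RtoC (Euler_gamma - hsum r - / (2 * INR (S r)))))%C (S k)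
  = (RtoC (Ac mu b k) * l + RtoC (Bc mu b k))%C.
Proof.
  intros hmu hb.
  set (T := fun r => F_term mu (b ^ 2 / 4) k r).
  set (U := fun r => F_term mu (b ^ 2 / 4) k r * (hsum r + / (2 * INR (S r)) - 1 / 2)).
  rewrite (Csum_ext _ (fun r => l * (RtoC (b / 2 * hc mu k) * RtoC (T r)) +
     RtoC (b / 2 * hc mu k * (Euler_gamma - 1 / 2 + ln (b / 2)) * T r + - (b / 2 * hc mu k) * U r))%C).
  - rewrite Csum_plus, !Csum_scal, !Csum_RtoC, Rsum_lin.
    unfold Ac, Bc, F. rewrite Rsum_sum_0, Fstar_hsum. fold U.
    change (F_term mu (b ^ 2 / 4) k) with T.
    rewrite <- RtoC_mult, (Cmult_comm l). f_equal. f_equal. ring.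
  - intros r hr. rewrite F_term_hc by (easy || lia). fold (T r).
    unfold U. fold (T r). rewrite <- RtoC_mult.
    replace (b / 2 * hc mu k * (Euler_gamma - 1 / 2 + ln (b / 2)) * T r + - (b / 2 * hc mu k) * (T r * (hsum r + / (2 * INR (S r)) - 1 / 2)))
      with (b / 2 * hc mu k * T r * (ln (b / 2) + (Euler_gamma - hsum r - / (2 * INR (S r))))) by ring.
    rewrite (RtoC_mult (b / 2 * hc mu k * T r)), RtoC_plus. ring.
Qed.

Lemma Csum_triangle (f : nat -> nat -> C) K :
  Csum (fun r => Csum (f r) (K - r)) K = Csum (fun k => Csum (fun r => f r (k - r)%nat) (S k)) K.
Proof.
  induction K as [|K IH]; [easy|].
  cbn [Csum] in *. rewrite <- IH. replace (S K - K)%nat with 1%nat by lia.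
  rewrite (Csum_ext _ (fun r => Csum (f r) (K - r) + f r (K - r)%nat)%C).
  - rewrite Csum_plus. cbn [Csum]. replace (K - K)%nat with 0%nat by lia. ring.
  - intros r hr. replace (S K - r)%nat with (S (K - r)) by lia. easy.
Qed.

(** With [r = |z|] and [Re z >= s r] one has [|1 + z^2|^2 >= 1 + 2 (2 s^2 - 1) r^2 + r^4], and this
    exceeds [s^2 (1 + r^2)^2] by [(1 - s^2) (1 - r^2)^2]. In particular [z] stays away from [i] and
    [- i]. *)
Lemma one_plus_sqr_cone s z : 0 < s <= 1 -> cone s z -> s * (1 + Cmod z ^ 2) <= Cmod (1 + z * z)%C.
Proof.
  intros hs hz. unfold cone in hz. assert (hr := Cmod_ge_0 z). assert (E := Cmod_sqr z).
  assert (E2 := Cmod_sqr (1 + z * z)).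
  assert (h1 : 0 <= s * (1 + Cmod z ^ 2)).
  { apply Rmult_le_pos; [lra|]. assert (T := pow_le (Cmod z) 2 hr). lra. }
  apply Rsqr_incr_0_var; [|apply Cmod_ge_0]. unfold Rsqr. rewrite E2.
  destruct z as [x y]. unfold Re, Im in *. simpl in *. set (r := Cmod (x, y)%C) in *.
  assert (hx : s * r * (s * r) <= x * x) by (apply Rmult_le_compat; try (apply Rmult_le_pos; lra); lra).
  assert (s * s <= 1) by nra.
  assert (0 <= (1 - s * s) * ((1 - r * r) * (1 - r * r))) by (apply Rmult_le_pos; [lra|apply Rle_0_sqr]).
  replace ((1 + (x * x - y * y)) * (1 + (x * x - y * y)) + (0 + (x * y + y * x)) * (0 + (x * y + y * x)))
    with (1 + 2 * (2 * (x * x) - (x * x + y * y)) + (x * x + y * y) * (x * x + y * y)) by ring.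
  rewrite <- E. nra.
Qed.

Definition opq (mu : R) (z : C) : C := Cpower (1 + z * z) (RtoC (- mu)).

Lemma opq_bound s mu z : 0 < s <= 1 -> 0 < mu -> cone s z -> Cmod (opq mu z)%C <= Rpower s (- mu).
Proof.
  intros hs hmu hz. unfold opq. rewrite Cmod_Cpower_R.
  assert (T := one_plus_sqr_cone s z hs hz). assert (hr := pow_le (Cmod z) 2 (Cmod_ge_0 z)).
  assert (s * 1 <= s * (1 + Cmod z ^ 2)) by (apply Rmult_le_compat_l; lra).
  rewrite !Rpower_Ropp. apply Rinv_le_contravar; [apply Rpower_pos|].
  apply Rle_Rpower_l; lra.
Qed.

Lemma cderiv_opq mu z : slit (1 + z * z)%C ->
  cderiv (opq mu) z (RtoC (- 2 * mu) * (z * opq (mu + 1) z))%C.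
Proof.
  intros hz. unfold opq.
  eapply cderiv_eq; [|apply (cderiv_comp (fun u => Cpower u (RtoC (- mu))) (fun z => (1 + z * z)%C))].
  2:{ apply cderiv_plus; [apply cderiv_const|]. apply cderiv_mult; apply cderiv_id. }
  2:{ apply cderiv_Cpower. exact hz. }
  replace (RtoC (- mu) - 1)%C with (RtoC (- (mu + 1))) by (rewrite !RtoC_opp, RtoC_plus; ring).
  rewrite RtoC_mult, !RtoC_opp. ring.
Qed.

Definition opq_err (mu : R) (j : nat) (z : C) : C :=
  (opq mu z - Csum (fun i => RtoC (hc mu i) * z ^ (2 * i)) j)%C.

Lemma hc_S mu i : hc mu (S i) * INR (S (S (2 * i))) = - 2 * mu * hc (mu + 1) i.
Proof.
  unfold hc. rewrite pochhammer_S_l, fact_simpl, mult_INR, INR_2S.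
  assert (h1 := INR_fact_neq_0 i). assert (h2 : INR (S i) <> 0) by (apply not_0_INR; lia).
  simpl pow. field. split; easy.
Qed.

(** Differentiation sends the error for [mu] to that for [mu + 1] with one term fewer. This sets up
    the induction on [j] with [mu] varying. *)
Lemma cderiv_opq_err mu j z : slit (1 + z * z)%C ->
  cderiv (opq_err mu (S j)) z (RtoC (- 2 * mu) * (z * opq_err (mu + 1) j z))%C.
Proof.
  intros hz. unfold opq_err.
  apply (cderiv_ext (fun w => opq mu w - (1 + Csum (fun i => RtoC (hc mu (S i)) * w ^ S (S (2 * i))) j))%C).
  { intros w. rewrite Csum_S_l. f_equal. f_equal. f_equal.
    - unfold hc. simpl. replace (1 / 1 * 1) with 1 by field. ring.
    - apply Csum_ext. intros k _. do 2 f_equal. lia. }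
  eapply cderiv_eq; [|apply cderiv_minus; [apply cderiv_opq, hz|apply cderiv_plus; [apply cderiv_const|]]].
  2:{ apply (cderiv_Csum (fun i w => RtoC (hc mu (S i)) * w ^ S (S (2 * i)))%C). intros k. apply cderiv_scal, cderiv_pow. }
  rewrite (Csum_ext _ (fun k => (RtoC (- 2 * mu) * z) * (RtoC (hc (mu + 1) k) * z ^ (2 * k)))%C).
  - rewrite Csum_scal. ring.
  - intros k _. rewrite Cmult_assoc, <- RtoC_mult, hc_S, RtoC_mult. cbn [Cpow]. ring.
Qed.

(** Integrating [cderiv_opq_err] from 0 raises the order by 2: one power comes from the factor [z],
    one from the integration. The error is continuous and vanishes at 0, as [cone_int] asks. *)
Lemma opq_err_pow s j : 0 < s <= 1 -> forall mu, 0 < mu -> exists A, 0 <= A /\ forall z, cone s z ->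
  Cmod (opq_err mu j z)%C <= A * Cmod z ^ (2 * j).
Proof.
  intros hs. induction j as [|j IH]; intros mu hmu.
  - exists (Rpower s (- mu)). split; [left; apply Rpower_pos|]. intros z hz. unfold opq_err. simpl.
    match goal with |- Cmod ?x <= _ => replace x with (opq mu z) by ring end.
    rewrite Rmult_1_r. apply opq_bound; easy.
  - destruct (IH (mu + 1) ltac:(lra)) as [A [hA HA]].
    assert (Pz : forall z, cone s z -> 0 < Cmod z).
    { intros z hz. apply Cmod_gt_0. intros ->. unfold cone in hz. rewrite Cmod_0 in hz. simpl in hz. lra. }
    destruct (cone_int s (INR (2 * j + 1)) (2 * mu * A) (opq_err mu (S j)) (fun z => RtoC (- 2 * mu) * (z * opq_err (mu + 1) j z))%C)
      as [B [hB HB]].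
    + lra.
    + assert (T := pos_INR (2 * j + 1)). lra.
    + apply Rmult_le_pos; lra.
    + intros z hz. apply cderiv_opq_err, slit_1_plus_sqr. eapply cone_rhp; [|exact hz]. lra.
    + intros z hz. specialize (HA z hz). rewrite !Cmod_mult, Cmod_R, Rpower_pow by (apply Pz; easy).
      rewrite Rabs_left by lra. rewrite pow_add. simpl (Cmod z ^ 1). assert (T := Cmod_ge_0 z).
      apply Rle_trans with (- (-2 * mu) * (Cmod z * (A * Cmod z ^ (2 * j)))); [|apply Req_le; ring].
      apply Rmult_le_compat_l; [lra|]. apply Rmult_le_compat_l; easy.
    + intros eps he.
      assert (Hc : ccont (opq_err mu (S j)) 0).
      { eapply cderiv_ccont, cderiv_opq_err. replace (1 + 0 * 0)%C with (RtoC 1) by ring. apply slit_pos. lra. }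
      assert (E0 : opq_err mu (S j) 0 = 0%C).
      { unfold opq_err, opq. replace (1 + 0 * 0)%C with (RtoC 1) by ring.
        rewrite Cpower_RtoC by lra. unfold Rpower. rewrite ln_1, Rmult_0_r, exp_0, Csum_S_l.
        rewrite (Csum_ext _ (fun k => 0 * 0)%C).
        - rewrite Csum_scal. unfold hc. simpl. replace (1 / 1 * 1) with 1 by field. ring.
        - intros k _. replace (2 * S k)%nat with (S (2 * k + 1)) by lia. simpl. ring. }
      destruct (Hc eps he) as [d [hd Hd]]. exists d. split; [easy|]. intros x hx.
      specialize (Hd (RtoC x) ltac:(rewrite Cmod_R, Rabs_pos_eq; lra)). rewrite E0 in Hd.
      match type of Hd with Cmod ?u < _ => replace u with (opq_err mu (S j) (RtoC x)) in Hd end; [lra|].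
      replace (0 + RtoC x)%C with (RtoC x) by ring. ring.
    + exists B. split; [easy|]. intros z hz. specialize (HB z hz).
      replace (INR (2 * j + 1) + 1) with (INR (2 * S j)) in HB by (rewrite <- S_INR; f_equal; lia).
      rewrite Rpower_pow in HB by (apply Pz; easy). easy.
Qed.

(** Combines the error after [S j] terms with that after [j] terms plus one more term. The factor
    [1 + |z|^2] will absorb a logarithm at 0 and at infinity alike, through [Clog_bound], so that
    the expansions hold in the whole cone. *)
Lemma opq_err_bound s j mu : 0 < s <= 1 -> 0 < mu -> exists A, 0 <= A /\ forall z, cone s z ->
  Cmod (opq_err mu (S j) z)%C * (1 + Cmod z ^ 2) <= A * Cmod z ^ (2 * S j).
Proof.
  intros hs hmu. destruct (opq_err_pow s j hs mu hmu) as [A [hA HA]].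
  destruct (opq_err_pow s (S j) hs mu hmu) as [B [hB HB]].
  exists (A + Rabs (hc mu j) + B). assert (T := Rabs_pos (hc mu j)). split; [lra|]. intros z hz.
  specialize (HA z hz). specialize (HB z hz).
  assert (hp := pow_le (Cmod z) 2 (Cmod_ge_0 z)).
  assert (H1 : Cmod (opq_err mu (S j) z)%C <= (A + Rabs (hc mu j)) * Cmod z ^ (2 * j)).
  { replace (opq_err mu (S j) z) with (opq_err mu j z - RtoC (hc mu j) * z ^ (2 * j))%C by (unfold opq_err; cbn [Csum]; ring).
    eapply Rle_trans; [apply Cmod_minus_triangle|]. rewrite Cmod_mult, Cmod_R, Cmod_pow. lra. }
  apply Rmult_le_compat_r with (r := Cmod z ^ 2) in H1; [|easy].
  replace (2 * S j)%nat with (2 * j + 2)%nat in * by lia. rewrite pow_add in *. lra.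
Qed.

Lemma Clog_bound (z : C) : z <> 0%C -> Cmod (Clog z)%C * Cmod z <= (PI + 2) * (1 + Cmod z ^ 2).
Proof.
  intros hz. assert (hr : 0 < Cmod z) by (apply Cmod_gt_0; easy). set (r := Cmod z) in *.
  assert (hP := PI_RGT_0). assert (hA := Arg_bound z hz).
  assert (h1 : Cmod (Clog z)%C <= Rabs (ln r) + PI).
  { eapply Rle_trans; [apply Cmod_le_abs|]. simpl. fold r. lra. }
  assert (h2 : Rabs (ln r) * r <= 1 + r * r).
  { assert (T := ln_le_sub_1 r hr). assert (T2 := ln_le_sub_1 (/ r) ltac:(apply Rinv_0_lt_compat; easy)).
    rewrite ln_Rinv in T2 by easy.
    assert (X : / r * r = 1) by (field; lra).
    destruct (Rle_dec 0 (ln r)) as [h|h]; [rewrite Rabs_pos_eq by lra|rewrite Rabs_left by lra].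
    - assert (ln r * r <= (r - 1) * r) by (apply Rmult_le_compat_r; lra). lra.
    - assert (- ln r * r <= (/ r - 1) * r) by (apply Rmult_le_compat_r; lra).
      assert (0 <= r * r) by (apply Rmult_le_pos; lra). lra. }
  apply Rmult_le_compat_r with (r := r) in h1; [|lra].
  assert (PI * r <= PI * (1 + r * r)) by (apply Rmult_le_compat_l; nra).
  nra.
Qed.

Definition phi (mu b : R) (z : C) : C := (BK 1 (RtoC b * z) * opq mu z)%C.

Definition Qs (mu b : R) (K : nat) (z : C) : C :=
  (Csum (fun k => RtoC (al mu b k) * (z ^ (2 * k) / z)) (S K)
   + Csum (fun k => (RtoC (Ac mu b k) * Clog z + RtoC (Bc mu b k)) * z ^ (2 * k + 1)) K)%C.

Lemma sc_pos r : 0 < sc r.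
Proof.
  assert (h := INR_fact_lt_0 r). assert (h2 : 0 < INR (S r)) by (apply lt_0_INR; lia).
  assert (h4 : 0 < 4 ^ r) by (apply pow_lt; lra).
  apply Rdiv_lt_0_compat; [|lra]. apply Rinv_0_lt_compat. repeat apply Rmult_lt_0_compat; easy.
Qed.

Definition lgt (b : R) (r : nat) (z : C) : C :=
  (Clog z + RtoC (ln (b / 2)) + RtoC (Euler_gamma - hsum r - / (2 * INR (S r))))%C.

Lemma Lg_scale b z : 0 < b -> 0 < Re z -> Lg (RtoC b * z) = (Clog z + RtoC (ln (b / 2)))%C.
Proof.
  intros hb hz. unfold Lg. rewrite Clog_mult, Clog_RtoC.
  - unfold Rdiv. rewrite ln_mult, ln_Rinv, RtoC_plus, RtoC_opp by lra. ring.
  - easy.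
  - intros E. apply RtoC_inj in E. lra.
  - intros ->. simpl in hz. lra.
  - rewrite Arg_pos_real, Rplus_0_l by easy. apply Arg_slit, slit_Re. easy.
Qed.

(** Three sources of error: the truncated Bessel series times the binomial factor, the truncated
    binomial series at the singular term [1 / (b z)], and the binomial remainder of order [K - r]
    attached to the Bessel term of index [r]. *)
Lemma Qs_split mu b K z : 0 < mu -> 0 < b -> 0 < Re z ->
  (phi mu b z - Qs mu b K z)%C =
  ((BK 1 (RtoC b * z) - (1 + K1s K (RtoC b * z)) / (RtoC b * z)) * opq mu z
   + / RtoC b * (opq_err mu (S K) z / z)
   + Csum (fun r => RtoC (sc r * b ^ (2 * r + 1)) * (z ^ (2 * r + 1) * lgt b r z) * opq_err mu (K - r) z) K)%C.
Proof.
  intros hmu hb hz.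
  assert (z0 : z <> 0%C) by (intros ->; simpl in hz; lra).
  assert (b0 : RtoC b <> 0%C) by (intros E; apply RtoC_inj in E; lra).
  set (X := fun r : nat => (RtoC (sc r * b ^ (2 * r + 1)) * (z ^ (2 * r + 1) * lgt b r z))%C).
  assert (E1 : (K1s K (RtoC b * z) / (RtoC b * z))%C = Csum X K).
  { unfold Cdiv. rewrite Cmult_comm. unfold K1s. rewrite <- Csum_scal. apply Csum_ext. intros r _.
    unfold K1t, X. rewrite Lg_scale by easy. unfold lgt. rewrite RtoC_mult, RtoC_pow.
    replace (2 * S r)%nat with (S (2 * r + 1)) by lia. cbn [Cpow]. rewrite Cpow_mult_l.
    field. easy. }
  assert (E2 : Csum (fun k => RtoC (al mu b k) * (z ^ (2 * k) / z))%C (S K) = (/ RtoC b * (opq mu z - opq_err mu (S K) z) / z)%C).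
  { unfold opq_err. replace (opq mu z - (opq mu z - Csum (fun i => RtoC (hc mu i) * z ^ (2 * i)) (S K)))%C
      with (Csum (fun i => RtoC (hc mu i) * z ^ (2 * i))%C (S K)) by ring.
    unfold Cdiv at 2. rewrite (Cmult_comm _ (/ z)), Cmult_assoc, <- Csum_scal. apply Csum_ext. intros k _.
    unfold al. rewrite RtoC_div by lra. field. easy. }
  assert (E3 : Csum (fun k => (RtoC (Ac mu b k) * Clog z + RtoC (Bc mu b k)) * z ^ (2 * k + 1))%C K
    = Csum (fun r => X r * (opq mu z - opq_err mu (K - r) z))%C K).
  { rewrite (Csum_ext (fun r => X r * (opq mu z - opq_err mu (K - r) z))%C
      (fun r => Csum (fun j => X r * (RtoC (hc mu j) * z ^ (2 * j))) (K - r))%C).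
    2:{ intros r _. rewrite Csum_scal. f_equal. unfold opq_err. ring. }
    rewrite (Csum_triangle (fun r j => X r * (RtoC (hc mu j) * z ^ (2 * j)))%C).
    apply Csum_ext. intros k _. rewrite <- log_coef by easy.
    rewrite Cmult_comm, <- Csum_scal. apply Csum_ext. intros r hr. unfold X, lgt.
    rewrite (RtoC_mult (sc r * b ^ (2 * r + 1))).
    replace (2 * k + 1)%nat with ((2 * r + 1) + 2 * (k - r))%nat by lia. rewrite Cpow_add_r. ring. }
  unfold Qs. rewrite E2, E3. unfold phi.
  assert (E4 : ((1 + K1s K (RtoC b * z)) / (RtoC b * z))%C = (/ (RtoC b * z) + Csum X K)%C).
  { rewrite <- E1. field. easy. }
  rewrite E4. rewrite (Csum_ext (fun r => X r * (opq mu z - opq_err mu (K - r) z))%C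
    (fun r => opq mu z * X r - X r * opq_err mu (K - r) z)%C) by (intros r _; ring).
  rewrite Csum_minus, Csum_scal. unfold X. field. easy.
Qed.

(** Each logarithmic error has order [z^(2r+1) z^(2K-2r)] times a logarithm, and the surplus factor
    [|z|] together with the [1 + |z|^2] of [opq_err_bound] pays for the logarithm. The remaining two
    errors come from [BK1_expansion] and from [opq_err_bound] directly. *)
Lemma phi_expansion mu b s K : 0 < mu -> 0 < b -> 0 < s <= 1 -> exists A, 0 <= A /\ forall z, cone s z ->
  Cmod (phi mu b z - Qs mu b K z)%C <= A * Cmod z ^ (2 * K).
Proof.
  intros hmu hb hs.
  destruct (BK1_expansion s K ltac:(lra)) as [A1 [hA1 HA1]].
  destruct (opq_err_bound s K mu hs hmu) as [A2 [hA2 HA2]].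
  assert (HX : forall n, (n <= K)%nat -> exists A, 0 <= A /\ forall z, cone s z ->
    Cmod (Csum (fun r => RtoC (sc r * b ^ (2 * r + 1)) * (z ^ (2 * r + 1) * lgt b r z) * opq_err mu (K - r) z) n)%C <= A * Cmod z ^ (2 * K)).
  { induction n as [|n IH]; intros hn.
    - exists 0. split; [lra|]. intros z _. simpl Csum. rewrite Cmod_0. lra.
    - destruct (IH ltac:(lia)) as [A [hA HA]].
      destruct (opq_err_bound s (K - S n) mu hs hmu) as [A3 [hA3 HA3]].
      replace (S (K - S n)) with (K - n)%nat in HA3 by lia.
      set (c := (RtoC (ln (b / 2)) + RtoC (Euler_gamma - hsum n - / (2 * INR (S n))))%C).
      assert (hs' : 0 < sc n * b ^ (2 * n + 1)) by (apply Rmult_lt_0_compat; [apply sc_pos|apply pow_lt; easy]).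
      assert (hP := PI_RGT_0). assert (hc0 := Cmod_ge_0 c).
      exists (A + sc n * b ^ (2 * n + 1) * ((PI + 2 + Cmod c) * A3)). split.
      { assert (0 <= sc n * b ^ (2 * n + 1) * ((PI + 2 + Cmod c) * A3)); [|lra].
        apply Rmult_le_pos; [lra|]. apply Rmult_le_pos; lra. }
      intros z hz. cbn [Csum]. eapply Rle_trans; [apply Cmod_triangle|].
      specialize (HA z hz). specialize (HA3 z hz).
      assert (z0 : z <> 0%C) by (intros ->; unfold cone in hz; rewrite Cmod_0 in hz; simpl in hz; lra).
      assert (hr : 0 < Cmod z) by (apply Cmod_gt_0; easy).
      assert (L := Clog_bound z z0).
      assert (L2 : Cmod (lgt b n z)%C * Cmod z <= (PI + 2 + Cmod c) * (1 + Cmod z ^ 2)).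
      { unfold lgt. rewrite <- Cplus_assoc. fold c.
        assert (T := Cmod_triangle (Clog z) c). apply Rmult_le_compat_r with (r := Cmod z) in T; [|lra].
        assert (Cmod c * Cmod z <= Cmod c * (1 + Cmod z ^ 2)) by (apply Rmult_le_compat_l; nra). lra. }
      rewrite !Cmod_mult, Cmod_R, Rabs_pos_eq, Cmod_pow by lra.
      assert (M : Cmod z ^ (2 * n + 1) * Cmod (lgt b n z)%C * Cmod (opq_err mu (K - n) z)%C <= (PI + 2 + Cmod c) * A3 * Cmod z ^ (2 * K)).
      { set (e := Cmod (opq_err mu (K - n) z)%C) in *. assert (he : 0 <= e) by apply Cmod_ge_0.
        assert (hp : 0 <= Cmod z ^ (2 * n)) by (apply pow_le; lra).
        rewrite pow_add. simpl (Cmod z ^ 1).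
        apply Rle_trans with (Cmod z ^ (2 * n) * e * (Cmod (lgt b n z)%C * Cmod z)); [apply Req_le; ring|].
        apply Rle_trans with (Cmod z ^ (2 * n) * e * ((PI + 2 + Cmod c) * (1 + Cmod z ^ 2))).
        { apply Rmult_le_compat_l; [apply Rmult_le_pos; easy|easy]. }
        apply Rle_trans with ((PI + 2 + Cmod c) * Cmod z ^ (2 * n) * (e * (1 + Cmod z ^ 2))); [apply Req_le; ring|].
        apply Rle_trans with ((PI + 2 + Cmod c) * Cmod z ^ (2 * n) * (A3 * Cmod z ^ (2 * (K - n)))).
        { apply Rmult_le_compat_l; [|easy]. apply Rmult_le_pos; lra. }
        apply Req_le. replace (2 * K)%nat with (2 * n + 2 * (K - n))%nat by lia. rewrite pow_add. ring. }
      apply Rmult_le_compat_l with (r := sc n * b ^ (2 * n + 1)) in M; [|lra].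
      rewrite !Rmult_assoc in *. lra. }
  destruct (HX K (Nat.le_refl K)) as [A4 [hA4 HA4]].
  set (D := Rpower s (- mu)). assert (hD : 0 < D) by apply Rpower_pos.
  assert (hbk : 0 < b ^ (2 * K)) by (apply pow_lt; easy).
  exists (A1 * b ^ (2 * K) * D + / b * A2 + A4). split.
  { assert (0 <= A1 * b ^ (2 * K) * D) by (apply Rmult_le_pos; [apply Rmult_le_pos|]; lra).
    assert (0 <= / b * A2) by (apply Rmult_le_pos; [left; apply Rinv_0_lt_compat|]; easy). lra. }
  intros z hz.
  assert (hRe : 0 < Re z) by (eapply cone_rhp; [|exact hz]; lra).
  assert (z0 : z <> 0%C) by (intros ->; simpl in hRe; lra).
  assert (hr : 0 < Cmod z) by (apply Cmod_gt_0; easy).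
  rewrite Qs_split by easy.
  assert (Eb : Cmod (RtoC b * z)%C = b * Cmod z) by (rewrite Cmod_mult, Cmod_R, Rabs_pos_eq; lra).
  assert (hbz : cone s (RtoC b * z)).
  { unfold cone in *. rewrite Eb. unfold Re in *. simpl. nra. }
  specialize (HA1 _ hbz). rewrite Eb in HA1.
  replace (2 * INR K) with (INR (2 * K)) in HA1 by (rewrite mult_INR; simpl; ring).
  rewrite Rpower_pow, Rpow_mult_distr in HA1 by (apply Rmult_lt_0_compat; easy).
  specialize (HA2 z hz). specialize (HA4 z hz).
  assert (HO := opq_bound s mu z hs hmu hz). fold D in HO.
  eapply Rle_trans; [apply Cmod_triangle|].
  assert (T1 : Cmod ((BK 1 (RtoC b * z) - (1 + K1s K (RtoC b * z)) / (RtoC b * z)) * opq mu z)%C <= A1 * b ^ (2 * K) * D * Cmod z ^ (2 * K)).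
  { rewrite Cmod_mult. apply Rle_trans with (A1 * (b ^ (2 * K) * Cmod z ^ (2 * K)) * D); [|apply Req_le; ring].
    apply Rmult_le_compat; try apply Cmod_ge_0; easy. }
  assert (T2 : Cmod (/ RtoC b * (opq_err mu (S K) z / z))%C <= / b * A2 * Cmod z ^ (2 * K)).
  { rewrite Cmod_mult, Cmod_inv by (intros E; apply RtoC_inj in E; lra).
    rewrite Cmod_R, Rabs_pos_eq, Rmult_assoc by lra.
    apply Rmult_le_compat_l; [left; apply Rinv_0_lt_compat; easy|].
    rewrite Cmod_div by easy. set (e := Cmod (opq_err mu (S K) z)%C) in *.
    assert (he : 0 <= e) by apply Cmod_ge_0.
    assert (X : e * Cmod z <= A2 * Cmod z ^ (2 * S K)).
    { eapply Rle_trans; [|exact HA2]. apply Rmult_le_compat_l; [easy|]. nra. }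
    apply Rmult_le_reg_r with (Cmod z * Cmod z); [nra|].
    replace (e / Cmod z * (Cmod z * Cmod z)) with (e * Cmod z) by (field; lra).
    replace (A2 * Cmod z ^ (2 * K) * (Cmod z * Cmod z)) with (A2 * Cmod z ^ (2 * S K)); [easy|].
    replace (2 * S K)%nat with (2 * K + 2)%nat by lia. rewrite pow_add. ring. }
  assert (T3 := Cmod_triangle ((BK 1 (RtoC b * z) - (1 + K1s K (RtoC b * z)) / (RtoC b * z)) * opq mu z) (/ RtoC b * (opq_err mu (S K) z / z))).
  lra.
Qed.

Lemma holo_rcont U f t : holo U f -> U (RtoC t) -> rcont (fun t => f (RtoC t)) t.
Proof. intros H h. eapply rderiv_rcont, rderiv_of_cderiv, holo_cderiv; eassumption. Qed.

Lemma rhp_slit z : rhp z -> slit z.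
Proof. apply slit_Re. Qed.

Lemma rhp_neq_0 (z : C) : rhp z -> z <> 0%C.
Proof. intros h ->. unfold rhp in h. simpl in h. lra. Qed.

Lemma rhp_RtoC x : 0 < x -> rhp (RtoC x).
Proof. easy. Qed.

Lemma holo_phi mu b : 0 < b -> holo rhp (phi mu b).
Proof.
  intros hb. assert (O := copen_rhp). apply holo_mult; [easy| |].
  - apply (holo_comp rhp rhp (BK 1)); [easy|apply holo_scal, holo_id; easy|apply holo_Lap, cosh_good|].
    intros z hz. unfold rhp, Re in *. simpl. nra.
  - apply (holo_comp rhp slit (fun z => Cpower z (RtoC (- mu)))); [easy| |apply holo_Cpower|].
    + apply holo_plus; [easy|apply holo_const; easy|apply holo_mult; [easy| |]; apply holo_id; easy].
    + intros z hz. apply slit_1_plus_sqr, hz.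
Qed.

(** [Lap_bound] holds with any exponent above 1, [Re z] is comparable to [|z|] in the cone, and the
    binomial factor is bounded there. *)
Lemma phi_decay mu b s n : 0 < mu -> 0 < b -> 0 < s <= 1 -> (1 < n)%nat ->
  exists A, 0 <= A /\ forall z, cone s z -> Cmod (phi mu b z)%C * Cmod z ^ n <= A.
Proof.
  intros hmu hb hs hn. set (D := Rpower s (- mu)). assert (hD : 0 < D) by apply Rpower_pos.
  assert (hf := INR_fact_lt_0 n). assert (hbs : 0 < (b * s) ^ n) by (apply pow_lt, Rmult_lt_0_compat; lra).
  exists (8 * INR (fact n) / (b * s) ^ n * D). split.
  { apply Rmult_le_pos; [|lra]. apply Rdiv_le_0_compat; lra. }
  intros z hz. assert (hRe : 0 < Re z) by (eapply cone_rhp; [|exact hz]; lra).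
  assert (hr : 0 < Cmod z) by (apply Cmod_gt_0, rhp_neq_0; easy).
  assert (Eb : Re (RtoC b * z) = b * Re z) by (unfold Re; simpl; ring).
  assert (T := Lap_bound cosh 1 n (RtoC b * z) cosh_good ltac:(rewrite Eb; apply Rmult_lt_0_compat; easy) hn).
  rewrite Eb in T. unfold phi. rewrite Cmod_mult.
  assert (HO := opq_bound s mu z hs hmu hz). fold D in HO.
  assert (hrn : 0 < Cmod z ^ n) by (apply pow_lt; easy).
  assert (T2 : 8 * INR (fact n) / (b * Re z) ^ n * Cmod z ^ n <= 8 * INR (fact n) / (b * s) ^ n).
  { unfold cone in hz. assert (M : (b * s) ^ n * Cmod z ^ n <= (b * Re z) ^ n).
    { rewrite <- Rpow_mult_distr. apply pow_incr. split; [|nra]. left. repeat apply Rmult_lt_0_compat; lra. }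
    assert (hq : 0 < (b * Re z) ^ n) by (apply pow_lt, Rmult_lt_0_compat; easy).
    apply Rmult_le_reg_r with ((b * s) ^ n * (b * Re z) ^ n); [apply Rmult_lt_0_compat; easy|].
    replace (8 * INR (fact n) / (b * Re z) ^ n * Cmod z ^ n * ((b * s) ^ n * (b * Re z) ^ n))
      with (8 * INR (fact n) * ((b * s) ^ n * Cmod z ^ n)) by (field; lra).
    replace (8 * INR (fact n) / (b * s) ^ n * ((b * s) ^ n * (b * Re z) ^ n)) with (8 * INR (fact n) * (b * Re z) ^ n) by (field; lra).
    apply Rmult_le_compat_l; lra. }
  change (BK 1 (RtoC b * z)) with (Lap cosh 1 (RtoC b * z)).
  set (X := Cmod (Lap cosh 1 (RtoC b * z))%C) in *. assert (hX : 0 <= X) by apply Cmod_ge_0.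
  assert (h1 : X * Cmod z ^ n <= 8 * INR (fact n) / (b * s) ^ n).
  { eapply Rle_trans; [|exact T2]. apply Rmult_le_compat_r; [lra|]. exact T. }
  replace (X * Cmod (opq mu z)%C * Cmod z ^ n) with (X * Cmod z ^ n * Cmod (opq mu z)%C) by ring.
  apply Rmult_le_compat; [apply Rmult_le_pos; lra|apply Cmod_ge_0|easy|easy].
Qed.

(** The non-logarithmic coefficient of [z^(2k+1)]. It has two parts because the algebraic series
    contains the same power at index [k + 1]. *)
Definition Dc (mu b : R) (k : nat) : R := al mu b (S k) + Bc mu b k.

Definition qterm (mu b : R) (k : nat) (z : C) : C :=
  ((RtoC (Ac mu b k) * Clog z + RtoC (Dc mu b k)) * z ^ (2 * k + 1))%C.

Lemma Qs_eq mu b K (z : C) : z <> 0%C ->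
  Qs mu b K z = (RtoC (al mu b 0) / z + Csum (fun k => qterm mu b k z) K)%C.
Proof.
  intros hz. unfold Qs. rewrite Csum_S_l. rewrite <- Cplus_assoc, <- Csum_plus.
  f_equal; [simpl; unfold Cdiv; ring|]. apply Csum_ext. intros k _. unfold qterm, Dc. rewrite RtoC_plus.
  replace (2 * S k)%nat with (S (2 * k + 1)) by lia. cbn [Cpow]. field. easy.
Qed.

Definition eexp (w : C) (k : nat) : C := (w + RtoC (INR (2 * k)))%C.

(** A primitive of [z^w] times [qterm]. The exponent [e] is [w + 2 k + 2], and
    [z^e log z / e - z^e / e^2] is the derivative of [z^e / e] in [e]. *)
Definition pterm (mu b : R) (w : C) (k : nat) (z : C) : C :=
  let e := eexp w (S k) in
  (RtoC (Ac mu b k) * (/ e * pl e z - / (e * e) * pw e z) + RtoC (Dc mu b k) * (/ e * pw e z))%C.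

Lemma cderiv_pw e z : slit z -> cderiv (pw e) z (e * (pw e z / z))%C.
Proof.
  intros hz. eapply cderiv_eq; [|apply cderiv_Cpower, hz].
  rewrite Cpower_minus_1; [easy|apply slit_neq_0, hz].
Qed.

Lemma cderiv_pl e z : slit z -> cderiv (pl e) z (e * (pl e z / z) + pw e z / z)%C.
Proof.
  intros hz. assert (z0 := slit_neq_0 z hz).
  eapply cderiv_eq; [|exact (cderiv_mult _ _ _ _ _ (cderiv_pw e z hz) (cderiv_Clog z hz))].
  unfold pl, pw. field. easy.
Qed.

Lemma Cpower_eexp w k (z : C) : z <> 0%C -> Cpower z (eexp w k) = (Cpower z w * z ^ (2 * k))%C.
Proof. intros hz. unfold eexp. rewrite Cpower_plus, Cpower_INR by easy. easy. Qed.

Lemma cderiv_pterm mu b w k z : slit z -> eexp w (S k) <> 0%C ->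
  cderiv (pterm mu b w k) z (Cpower z w * qterm mu b k z)%C.
Proof.
  intros hz he. assert (z0 := slit_neq_0 z hz). unfold pterm. set (e := eexp w (S k)) in *.
  assert (E : pw e z = (Cpower z w * z ^ (2 * k + 1) * z)%C).
  { unfold pw, e. rewrite Cpower_eexp by easy. replace (2 * S k)%nat with (S (2 * k + 1)) by lia. cbn [Cpow]. ring. }
  assert (E2 : pl e z = (pw e z * Clog z)%C) by easy.
  eapply cderiv_eq; [|apply cderiv_plus; [apply cderiv_scal, cderiv_minus; apply cderiv_scal; [apply cderiv_pl, hz|apply cderiv_pw, hz]|apply cderiv_scal, cderiv_scal, cderiv_pw, hz]].
  rewrite E2, E. unfold qterm. field. split; easy.
Qed.

Lemma holo_qterm mu b k : holo slit (qterm mu b k).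
Proof.
  assert (O := copen_slit). apply holo_mult; [easy| |apply holo_pow, holo_id; easy].
  apply holo_plus; [easy|apply holo_scal; [easy|apply holo_Clog]|apply holo_const; easy].
Qed.

Lemma holo_Qs mu b K : holo slit (Qs mu b K).
Proof.
  assert (O := copen_slit). apply (holo_ext _ (fun z => RtoC (al mu b 0) / z + Csum (fun k => qterm mu b k z) K)%C); [easy| |].
  { intros z hz. symmetry. apply Qs_eq, slit_neq_0, hz. }
  apply holo_plus; [easy| |apply (holo_Csum slit (qterm mu b)); [easy|intros k _; apply holo_qterm]].
  apply holo_scal; [easy|]. apply holo_inv; [easy|apply holo_id; easy|apply slit_neq_0].
Qed.

(** * The Mellin transform of [phi] and its continuation *)

Lemma pw_small e : 0 < Re e -> forall eps, 0 < eps -> exists r, 0 < r /\ forall x, 0 < x < r -> Cmod (pw e (RtoC x))%C <= eps.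
Proof.
  intros he eps h. destruct (Rpower_small (Re e) eps he h) as [r [hr E]]. exists r. split; [easy|].
  intros x hx. unfold pw. rewrite Cmod_Cpower_pos by easy. eapply Rle_trans; [|exact E]. apply Rle_Rpower_l; lra.
Qed.

Lemma pl_small e : 1 < Re e -> forall eps, 0 < eps -> exists r, 0 < r /\ forall x, 0 < x < r -> Cmod (pl e (RtoC x))%C <= eps.
Proof.
  intros he eps h. assert (hP := PI_RGT_0).
  destruct (Rpower_small (Re e - 1) (eps / ((PI + 2) * 2)) ltac:(lra)) as [r [hr E]].
  { apply Rdiv_lt_0_compat; lra. }
  exists r. split; [easy|]. intros x hx. unfold pl. rewrite Cmod_mult, Cmod_Cpower_pos by easy.
  replace (Re e) with ((Re e - 1) + 1) by ring. rewrite Rpower_plus, Rpower_1 by easy.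
  assert (L := Clog_bound (RtoC x) (rhp_neq_0 _ (rhp_RtoC x (proj1 hx)))). rewrite Cmod_R, Rabs_pos_eq in L by lra.
  assert (P : Rpower x (Re e - 1) <= eps / ((PI + 2) * 2)) by (eapply Rle_trans; [|exact E]; apply Rle_Rpower_l; lra).
  assert (P0 := Rpower_pos x (Re e - 1)).
  rewrite Rmult_assoc, (Rmult_comm x).
  assert (x ^ 2 <= 1) by nra.
  apply Rle_trans with (eps / ((PI + 2) * 2) * ((PI + 2) * 2)); [|apply Req_le; field; lra].
  apply Rmult_le_compat; [lra|apply Rmult_le_pos; [apply Cmod_ge_0|lra]|easy|].
  eapply Rle_trans; [exact L|]. apply Rmult_le_compat_l; lra.
Qed.

Lemma lin_small c (f : R -> C) :
  (forall eps, 0 < eps -> exists r, 0 < r /\ forall x, 0 < x < r -> Cmod (f x)%C <= eps) ->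
  forall eps, 0 < eps -> exists r, 0 < r /\ forall x, 0 < x < r -> Cmod (c * f x)%C <= eps.
Proof.
  intros H eps he. assert (hc := Cmod_ge_0 c).
  destruct (H (eps / (Cmod c + 1)) ltac:(apply Rdiv_lt_0_compat; lra)) as [r [hr Hr]].
  exists r. split; [easy|]. intros x hx. specialize (Hr x hx). rewrite Cmod_mult.
  apply Rle_trans with ((Cmod c + 1) * (eps / (Cmod c + 1))); [|apply Req_le; field; lra].
  apply Rmult_le_compat; try apply Cmod_ge_0; lra.
Qed.

Lemma sum_small (f g : R -> C) :
  (forall eps, 0 < eps -> exists r, 0 < r /\ forall x, 0 < x < r -> Cmod (f x)%C <= eps) ->
  (forall eps, 0 < eps -> exists r, 0 < r /\ forall x, 0 < x < r -> Cmod (g x)%C <= eps) ->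
  forall eps, 0 < eps -> exists r, 0 < r /\ forall x, 0 < x < r -> Cmod (f x + g x)%C <= eps.
Proof.
  intros H1 H2 eps he. destruct (H1 (eps / 2) ltac:(lra)) as [r1 [h1 K1]]. destruct (H2 (eps / 2) ltac:(lra)) as [r2 [h2 K2]].
  exists (Rmin r1 r2). split; [apply Rmin_pos; easy|]. intros x [hx hx2]. apply Rmin_Rgt_l in hx2.
  specialize (K1 x ltac:(lra)). specialize (K2 x ltac:(lra)). eapply Rle_trans; [apply Cmod_triangle|]. lra.
Qed.

Lemma pterm_small mu b w k : 1 < Re (eexp w (S k)) ->
  forall eps, 0 < eps -> exists r, 0 < r /\ forall x, 0 < x < r -> Cmod (pterm mu b w k (RtoC x))%C <= eps.
Proof.
  intros he eps heps. unfold pterm. set (e := eexp w (S k)) in *.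
  destruct (sum_small (fun x => RtoC (Ac mu b k) * (/ e * pl e (RtoC x)) + (- RtoC (Ac mu b k) * / (e * e)) * pw e (RtoC x))%C
    (fun x => (RtoC (Dc mu b k) * / e) * pw e (RtoC x))%C) with eps as [r [hr Hr]]; try easy.
  - apply sum_small; [apply lin_small, lin_small, pl_small; easy|apply lin_small, pw_small; lra].
  - apply lin_small, pw_small. lra.
  - exists r. split; [easy|]. intros x hx. specialize (Hr x hx).
    match goal with |- Cmod ?a <= _ => match type of Hr with Cmod ?c <= _ => replace a with c by ring end end. easy.
Qed.

(* Analytic for [Re w > - 2 K - 1]; adding [Rat] makes it independent of [K]. *)
Definition Ent (mu b : R) (K : nat) : C -> C :=
  Mlim (fun t => phi mu b (RtoC t) - Qs mu b K (RtoC t))%C (fun t => phi mu b (RtoC t)).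

Lemma rcont_phi mu b t : 0 < b -> 0 < t -> rcont (fun t => phi mu b (RtoC t)) t.
Proof. intros hb ht. apply (holo_rcont rhp); [apply holo_phi|]; easy. Qed.

Lemma rcont_Qs mu b K t : 0 < t -> rcont (fun t => Qs mu b K (RtoC t)) t.
Proof. intros ht. apply (holo_rcont slit); [apply holo_Qs|apply slit_pos; easy]. Qed.

Lemma phi_far mu b : 0 < mu -> 0 < b ->
  forall q, exists B, 0 <= B /\ forall t, 1 <= t -> Cmod (phi mu b (RtoC t))%C * t ^ q <= B.
Proof.
  intros hmu hb q. destruct (phi_decay mu b (1 / 2) (q + 2) hmu hb ltac:(lra) ltac:(lia)) as [B [hB HB]].
  exists B. split; [easy|]. intros t ht.
  assert (X := HB (RtoC t) (cone_RtoC (1 / 2) t ltac:(lra) ltac:(lra))). rewrite Cmod_R, Rabs_pos_eq in X by lra.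
  eapply Rle_trans; [|exact X]. apply Rmult_le_compat_l; [apply Cmod_ge_0|]. apply Rle_pow; [easy|lia].
Qed.

Lemma phi_Qs_data mu b K : 0 < mu -> 0 < b ->
  Mellin_data (fun t => phi mu b (RtoC t) - Qs mu b K (RtoC t))%C (fun t => phi mu b (RtoC t)) (2 * INR K).
Proof.
  intros hmu hb. split; [|split; [|apply phi_far; easy]].
  - intros t ht. split; [apply rcont_minus; [apply rcont_phi|apply rcont_Qs]|apply rcont_phi]; easy.
  - destruct (phi_expansion mu b (1 / 2) K hmu hb ltac:(lra)) as [A [hA HA]]. exists (A + 1). split; [lra|]. intros t ht.
    assert (X := HA (RtoC t) (cone_RtoC (1 / 2) t ltac:(lra) ltac:(lra))). rewrite Cmod_R, Rabs_pos_eq in X by lra.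
    replace (2 * INR K) with (INR (2 * K)) by (rewrite mult_INR; simpl; ring). rewrite Rpower_pow by lra.
    assert (0 <= t ^ (2 * K)) by (apply pow_le; lra). lra.
Qed.

Lemma Ent_CF mu b K w0 : 0 < mu -> 0 < b -> - 2 * INR K - 1 < Re w0 -> exists r, CF (Ent mu b K) w0 r.
Proof. intros hmu hb hw. apply (Mlim_CF _ _ _ _ (phi_Qs_data mu b K hmu hb)). lra. Qed.

Lemma Clim_at_0 (f : R -> C) :
  (forall eps, 0 < eps -> exists r, 0 < r /\ forall x, 0 < x < r -> Cmod (f x)%C <= eps) ->
  Clim (fun n => f (/ INR (S n))) 0.
Proof.
  intros H eps he. destruct (H eps he) as [r [hr Hr]]. destruct (inv_INR_small r hr) as [N HN].
  exists N. intros n hn. match goal with |- Cmod ?u <= _ => replace u with (f (/ INR (S n))) by ring end.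
  apply Hr, HN, hn.
Qed.

Lemma Re_eexp w k : Re (eexp w k) = Re w + 2 * INR k.
Proof. change (Re (eexp w k)) with (Re w + INR (2 * k)). rewrite mult_INR. simpl (INR 2). ring. Qed.

Lemma pterm_one mu b w k : pterm mu b w k 1 =
  (RtoC (Dc mu b k) / eexp w (S k) - RtoC (Ac mu b k) / (eexp w (S k) * eexp w (S k)))%C.
Proof.
  unfold pterm, pl, pw, Cpower. rewrite Clog_RtoC, ln_1 by lra.
  replace (eexp w (S k) * 0)%C with (RtoC 0) by ring. rewrite Cexp_0. unfold Cdiv. ring.
Qed.

Lemma is_CI_qterm mu b w k a : 0 < a <= 1 -> eexp w (S k) <> 0%C ->
  is_CI (fun t => tpow w t * qterm mu b k (RtoC t))%C a 1 (pterm mu b w k 1 - pterm mu b w k (RtoC a))%C.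
Proof.
  intros ha he. apply is_CI_ext with (fun t => Cpower (RtoC t) w * qterm mu b k (RtoC t))%C; [lra| |].
  { intros t ht. rewrite tpow_Cpower by lra. easy. }
  apply (is_CI_derive (fun t => pterm mu b w k (RtoC t))); [lra| |].
  - intros t ht. apply (rderiv_of_cderiv (pterm mu b w k)), cderiv_pterm; [apply slit_pos; lra|easy].
  - intros t ht. apply (rcont_mult (fun t => pw w (RtoC t)) (fun t => qterm mu b k (RtoC t))).
    + apply (holo_rcont slit (pw w)); [apply holo_pw|apply slit_pos; lra].
    + apply (holo_rcont slit); [apply holo_qterm|apply slit_pos; lra].
Qed.

(** One more term of [Qs] removes the integral of [t^w qterm] over [(0, 1]], which is the value of
    [pterm] at 1 because the primitive tends to 0 at the origin. *)
Lemma Ent_succ mu b K w : 0 < mu -> 0 < b -> - 2 * INR K - 1 < Re w ->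
  Ent mu b (S K) w = (Ent mu b K w - pterm mu b w K 1)%C.
Proof.
  intros hmu hb hw. apply (Mlim_unique _ _ _ _ _ (phi_Qs_data mu b (S K) hmu hb)); [rewrite S_INR; lra|].
  assert (hRe : 1 < Re (eexp w (S K))) by (rewrite Re_eexp, S_INR; lra).
  assert (he : eexp w (S K) <> 0%C) by (intros E; rewrite E in hRe; simpl in hRe; lra).
  apply Clim_ext with (fun n => Mn (fun t => phi mu b (RtoC t) - Qs mu b K (RtoC t)) (fun t => phi mu b (RtoC t)) n w - (pterm mu b w K 1 - pterm mu b w K (RtoC (/ INR (S n)))))%C.
  - intros n. assert (hn := inv_INR_S n). unfold Mn.
    set (f := fun t => (tpow w t * (phi mu b (RtoC t) - Qs mu b K (RtoC t)))%C).
    assert (E : CI (fun t => tpow w t * (phi mu b (RtoC t) - Qs mu b (S K) (RtoC t)))%C (/ INR (S n)) 1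
      = (CI f (/ INR (S n)) 1 - (pterm mu b w K 1 - pterm mu b w K (RtoC (/ INR (S n)))))%C).
    { apply CI_unique.
      apply is_CI_ext with (fun t => f t - tpow w t * qterm mu b K (RtoC t))%C; [lra| |].
      - intros t ht. unfold f. rewrite !Qs_eq by (apply rhp_neq_0, rhp_RtoC; lra). cbn [Csum]. ring.
      - apply is_CI_minus; [|apply is_CI_qterm; easy]. apply is_CI_CI; [lra|]. intros t ht.
        apply rcont_mult; [apply rcont_tpow; lra|]. apply rcont_minus; [apply rcont_phi|apply rcont_Qs]; lra. }
    rewrite E. ring.
  - apply Clim_minus; [apply (Mlim_spec _ _ _ _ (phi_Qs_data mu b K hmu hb)); lra|].
    assert (T : Clim (fun n => pterm mu b w K 1 - pterm mu b w K (RtoC (/ INR (S n))))%C (pterm mu b w K 1 - 0)%C).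
    { apply Clim_minus; [apply Clim_const|]. apply (Clim_at_0 (fun x => pterm mu b w K (RtoC x))).
      apply pterm_small. easy. }
    replace (pterm mu b w K 1 - 0)%C with (pterm mu b w K 1) in T by ring. exact T.
Qed.

(** The integral of [t^w Qs] over [(0, 1]] for [Re w > 0], taken as a rational function of [w]. It
    carries the poles: at [w = 0] at most simple, at the points [- 2 k - 2] at most double because
    of the logarithm. *)
Definition Rat (mu b : R) (K : nat) (w : C) : C :=
  (RtoC (al mu b 0) / w + Csum (fun k => pterm mu b w k 1) K)%C.

Lemma Ent_Rat_stable mu b K K' w : 0 < mu -> 0 < b -> - 2 * INR K - 1 < Re w -> (K <= K')%nat ->
  (Ent mu b K' w + Rat mu b K' w = Ent mu b K w + Rat mu b K w)%C.
Proof.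
  intros hmu hb hw h. induction h as [|K' h IH]; [easy|]. rewrite <- IH.
  rewrite Ent_succ; try easy.
  - unfold Rat. cbn [Csum]. ring.
  - apply le_INR in h. lra.
Qed.

Definition Mel (mu b : R) (w : C) : C :=
  let K := epsilon (inhabits O) (fun K => - 2 * INR K - 1 < Re w) in (Ent mu b K w + Rat mu b K w)%C.

Lemma Mel_eq mu b K w : 0 < mu -> 0 < b -> - 2 * INR K - 1 < Re w -> Mel mu b w = (Ent mu b K w + Rat mu b K w)%C.
Proof.
  intros hmu hb hw. unfold Mel. set (K0 := epsilon _ _).
  assert (h0 : - 2 * INR K0 - 1 < Re w) by (unfold K0; apply (epsilon_spec (inhabits O) (fun K => - 2 * INR K - 1 < Re w)); exists K; easy).
  destruct (Nat.le_ge_cases K K0) as [h|h]; [|symmetry]; apply Ent_Rat_stable; easy.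
Qed.

Lemma phi_data mu b : 0 < mu -> 0 < b -> Mellin_data (fun t => phi mu b (RtoC t)) (fun t => phi mu b (RtoC t)) (- (1)).
Proof.
  intros hmu hb. split; [|split; [|apply phi_far; easy]].
  - intros t ht. split; apply rcont_phi; easy.
  - destruct (phi_expansion mu b (1 / 2) 0 hmu hb ltac:(lra)) as [A [hA HA]].
    assert (hc := Rabs_pos (al mu b 0)). exists (A + 1 + Rabs (al mu b 0)). split; [lra|]. intros t ht.
    assert (X := HA (RtoC t) (cone_RtoC (1 / 2) t ltac:(lra) ltac:(lra))). assert (t0 := rhp_neq_0 _ (rhp_RtoC t (proj1 ht))).
    rewrite Qs_eq in X by easy. simpl in X. rewrite Rmult_1_r in X.
    rewrite Rpower_Ropp, Rpower_1 by lra.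
    replace (phi mu b (RtoC t)) with ((phi mu b (RtoC t) - (RtoC (al mu b 0) / RtoC t + 0)) + RtoC (al mu b 0) / RtoC t)%C by ring.
    eapply Rle_trans; [apply Cmod_triangle|]. rewrite Cmod_div by easy. rewrite !Cmod_R, (Rabs_pos_eq t) by lra.
    assert (1 <= / t) by (rewrite <- Rinv_1; apply Rinv_le_contravar; lra).
    assert ((A + 1) * 1 <= (A + 1) * / t) by (apply Rmult_le_compat_l; lra). lra.
Qed.

(** With [K = 0] only the term [al 0 / z] has been subtracted, and its integral [al 0 / w] over
    [(0, 1]] is what [Rat] restores. *)
Lemma Mel_IInt mu b w : 0 < mu -> 0 < b -> 0 < Re w ->
  IInt (fun t => tpow w t * phi mu b (RtoC t))%C (Mel mu b w).
Proof.
  intros hmu hb hw. set (c := al mu b 0). set (f := fun t => phi mu b (RtoC t)).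
  assert (w0 : w <> 0%C) by (apply rhp_neq_0, hw). assert (D := phi_data mu b hmu hb). fold f in D.
  replace (Mel mu b w) with (Mlim f f w); [apply (Mlim_IInt f (- (1))); [exact D|lra]|].
  rewrite (Mel_eq mu b 0) by (simpl; lra).
  assert (E : Ent mu b 0 w = (Mlim f f w - RtoC c / w)%C); [|rewrite E; unfold Rat; simpl Csum; fold c; ring].
  apply (Mlim_unique _ _ _ _ _ (phi_Qs_data mu b 0 hmu hb)); [simpl; lra|].
  apply Clim_ext with (fun n => Mn f f n w - (RtoC c / w - RtoC c / w * pw w (RtoC (/ INR (S n)))))%C.
  - intros n. assert (hn := inv_INR_S n). unfold Mn.
    assert (E : CI (fun t => tpow w t * (phi mu b (RtoC t) - Qs mu b 0 (RtoC t)))%C (/ INR (S n)) 1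
      = (CI (fun t => tpow w t * f t)%C (/ INR (S n)) 1 - (RtoC c / w - RtoC c / w * pw w (RtoC (/ INR (S n)))))%C).
    { apply CI_unique.
      apply is_CI_ext with (fun t => tpow w t * f t - pw w (RtoC t) * (RtoC c / RtoC t))%C; [lra| |].
      - intros t ht. assert (t0 := rhp_neq_0 _ (rhp_RtoC t ltac:(lra))).
        rewrite Qs_eq by exact t0. rewrite tpow_Cpower by lra. unfold pw, f. simpl Csum. fold c. ring.
      - apply is_CI_minus.
        { apply is_CI_CI; [lra|]. intros t ht. assert (t1 : 0 < t) by lra.
          apply (rcont_mult (tpow w) f); [apply rcont_tpow, t1|apply (proj1 D t t1)]. }
        replace (RtoC c / w)%C with (RtoC c / w * pw w (RtoC 1))%C at 1.
        2:{ unfold pw, Cpower. rewrite Clog_RtoC, ln_1 by lra. replace (w * 0)%C with (RtoC 0) by ring. rewrite Cexp_0. ring. }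
        apply (is_CI_derive (fun t => RtoC c / w * pw w (RtoC t))%C); [lra| |].
        + intros t ht. apply (rderiv_of_cderiv (fun z => RtoC c / w * pw w z)%C).
          eapply cderiv_eq; [|apply cderiv_scal, cderiv_pw, slit_pos; lra].
          assert (RtoC t <> 0%C) by (apply rhp_neq_0, rhp_RtoC; lra). field. easy.
        + intros t ht. apply (rcont_mult (fun t => pw w (RtoC t))); [apply (holo_rcont slit (pw w)); [apply holo_pw|apply slit_pos; lra]|].
          apply (holo_rcont rhp (fun z => RtoC c / z)%C); [|apply rhp_RtoC; lra].
          apply holo_scal; [apply copen_rhp|].
          apply holo_inv; [apply copen_rhp|apply holo_id, copen_rhp|apply rhp_neq_0]. }
    rewrite E. unfold f. ring.
  - apply Clim_minus; [apply (Mlim_spec f f _ _ D); lra|].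
    assert (T : Clim (fun n => RtoC c / w - RtoC c / w * pw w (RtoC (/ INR (S n))))%C (RtoC c / w - RtoC c / w * 0)%C).
    { apply Clim_minus; [apply Clim_const|]. apply Clim_scal, (Clim_at_0 (fun x => pw w (RtoC x))), pw_small. easy. }
    replace (RtoC c / w - RtoC c / w * 0)%C with (RtoC c / w)%C in T by ring. exact T.
Qed.

(** * Meromorphy of the transform and the value of [H1] *)

Definition lan (f : C -> C) (z0 : C) : Prop := exists r, 0 < r /\ holo (cdisc z0 r) f.

Lemma CF_lan f z0 r : CF f z0 r -> lan f z0.
Proof. intros H. exists r. split; [apply H|apply CF_holo_disc; easy]. Qed.

Lemma lan_CF f z0 : lan f z0 -> exists r, CF f z0 r.
Proof. intros [r [hr H]]. exists (r / 2). apply (disc_CF (cdisc z0 r)); try easy. apply copen_disc. Qed.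

Lemma lan_analytic f z0 : lan f z0 -> analytic_at f z0.
Proof. intros H. destruct (lan_CF f z0 H) as [r Hr]. eapply CF_analytic; eassumption. Qed.

Lemma lan_mrep f z0 : lan f z0 -> mrep f z0.
Proof. intros H. apply analytic_mrep, lan_analytic, H. Qed.

Lemma lan_common f g z0 : lan f z0 -> lan g z0 -> exists r, 0 < r /\ holo (cdisc z0 r) f /\ holo (cdisc z0 r) g.
Proof.
  intros [r1 [h1 H1]] [r2 [h2 H2]]. exists (Rmin r1 r2). split; [apply Rmin_pos; easy|].
  assert (A := Rmin_l r1 r2). assert (B := Rmin_r r1 r2).
  split; [apply (holo_subset (cdisc z0 r1))|apply (holo_subset (cdisc z0 r2))]; try easy; intros w hw; unfold cdisc in *; lra.
Qed.

Lemma lan_plus f g z0 : lan f z0 -> lan g z0 -> lan (fun w => f w + g w)%C z0.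
Proof. intros H1 H2. destruct (lan_common f g z0 H1 H2) as [r [hr [A B]]]. exists r. split; [easy|]. apply holo_plus; try easy. apply copen_disc. Qed.

Lemma lan_mult f g z0 : lan f z0 -> lan g z0 -> lan (fun w => f w * g w)%C z0.
Proof. intros H1 H2. destruct (lan_common f g z0 H1 H2) as [r [hr [A B]]]. exists r. split; [easy|]. apply holo_mult; try easy. apply copen_disc. Qed.

Lemma lan_const c z0 : lan (fun _ => c) z0.
Proof. exists 1. split; [lra|]. apply holo_const, copen_disc. Qed.

Lemma lan_shift f c z0 : lan f (c + z0)%C -> lan (fun s => f (c + s)%C) z0.
Proof.
  intros [r [hr H]]. exists r. split; [easy|]. apply (holo_comp _ (cdisc (c + z0)%C r)); try easy; [apply copen_disc| |].
  - apply holo_plus; [apply copen_disc|apply holo_const, copen_disc|apply holo_id, copen_disc].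
  - intros w hw. unfold cdisc in *. replace (c + w - (c + z0))%C with (w - z0)%C by ring. easy.
Qed.

Lemma lan_ext f g z0 r : 0 < r -> (forall w, cdisc z0 r w -> f w = g w) -> lan f z0 -> lan g z0.
Proof.
  intros hr E [r' [hr' H]]. exists (Rmin r r'). split; [apply Rmin_pos; easy|].
  assert (A := Rmin_l r r'). assert (B := Rmin_r r r').
  apply (holo_ext _ f); [apply copen_disc|intros w hw; apply E; unfold cdisc in *; lra|].
  apply (holo_subset (cdisc z0 r')); [intros w hw; unfold cdisc in *; lra|easy].
Qed.

Lemma mrep_intro f z0 m A r : 0 < r -> lan A z0 -> (forall w, punct z0 r w -> f w = (A w / (w - z0) ^ m)%C) -> mrep f z0.
Proof.
  intros hr HA E. destruct (lan_CF A z0 HA) as [r' Hr']. assert (h' : 0 < r') by apply Hr'.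
  assert (hm : 0 < Rmin r r') by (apply Rmin_pos; easy). assert (a := Rmin_l r r'). assert (b := Rmin_r r r').
  exists m, A, (Rmin r r' / 2). split; [apply (CF_smaller _ _ r'); [easy|lra]|].
  intros w [k1 k2]. apply E. split; lra.
Qed.

Lemma mrep_common f g z0 : mrep f z0 -> mrep g z0 -> exists m A n B r, 0 < r /\ lan A z0 /\ lan B z0 /\
  forall w, punct z0 r w -> (w - z0)%C <> 0%C /\ f w = (A w / (w - z0) ^ m)%C /\ g w = (B w / (w - z0) ^ n)%C.
Proof.
  intros [m [A [r1 [HA E1]]]] [n [B [r2 [HB E2]]]]. assert (h1 : 0 < r1) by apply HA. assert (h2 : 0 < r2) by apply HB.
  exists m, A, n, B, (Rmin r1 r2). split; [apply Rmin_pos; easy|]. split; [eapply CF_lan; eassumption|].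
  split; [eapply CF_lan; eassumption|]. intros w [k1 k2]. apply Rmin_Rgt_l in k2.
  split; [apply Cmod_gt_0; easy|]. split; [apply E1|apply E2]; split; lra.
Qed.

Lemma lan_pow_center z0 m : lan (fun w => (w - z0) ^ m)%C z0.
Proof.
  exists 1. split; [lra|]. assert (O := copen_disc z0 1). apply holo_pow; [easy|].
  apply holo_minus; [easy|apply holo_id; easy|apply holo_const; easy].
Qed.

Lemma mrep_plus f g z0 : mrep f z0 -> mrep g z0 -> mrep (fun w => f w + g w)%C z0.
Proof.
  intros H1 H2. destruct (mrep_common f g z0 H1 H2) as [m [A [n [B [r [hr [HA [HB E]]]]]]]].
  apply (mrep_intro _ z0 (m + n) (fun w => A w * (w - z0) ^ n + B w * (w - z0) ^ m)%C r hr).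
  - apply lan_plus; apply lan_mult; try easy; apply lan_pow_center.
  - intros w hw. destruct (E w hw) as [hne [-> ->]]. rewrite Cpow_add_r.
    assert (h1 := Cpow_nz _ m hne). assert (h2 := Cpow_nz _ n hne). field. easy.
Qed.

Lemma mrep_mult f g z0 : mrep f z0 -> mrep g z0 -> mrep (fun w => f w * g w)%C z0.
Proof.
  intros H1 H2. destruct (mrep_common f g z0 H1 H2) as [m [A [n [B [r [hr [HA [HB E]]]]]]]].
  apply (mrep_intro _ z0 (m + n) (fun w => A w * B w)%C r hr).
  - apply lan_mult; easy.
  - intros w hw. destruct (E w hw) as [hne [-> ->]]. rewrite Cpow_add_r.
    assert (h1 := Cpow_nz _ m hne). assert (h2 := Cpow_nz _ n hne). field. easy.
Qed.

Lemma mrep_ext f g z0 r : 0 < r -> (forall w, cdisc z0 r w -> f w = g w) -> mrep f z0 -> mrep g z0.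
Proof.
  intros hr E [m [A [r' [HA E']]]]. assert (h' : 0 < r') by apply HA.
  apply (mrep_intro _ _ m A (Rmin r r')); [apply Rmin_pos; easy|eapply CF_lan; eassumption|].
  intros w [k1 k2]. apply Rmin_Rgt_l in k2. rewrite <- E by (unfold cdisc; lra). apply E'. split; lra.
Qed.

Lemma mrep_shift f c z0 : mrep f (c + z0)%C -> mrep (fun s => f (c + s)%C) z0.
Proof.
  intros [m [A [r [HA E]]]]. apply (mrep_intro _ _ m (fun s => A (c + s)%C) r); [apply HA|apply lan_shift; eapply CF_lan; eassumption|].
  intros w hw. unfold punct in *. replace (w - z0)%C with (c + w - (c + z0))%C in * by ring. apply E. easy.
Qed.

Lemma lan_inv_lin (p z0 : C) : (z0 + p)%C <> 0%C -> lan (fun w => / (w + p))%C z0.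
Proof.
  intros h. apply Cmod_gt_0 in h. exists (Cmod (z0 + p)%C). split; [easy|]. assert (O := copen_disc z0 (Cmod (z0 + p)%C)).
  apply holo_inv; [easy|apply holo_plus; [easy|apply holo_id; easy|apply holo_const; easy]|].
  intros w hw. unfold cdisc in hw. intros E. replace (w - z0)%C with ((w + p) - (z0 + p))%C in hw by ring.
  rewrite E in hw. replace (0 - (z0 + p))%C with (- (z0 + p))%C in hw by ring. rewrite Cmod_opp in hw. lra.
Qed.

Lemma mrep_inv_lin (p z0 : C) : mrep (fun w => / (w + p))%C z0.
Proof.
  destruct (classic ((z0 + p)%C = 0%C)) as [h|h].
  - apply (mrep_intro _ z0 1 (fun _ => 1%C) 1); [lra|apply lan_const|].
    intros w [k _]. apply Cmod_gt_0 in k. replace (w + p)%C with (w - z0)%C.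
    + field. easy.
    + replace p with (- z0 + (z0 + p))%C by ring. rewrite h. ring.
  - apply lan_mrep, lan_inv_lin, h.
Qed.

(** At [e = 0] both sides are 0 by the convention for the inverse, so the rewriting of [Rat] in
    [Rat_closed] is an identity of functions on the whole plane. *)
Lemma Cinv_sqr (e : C) : (/ (e * e))%C = (/ e * / e)%C.
Proof.
  destruct (classic (e = 0%C)) as [->|h]; [|field; easy].
  replace (0 * 0)%C with (RtoC 0) by ring.
  assert (E : (/ RtoC 0)%C = RtoC 0) by (unfold Cinv, RtoC; simpl; f_equal; unfold Rdiv; ring).
  rewrite E. ring.
Qed.

(* Both closure properties are needed for [Rat]: [P] is either [lan] at a point off the poles or [mrep]. *)
Lemma Rat_closed (P : (C -> C) -> Prop) mu b K : (forall c, P (fun _ => c)) ->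
  (forall f g, P f -> P g -> P (fun w => f w + g w)%C) -> (forall f g, P f -> P g -> P (fun w => f w * g w)%C) ->
  (forall k, (k <= K)%nat -> P (fun w => / eexp w k)%C) -> P (Rat mu b K).
Proof.
  intros Pc Pp Pm Pi.
  assert (E : Rat mu b K = (fun w => RtoC (al mu b 0) * / eexp w 0 + Csum (fun k => RtoC (Dc mu b k) * / eexp w (S k)
    + RtoC (- Ac mu b k) * (/ eexp w (S k) * / eexp w (S k))) K)%C).
  { apply functional_extensionality. intros w. unfold Rat. f_equal.
    - unfold eexp. simpl. replace (w + 0)%C with w by ring. easy.
    - apply Csum_ext. intros k _. rewrite pterm_one, RtoC_opp. unfold Cdiv.
      rewrite Cinv_sqr. ring. }
  rewrite E. apply Pp; [apply Pm; [apply Pc|apply Pi; lia]|].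
  assert (G : forall n, (n <= K)%nat -> P (fun w => Csum (fun k => RtoC (Dc mu b k) * / eexp w (S k)
    + RtoC (- Ac mu b k) * (/ eexp w (S k) * / eexp w (S k))) n)%C).
  { induction n as [|n IH]; intros hn; [apply (Pc 0%C)|]. cbn [Csum]. apply Pp; [apply IH; lia|].
    assert (I := Pi (S n) hn). apply Pp; apply Pm; try apply Pc; try easy. apply Pm; easy. }
  apply G. easy.
Qed.

Lemma Mel_local mu b w0 : 0 < mu -> 0 < b -> exists K, - 2 * INR K - 1 < Re w0 /\
  forall w, cdisc w0 1 w -> Mel mu b w = (Ent mu b K w + Rat mu b K w)%C.
Proof.
  intros hmu hb. destruct (INR_large (Rabs (Re w0))) as [K hK]. specialize (hK K (Nat.le_refl _)).
  assert (T := Rle_abs (- Re w0)). rewrite Rabs_Ropp in T. assert (T0 := Rabs_pos (Re w0)).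
  exists K. split; [lra|]. intros w hw. apply Mel_eq; try easy.
  assert (T1 := re_le_Cmod (w - w0)). change (Re (w - w0)) with (Re w - Re w0) in T1.
  assert (T2 := Rle_lt_trans _ _ _ T1 hw). apply Rabs_lt_between in T2. lra.
Qed.

Lemma mrep_Mel mu b w0 : 0 < mu -> 0 < b -> mrep (Mel mu b) w0.
Proof.
  intros hmu hb. destruct (Mel_local mu b w0 hmu hb) as [K [hK E]].
  apply (mrep_ext (fun w => Ent mu b K w + Rat mu b K w)%C _ w0 1); [lra|intros w hw; symmetry; apply E; easy|].
  apply mrep_plus.
  - destruct (Ent_CF mu b K w0 hmu hb hK) as [r Hr]. eapply lan_mrep, CF_lan, Hr.
  - apply (Rat_closed (fun f => mrep f w0)).
    + intros c. apply lan_mrep, lan_const.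
    + intros f g. apply mrep_plus.
    + intros f g. apply mrep_mult.
    + intros k _. apply (mrep_inv_lin (RtoC (INR (2 * k)))).
Qed.

Lemma lan_Mel mu b w0 : 0 < mu -> 0 < b -> (forall k, eexp w0 k <> 0%C) -> lan (Mel mu b) w0.
Proof.
  intros hmu hb hp. destruct (Mel_local mu b w0 hmu hb) as [K [hK E]].
  apply (lan_ext (fun w => Ent mu b K w + Rat mu b K w)%C _ w0 1); [lra|intros w hw; symmetry; apply E; easy|].
  apply lan_plus.
  - destruct (Ent_CF mu b K w0 hmu hb hK) as [r Hr]. eapply CF_lan, Hr.
  - apply (Rat_closed (fun f => lan f w0)).
    + intros c. apply lan_const.
    + intros f g. apply lan_plus.
    + intros f g. apply lan_mult.
    + intros k _. apply (lan_inv_lin (RtoC (INR (2 * k)))), hp.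
Qed.

Lemma H1_integrand mu gamma b s t : 0 < b -> 0 < t ->
  (tpow (RtoC gamma - 1 + s) t * phi mu b (RtoC t))%C =
  (Cpower t (gamma + s - 1) * BesselK1 (RtoC (b * t)) / RtoC (Rpower (1 + t ^ 2) mu))%C.
Proof.
  intros hb ht. rewrite tpow_Cpower by easy.
  replace (RtoC gamma - 1 + s)%C with (RtoC gamma + s - 1)%C by ring.
  rewrite BesselK1_BK by (simpl; apply Rmult_lt_0_compat; easy).
  unfold phi, opq. rewrite RtoC_mult.
  replace (1 + RtoC t * RtoC t)%C with (RtoC (1 + t ^ 2)) by (simpl pow; rewrite Rmult_1_r, RtoC_plus, RtoC_mult; ring).
  assert (hp : 0 < 1 + t ^ 2) by (assert (0 <= t ^ 2) by (apply pow_le; lra); lra).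
  rewrite Cpower_RtoC, Rpower_Ropp by easy. rewrite RtoC_inv by (apply Rgt_not_eq, Rpower_pos).
  unfold Cdiv. ring.
Qed.

(** The substitution [w = gamma - 1 + s] takes [s = 1] to [gamma], which is no pole by hypothesis.
    [Mel] is only known to be locally a quotient, with arbitrary values at removable singularities,
    so it is repaired before being offered as the continuation. *)
Lemma H1_value mu gamma b : 0 < mu -> 0 < b -> (forall m : nat, gamma <> - 2 * INR m) ->
  H1 mu gamma b (RtoC 1) = Mel mu b (RtoC gamma).
Proof.
  intros hmu hb hg. set (f := fun s => Mel mu b (RtoC gamma - 1 + s)%C).
  destruct (mero_repair f) as [G [HG HGf]].
  { intros z. apply mrep_shift, mrep_Mel; easy. }
  assert (L : forall s, (forall k, eexp (RtoC gamma - 1 + s) k <> 0%C) -> lan f s).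
  { intros s h. apply lan_shift, lan_Mel; easy. }
  assert (L1 : lan f 1).
  { apply L. intros k E. apply (f_equal Re) in E. rewrite Re_eexp in E. simpl in E. apply (hg k). lra. }
  assert (LG : analytic_at G 1).
  { destruct L1 as [r [hr Hr]]. apply (holo_analytic (cdisc 1 r)); [apply copen_disc| |apply disc_center; easy].
    apply (holo_ext _ f); [apply copen_disc| |easy]. intros z hz. symmetry. apply HGf.
    apply (holo_analytic (cdisc 1 r)); [apply copen_disc|easy|easy]. }
  unfold H1. destruct (continuation_eq (fun s => - gamma + 1 < Re s)
    (fun s => CInt_0_infty (fun x => Cpower x (gamma + s - 1) * BesselK1 (RtoC (b * x)) / RtoC (Rpower (1 + x ^ 2) mu))%C)
    G (RtoC (- gamma + 2)) 1) as [r [hr E]]; try easy.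
  - apply copen_Re_gt.
  - simpl. lra.
  - intros s hs. assert (hw : 0 < Re (RtoC gamma - 1 + s)) by (unfold Re in *; simpl; lra).
    rewrite HGf.
    + symmetry. apply IInt_CInt.
      apply IInt_ext with (fun t => tpow (RtoC gamma - 1 + s) t * phi mu b (RtoC t))%C; [|apply Mel_IInt; easy].
      intros t ht. apply H1_integrand; easy.
    + apply lan_analytic, L. intros k Ek. apply (f_equal Re) in Ek. rewrite Re_eexp in Ek.
      assert (T := pos_INR k). change (Re 0) with 0 in Ek. lra.
  - rewrite E by (apply (disc_center 1 r hr)). rewrite HGf by (apply lan_analytic, L1).
    unfold f. f_equal. ring.
Qed.

(** * The decaying primitive of the summand *)

(** The half plane is convex, so [f] can be integrated along the segment from 1 to [z].
    Differentiating [(z - 1)] times the averaged integral gives the integral of the total derivative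
    of [t f (p t)], that is [f z]. *)
Lemma holo_primitive f : holo rhp f -> exists F, forall z, rhp z -> cderiv F z (f z).
Proof.
  intros Hf.
  set (I := fun w => CI (fun t => f (RtoC (1 - t) + w * RtoC t) * 1)%C 0 1).
  exists (fun w => (w - 1) * I w)%C. intros z hz.
  set (p := fun t : R => (RtoC (1 - t) + z * RtoC t)%C).
  assert (Up : forall t, 0 <= t <= 1 -> rhp (p t)).
  { intros t ht. unfold rhp, p in *. unfold Re in *. simpl. nra. }
  assert (Dp : forall t, rderiv p t (z - 1)%C).
  { intros t. apply (rderiv_ext (fun s => 1 + RtoC s * (z - 1))%C); [|apply rderiv_line].
    intros s. unfold p. rewrite RtoC_minus. ring. }
  assert (cp : forall t, 0 <= t <= 1 -> rcont (fun t => f (p t)) t).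
  { intros t ht. apply (rcont_comp f p); [eapply rderiv_rcont, Dp|]. eapply cderiv_ccont, (holo_cderiv rhp); [easy|apply Up; easy]. }
  assert (cp' : forall t, 0 <= t <= 1 -> rcont (fun t => C_derive f (p t)) t).
  { intros t ht. apply (rcont_comp (C_derive f) p); [eapply rderiv_rcont, Dp|]. apply Hf, Up, ht. }
  assert (ct : forall t, rcont (fun t => RtoC t) t) by (intros t; eapply rderiv_rcont, rderiv_RtoC).
  assert (DI : cderiv I z (CI (fun t => C_derive f (p t) * RtoC t * 1)%C 0 1)).
  { apply (cderiv_CI_affine rhp f (C_derive f) (fun t => RtoC (1 - t)) RtoC (fun _ => 1%C) 0 1 z).
    - lra.
    - apply copen_rhp.
    - exact Hf.
    - intros t _. apply (rcont_ext (fun t => 1 - RtoC t)%C); [intros s; rewrite RtoC_minus; easy|].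
      apply rcont_minus; [apply rcont_const|apply ct].
    - intros t _. apply ct.
    - intros t _. apply rcont_const.
    - exact Up. }
  eapply cderiv_eq; [|exact (cderiv_mult _ _ _ _ _ (cderiv_minus _ _ _ _ _ (cderiv_id z) (cderiv_const 1 z)) DI)].
  cbv beta.
  assert (E1 : is_CI (fun t => f (p t) * 1 + (z - 1) * (C_derive f (p t) * RtoC t * 1))%C 0 1
     (I z + (z - 1) * CI (fun t => C_derive f (p t) * RtoC t * 1)%C 0 1)%C).
  { apply is_CI_plus; [|apply is_CI_scal]; apply is_CI_CI; try lra; intros t ht.
    - apply rcont_mult; [apply cp; easy|apply rcont_const].
    - repeat apply rcont_mult; [apply cp'; easy|apply ct|apply rcont_const]. }
  assert (E2 : is_CI (fun t => f (p t) * 1 + (z - 1) * (C_derive f (p t) * RtoC t * 1))%C 0 1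
     (RtoC 1 * f (p 1) - RtoC 0 * f (p 0))%C).
  { apply (is_CI_derive (fun t => RtoC t * f (p t))%C); [lra| |].
    - intros t ht. eapply rderiv_eq; [|exact (rderiv_mult _ _ _ _ _ (rderiv_RtoC t) (rderiv_comp f p t _ _ (Dp t) (holo_cderiv rhp f (p t) Hf (Up t ht))))].
      cbv beta. ring.
    - intros t ht. apply rcont_plus; [apply rcont_mult; [apply cp; easy|apply rcont_const]|].
      apply rcont_mult; [apply rcont_const|]. repeat apply rcont_mult; [apply cp'; easy|apply ct|apply rcont_const]. }
  apply CI_unique in E1. apply CI_unique in E2. rewrite E1 in E2.
  replace (p 1) with z in E2 by (unfold p; replace (1 - 1) with 0 by ring; ring).
  transitivity (I z + (z - 1) * CI (fun t => C_derive f (p t) * RtoC t * 1)%C 0 1)%C; [ring|]. rewrite E2. ring.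
Qed.

(** As [m < -1], a primitive has a limit along the positive axis, and subtracting it gives decay
    there. The chord from [|z|] to [z] carries the bound to the cone. *)
Lemma primitive_decay s A m f : 0 < s < 1 -> 0 <= A -> m < -1 -> holo rhp f ->
  (forall z, cone s z -> Cmod (f z)%C <= A * Rpower (Cmod z) m) ->
  exists G B, 0 <= B /\ (forall z, rhp z -> cderiv G z (f z)) /\
    forall z, cone s z -> Cmod (G z)%C <= B * Rpower (Cmod z) (m + 1).
Proof.
  intros hs hA hm Hf Hb. destruct (holo_primitive f Hf) as [F HF].
  set (c := A / - (m + 1)). assert (hc : 0 <= c) by (apply Rdiv_le_0_compat; lra).
  assert (Inc : forall x y, 0 < x <= y -> Cmod (F (RtoC y) - F (RtoC x))%C <= c * Rpower x (m + 1)).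
  { intros x y hxy. eapply Rle_trans; [apply (primitive_increment F f A m); [easy|lra| |]|].
    - intros t ht. apply HF, rhp_RtoC. lra.
    - intros t ht. assert (T := Hb (RtoC t) (cone_RtoC s t ltac:(lra) ltac:(lra))). rewrite Cmod_R, Rabs_pos_eq in T by lra. exact T.
    - assert (P := Rpower_pos y (m + 1)). assert (0 <= c * Rpower y (m + 1)) by (apply Rmult_le_pos; lra).
      replace (A / (m + 1)) with (- c) by (unfold c; field; lra). lra. }
  destruct (Clim_Cauchy (fun n => F (RtoC (INR (S n))))) as [L HL].
  { intros eps he. destruct (Rpower_neg_lim (m + 1) ltac:(lra) (eps / (c + 1)) ltac:(apply Rdiv_lt_0_compat; lra)) as [X [hX HX]].
    destruct (INR_large X) as [N HN]. exists N.
    assert (K : forall n p, (N <= n)%nat -> (n <= p)%nat -> Cmod (F (RtoC (INR (S p))) - F (RtoC (INR (S n))))%C <= eps).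
    { intros n p hn hp. assert (T := HN (S n) ltac:(lia)). eapply Rle_trans; [apply Inc; split; [apply lt_0_INR; lia|apply le_INR; lia]|].
      specialize (HX _ T). assert (P := Rpower_pos (INR (S n)) (m + 1)).
      apply Rle_trans with ((c + 1) * (eps / (c + 1))); [apply Rmult_le_compat; lra|apply Req_le; field; lra]. }
    intros n p hn hp. destruct (Nat.le_ge_cases n p) as [h|h]; [rewrite Cmod_minus_sym|]; apply K; easy. }
  assert (Real : forall x, 0 < x -> Cmod (F (RtoC x) - L)%C <= c * Rpower x (m + 1)).
  { intros x hx. apply le_epsilon. intros eps he. destruct (HL eps he) as [N HN]. destruct (INR_large x) as [N2 HN2].
    specialize (HN (max N N2) ltac:(lia)). specialize (HN2 (S (max N N2)) ltac:(lia)).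
    specialize (Inc x (INR (S (max N N2))) ltac:(lra)). rewrite Cmod_minus_sym in Inc.
    eapply Rle_trans; [apply Cmod_split with (y := F (RtoC (INR (S (max N N2)))))|]. lra. }
  set (d := A * (1 + Rpower s m)). assert (hsm := Rpower_pos s m).
  assert (hd : 0 <= d) by (apply Rmult_le_pos; lra).
  exists (fun z => F z - L)%C, (c + 2 * d). split; [lra|]. split.
  - intros z hz. eapply cderiv_eq; [|apply cderiv_minus; [apply HF, hz|apply cderiv_const]]. ring.
  - intros z hz. assert (hRe : 0 < Re z) by (eapply cone_rhp; [|exact hz]; lra).
    assert (hr : 0 < Cmod z) by (apply Cmod_gt_0, rhp_neq_0; easy). set (r := Cmod z) in *.
    assert (Sg : Cmod (F (RtoC r) - F z)%C <= d * Rpower r m * Cmod (RtoC r - z)%C).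
    { apply (cmvt_seg F f).
      - intros t ht. apply HF. destruct (seg_in_cone s z t ltac:(lra) hz ht) as [h1 _]. eapply cone_rhp; [|exact h1]. lra.
      - intros t ht. destruct (seg_in_cone s z t ltac:(lra) hz ht) as [h1 h2]. fold r in h1, h2.
        eapply Rle_trans; [apply Hb; exact h1|]. unfold d. rewrite Rmult_assoc. apply Rmult_le_compat_l; [easy|].
        apply Rpower_between; [lra|easy|exact h2]. }
    assert (hq : Cmod (RtoC r - z)%C <= 2 * r).
    { eapply Rle_trans; [apply Cmod_minus_triangle|]. rewrite Cmod_R, Rabs_pos_eq by lra. fold r. lra. }
    specialize (Real r hr). rewrite Cmod_minus_sym in Sg.
    assert (E : Rpower r (m + 1) = Rpower r m * r) by (rewrite Rpower_plus, Rpower_1; easy).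
    assert (P := Rpower_pos r m).
    assert (d * Rpower r m * Cmod (RtoC r - z)%C <= d * Rpower r m * (2 * r)).
    { apply Rmult_le_compat_l; [apply Rmult_le_pos; lra|easy]. }
    eapply Rle_trans; [apply Cmod_split with (y := F (RtoC r))|]. rewrite E in *. lra.
Qed.

Definition gfun (mu b gamma : R) (z : C) : C := (Cpower z (RtoC gamma) * phi mu b z)%C.

Lemma holo_gfun mu b gamma : 0 < b -> holo rhp (gfun mu b gamma).
Proof.
  intros hb. apply holo_mult; [apply copen_rhp| |apply holo_phi, hb].
  apply (holo_subset slit); [apply rhp_slit|apply holo_Cpower].
Qed.

Definition Prim (mu b gamma : R) (K : nat) (z : C) : C :=
  (RtoC (al mu b 0) * (/ RtoC gamma * pw (RtoC gamma) z) + Csum (fun k => pterm mu b (RtoC gamma) k z) K)%C.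

Lemma eexp_neq_0 gamma k : (forall m : nat, gamma <> - 2 * INR m) -> eexp (RtoC gamma) k <> 0%C.
Proof.
  intros hg E. apply (f_equal Re) in E. rewrite Re_eexp in E. change (Re 0) with 0 in E.
  change (Re (RtoC gamma)) with gamma in E. apply (hg k). lra.
Qed.

Lemma cderiv_Prim mu b gamma K z : (forall m : nat, gamma <> - 2 * INR m) -> slit z ->
  cderiv (Prim mu b gamma K) z (Cpower z (RtoC gamma) * Qs mu b K z)%C.
Proof.
  intros hg hz. assert (z0 := slit_neq_0 z hz).
  assert (g0 : RtoC gamma <> 0%C) by (intros E; apply RtoC_inj in E; apply (hg O); simpl; lra).
  eapply cderiv_eq; [|apply cderiv_plus; [apply cderiv_scal, cderiv_scal, cderiv_pw, hz|
    apply (cderiv_Csum (pterm mu b (RtoC gamma))); intros k; apply cderiv_pterm; [exact hz|apply eexp_neq_0, hg]]].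
  rewrite Csum_scal, Qs_eq by easy. unfold pw. field. easy.
Qed.

Lemma Prim_one mu b gamma K : Prim mu b gamma K 1 = Rat mu b K (RtoC gamma).
Proof.
  unfold Prim, Rat. f_equal. unfold pw, Cpower. rewrite Clog_RtoC, ln_1 by lra.
  replace (RtoC gamma * 0)%C with (RtoC 0) by ring. rewrite Cexp_0. unfold Cdiv. ring.
Qed.

Lemma gfun_expansion mu b gamma s K : 0 < mu -> 0 < b -> 0 < s <= 1 -> exists A, 0 <= A /\ forall z, cone s z ->
  Cmod (gfun mu b gamma z - Cpower z (RtoC gamma) * Qs mu b K z)%C <= A * Rpower (Cmod z) (gamma + 2 * INR K).
Proof.
  intros hmu hb hs. destruct (phi_expansion mu b s K hmu hb hs) as [A [hA HA]]. exists A. split; [easy|]. intros z hz.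
  assert (hr : 0 < Cmod z) by (apply Cmod_gt_0, rhp_neq_0; eapply cone_rhp; [|exact hz]; lra).
  unfold gfun. replace (Cpower z (RtoC gamma) * phi mu b z - Cpower z (RtoC gamma) * Qs mu b K z)%C
    with (Cpower z (RtoC gamma) * (phi mu b z - Qs mu b K z))%C by ring.
  rewrite Cmod_mult, Cmod_Cpower_R, Rpower_plus.
  replace (2 * INR K) with (INR (2 * K)) by (rewrite mult_INR; simpl; ring). rewrite Rpower_pow by easy.
  specialize (HA z hz). assert (P := Rpower_pos (Cmod z) gamma).
  apply Rmult_le_compat_l with (r := Rpower (Cmod z) gamma) in HA; [|lra]. lra.
Qed.

Lemma gfun_decay mu b gamma s : 0 < mu -> 0 < b -> 0 < s <= 1 -> exists A m, 0 <= A /\ m < -1 /\ forall z, cone s z ->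
  Cmod (gfun mu b gamma z)%C <= A * Rpower (Cmod z) m.
Proof.
  intros hmu hb hs. destruct (INR_large gamma) as [n0 hn0]. specialize (hn0 n0 (Nat.le_refl _)).
  destruct (phi_decay mu b s (n0 + 2) hmu hb hs ltac:(lia)) as [A [hA HA]].
  exists A, (gamma - INR (n0 + 2)). rewrite plus_INR. simpl (INR 2). split; [easy|]. split; [lra|]. intros z hz.
  assert (hr : 0 < Cmod z) by (apply Cmod_gt_0, rhp_neq_0; eapply cone_rhp; [|exact hz]; lra).
  replace (gamma - (INR n0 + (1 + 1))) with (gamma + - INR (n0 + 2)) by (rewrite plus_INR; simpl; ring).
  rewrite Rpower_plus, Rpower_Ropp, Rpower_pow by easy. unfold gfun. rewrite Cmod_mult, Cmod_Cpower_R.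
  specialize (HA z hz). assert (P := Rpower_pos (Cmod z) gamma). assert (Q : 0 < Cmod z ^ (n0 + 2)) by (apply pow_lt; easy).
  apply Rmult_le_reg_r with (Cmod z ^ (n0 + 2)); [easy|].
  replace (A * (Rpower (Cmod z) gamma * / Cmod z ^ (n0 + 2)) * Cmod z ^ (n0 + 2)) with (Rpower (Cmod z) gamma * A) by (field; lra).
  rewrite Rmult_assoc. apply Rmult_le_compat_l; lra.
Qed.

(* [Prim] approximates the decaying primitive near 0 up to the constant [Mel], which is the
   regularised integral of [gfun] over the half line. *)
Lemma primitive_expansion mu b gamma s K : 0 < mu -> 0 < b -> 0 < s < 1 -> (forall m : nat, gamma <> - 2 * INR m) ->
  -1 < gamma + 2 * INR K ->
  exists G m B B', m < 0 /\ 0 <= B /\ 0 <= B' /\ (forall z, rhp z -> cderiv G z (gfun mu b gamma z)) /\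
    forall z, cone s z -> Cmod (G z)%C <= B * Rpower (Cmod z) m /\
      Cmod (G z - Prim mu b gamma K z + Mel mu b (RtoC gamma))%C <= B' * Rpower (Cmod z) (gamma + 2 * INR K + 1).
Proof.
  intros hmu hb hs hg hK.
  destruct (gfun_decay mu b gamma s hmu hb ltac:(lra)) as [A [m [hA [hm HA]]]].
  destruct (primitive_decay s A m _ hs hA hm (holo_gfun mu b gamma hb) HA) as [G [B [hB [HG HGB]]]].
  destruct (gfun_expansion mu b gamma s K hmu hb ltac:(lra)) as [A' [hA' HA']].
  set (e := fun z => (gfun mu b gamma z - Cpower z (RtoC gamma) * Qs mu b K z)%C) in *.
  set (E := fun z => (G z - Prim mu b gamma K z)%C).
  assert (DE : forall z, rhp z -> cderiv E z (e z)).
  { intros z hz. apply cderiv_minus; [apply HG, hz|]. apply cderiv_Prim; [easy|apply rhp_slit, hz]. }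
  destruct (limit_at_0 E e A' (gamma + 2 * INR K) hA' hK) as [l Hl0].
  { intros t ht. apply DE, rhp_RtoC, ht. }
  { intros t ht. assert (T := HA' (RtoC t) (cone_RtoC s t ltac:(lra) ht)). rewrite Cmod_R, Rabs_pos_eq in T by lra. exact T. }
  assert (Hl : forall eps, 0 < eps -> exists r, 0 < r /\ forall x, 0 < x < r -> Cmod (E (RtoC x) - l)%C <= eps).
  { intros eps he. set (q := A' / (gamma + 2 * INR K + 1)) in *. assert (hq : 0 <= q) by (apply Rdiv_le_0_compat; lra).
    destruct (Rpower_small (gamma + 2 * INR K + 1) (eps / (q + 1)) ltac:(lra) ltac:(apply Rdiv_lt_0_compat; lra)) as [r [hr Hr]].
    exists r. split; [easy|]. intros x hx. eapply Rle_trans; [apply Hl0; easy|].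
    assert (Rpower x (gamma + 2 * INR K + 1) <= Rpower r (gamma + 2 * INR K + 1)) by (apply Rle_Rpower_l; lra).
    assert (P := Rpower_pos x (gamma + 2 * INR K + 1)).
    apply Rle_trans with ((q + 1) * (eps / (q + 1))); [apply Rmult_le_compat; lra|apply Req_le; field; lra]. }
  assert (El : l = (- Mel mu b (RtoC gamma))%C).
  { assert (hw : - 2 * INR K - 1 < Re (RtoC gamma)) by (change (Re (RtoC gamma)) with gamma; lra).
    rewrite (Mel_eq mu b K) by easy. rewrite <- Prim_one.
    (* On [(0, 1]] the integrand of [Ent] has primitive [E], with limit [l] at 0; beyond 1 it has
       primitive [G], with limit 0. As [E 1 = G 1 - Rat], the value [G 1] cancels and
       [Ent + Rat = - l]. *)
    assert (EE : Ent mu b K (RtoC gamma) = (E 1 - l + (0 - G 1))%C); [|rewrite EE; unfold E; ring].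
    apply (Mlim_unique _ _ _ _ _ (phi_Qs_data mu b K hmu hb)); [lra|].
    apply Clim_ext with (fun n => (E 1 - E (RtoC (/ INR (S n)))) + (G (RtoC (INR (S n))) - G 1))%C.
    - intros n. assert (hn := inv_INR_S n). assert (h1 := INR_S_ge_1 n). unfold Mn. f_equal; symmetry; apply CI_unique.
      + apply is_CI_ext with (fun t => e (RtoC t)); [lra| |].
        { intros t ht. unfold e, gfun. rewrite tpow_Cpower by lra. ring. }
        apply (is_CI_derive (fun t => E (RtoC t))); [lra| |].
        * intros t ht. apply rderiv_of_cderiv, DE, rhp_RtoC. lra.
        * intros t ht. apply rcont_minus.
          -- apply (holo_rcont rhp); [apply holo_gfun, hb|apply rhp_RtoC; lra].
          -- apply (rcont_mult (fun t => Cpower (RtoC t) (RtoC gamma))); [|apply rcont_Qs; lra].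
             apply (holo_rcont slit (fun z => Cpower z (RtoC gamma))); [apply holo_Cpower|apply slit_pos; lra].
      + apply is_CI_ext with (fun t => gfun mu b gamma (RtoC t)); [lra| |].
        { intros t ht. rewrite tpow_Cpower by lra. easy. }
        apply (is_CI_derive (fun t => G (RtoC t))); [lra| |].
        * intros t ht. apply rderiv_of_cderiv, HG, rhp_RtoC. lra.
        * intros t ht. apply (holo_rcont rhp); [apply holo_gfun, hb|apply rhp_RtoC; lra].
    - apply Clim_plus; apply Clim_minus; try apply Clim_const.
      + assert (T := Clim_at_0 (fun x => E (RtoC x) - l)%C Hl). cbv beta in T.
        assert (T2 := Clim_plus _ _ _ _ T (Clim_const l)). replace (0 + l)%C with l in T2 by ring.
        eapply Clim_ext; [|exact T2]. intros n. cbv beta. ring.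
      + intros eps he. destruct (Rpower_neg_lim (m + 1) ltac:(lra) (eps / (B + 1)) ltac:(apply Rdiv_lt_0_compat; lra)) as [X [hX HX]].
        destruct (INR_large X) as [N HN]. exists N. intros n hn. specialize (HN (S n) ltac:(lia)). specialize (HX _ HN).
        assert (T := HGB (RtoC (INR (S n))) (cone_RtoC s (INR (S n)) ltac:(lra) ltac:(lra))). rewrite Cmod_R, Rabs_pos_eq in T by lra.
        replace (G (RtoC (INR (S n))) - 0)%C with (G (RtoC (INR (S n)))) by ring. eapply Rle_trans; [exact T|].
        assert (P := Rpower_pos (INR (S n)) (m + 1)).
        apply Rle_trans with ((B + 1) * (eps / (B + 1))); [apply Rmult_le_compat; lra|apply Req_le; field; lra]. }
  destruct (cone_int s (gamma + 2 * INR K) A' (fun z => E z - l)%C e) as [B' [hB' HB']]; try easy; try lra.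
  - intros z hz. eapply cderiv_eq; [|apply cderiv_minus; [apply DE; eapply cone_rhp; [|exact hz]; lra|apply cderiv_const]]. ring.
  - exists G, (m + 1), B, B'. split; [lra|]. split; [easy|]. split; [easy|]. split; [easy|]. intros z hz. split; [apply HGB, hz|].
    specialize (HB' z hz). rewrite El in HB'.
    replace (G z - Prim mu b gamma K z + Mel mu b (RtoC gamma))%C with (E z - - Mel mu b (RtoC gamma))%C by (unfold E; ring).
    exact HB'.
Qed.

(** * The expansion at the scaled argument [x / a] *)

Lemma Clog_div (x a : C) : rhp x -> rhp a -> Clog (x / a)%C = (Clog x - Clog a)%C.
Proof.
  intros hx ha. assert (x0 := rhp_neq_0 x hx). assert (a0 := rhp_neq_0 a ha).
  unfold Cdiv. rewrite Clog_mult, Clog_inv; try easy.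
  - apply rhp_slit, ha.
  - intros E. apply a0. replace a with (a * a * / a)%C by (field; easy). rewrite E. ring.
  - rewrite Arg_inv by apply rhp_slit, ha.
    assert (T1 := cos_pos_Arg x x0 hx). assert (T2 := cos_pos_Arg a a0 ha).
    apply Rabs_lt_between in T1. apply Rabs_lt_between in T2. apply Rabs_lt_between. lra.
Qed.

Lemma Cpower_div (x a e : C) : rhp x -> rhp a -> Cpower (x / a) e = (Cpower a (- e) * Cpower x e)%C.
Proof.
  intros hx ha. unfold Cpower. rewrite Clog_div, <- Cexp_plus by easy. f_equal. ring.
Qed.

Lemma pl_div (x a e : C) : rhp x -> rhp a ->
  pl e (x / a)%C = (Cpower a (- e) * (pl e x - Clog a * pw e x))%C.
Proof. intros hx ha. unfold pl, pw. rewrite Cpower_div, Clog_div by easy. ring. Qed.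

Lemma pw_div (x a e : C) : rhp x -> rhp a -> pw e (x / a)%C = (Cpower a (- e) * pw e x)%C.
Proof. apply Cpower_div. Qed.

(** The primitive [pterm] at [x / a], rearranged as a function of [x] with coefficients depending on
    [a]. Splitting [log (x / a)] moves [- log a] into the non-logarithmic coefficient, the source of
    the logarithm in the theorem. *)
Definition pscaled (mu b gamma : R) (k : nat) (a x : C) : C :=
  let e := eexp (RtoC gamma) (S k) in
  (Cpower a (- e) * (RtoC (Ac mu b k) * (/ e * pl e x - / (e * e) * pw e x)
    + (RtoC (Dc mu b k) - RtoC (Ac mu b k) * Clog a) * (/ e * pw e x)))%C.

Lemma pterm_div mu b gamma k (x a : C) : rhp x -> rhp a ->
  pterm mu b (RtoC gamma) k (x / a)%C = pscaled mu b gamma k a x.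
Proof.
  intros hx ha. unfold pterm, pscaled. rewrite pl_div, pw_div by easy. ring.
Qed.

Lemma holo_pscaled mu b gamma k a : holo slit (pscaled mu b gamma k a).
Proof.
  assert (O := copen_slit). set (e := eexp (RtoC gamma) (S k)).
  apply holo_scal; [easy|]. apply holo_plus; [easy| |]; apply holo_scal; try easy.
  - apply holo_minus; [easy| |]; apply holo_scal; try easy; [apply holo_pl|apply holo_pw].
  - apply holo_scal; [easy|apply holo_pw].
Qed.

Definition Pval (mu b gamma : R) (k : nat) (a : C) : C :=
  let e := eexp (RtoC gamma) (S k) in
  (Cpower a (- e) * (RtoC (Ac mu b k) * (- C_derive zeta (1 - e)) + (RtoC (Dc mu b k) - RtoC (Ac mu b k) * Clog a) * zeta (1 - e)))%C.

Lemma LamS_pscaled mu b gamma k a N : (forall m : nat, gamma <> - 2 * INR m) ->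
  gamma + 2 * INR (S k) + 1 <= INR N - 1 ->
  Clim (fun n => LamS N n (pscaled mu b gamma k a)) (Pval mu b gamma k a).
Proof.
  intros hg hN. set (e := eexp (RtoC gamma) (S k)).
  assert (he : e <> 0%C) by (apply eexp_neq_0, hg).
  assert (hRe : Re e + 1 <= INR N - 1) by (unfold e; rewrite Re_eexp; change (Re (RtoC gamma)) with gamma; easy).
  set (F1 := fun z => (/ e * pl e z - / (e * e) * pw e z)%C). set (F2 := fun z => (/ e * pw e z)%C).
  set (c := (RtoC (Dc mu b k) - RtoC (Ac mu b k) * Clog a)%C).
  assert (O := copen_slit).
  assert (H1 : holo slit F1) by (apply holo_minus; [easy| |]; (apply holo_scal; [easy|]); [apply holo_pl|apply holo_pw]).
  assert (H2 : holo slit F2) by (apply holo_scal; [easy|apply holo_pw]).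
  apply Clim_ext with (fun n => Cpower a (- e) * (RtoC (Ac mu b k) * LamS N n F1 + c * LamS N n F2))%C.
  - intros n. symmetry.
    change (LamS N n (fun x => Cpower a (- e) * (RtoC (Ac mu b k) * F1 x + c * F2 x))%C
      = (Cpower a (- e) * (RtoC (Ac mu b k) * LamS N n F1 + c * LamS N n F2))%C).
    rewrite (LamS_scal slit N n (Cpower a (- e)) (fun x => RtoC (Ac mu b k) * F1 x + c * F2 x)%C); [|easy| |apply slit_pos].
    + rewrite (LamS_plus slit N n (fun x => RtoC (Ac mu b k) * F1 x)%C (fun x => c * F2 x)%C);
        [|easy|apply holo_scal; easy|apply holo_scal; easy|apply slit_pos].
      rewrite !(LamS_scal slit) by (easy || apply slit_pos). easy.
    + apply holo_plus; [easy| |]; apply holo_scal; easy.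
  - apply Clim_scal, Clim_plus; apply Clim_scal.
    + apply LamS_zeta'; easy.
    + apply LamS_zeta; easy.
Qed.

Definition Psc (mu b gamma : R) (K : nat) (a x : C) : C :=
  (RtoC (al mu b 0) * Cpower a (- RtoC gamma) * (/ RtoC gamma * pw (RtoC gamma) x)
   + Csum (fun k => pscaled mu b gamma k a x) K)%C.

Lemma holo_Psc mu b gamma K a : holo slit (Psc mu b gamma K a).
Proof.
  assert (O := copen_slit). apply holo_plus; [easy| |].
  - apply holo_scal; [easy|]. apply holo_scal; [easy|apply holo_pw].
  - apply (holo_Csum slit (fun k => pscaled mu b gamma k a)); [easy|]. intros k _. apply holo_pscaled.
Qed.

Lemma Prim_div mu b gamma K (x a : C) : rhp x -> rhp a -> Prim mu b gamma K (x / a)%C = Psc mu b gamma K a x.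
Proof.
  intros hx ha. unfold Prim, Psc. rewrite pw_div by easy. f_equal; [ring|].
  apply Csum_ext. intros k _. apply pterm_div; easy.
Qed.

Lemma Clim_Csum (u : nat -> nat -> C) l K : (forall k, (k < K)%nat -> Clim (u k) (l k)) ->
  Clim (fun n => Csum (fun k => u k n) K) (Csum l K).
Proof.
  induction K as [|K IH]; intros H; [apply (Clim_const 0%C)|].
  cbn [Csum]. apply Clim_plus; [apply IH; intros k hk; apply H; lia|apply H; lia].
Qed.

Lemma Csum_zero (u : nat -> C) n : (forall k, (k < n)%nat -> u k = 0%C) -> Csum u n = 0%C.
Proof.
  induction n as [|n IH]; intros H; [easy|]. cbn [Csum]. rewrite IH, H by (intros; try apply H; lia). ring.
Qed.

Lemma LamS_zero N n : LamS N n (fun _ => 0%C) = 0%C.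
Proof.
  unfold LamS. rewrite !Csum_zero; [ring| |].
  - intros k _. assert (Z : forall z, Dn k (fun _ => 0%C) z = 0%C) by (destruct k; [easy|intros z; apply (Dn_const k 0%C)]).
    rewrite Z. ring.
  - intros k _. apply cderiv_C_derive, cderiv_const.
Qed.

Definition Ptot (mu b gamma : R) (K : nat) (a : C) : C :=
  (RtoC (al mu b 0) * Cpower a (- RtoC gamma) * zeta (1 - RtoC gamma) + Csum (fun k => Pval mu b gamma k a) K)%C.

Lemma LamS_Psc mu b gamma K a N : (forall m : nat, gamma <> - 2 * INR m) ->
  gamma + 2 * INR K + 1 <= INR N - 1 ->
  Clim (fun n => LamS N n (Psc mu b gamma K a)) (Ptot mu b gamma K a).
Proof.
  intros hg hN. assert (O := copen_slit).
  assert (g0 : RtoC gamma <> 0%C) by (intros E; apply RtoC_inj in E; apply (hg 0%nat); simpl; lra).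
  assert (hK := pos_INR K).
  apply Clim_ext with (fun n => RtoC (al mu b 0) * Cpower a (- RtoC gamma) * LamS N n (fun x => / RtoC gamma * pw (RtoC gamma) x)
     + Csum (fun k => LamS N n (pscaled mu b gamma k a)) K)%C.
  - intros n. symmetry. unfold Psc.
    assert (Hp : holo slit (fun x => / RtoC gamma * pw (RtoC gamma) x)%C) by (apply holo_scal; [easy|apply holo_pw]).
    assert (HC : forall J, holo slit (fun x => Csum (fun k => pscaled mu b gamma k a x) J)).
    { intros J. apply (holo_Csum slit (fun k => pscaled mu b gamma k a)); [easy|]. intros k _. apply holo_pscaled. }
    rewrite (LamS_plus slit N n (fun x => RtoC (al mu b 0) * Cpower a (- RtoC gamma) * (/ RtoC gamma * pw (RtoC gamma) x))%C
      (fun x => Csum (fun k => pscaled mu b gamma k a x) K)); [|easy|apply holo_scal; easy|apply HC|apply slit_pos].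
    rewrite (LamS_scal slit N n _ (fun x => / RtoC gamma * pw (RtoC gamma) x)%C) by (easy || apply slit_pos). f_equal.
    clear hN hK. induction K as [|K IH].
    + apply LamS_zero.
    + cbn [Csum]. rewrite (LamS_plus slit N n (fun x => Csum (fun k => pscaled mu b gamma k a x) K) (pscaled mu b gamma K a));
        [|easy|apply HC|apply holo_pscaled|apply slit_pos]. rewrite IH. easy.
  - apply Clim_plus.
    + apply Clim_scal, LamS_zeta; [easy|]. change (Re (RtoC gamma)) with gamma. lra.
    + apply (Clim_Csum (fun k n => LamS N n (pscaled mu b gamma k a))). intros k hk. apply LamS_pscaled; [easy|].
      assert (INR (S k) <= INR K) by (apply le_INR; lia). lra.
Qed.

Lemma Re_Arg_bound (a : C) delta : a <> 0%C -> 0 < delta < PI / 2 -> Rabs (Arg a) <= PI / 2 - delta ->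
  sin delta * Cmod a <= Re a.
Proof.
  intros ha hd h. assert (hr : 0 < Cmod a) by (apply Cmod_gt_0; easy).
  assert (E : Re a = Cmod a * cos (Arg a)) by (rewrite cos_Arg by easy; field; lra).
  assert (C : sin delta <= cos (Arg a)).
  { rewrite <- cos_shift. assert (C : cos (Rabs (Arg a)) = cos (Arg a)).
    { unfold Rabs. destruct (Rcase_abs (Arg a)); [apply cos_neg|easy]. }
    rewrite <- C. assert (P := Rabs_pos (Arg a)). apply cos_decr_1; lra. }
  rewrite E. rewrite (Rmult_comm (sin delta)). apply Rmult_le_compat_l; lra.
Qed.

(** The opening of the narrow cone is chosen so that [|Im x| <= s/4 |x|], and then [Re x > 3/4 |x|].
    Hence [Re x Re a + Im x Im a > (3/4 - 1/4) s |x| |a|], which is the claim for the cone of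
    parameter [s / 2]. *)
Lemma cone_div s (x a : C) : 0 < s <= 1 -> a <> 0%C -> s * Cmod a <= Re a ->
  cone (sqrt (1 - s * s / 16)) x -> cone (s / 2) (x / a)%C.
Proof.
  intros hs ha h hx. set (s' := sqrt (1 - s * s / 16)) in *.
  assert (hs' : s' * s' = 1 - s * s / 16) by (apply sqrt_sqrt; nra).
  assert (hs0 : 0 <= s') by apply sqrt_pos.
  assert (hs3 : 3 / 4 < s') by nra.
  assert (hr : 0 < Cmod a) by (apply Cmod_gt_0; easy).
  assert (hx0 : 0 < Cmod x).
  { apply Cmod_gt_0. intros ->. unfold cone in hx. rewrite Cmod_0 in hx. simpl in hx. lra. }
  unfold cone in *.
  assert (E : Re (x / a) = (Re x * Re a + Im x * Im a) / (Cmod a * Cmod a)).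
  { rewrite Cmod_sqr. assert (T := Cmod_sqr a). assert (0 < Cmod a * Cmod a) by nra.
    destruct x as [x1 x2], a as [a1 a2]. unfold Re, Im in *. cbn [fst snd] in *. simpl. field. lra. }
  rewrite E, Cmod_div by easy.
  assert (HI : Rabs (Im x) <= s / 4 * Cmod x).
  { assert (T := Cmod_sqr x). apply Rsqr_incr_0_var; [|nra]. unfold Rsqr. rewrite <- Rabs_mult, Rabs_pos_eq by apply Rle_0_sqr.
    assert (s' * Cmod x * (s' * Cmod x) <= Re x * Re x) by (apply Rmult_le_compat; nra).
    replace (s / 4 * Cmod x * (s / 4 * Cmod x)) with (s * s / 16 * (Cmod x * Cmod x)) by field.
    replace (s' * Cmod x * (s' * Cmod x)) with ((s' * s') * (Cmod x * Cmod x)) in H by ring. rewrite hs' in H. lra. }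
  assert (HA := im_le_Cmod a).
  assert (P : Rabs (Im x * Im a) <= s / 4 * Cmod x * Cmod a).
  { rewrite Rabs_mult. apply Rmult_le_compat; try apply Rabs_pos; easy. }
  assert (Q : s' * Cmod x * (s * Cmod a) < Re x * Re a).
  { apply Rlt_le_trans with (Re x * (s * Cmod a)); [apply Rmult_lt_compat_r; nra|]. apply Rmult_le_compat_l; nra. }
  apply Rabs_le_between in P.
  apply Rmult_lt_reg_r with (Cmod a * Cmod a); [nra|].
  replace (s / 2 * (Cmod x / Cmod a) * (Cmod a * Cmod a)) with (s / 2 * (Cmod x * Cmod a)) by (field; lra).
  replace ((Re x * Re a + Im x * Im a) / (Cmod a * Cmod a) * (Cmod a * Cmod a)) with (Re x * Re a + Im x * Im a) by (field; lra).
  assert (3 / 4 * (s * (Cmod x * Cmod a)) <= s' * (s * (Cmod x * Cmod a))) by (apply Rmult_le_compat_r; lra).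
  lra.
Qed.

(** * The asymptotic expansion *)

(** For a decaying function all boundary terms tend to 0, since derivatives decay at least as fast
    in a narrower cone. The functional then has the same limit as the plain partial sums. *)
Lemma LamS_decay s m B N F : 0 < s < 1 -> m < 0 -> holo (cone s) F ->
  (forall z, cone s z -> Cmod (F z)%C <= B * Rpower (Cmod z) m) ->
  Clim (fun n => Csum (fun k => C_derive F (RtoC (INR (S k)))) n - LamS N n F)%C 0.
Proof.
  intros hs hm HF Hb.
  apply Clim_ext with (fun n => Csum (fun k => RtoC (bcoef k) * Dn k F (RtoC (INR (S n)))) N)%C.
  { intros n. unfold LamS. ring. }
  replace (RtoC 0) with (Csum (fun _ => 0%C) N) by (apply Csum_zero; easy).
  apply (Clim_Csum (fun k n => RtoC (bcoef k) * Dn k F (RtoC (INR (S n))))%C). intros k _.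
  replace (RtoC 0) with (RtoC (bcoef k) * 0)%C by ring. apply Clim_scal.
  destruct (cone_Dn k s ((1 + s) / 2) m ltac:(lra) ltac:(lra) ltac:(lra)) as [A [hA HA]].
  specialize (HA F B HF Hb). intros eps he. assert (hk := pos_INR k).
  set (c := Rabs (A * B) + 1). assert (hc : 0 < c) by (assert (T := Rabs_pos (A * B)); unfold c; lra).
  destruct (Rpower_neg_lim (m - INR k) ltac:(lra) (eps / c) ltac:(apply Rdiv_lt_0_compat; lra)) as [X [hX HX]].
  destruct (INR_large X) as [M HM]. exists M. intros n hn. specialize (HM (S n) ltac:(lia)). specialize (HX _ HM).
  specialize (HA (RtoC (INR (S n))) (cone_RtoC ((1 + s) / 2) (INR (S n)) ltac:(lra) ltac:(lra))).
  rewrite Cmod_R, Rabs_pos_eq in HA by lra.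
  match goal with |- Cmod ?u <= _ => replace u with (Dn k F (RtoC (INR (S n)))) by ring end.
  eapply Rle_trans; [exact HA|]. assert (P := Rpower_pos (INR (S n)) (m - INR k)).
  assert (A * B <= c) by (assert (T := Rle_abs (A * B)); unfold c; lra).
  apply Rle_trans with (c * Rpower (INR (S n)) (m - INR k)); [apply Rmult_le_compat_r; lra|].
  apply Rle_trans with (c * (eps / c)); [apply Rmult_le_compat_l; lra|apply Req_le; field; lra].
Qed.

Lemma holo_div_const (a : C) : holo rhp (fun x => x / a)%C.
Proof. apply holo_mult; [apply copen_rhp|apply holo_id, copen_rhp|apply holo_const, copen_rhp]. Qed.

(** The function [a G(x/a)] is split into the scaled primitive, a constant and the remainder [Ea].
    The first gives zeta values, the second the regularised integral, and [LamS_bound] transfers the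
    smallness of the third in [a] to the sum. *)
Lemma series_expansion mu b gamma K delta : 0 < mu -> 0 < b -> (forall m : nat, gamma <> - 2 * INR m) ->
  0 < delta < PI / 2 -> -1 < gamma + 2 * INR K ->
  exists C0, 0 <= C0 /\ forall a : C, a <> 0%C -> Rabs (Arg a) <= PI / 2 - delta ->
  exists r, Cmod r <= C0 * Rpower (Cmod a) (- (gamma + 2 * INR K)) /\
    Clim (Csum (fun n => gfun mu b gamma (RtoC (INR (S n)) / a)%C)) (a * Ptot mu b gamma K a + a * Mel mu b (RtoC gamma) + r)%C.
Proof.
  intros hmu hb hg hd hK. set (sd := sin delta).
  assert (hsd : 0 < sd < 1).
  { split; [apply sin_gt_0; lra|]. rewrite <- sin_PI2. apply sin_increasing_1; lra. }
  destruct (primitive_expansion mu b gamma (sd / 2) K hmu hb ltac:(lra) hg hK) as [G [m [B [B' [hm [hB [hB' [HG HE]]]]]]]].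
  set (s' := sqrt (1 - sd * sd / 16)).
  assert (hs'2 : s' * s' = 1 - sd * sd / 16) by (apply sqrt_sqrt; nra).
  assert (hs'0 : 0 <= s') by apply sqrt_pos. assert (hs' : 0 < s' < 1) by nra.
  set (M := gamma + 2 * INR K) in *.
  (* Order [S N0] is large enough for the remainder bound and for every power in [Psc]; being a
     successor, it also admits [LamS_const]. *)
  destruct (INR_large (M + 3)) as [N0 HN0]. specialize (HN0 (S N0) ltac:(lia)).
  destruct (LamS_bound s' (M + 1) (S N0) hs') as [A [hA HA]]; [rewrite (S_INR (S N0)); lra|].
  exists (A * B'). split; [apply Rmult_le_pos; easy|]. intros a a0 harg.
  assert (hRe := Re_Arg_bound a delta a0 hd harg). fold sd in hRe.
  assert (hr : 0 < Cmod a) by (apply Cmod_gt_0; easy). set (r := Cmod a) in *.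
  assert (ha : rhp a) by (unfold rhp; nra).
  assert (Hdiv : forall x, cone s' x -> cone (sd / 2) (x / a)%C) by (intros x hx; apply cone_div; easy || lra).
  assert (Hrhp : forall x, cone s' x -> rhp x) by (intros x hx; eapply cone_rhp; [|exact hx]; lra).
  assert (Hrhpd : forall x, cone s' x -> rhp (x / a)%C) by (intros x hx; eapply cone_rhp; [|apply Hdiv, hx]; lra).
  assert (O : copen (cone s')) by (apply copen_cone; lra).
  assert (HP : forall x, 0 < x -> cone s' (RtoC x)) by (intros x hx; apply cone_RtoC; lra).
  assert (holoG : holo rhp G).
  { apply (Holo_holo rhp G (gfun mu b gamma)); [apply copen_rhp|]. intros z hz. split; [apply HG, hz|].
    eapply cderiv_ccont, (holo_cderiv rhp); [apply holo_gfun, hb|exact hz]. }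
  assert (hdiv : holo (cone s') (fun x => x / a)%C) by (apply (holo_subset rhp); [exact Hrhp|apply holo_div_const]).
  set (Fa := fun x => (a * G (x / a))%C).
  assert (hFa : holo (cone s') Fa).
  { apply holo_scal; [easy|]. apply (holo_comp (cone s') rhp G); easy. }
  set (c := (a * Mel mu b (RtoC gamma))%C).
  set (Ea := fun x => (Fa x - a * Psc mu b gamma K a x + c)%C).
  assert (hPs : holo (cone s') (fun x => a * Psc mu b gamma K a x)%C).
  { apply holo_scal; [easy|]. apply (holo_subset slit); [intros x hx; apply rhp_slit, Hrhp, hx|apply holo_Psc]. }
  assert (hEa : holo (cone s') Ea).
  { apply holo_plus; [easy|apply holo_minus; easy|apply holo_const; easy]. }
  assert (Cdiv_mod : forall x, Cmod (x / a)%C = Cmod x / r) by (intros x; apply Cmod_div; easy).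
  assert (Rp : forall x e, cone s' x -> Rpower (Cmod x / r) e = Rpower r (- e) * Rpower (Cmod x) e).
  { intros x e hx. assert (hx0 : 0 < Cmod x) by (apply Cmod_gt_0, rhp_neq_0, Hrhp, hx).
    unfold Rdiv, Rpower. rewrite ln_mult, ln_Rinv by (try easy; apply Rinv_0_lt_compat; easy).
    rewrite <- exp_plus. f_equal. ring. }
  assert (bFa : forall x, cone s' x -> Cmod (Fa x)%C <= (r * (B * Rpower r (- m))) * Rpower (Cmod x) m).
  { intros x hx. unfold Fa. rewrite Cmod_mult. fold r. destruct (HE (x / a)%C (Hdiv x hx)) as [h1 _].
    rewrite Cdiv_mod, Rp in h1 by easy. rewrite Rmult_assoc. apply Rmult_le_compat_l; lra. }
  assert (bEa : forall x, cone s' x -> Cmod (Ea x)%C <= (B' * Rpower r (- M)) * Rpower (Cmod x) (M + 1)).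
  { intros x hx. destruct (HE (x / a)%C (Hdiv x hx)) as [_ h2]. rewrite Prim_div in h2 by (try easy; apply Hrhp, hx).
    rewrite Cdiv_mod, Rp in h2 by easy.
    replace (Ea x) with (a * (G (x / a) - Psc mu b gamma K a x + Mel mu b (RtoC gamma)))%C by (unfold Ea, Fa, c; ring).
    rewrite Cmod_mult. fold r. apply Rmult_le_compat_l with (r := r) in h2; [|lra].
    eapply Rle_trans; [exact h2|]. apply Req_le.
    (* The factor [a] in [Ea] raises the power of [r] from [- (M + 1)] to [- M]. *)
    replace (- M) with (1 + - (M + 1)) by ring. rewrite (Rpower_plus 1), Rpower_1 by easy. ring. }
  destruct (HA Ea _ hEa bEa) as [b1 b2].
  set (D := B' * Rpower r (- M)) in *.
  destruct (Clim_Cauchy (fun n => LamS (S N0) n Ea)) as [e He].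
  { intros eps he. destruct (INR_large ((A * D + 1) / eps)) as [n0 Hn0]. exists n0.
    assert (Q : forall n p, (n0 <= n)%nat -> (n <= p)%nat -> Cmod (LamS (S N0) p Ea - LamS (S N0) n Ea)%C <= eps).
    { intros n p hn hp. eapply Rle_trans; [apply b2; easy|]. specialize (Hn0 (S n) ltac:(lia)). assert (h1 := INR_S_ge_1 n).
      apply Rmult_le_reg_r with (INR (S n)); [lra|]. unfold Rdiv. rewrite Rmult_assoc, Rinv_l, Rmult_1_r by lra.
      apply Rmult_le_compat_r with (r := eps) in Hn0; [|lra].
      replace ((A * D + 1) / eps * eps) with (A * D + 1) in Hn0 by (field; lra). lra. }
    intros n p hn hp. destruct (Nat.le_ge_cases n p) as [h|h]; [rewrite Cmod_minus_sym|]; apply Q; easy. }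
  exists e. split.
  { eapply Rle_trans; [apply (Clim_le _ _ (A * D) He), b1|]. unfold D. apply Req_le. ring. }
  assert (L1 := LamS_decay s' m _ (S N0) Fa hs' hm hFa bFa).
  assert (L2 : Clim (fun n => LamS (S N0) n Fa) (a * Ptot mu b gamma K a + c + e)%C).
  { apply Clim_ext with (fun n => a * LamS (S N0) n (Psc mu b gamma K a) + c + LamS (S N0) n Ea)%C.
    - intros n. symmetry.
      (* The constant enters as [- c], and the functional reverses its sign, so the regularised
         integral appears with a plus. *)
      rewrite (LamS_ext (cone s') (S N0) n Fa (fun x => (a * Psc mu b gamma K a x + - c) + Ea x)%C); try easy.
      + rewrite (LamS_plus (cone s') (S N0) n (fun x => a * Psc mu b gamma K a x + - c)%C Ea); try easy.
        * rewrite (LamS_plus (cone s') (S N0) n (fun x => a * Psc mu b gamma K a x)%C (fun _ => (- c)%C)); try easy; [|apply holo_const, O].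
          rewrite (LamS_scal slit) by (try apply copen_slit; try apply holo_Psc; apply slit_pos).
          rewrite LamS_const. ring.
        * apply holo_plus; [easy|easy|apply holo_const, O].
      + intros z hz. unfold Ea. ring.
    - apply Clim_plus; [|exact He]. apply Clim_plus; [|apply Clim_const]. apply Clim_scal, LamS_Psc; [easy|].
      unfold M in HN0. lra. }
  assert (L3 := Clim_plus _ _ _ _ L1 L2). cbv beta in L3.
  replace (0 + (a * Ptot mu b gamma K a + c + e))%C with (a * Ptot mu b gamma K a + c + e)%C in L3 by ring.
  eapply Clim_ext; [|exact L3]. intros n. cbv beta.
  match goal with |- (?u - ?v + ?v)%C = _ => transitivity u; [ring|] end.
  apply Csum_ext. intros k _. apply cderiv_C_derive.
  assert (hk : cone s' (RtoC (INR (S k)))) by (apply HP, lt_0_INR; lia).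
  eapply cderiv_eq; [|apply cderiv_scal, (cderiv_comp G (fun x => x / a)%C)].
  2:{ unfold Cdiv. apply cderiv_mult; [apply cderiv_id|apply cderiv_const]. }
  2:{ apply HG, Hrhpd, hk. }
  cbv beta. field. easy.
Qed.

(** Principal powers split here: [Cpower_div] handles [x^gamma] because both arguments lie in the
    right half plane, and [Clog_sqr_plus] handles the denominator. *)
Lemma S1_term mu gamma b (a : C) x : 0 < b -> rhp a -> 0 < x -> rhp (RtoC x / a)%C ->
  (RtoC (Rpower x gamma) * BesselK1 (RtoC x * RtoC b / a) / Cpower (RtoC x * RtoC x + a * a) (RtoC mu))%C
  = (Cpower a (RtoC (gamma - 2 * mu)) * gfun mu b gamma (RtoC x / a))%C.
Proof.
  intros hb ha hx hz. assert (a0 := rhp_neq_0 a ha).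
  assert (E1 : (RtoC x * RtoC b / a)%C = (RtoC b * (RtoC x / a))%C) by (field; easy).
  assert (hbz : 0 < Re (RtoC b * (RtoC x / a))).
  { unfold rhp in hz. change (Re (RtoC b * (RtoC x / a))) with (b * Re (RtoC x / a) - 0 * Im (RtoC x / a)). nra. }
  rewrite E1, BesselK1_BK by easy.
  unfold gfun, phi, opq. rewrite Cpower_div, (Cpower_RtoC x gamma) by (try easy; apply rhp_RtoC, hx).
  unfold Cpower at 1. rewrite Clog_sqr_plus by easy.
  replace (RtoC mu * (2 * Clog a + Clog (1 + RtoC x / a * (RtoC x / a))%C))%C
    with (RtoC (2 * mu) * Clog a + RtoC mu * Clog (1 + RtoC x / a * (RtoC x / a))%C)%C by (rewrite RtoC_mult; ring).
  rewrite Cexp_plus. unfold Cdiv at 1.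
  match goal with |- (?u * ?v * / (Cexp ?p * Cexp ?q))%C = _ =>
    replace (/ (Cexp p * Cexp q))%C with (Cexp (- p)%C * Cexp (- q)%C)%C
      by (rewrite !Cexp_opp; field; split; apply Cexp_neq_0) end.
  unfold Cpower.
  replace (- (RtoC (2 * mu) * Clog a))%C with (RtoC (gamma - 2 * mu) * Clog a + - RtoC gamma * Clog a)%C
    by (rewrite RtoC_minus; ring).
  replace (- (RtoC mu * Clog (1 + RtoC x / a * (RtoC x / a))%C))%C with (RtoC (- mu) * Clog (1 + RtoC x / a * (RtoC x / a))%C)%C
    by (rewrite RtoC_opp; ring).
  rewrite Cexp_plus. ring.
Qed.

Lemma Csum_limit_scal c (u v : nat -> C) l : (forall n, u n = (c * v n)%C) -> Clim (Csum v) l -> Clim (Csum u) (c * l)%C.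
Proof.
  intros E H. apply Clim_ext with (fun n => c * Csum v n)%C; [|apply Clim_scal, H].
  intros n. rewrite <- Csum_scal. apply Csum_ext. intros k _. symmetry. apply E.
Qed.

Lemma rhp_div_pos (a : C) x : rhp a -> 0 < x -> rhp (RtoC x / a)%C.
Proof.
  intros ha hx. unfold rhp in *. assert (T := Cmod_sqr a). assert (0 < Re a * Re a) by nra.
  assert (0 <= Im a * Im a) by apply Rle_0_sqr.
  assert (E : Re (RtoC x / a) = x * Re a / (Re a * Re a + Im a * Im a)).
  { destruct a as [a1 a2]. unfold Re, Im in *. cbn [fst snd] in *. simpl. field. lra. }
  rewrite E. apply Rdiv_lt_0_compat; [apply Rmult_lt_0_compat; easy|lra].
Qed.

Lemma S1_limit mu gamma b (a : C) l : 0 < b -> rhp a ->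
  Clim (Csum (fun n => gfun mu b gamma (RtoC (INR (S n)) / a)%C)) l ->
  S1 mu gamma a b = (Cpower a (RtoC (gamma - 2 * mu)) * l)%C.
Proof.
  intros hb ha H. apply CSeries_Clim. eapply Csum_limit_scal; [|exact H].
  intros n. assert (hn : 0 < INR (S n)) by (apply lt_0_INR; lia).
  apply S1_term; try easy. apply rhp_div_pos; easy.
Qed.

(** * Matching with the two sums of the theorem, and the order of the error *)

Definition first_term (mu b gamma : R) (a : C) (k : nat) : C :=
  (RtoC (1 / 2) * Cpower a (RtoC (1 - 2 * mu)) * RtoC (Rpower (b ^ 2 / 4) (- 1 / 2)) *
   (RtoC (hc mu k) * zeta (RtoC (1 - gamma - 2 * INR k)) * Cpower a (RtoC (- 2 * INR k))))%C.

Definition second_term (mu b gamma : R) (a : C) (k : nat) : C :=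
  let chi := b ^ 2 / 4 in let w := RtoC (- gamma - 1 - 2 * INR k) in
  (Cpower a (RtoC (- 1 - 2 * mu)) * RtoC (Rpower chi (1 / 2)) *
   (RtoC ((-1) ^ S k / INR (fact k) * pochhammer mu k) * Cpower a (RtoC (- 2 * INR k))
      * (zeta w * RtoC (F mu chi k) * (Clog (2 * a / b)%C - RtoC Euler_gamma + RtoC (1 / 2))
         + C_derive zeta w * RtoC (F mu chi k) + zeta w * RtoC (Fstar_sum mu chi k))))%C.

Lemma Rpower_chi b : 0 < b -> Rpower (b ^ 2 / 4) (1 / 2) = b / 2 /\ Rpower (b ^ 2 / 4) (- 1 / 2) = 2 / b.
Proof.
  intros hb. assert (E : b ^ 2 / 4 = Rpower (b / 2) 2).
  { replace 2 with (INR 2) at 2 by (simpl; ring). rewrite Rpower_pow by lra. field. }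
  rewrite E, !Rpower_mult. split.
  - replace (2 * (1 / 2)) with 1 by field. apply Rpower_1. lra.
  - replace (2 * (- 1 / 2)) with (- (1)) by field. rewrite Rpower_Ropp, Rpower_1 by lra. field. lra.
Qed.

Lemma Clog_2ab b (a : C) : 0 < b -> rhp a -> Clog (2 * a / b)%C = (Clog a - RtoC (ln (b / 2)))%C.
Proof.
  intros hb ha. assert (b0 : RtoC b <> 0%C) by (intros E; apply RtoC_inj in E; lra).
  replace (2 * a / b)%C with (a / RtoC (b / 2))%C.
  - rewrite Clog_div, Clog_RtoC; try easy; [lra|]. apply rhp_RtoC. lra.
  - rewrite RtoC_div by lra. field. easy.
Qed.

Lemma Cpower_collect (a : C) u v (w : R) : a <> 0%C -> (u + 1 + v)%C = RtoC w ->
  (Cpower a u * (a * Cpower a v))%C = Cpower a (RtoC w).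
Proof.
  intros ha <-. rewrite !Cpower_plus, Cpower_1 by easy. ring.
Qed.

(** With [e = gamma + 2 k + 2] the zeta argument [1 - e] belongs to index [k + 1] of the first sum
    and to index [k] of the second. The two parts of [Dc] feed these two terms. *)
Lemma Pval_terms mu b gamma k a : 0 < b -> rhp a ->
  (Cpower a (RtoC (gamma - 2 * mu)) * (a * Pval mu b gamma k a))%C = (first_term mu b gamma a (S k) + second_term mu b gamma a k)%C.
Proof.
  intros hb ha. assert (a0 := rhp_neq_0 a ha).
  destruct (Rpower_chi b hb) as [c1 c2].
  unfold Pval. set (e := eexp (RtoC gamma) (S k)).
  assert (Ew : (1 - e)%C = RtoC (- gamma - 1 - 2 * INR k)).
  { unfold e, eexp. rewrite <- RtoC_plus, <- RtoC_minus. f_equal. rewrite mult_INR, (S_INR k). simpl. ring. }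
  assert (Ew' : RtoC (1 - gamma - 2 * INR (S k)) = RtoC (- gamma - 1 - 2 * INR k)) by (f_equal; rewrite S_INR; ring).
  assert (P1 : (Cpower a (RtoC (gamma - 2 * mu)) * (a * Cpower a (- e)))%C = (Cpower a (RtoC (- 1 - 2 * mu)) * Cpower a (RtoC (- 2 * INR k)))%C).
  { rewrite <- Cpower_plus, <- RtoC_plus. apply Cpower_collect; [easy|].
    unfold e, eexp. rewrite <- !RtoC_plus, <- RtoC_opp, <- !RtoC_plus. f_equal. rewrite mult_INR, (S_INR k). simpl. ring. }
  assert (P2 : (Cpower a (RtoC (1 - 2 * mu)) * Cpower a (RtoC (- 2 * INR (S k))))%C = (Cpower a (RtoC (- 1 - 2 * mu)) * Cpower a (RtoC (- 2 * INR k)))%C).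
  { rewrite <- !Cpower_plus, <- !RtoC_plus. do 2 f_equal. rewrite (S_INR k). ring. }
  rewrite Ew. set (z := zeta (RtoC (- gamma - 1 - 2 * INR k))). set (z' := C_derive zeta (RtoC (- gamma - 1 - 2 * INR k))).
  set (U := (Cpower a (RtoC (- 1 - 2 * mu)) * Cpower a (RtoC (- 2 * INR k)))%C) in *.
  set (V := Cpower a (RtoC (- 1 - 2 * mu))) in *. set (Y := Cpower a (RtoC (- 2 * INR k))) in *.
  transitivity (U * (RtoC (Ac mu b k) * - z' + (RtoC (Dc mu b k) - RtoC (Ac mu b k) * Clog a) * z))%C.
  { rewrite <- P1. ring. }
  unfold first_term, second_term. rewrite Ew', Clog_2ab, c1, c2 by easy. fold z z' V Y.
  set (Fk := F mu (b ^ 2 / 4) k). set (Fs := Fstar_sum mu (b ^ 2 / 4) k).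
  assert (Eh : (-1) ^ S k / INR (fact k) * pochhammer mu k = - hc mu k) by (unfold hc; simpl; unfold Rdiv; ring).
  rewrite Eh.
  transitivity (U * (RtoC (1 / 2) * RtoC (2 / b) * RtoC (hc mu (S k)) * z) + U * RtoC (b / 2) * (RtoC (- hc mu k) *
    (z * RtoC Fk * (Clog a - RtoC (ln (b / 2)) - RtoC Euler_gamma + RtoC (1 / 2)) + z' * RtoC Fk + z * RtoC Fs)))%C.
  2:{ rewrite <- P2 at 1. unfold U. ring. }
  unfold Dc, Ac, Bc, al. fold Fk Fs. set (h := hc mu k). set (h' := hc mu (S k)).
  (* Writing [1 / b] as [1/2 * (2/b)] exhibits the prefactor [1/2 chi^(-1/2)] of the first sum. *)
  replace (h' / b + b / 2 * h * ((Euler_gamma - 1 / 2 + ln (b / 2)) * Fk - Fs))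
    with (1 / 2 * (2 / b) * h' + b / 2 * h * ((Euler_gamma - 1 / 2 + ln (b / 2)) * Fk - Fs)) by (field; lra).
  rewrite !RtoC_plus, !RtoC_mult, !RtoC_minus, !RtoC_opp, !RtoC_mult, !RtoC_plus, !RtoC_minus. ring.
Qed.

(** The leading power [z^(gamma - 1)] supplies the first term of index 0, and each [Pval] one term
    of either sum, so the first sum comes out one term longer. *)
Lemma Ptot_terms mu b gamma K a : 0 < b -> rhp a ->
  (Cpower a (RtoC (gamma - 2 * mu)) * (a * Ptot mu b gamma K a))%C = (Csum (first_term mu b gamma a) (S K) + Csum (second_term mu b gamma a) K)%C.
Proof.
  intros hb ha. assert (a0 := rhp_neq_0 a ha). rewrite Csum_S_l, <- Cplus_assoc, <- Csum_plus.
  rewrite (Csum_ext (fun k => first_term mu b gamma a (S k) + second_term mu b gamma a k)%C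
    (fun k => Cpower a (RtoC (gamma - 2 * mu)) * a * Pval mu b gamma k a)%C).
  2:{ intros k _. rewrite <- Pval_terms by easy. ring. }
  rewrite Csum_scal. unfold Ptot.
  assert (E0 : first_term mu b gamma a 0 = (Cpower a (RtoC (gamma - 2 * mu)) * (a * Cpower a (- RtoC gamma)) * (RtoC (al mu b 0) * zeta (1 - RtoC gamma)))%C).
  { rewrite (Cpower_collect a _ _ (1 - 2 * mu) a0).
    - unfold first_term. destruct (Rpower_chi b hb) as [_ ->]. replace (RtoC (1 - gamma - 2 * INR 0)) with (1 - RtoC gamma)%C.
      + replace (Cpower a (RtoC (- 2 * INR 0))) with (RtoC 1).
        * unfold al. replace (hc mu 0 / b) with (1 / 2 * (2 / b) * hc mu 0) by (field; lra). rewrite !RtoC_mult. ring.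
        * rewrite Rmult_0_r, Cpower_0. easy.
      + rewrite <- RtoC_minus. f_equal. simpl. ring.
    - rewrite <- RtoC_plus, <- RtoC_opp, <- RtoC_plus. f_equal. ring. }
  rewrite E0. ring.
Qed.

Lemma first_term_bound mu b gamma k : exists c, forall a : C, Cmod (first_term mu b gamma a k)%C <= c * Rpower (Cmod a) (1 - 2 * mu - 2 * INR k).
Proof.
  exists (Cmod (RtoC (1 / 2) * RtoC (Rpower (b ^ 2 / 4) (- 1 / 2)) * (RtoC (hc mu k) * zeta (RtoC (1 - gamma - 2 * INR k))))%C).
  intros a. unfold first_term. rewrite !Cmod_mult, !Cmod_Cpower_R.
  replace (1 - 2 * mu - 2 * INR k) with ((1 - 2 * mu) + - 2 * INR k) by ring. rewrite Rpower_plus.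
  apply Req_le. ring.
Qed.

(** The natural order is [|a|^(-1 - 2 mu - 2 k)] times a logarithm. Two powers of [|a|] are to
    spare, and one of them dominates [|Clog a|] for [|a| >= 1]. *)
Lemma second_term_bound mu b gamma k : 0 < b -> exists c, forall a : C, 1 <= Cmod a -> rhp a ->
  Cmod (second_term mu b gamma a k)%C <= c * Rpower (Cmod a) (1 - 2 * mu - 2 * INR k).
Proof.
  intros hb. set (chi := b ^ 2 / 4). set (w := RtoC (- gamma - 1 - 2 * INR k)).
  set (p := (RtoC (Rpower chi (1 / 2)) * RtoC ((-1) ^ S k / INR (fact k) * pochhammer mu k))%C).
  set (q := (zeta w * RtoC (F mu chi k))%C).
  set (d := (q * (- RtoC (ln (b / 2)) - RtoC Euler_gamma + RtoC (1 / 2)) + C_derive zeta w * RtoC (F mu chi k) + zeta w * RtoC (Fstar_sum mu chi k))%C).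
  exists (Cmod p * (Cmod q * (2 * (PI + 2)) + Cmod d)). intros a h1 ha. assert (a0 := rhp_neq_0 a ha).
  assert (hP := PI_RGT_0).
  assert (L : Cmod (Clog a)%C <= 2 * (PI + 2) * Cmod a).
  { assert (T := Clog_bound a a0). apply Rmult_le_reg_r with (Cmod a); [lra|]. eapply Rle_trans; [exact T|].
    replace (2 * (PI + 2) * Cmod a * Cmod a) with ((PI + 2) * (2 * (Cmod a * Cmod a))) by ring.
    apply Rmult_le_compat_l; [lra|]. nra. }
  assert (E : second_term mu b gamma a k = (Cpower a (RtoC (- 1 - 2 * mu)) * Cpower a (RtoC (- 2 * INR k)) * p * (q * Clog a + d))%C).
  { unfold second_term. fold chi. fold w. rewrite Clog_2ab by easy. unfold p, q, d. unfold q. ring. }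
  rewrite E, !Cmod_mult, !Cmod_Cpower_R.
  assert (B : Cmod (q * Clog a + d)%C <= (Cmod q * (2 * (PI + 2)) + Cmod d) * Cmod a).
  { eapply Rle_trans; [apply Cmod_triangle|]. rewrite Cmod_mult. assert (hq := Cmod_ge_0 q). assert (hd := Cmod_ge_0 d).
    assert (Cmod q * Cmod (Clog a)%C <= Cmod q * (2 * (PI + 2) * Cmod a)) by (apply Rmult_le_compat_l; easy).
    assert (Cmod d * 1 <= Cmod d * Cmod a) by (apply Rmult_le_compat_l; easy). lra. }
  replace (1 - 2 * mu - 2 * INR k) with ((- 1 - 2 * mu) + - 2 * INR k + 1 + 1) by ring.
  rewrite !Rpower_plus, Rpower_1 by lra.
  set (X := Rpower (Cmod a) (- 1 - 2 * mu) * Rpower (Cmod a) (- 2 * INR k)).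
  assert (hX : 0 < X) by (apply Rmult_lt_0_compat; apply Rpower_pos).
  assert (hp := Cmod_ge_0 p). set (T := Cmod q * (2 * (PI + 2)) + Cmod d) in *.
  assert (hT : 0 <= T).
  { unfold T. assert (hq := Cmod_ge_0 q). assert (hd := Cmod_ge_0 d). assert (0 <= Cmod q * (2 * (PI + 2))) by (apply Rmult_le_pos; lra). lra. }
  apply Rle_trans with (X * Cmod p * (T * Cmod a)).
  - apply Rmult_le_compat_l; [apply Rmult_le_pos; lra|easy].
  - assert (0 <= X * Cmod p * (T * Cmod a)) by (apply Rmult_le_pos; apply Rmult_le_pos; lra).
    assert (X * Cmod p * (T * Cmod a) * 1 <= X * Cmod p * (T * Cmod a) * Cmod a) by (apply Rmult_le_compat_l; easy).
    lra.
Qed.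

Definition err (mu b gamma : R) (K : nat) (a : C) : C :=
  (S1 mu gamma a b - Cpower a (RtoC (gamma - 2 * mu + 1)) * H1 mu gamma b (RtoC 1)
   - (Csum (first_term mu b gamma a) K + Csum (second_term mu b gamma a) K))%C.

Definition err_small (mu b gamma : R) (K : nat) (delta : R) : Prop :=
  exists M, forall a : C, 1 <= Cmod a -> Rabs (Arg a) <= PI / 2 - delta ->
    Cmod (err mu b gamma K a)%C <= M * Rpower (Cmod a) (1 - 2 * mu - 2 * INR K).

Lemma sector_rhp (a : C) delta : 1 <= Cmod a -> 0 < delta < PI / 2 -> Rabs (Arg a) <= PI / 2 - delta -> a <> 0%C /\ rhp a.
Proof.
  intros h1 hd h. assert (a0 : a <> 0%C) by (intros ->; rewrite Cmod_0 in h1; lra). split; [easy|].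
  assert (T := Re_Arg_bound a delta a0 hd h). assert (0 < sin delta) by (apply sin_gt_0; lra). unfold rhp. nra.
Qed.

Lemma err_small_large mu b gamma K delta : 0 < mu -> 0 < b -> (forall m : nat, gamma <> - 2 * INR m) ->
  0 < delta < PI / 2 -> -1 < gamma + 2 * INR K -> err_small mu b gamma K delta.
Proof.
  intros hmu hb hg hd hK.
  destruct (series_expansion mu b gamma K delta hmu hb hg hd hK) as [C0 [hC0 HC]].
  destruct (first_term_bound mu b gamma K) as [c Hc].
  exists (C0 + c). intros a h1 harg. destruct (sector_rhp a delta h1 hd harg) as [a0 ha].
  destruct (HC a a0 harg) as [r [hr Hl]]. specialize (Hc a).
  assert (E : err mu b gamma K a = (Cpower a (RtoC (gamma - 2 * mu)) * r + first_term mu b gamma a K)%C).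
  { unfold err. rewrite (S1_limit _ _ _ _ _ hb ha Hl), H1_value by easy.
    assert (P := Ptot_terms mu b gamma K a hb ha). cbn [Csum] in P.
    rewrite RtoC_plus, Cpower_plus, Cpower_1 by easy.
    replace (Cpower a (RtoC (gamma - 2 * mu)) * (a * Ptot mu b gamma K a + a * Mel mu b (RtoC gamma) + r))%C
      with (Cpower a (RtoC (gamma - 2 * mu)) * (a * Ptot mu b gamma K a) + Cpower a (RtoC (gamma - 2 * mu)) * (a * Mel mu b (RtoC gamma) + r))%C by ring.
    rewrite P. ring. }
  rewrite E. eapply Rle_trans; [apply Cmod_triangle|]. rewrite Cmod_mult, Cmod_Cpower_R.
  assert (B : Rpower (Cmod a) (gamma - 2 * mu) * Cmod r <= C0 * Rpower (Cmod a) (1 - 2 * mu - 2 * INR K)).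
  { assert (P := Rpower_pos (Cmod a) (gamma - 2 * mu)).
    apply Rle_trans with (Rpower (Cmod a) (gamma - 2 * mu) * (C0 * Rpower (Cmod a) (- (gamma + 2 * INR K)))); [apply Rmult_le_compat_l; lra|].
    replace (Rpower (Cmod a) (gamma - 2 * mu) * (C0 * Rpower (Cmod a) (- (gamma + 2 * INR K))))
      with (C0 * Rpower (Cmod a) ((gamma - 2 * mu) + - (gamma + 2 * INR K))) by (rewrite Rpower_plus; ring).
    apply Rmult_le_compat_l; [easy|]. apply Rle_Rpower; lra. }
  lra.
Qed.

Lemma err_small_descend mu b gamma K delta : 0 < b -> 0 < delta < PI / 2 ->
  err_small mu b gamma (S K) delta -> err_small mu b gamma K delta.
Proof.
  intros hb hd [M HM]. destruct (first_term_bound mu b gamma K) as [c1 H1]. destruct (second_term_bound mu b gamma K hb) as [c2 H2].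
  exists (Rabs M + c1 + c2). intros a h1 harg. destruct (sector_rhp a delta h1 hd harg) as [a0 ha].
  specialize (HM a h1 harg). specialize (H1 a). specialize (H2 a h1 ha).
  assert (E : err mu b gamma K a = (err mu b gamma (S K) a + (first_term mu b gamma a K + second_term mu b gamma a K))%C) by (unfold err; cbn [Csum]; ring).
  rewrite E. eapply Rle_trans; [apply Cmod_triangle|].
  assert (T := Cmod_triangle (first_term mu b gamma a K) (second_term mu b gamma a K)).
  assert (B : M * Rpower (Cmod a) (1 - 2 * mu - 2 * INR (S K)) <= Rabs M * Rpower (Cmod a) (1 - 2 * mu - 2 * INR K)).
  { assert (P := Rpower_pos (Cmod a) (1 - 2 * mu - 2 * INR (S K))). assert (hM := Rle_abs M). assert (hM0 := Rabs_pos M).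
    apply Rle_trans with (Rabs M * Rpower (Cmod a) (1 - 2 * mu - 2 * INR (S K))); [apply Rmult_le_compat_r; lra|].
    apply Rmult_le_compat_l; [easy|]. apply Rle_Rpower; [easy|]. rewrite S_INR. lra. }
  lra.
Qed.

Lemma err_small_all mu b gamma K delta : 0 < mu -> 0 < b -> (forall m : nat, gamma <> - 2 * INR m) ->
  0 < delta < PI / 2 -> err_small mu b gamma K delta.
Proof.
  intros hmu hb hg hd. destruct (INR_large (- gamma)) as [n hn].
  assert (H : err_small mu b gamma (K + n) delta).
  { apply err_small_large; try easy. specialize (hn (K + n)%nat ltac:(lia)). assert (T := pos_INR (K + n)). lra. }
  clear hn. induction n as [|n IH]; [rewrite Nat.add_0_r in H; easy|].
  apply IH. apply err_small_descend; try easy. rewrite <- plus_n_Sm in H. exact H.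
Qed.

Theorem theorem3 (mu b gamma chi : R) (hmu : 0 < mu) (hb : 0 < b)
  (hgamma : forall m : nat, gamma <> - 2 * INR m) (hchi : chi = b ^ 2 / 4) :
  forall (K : nat) (delta : R), 0 < delta < PI / 2 ->
  exists M A : R, 0 < A /\
    forall a : C, A <= Cmod a -> Rabs (Arg a) <= PI / 2 - delta ->
      Cmod (S1 mu gamma a b
            - Cpower a (RtoC (gamma - 2 * mu + 1)) * H1 mu gamma b (RtoC 1)
            - (RtoC (1 / 2) * Cpower a (RtoC (1 - 2 * mu))
                 * RtoC (Rpower chi (- 1 / 2)) * first_sum mu gamma K a
               + Cpower a (RtoC (- 1 - 2 * mu))
                   * RtoC (Rpower chi (1 / 2)) * second_sum mu b gamma chi K a))%C
        <= M * Rpower (Cmod a) (1 - 2 * mu - 2 * INR K).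
Proof.
  intros K delta hd. subst chi.
  destruct (err_small_all mu b gamma K delta hmu hb hgamma hd) as [M HM].
  exists M, 1. split; [lra|]. intros a h1 harg. specialize (HM a h1 harg).
  unfold first_sum, second_sum. rewrite <- !Csum_scal. exact HM.
Qed.
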